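(* Let $M$ be a $2n$-dimensional symplectic manifold with symplectic form $\sigma$, let $\Delta\subset TM$ be a Lagrange distribution, and let $h\in C^\infty(M)$ be such that the Hamiltonian field $\vec h$ is complete and monotone with respect to $\Delta$ (at every point of $M$). Let $c\in\mathbb R$ and let $S\subset h^{-1}(c)$ be a compact invariant subset of the flow $e^{t\vec h}$ such that $\vec h(x)\notin\Delta_x$ for all $x\in S$. If $\vec h$ has negative reduced curvature with respect to $\Delta$ at each point of $S$, then $S$ is a hyperbolic set of the flow $e^{t\vec h}\bigr|_{h^{-1}(c)}$.
   Context: All objects are $C^\infty$. A Lagrange distribution $\Delta\subset TM$ is a smooth vector subbundle each of whose fibers $\Delta_x=\Delta\cap T_xM$ is a Lagrangian subspace of $(T_xM,\sigma_x)$ (i.e. $\dim\Delta_x=n$ and $\sigma_x$ vanishes on $\Delta_x\times\Delta_x$). $\bar\Delta$ denotes the space of smooth sections of $\Delta$. For $h\in C^\infty(M)$, the Hamiltonian vector field $\vec h$ is defined by $dh=\sigma(\cdot,\vec h)$; $e^{t\vec h}$, $t\in\mathbb R$, denotes its flow. The Lie bracket is $[v_1,v_2]=v_1\circ v_2-v_2\circ v_1$ (vector fields acting as derivations). Regularity: $\vec h$ is regular at $x$ with respect to $\Delta$ if $\{[\vec h,v](x):v\in\bar\Delta\}=T_xM$. The form $g^h_x$: for $v_1,v_2\in\bar\Delta$ the number $\sigma([\vec h,v_1],v_2)(x)$ depends only on $v_1(x),v_2(x)$ and is symmetric in $v_1,v_2$; thus $g^h_x(v_1(x),v_2(x))=\sigma([\vec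 h,v_1],v_2)(x)$ defines a symmetric bilinear form on $\Delta_x$. It is nondegenerate if and only if $\vec h$ is regular at $x$. Monotonicity: a regular field $\vec h$ is monotone at $x$ with respect to $\Delta$ if $g^h_x$ is sign-definite (positive definite or negative definite). Curvature: for transversal $n$-dimensional subspaces $X_1,X_2\subset T_xM$, let $\pi_x(X_1,X_2):T_xM\to T_xM$ be the projector onto $X_2$ parallel to $X_1$ (so it is $0$ on $X_1$ and the identity on $X_2$). Put $J_x(t)=e^{-t\vec h}_*\Delta_{e^{t\vec h}(x)}\subset T_xM$, where $e^{-t\vec h}_*$ is the differential of $e^{-t\vec h}$. If $\vec h$ is regular, $J_x(t)$ and $J_x(\tau)$ are transversal for $t\neq\tau$ close to $0$, and there is a unique linear operator $R^h_x:\Delta_x\to\Delta_x$, self-adjoint with respect to $g^h_x$, such that $$\frac{\partial^2}{\partial t\,\partial\tau}\Bigl(\pi_x(J_x(\tau),J_x(t))\bigr|_{\Delta_x}\Bigr)\Bigr|_{\tau=0}=t^{-2}\mathbf 1+\tfrac13R^h_x+O(t)\quad\text{as } t\to0.$$ $R^h_x$ is the curvature operator and $r^h_x(\xi)=g^h_x(R^h_x\xi,\xi)$ is the curvature form of $\vec h$ at $x$ with respect to $\Delta$. (Normalization: for $M=\mathbb R^n\times\mathbb R^n$ with $\sigma=\sum dp_i\wedge dq_i$, $\Delta_{(p,q)}=(\mathbb R^n,0)$ and $h=\frac12|p|^2+U(q)$, one has $R^h_{(p,q)}=\frac{d^2U}{dq^2}$.) Reduced curvature: $\sigma_x$ induces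 a nondegenerate pairing of $T_xM/\Delta_x$ and $\Delta_x$, so there is a unique linear map $G_x:\Delta_x\to T_xM/\Delta_x$ with $g^h_x(\xi_1,\xi_2)=\sigma_x(G_x\xi_1,\xi_2)$ for all $\xi_1,\xi_2\in\Delta_x$; it is invertible since $g^h_x$ is nondegenerate. Let $\Pi_x:T_xM\to T_xM/\Delta_x$ be the canonical projection and $v(x)=G_x^{-1}\Pi_x\vec h(x)$; then $v\in\bar\Delta$. If $\vec h$ is monotone and $\vec h(x)\notin\Delta_x$, the reduced curvature form at $x$ is $$\hat r^h_x(\xi)=r^h_x(\xi)+\frac{3\,\sigma_x([\vec h,[\vec h,v]](x),\xi)^2}{4\,g^h_x(v(x),v(x))},\qquad \xi\in\Delta_x\cap\ker d_xh.$$ $\vec h$ has negative reduced curvature at $x$ if $\hat r^h_x(\xi)\,g^h_x(\xi,\xi)<0$ for all nonzero $\xi\in\Delta_x\cap\ker d_xh$. Hyperbolic set (in the sense of the book of A. B. Katok and B. Hasselblatt, Introduction to the Modern Theory of Dynamical Systems, Cambridge Univ. Press, 1997): a compact invariant set $S$ of a smooth flow $\varphi^t$ on a manifold $W$ is hyperbolic if there are a Riemannian metric on an open neighborhood of $S$ in $W$ and numbers $\lambda<1<\mu$ such that for every $x\in S$ there is a splitting $T_xW=E^0_x\oplus E^+_x\oplus E^-_x$ with $\dim E^0_x=1$, $\frac{d}{dt}\varphi^t(x)|_{t=0}\in E^0_x\setminus\{0\}$, $D\varphi^t E^\pm_x=E^\pm_{\varphi^t(x)}$ for all $t$, and $\|D\varphi^t|_{E^-_x}\|\le\lambda^t$,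 $\|D\varphi^{-t}|_{E^+_x}\|\le\mu^{-t}$ for all $t\ge0$. Here $W$ is the level set $h^{-1}(c)$, which is a smooth hypersurface near $S$ because $\vec h\ne0$ on $S$. *)

(* Defs.v *)
From HB Require Import structures.
From mathcomp Require Import all_boot all_order all_algebra.
From mathcomp Require Import all_classical all_reals all_analysis.

Set Implicit Arguments.
Unset Strict Implicit.
Unset Printing Implicit Defensive.

Import Order.TTheory GRing.Theory Num.Theory.
Import numFieldNormedType.Exports.

Local Open Scope classical_set_scope.
Local Open Scope ring_scope.

(* ** Smooth manifolds *)

(* Intended for open [U]. *)
Fixpoint Ck {R : realType} {m : nat} (k : nat) (U : set 'rV[R]_m)
    (f : 'rV[R]_m -> R) : Prop :=
  match k with
  | 0 => forall u, U u -> {for u, continuous f}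
  | k'.+1 => (forall u, U u -> differentiable f u) /\
             (forall i : 'I_m, Ck k' U (fun u => 'D_(delta_mx 0 i) f u))
  end.

Definition smooth_on {R : realType} {m : nat} (U : set 'rV[R]_m)
    (f : 'rV[R]_m -> R) : Prop := forall k, Ck k U f.

(* [chart_fun] and [chart_inv] are meaningful on [chart_dom] and [chart_cod]
   only. *)
Record chart (R : realType) (m : nat) (M : topologicalType) := Chart {
  chart_dom : set M;
  chart_cod : set 'rV[R]_m;
  chart_fun : M -> 'rV[R]_m;
  chart_inv : 'rV[R]_m -> M;
  chart_dom_open : open chart_dom;
  chart_cod_open : open chart_cod;
  chart_fun_cod : forall x, chart_dom x -> chart_cod (chart_fun x);
  chart_inv_dom : forall u, chart_cod u -> chart_dom (chart_inv u);
  chart_funK : forall x, chart_dom x -> chart_inv (chart_fun x) = x;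
  chart_invK : forall u, chart_cod u -> chart_fun (chart_inv u) = u;
  chart_fun_cont : forall x, chart_dom x -> {for x, continuous chart_fun};
  chart_inv_cont : forall u, chart_cod u -> {for u, continuous chart_inv} }.

Record manifold (R : realType) (m : nat) := Manifold {
  carrier :> topologicalType;
  atlas : set (chart R m carrier);
  manifold_hausdorff : hausdorff_space carrier;
  manifold_second_countable : @second_countable carrier;
  atlas_cover : forall x : carrier, exists2 a, atlas a & chart_dom a x;
  atlas_compat : forall a b, atlas a -> atlas b -> forall i : 'I_m,
    smooth_on (chart_cod a `&` chart_inv a @^-1` chart_dom b)
      (fun u => chart_fun b (chart_inv a u) 0 i) }.
Arguments atlas {R m} M : rename.

Section Geometry.
Variables (R : realType) (m : nat) (M : manifold R m).

Definition Cinf (f : M -> R) : Prop :=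
  forall a, atlas M a -> smooth_on (chart_cod a) (f \o chart_inv a).

(* ** Tangent vectors, vector fields *)

(* A tangent vector is a derivation of C^oo(M) at a point.  It is encoded as a
   functional on all functions M -> R that vanishes outside C^oo(M), so that
   equality of functionals is equality of derivations, and the tangent spaces
   are subspaces of one vector space. *)
Definition tvec : Type := (M -> R) -> R.
HB.instance Definition _ := GRing.Lmodule.on tvec.

Definition tangent (x : M) : set tvec := [set xi |
  [/\ (forall f, ~ Cinf f -> xi f = 0),
      (forall (a : R) f g, Cinf f -> Cinf g ->
         xi (fun y => a * f y + g y) = a * xi f + xi g) &
      (forall f g, Cinf f -> Cinf g ->
         xi (fun y => f y * g y) = xi f * g x + f x * xi g)]].

Definition vector_field (X : M -> tvec) : Prop :=
  (forall x, tangent x (X x)) /\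
  (forall f, Cinf f -> Cinf (fun x => X x f)).

Definition lie (X Y : M -> tvec) : M -> tvec :=
  fun x f => X x (fun y => Y y f) - Y x (fun y => X y f).

(* ** Linear algebra in tangent spaces *)

Definition subspace (V : set tvec) : Prop :=
  V 0 /\ forall (a : R) u w, V u -> V w -> V (a *: u + w).

Definition is_basis k (e : 'I_k -> tvec) (V : set tvec) : Prop :=
  (forall a : 'I_k -> R, \sum_i a i *: e i = 0 -> forall i, a i = 0) /\
  V = [set \sum_i a i *: e i | a in [set: 'I_k -> R]].

Definition has_dim (V : set tvec) (k : nat) : Prop :=
  exists e : 'I_k -> tvec, is_basis e V.

Definition direct_sum3 (V A B C : set tvec) : Prop :=
  V = [set u | exists a b c, [/\ A a, B b, C c & u = a + b + c]] /\
  (forall a b c, A a -> B b -> C c -> a + b + c = 0 ->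
     [/\ a = 0, b = 0 & c = 0]).

Definition bilinear_on (V : set tvec) (b : tvec -> tvec -> R) : Prop :=
  forall (a : R) u v w, V u -> V v -> V w ->
    b (a *: u + v) w = a * b u w + b v w /\
    b w (a *: u + v) = a * b w u + b w v.

(* The projector of the sum of V1 and V2 onto V2 parallel to V1, for
   transversal V1 and V2. *)
Definition projector (V1 V2 : set tvec) (xi : tvec) : tvec :=
  xget 0 [set eta | V2 eta /\ V1 (xi - eta)].

(* ** Flows *)

Definition velocity (phi : R -> M -> M) (x : M) : tvec :=
  fun f => if `[< Cinf f >] then derive1 (fun t => f (phi t x)) 0 else 0.

(* Smoothness of phi : R * M -> M, tested by pulling back smooth functions
   and reading R * M in the charts (t, u) of R * M. *)
Definition smooth_flow (phi : R -> M -> M) : Prop :=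
  [/\ (forall x, phi 0 x = x),
      (forall s t x, phi (s + t) x = phi s (phi t x)) &
      (forall f a, Cinf f -> atlas M a ->
         smooth_on [set w : 'rV[R]_(1 + m) | chart_cod a (rsubmx w)]
           (fun w => f (phi (lsubmx w 0 0) (chart_inv a (rsubmx w)))))].

(* X is complete and phi t = e^{tX}. *)
Definition flow_of (X : M -> tvec) (phi : R -> M -> M) : Prop :=
  smooth_flow phi /\ velocity phi = X.

Definition push (F : M -> M) (xi : tvec) : tvec := fun f => xi (f \o F).

Definition invariant_set (phi : R -> M -> M) (S : set M) : Prop :=
  forall t x, S x -> S (phi t x).

(* ** Hyperbolic sets in a level set of a function *)

(* ker d_x h; it is the tangent space at x of the level set of h through x
   when d_x h is nonzero. *)
Definition ker_d (h : M -> R) (x : M) : set tvec :=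
  [set xi | tangent x xi /\ xi h = 0].

Definition locally_smooth_restr (A : set M) (f : M -> R) : Prop :=
  forall x, A x -> exists2 F, Cinf F & \forall y \near x, A y -> f y = F y.

(* U is a relatively open subset of a level set of h, without critical points
   of h. The smoothness of rho is tested on pairs of vector fields tangent
   to U. *)
Definition riemannian_metric (h : M -> R) (U : set M)
    (rho : M -> tvec -> tvec -> R) : Prop :=
  (forall x, U x ->
    [/\ bilinear_on (ker_d h x) (rho x),
        (forall xi eta, ker_d h x xi -> ker_d h x eta ->
           rho x xi eta = rho x eta xi) &
        (forall xi, ker_d h x xi -> xi <> 0 -> 0 < rho x xi xi)]) /\
  (forall X Y, vector_field X -> vector_field Y ->
     (forall x, U x -> X x h = 0 /\ Y x h = 0) ->
     locally_smooth_restr U (fun x => rho x (X x) (Y x))).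

(* S is a hyperbolic set of the restriction of phi to W = h^{-1}(c), for a
   flow phi preserving h. *)
Definition hyperbolic_set (h : M -> R) (c : R) (phi : R -> M -> M)
    (S : set M) : Prop :=
  let W := [set x | h x = c] in
  [/\ compact S, S `<=` W, invariant_set phi S &
  exists (O : set M) (rho : M -> tvec -> tvec -> R) (lambda mu : R)
         (E0 Ep Em : M -> set tvec),
    let norm x xi := Num.sqrt (rho x xi xi) in
    [/\ open O /\ S `<=` O,
        (forall x, (W `&` O) x -> exists2 xi, tangent x xi & xi h <> 0),
        riemannian_metric h (W `&` O) rho,
        0 < lambda < 1 /\ 1 < mu &
        forall x, S x ->
          [/\ [/\ subspace (E0 x), subspace (Ep x) & subspace (Em x)],
              direct_sum3 (ker_d h x) (E0 x) (Ep x) (Em x),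
              [/\ has_dim (E0 x) 1, E0 x (velocity phi x) &
                  velocity phi x <> 0],
              (forall t, push (phi t) @` Ep x = Ep (phi t x) /\
                         push (phi t) @` Em x = Em (phi t x)) &
              (forall t, 0 <= t ->
                 (forall xi, Em x xi ->
                    norm (phi t x) (push (phi t) xi)
                      <= lambda `^ t * norm x xi) /\
                 (forall xi, Ep x xi ->
                    norm (phi (- t) x) (push (phi (- t)) xi)
                      <= mu `^ (- t) * norm x xi))]]].

(* ** Symplectic forms, Lagrange distributions *)

(* The closedness condition is the invariant formula for d sigma. *)
Definition symplectic_form (sigma : M -> tvec -> tvec -> R) : Prop :=
  [/\ (forall x, bilinear_on (tangent x) (sigma x) /\
                 forall xi, tangent x xi -> sigma x xi xi = 0),
      (forall x xi, tangent x xi ->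
         (forall eta, tangent x eta -> sigma x xi eta = 0) -> xi = 0),
      (forall X Y, vector_field X -> vector_field Y ->
         Cinf (fun x => sigma x (X x) (Y x))) &
      (forall X Y Z, vector_field X -> vector_field Y -> vector_field Z ->
         forall x,
         X x (fun y => sigma y (Y y) (Z y)) +
         Y x (fun y => sigma y (Z y) (X y)) +
         Z x (fun y => sigma y (X y) (Y y)) -
         sigma x (lie X Y x) (Z x) - sigma x (lie Y Z x) (X x) -
         sigma x (lie Z X x) (Y x) = 0)].

(* Local frames of the subbundle are given by global vector fields: any local
   frame extends to M after shrinking its domain. *)
Definition smooth_subbundle (k : nat) (Delta : M -> set tvec) : Prop :=
  forall x : M, exists2 e : 'I_k -> M -> tvec,
    (forall i, vector_field (e i)) &
    \forall y \near x, is_basis (fun i => e i y) (Delta y).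

Definition lagrange_distribution (n : nat) (sigma : M -> tvec -> tvec -> R)
    (Delta : M -> set tvec) : Prop :=
  smooth_subbundle n Delta /\
  (forall x xi eta, Delta x xi -> Delta x eta -> sigma x xi eta = 0).

Definition sections (Delta : M -> set tvec) : set (M -> tvec) :=
  [set v | vector_field v /\ forall x, Delta x (v x)].

(* ** Curvature of a Hamiltonian field *)

Section Curvature.
Variables (sigma : M -> tvec -> tvec -> R) (Delta : M -> set tvec).
Variables (h : M -> R) (phi : R -> M -> M).

(* Objects determined uniquely by a property are selected by [xget 0]. *)

Definition hamiltonian_field (x : M) : tvec :=
  xget 0 [set eta | tangent x eta /\
                    forall xi, tangent x xi -> xi h = sigma x xi eta].
Local Notation hv := hamiltonian_field.

Definition regular (x : M) : Prop :=
  [set lie hv v x | v in sections Delta] = tangent x.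

Definition gform (x : M) (xi1 xi2 : tvec) : R :=
  xget 0 [set r | exists v1 v2 : M -> tvec,
    [/\ sections Delta v1, sections Delta v2, v1 x = xi1, v2 x = xi2 &
        r = sigma x (lie hv v1 x) (v2 x)]].

Definition monotone_at (x : M) : Prop :=
  regular x /\
  ((forall xi, Delta x xi -> xi <> 0 -> 0 < gform x xi xi) \/
   (forall xi, Delta x xi -> xi <> 0 -> gform x xi xi < 0)).

Definition jacobi_curve (x : M) (t : R) : set tvec :=
  push (phi (- t)) @` Delta (phi t x).

(* Evaluated on xi in Delta x and then on a function f. *)
Definition mixed_derivative (x : M) (xi : tvec) (f : M -> R) (t : R) : R :=
  derive1 (fun s =>
    derive1 (fun tau =>
      projector (jacobi_curve x tau) (jacobi_curve x s) xi f) 0) t.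

Definition is_curvature_operator (x : M) (A : tvec -> tvec) : Prop :=
  [/\ (forall xi, Delta x xi -> Delta x (A xi)),
      (forall (a : R) xi eta, Delta x xi -> Delta x eta ->
         A (a *: xi + eta) = a *: A xi + A eta),
      (forall xi eta, Delta x xi -> Delta x eta ->
         gform x (A xi) eta = gform x xi (A eta)) &
      (forall xi f, Delta x xi -> Cinf f ->
         (fun t : R => mixed_derivative x xi f t
                       - (t ^- 2 * xi f + 3^-1 * A xi f)) =O_ (0^') (@idfun R))].

Definition curvature_operator (x : M) : tvec -> tvec :=
  xget 0 (is_curvature_operator x).

Definition curvature_form (x : M) (xi : tvec) : R :=
  gform x (curvature_operator x xi) xi.

(* Elements of T_xM / Delta_x are represented by cosets. *)
Definition quot_proj (x : M) (zeta : tvec) : set tvec :=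
  [set zeta' | tangent x zeta' /\ Delta x (zeta' - zeta)].

Definition gmap (x : M) (xi : tvec) : set tvec :=
  [set zeta | tangent x zeta /\
              forall eta, Delta x eta -> gform x xi eta = sigma x zeta eta].

Definition vfield (x : M) : tvec :=
  xget 0 [set xi | Delta x xi /\ gmap x xi = quot_proj x (hv x)].

Definition reduced_curvature_form (x : M) (xi : tvec) : R :=
  curvature_form x xi +
  3 * sigma x (lie hv (lie hv vfield) x) xi ^+ 2
    / (4 * gform x (vfield x) (vfield x)).

Definition negative_reduced_curvature (x : M) : Prop :=
  forall xi, Delta x xi -> ker_d h x xi -> xi <> 0 ->
    reduced_curvature_form x xi * gform x xi xi < 0.

End Curvature.
End Geometry.

(* Main.v *)
(* Along the flow the Lagrange distribution carries a canonical connection.  In a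
   local frame a tangent vector is a pair (p, q) with p = sigma(xi, e_j) and
   covariant derivatives Dp = q, Dq = - p R, where R is the matrix of the curvature
   operator, as follows from an expansion of the Jacobi curve.  On a level set of h
   the vector xi is projected along hv to hat xi with <p, p(hv)> = 0, where < , > is
   the form dual to g^h.  Negativity of the reduced curvature says precisely that
   Q = <q, p> satisfies Q' >= c (<p, p> + <q, q>) for the projected vectors (the
   form taken positive), with c uniform by compactness.  Vectors with Q <= 0 for all
   positive times therefore decay exponentially.  They are found as limits, for
   T -> infinity, of solutions with p(T) = 0, and form a space of dimension n - 1;
   reversing time gives the unstable space. *)

From HB Require Import structures.
Require Import Defs.
From mathcomp Require Import all_boot all_order all_algebra.
From mathcomp Require Import all_classical all_reals all_analysis.
From mathcomp Require Import ring lra.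
Import Order.TTheory GRing.Theory Num.Theory.
Import numFieldNormedType.Exports.

Set Implicit Arguments.
Unset Strict Implicit.
Unset Printing Implicit Defensive.

Local Open Scope classical_set_scope.
Local Open Scope ring_scope.

(** * Smooth functions of several real variables *)

Section SmoothFunctions.
Variable R : realType.

(** Regularity makes the [e_j] and their brackets with the field a basis of each tangent space;
    hence p satisfies a linear second order equation along orbits, and removing its first order term
    defines q. Frames exist only locally, so what is followed over a whole orbit are pairings of p's
    and q's; that they do not depend on the frame is seen by differentiating a pairing already known
    to be invariant and comparing with sigma. The coefficient 3/4 of the reduced curvature comes
    from the projection along hv: it subtracts 4 b^2 / m from Q', where b = <q(hv), p> and m =
    <p(hv), p(hv)>; the component of q along p(hv) gives back b^2 / m; and sigma([h, [h, v]], .)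
    equals 2 b. The projection forgets the flow component of xi. On vectors with Q <= 0 that
    component converges, and its limit times hv must be subtracted before the vector really decays.
    The definition of a hyperbolic set admits no constant in front of the exponential, so the metric
    is itself the decaying combination of <p, p>, <q, q> and the squared flow component. *)

Lemma near_eq_differentiable (V W : normedModType R) (f g : V -> W) (x : V) :
  (\forall y \near x, f y = g y) -> differentiable f x -> differentiable g x.
Proof.
move=> fg df.
(* [z] vanishes near [x], so its differential there is 0 by uniqueness, and [g = f + z] inherits
   differentiability from [f]. *)
pose z := g - f.
have z0 : \forall y \near x, z y = 0.
  by apply: filterS fg => y fgy; rewrite /z !fctE fgy subrr.
have zx : z x = 0 by apply: nbhs_singleton z0.
have -> : g = f + z by rewrite /z addrC subrK.
apply: differentiableD => //.
apply/diff_locallyP.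
have key : z \o shift x = cst (z x) + (0 : V -> W) +o_ 0 id.
  apply: eqaddoE; apply/eqaddoP.
  move=> _/posnumP[e].
  near=> y.
  change (`|z (y + x) - (z x + 0)| <= e%:num * `|y|).
  have -> : z (y + x) = 0.
    by near: y; have := z0; rewrite (near_shift 0) /=; apply: filterS => y; rewrite /= subr0.
  by rewrite zx addr0 subrr normr0 mulr_ge0.
have -> : 'd z x = 0 :> (V -> W).
  apply: (@diff_unique _ _ _ z (\0 : {linear V -> W})) => //.
  exact: cst_continuous.
by split => //; exact: cst_continuous.
Unshelve. all: by end_near. Qed.

Variables (m : nat).
Implicit Types (U V : set 'rV[R]_m) (f g : 'rV[R]_m -> R).

Lemma Ck_sub k U V f : V `<=` U -> Ck k U f -> Ck k V f.
Proof.
elim: k f => [|k IH] f VU /=; first by move=> H u /VU; apply: H.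
by case=> H1 H2; split=> [u /VU|i]; [apply: H1|apply: IH].
Qed.

Lemma Ck_ext k U f g : open U -> (forall u, U u -> f u = g u) -> Ck k U f -> Ck k U g.
Proof.
move=> oU; elim: k f g => [|k IH] f g fg /=.
  move=> H u Uu; have nfg : \forall v \near u, f v = g v.
    by apply: (filterS _ (open_nbhs_nbhs (conj oU Uu))) => v; apply: fg.
  have := H u Uu; rewrite /prop_for /continuous_at -(fg u Uu).
  by apply: cvg_trans; exact: near_eq_cvg nfg.
case=> H1 H2; have nfg u : U u -> \forall v \near u, f v = g v.
  by move=> Uu; apply: filterS (open_nbhs_nbhs (conj oU Uu)).
split=> [u Uu|i]; first exact: near_eq_differentiable (nfg u Uu) (H1 _ Uu).
by apply: IH (H2 i) => u Uu; apply: near_eq_derive; apply: nfg.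
Qed.

Lemma Ck_prev k U f : Ck k.+1 U f -> Ck k U f.
Proof.
elim: k f => [|k IH] f [H1 H2] /=; first by move=> u Uu; apply: differentiable_continuous; apply: H1.
by split=> // i; apply: IH.
Qed.

Lemma Ck_near k U f : (forall u, U u -> exists V, [/\ open V, V u & Ck k V f]) -> Ck k U f.
Proof.
elim: k f => [|k IH] f H /=; first by move=> u /H [V [_ Vu]]; apply.
split=> [u /H[V [_ Vu [/(_ u Vu)]]]//|i].
by apply: IH => u /H[V [oV Vu [_ /(_ i)]]]; exists V.
Qed.

Lemma Ck_cst k U (c : R) : Ck k U (fun=> c).
Proof.
elim: k c => [|k IH] c /=; first by move=> u _; apply: cst_continuous.
split=> [u _|i]; first exact: differentiable_cst.
have E : 'D_(delta_mx 0 i) (fun=> c) = (fun=> 0 : R) :> ('rV[R]_m -> R).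
  by apply/funext => u; rewrite derive_cst.
by change (Ck k U ('D_(delta_mx 0 i) (fun=> c))); rewrite E.
Qed.

Lemma Ck_coord k U (j : 'I_m) : Ck k U (fun u => u 0 j).
Proof.
case: k => [|k] /=; first by move=> u _; apply: coord_continuous.
split=> [u _|i]; first exact: differentiable_coord.
have E : 'D_(delta_mx 0 i) (fun u : 'rV[R]_m => u 0 j) = fun=> (delta_mx 0 i : 'rV[R]_m) 0 j; last first.
  by change (Ck k U ('D_(delta_mx 0 i) (fun u : 'rV[R]_m => u 0 j))); rewrite E; exact: Ck_cst.
apply/funext => u; rewrite deriveE; last exact: differentiable_coord.
pose l : 'rV[R]_m -> R := fun u => u 0 j.
have ll : linear l by move=> a b c; rewrite /l !mxE.
pose L : {linear 'rV[R]_m -> R} := HB.pack l (GRing.isLinear.Build _ _ _ _ l ll).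
by rewrite (@diff_lin _ _ _ L) //; apply: coord_continuous.
Qed.

Lemma Ck_add k U f g : open U -> Ck k U f -> Ck k U g -> Ck k U (fun u => f u + g u).
Proof.
move=> oU; elim: k f g => [|k IH] f g /=; first by move=> H1 H2 u Uu; exact: (cvgD (H1 u Uu) (H2 u Uu)).
move=> [f1 f2] [g1 g2]; split=> [u Uu|i]; first by apply: differentiableD; [apply: f1|apply: g1].
apply: Ck_ext (IH _ _ (f2 i) (g2 i)) => // u Uu.
by rewrite -[RHS]/('D_(delta_mx 0 i) (f + g) u) deriveD //; apply: diff_derivable; [apply: f1|apply: g1].
Qed.

Lemma Ck_mul k U f g : open U -> Ck k U f -> Ck k U g -> Ck k U (fun u => f u * g u).
Proof.
move=> oU; elim: k f g => [|k IH] f g; first by move=> H1 H2 u Uu; exact: (cvgM (H1 u Uu) (H2 u Uu)).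
move=> F G; have [f1 f2] := F; have [g1 g2] := G.
split=> [u Uu|i]; first by apply: differentiableM; [apply: f1|apply: g1].
apply: (@Ck_ext _ _ (fun u => f u * 'D_(delta_mx 0 i) g u + g u * 'D_(delta_mx 0 i) f u)) => // [u Uu|].
  by rewrite -[RHS]/('D_(delta_mx 0 i) (f * g) u) deriveM //; apply: diff_derivable; [apply: f1|apply: g1].
exact: Ck_add oU (IH _ _ (Ck_prev F) (g2 i)) (IH _ _ (Ck_prev G) (f2 i)).
Qed.

Lemma Ck_inv k U f : open U -> (forall u, U u -> f u != 0) -> Ck k U f -> Ck k U (fun u => (f u)^-1).
Proof.
move=> oU f0; elim: k => [|k IH]; first by move=> H u Uu; exact: (cvgV (f0 u Uu) (H u Uu)).
move=> F; have [f1 f2] := F.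
split=> [u Uu|i]; first by apply: differentiableV; [apply: f1|apply: f0].
apply: (@Ck_ext _ _ (fun u => (-1) * ('D_(delta_mx 0 i) f u * ((f u)^-1 * (f u)^-1)))) => // [u Uu|].
  rewrite -[RHS]/('D_(delta_mx 0 i) (fun x => (f x)^-1) u) deriveV ?f0//; last by apply: diff_derivable; apply: f1.
  rewrite /GRing.scale /= ?expr2 ?invfM; ring.
have I := IH (Ck_prev F).
exact: Ck_mul oU (Ck_cst _ _ _) (Ck_mul oU (f2 i) (Ck_mul oU I I)).
Qed.

Lemma Ck_sum k U n (f : 'I_n -> 'rV[R]_m -> R) : open U ->
  (forall i, Ck k U (f i)) -> Ck k U (fun u => \sum_i f i u).
Proof.
move=> oU; elim: n f => [|n IH] f H.
  by rewrite (_ : (fun _ => _) = fun=> 0); [apply: Ck_cst|apply/funext => u; rewrite big_ord0].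
rewrite (_ : (fun _ => _) = fun u => f ord0 u + \sum_i f (lift ord0 i) u); last first.
  by apply/funext => u; rewrite big_ord_recl.
by apply: Ck_add => //; apply: IH.
Qed.

End SmoothFunctions.

Section SmoothComposition.
Variable R : realType.

Lemma cvg_mx (T : Type) (F : set_system T) (FF : Filter F) m n (f : T -> 'M[R]_(m, n)) (l : 'M[R]_(m, n)) :
  (forall i j, (fun x => f x i j) @ F --> l i j) -> f @ F --> l.
Proof.
move=> H; apply/cvg_ballP => e e0.
have : \forall x \near F, forall i j, ball (l i j) e (f x i j).
  apply: filter_forall => i; apply: filter_forall => j.
  by have /cvg_ballP := H i j; apply.
by apply: filterS => x Hx; split.
Qed.

Lemma differentiable_row (V : normedModType R) p (T : V -> 'rV[R]_p) x :
  (forall j, differentiable (fun v => T v 0 j) x) -> differentiable T x.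
Proof.
move=> H; have -> : T = \sum_j (fun v => T v 0 j *: delta_mx 0 j).
  by apply/funext => v; rewrite fct_sumE {1}(row_sum_delta (T v)).
by apply: differentiable_sum => j; apply: differentiableZl.
Qed.

Lemma deriv_comp m p (T : 'rV[R]_m -> 'rV[R]_p) (f : 'rV[R]_p -> R) u v :
  differentiable T u -> differentiable f (T u) ->
  'D_v (fun w => f (T w)) u = \sum_j 'D_(delta_mx 0 j) f (T u) * 'D_v (fun w => T w 0 j) u.
Proof.
move=> dT df.
have dc : differentiable (f \o T) u by apply: differentiable_comp.
rewrite -[LHS]/('D_v (f \o T) u) deriveE // diff_comp //=.
rewrite -(deriveE _ dT) derive_mx; last exact: diff_derivable.
rewrite [X in 'd f (T u) X](row_sum_delta) linear_sum /=.
apply: eq_bigr => j _; rewrite linearZ /= mxE mulrC /GRing.scale /=.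
by rewrite -(deriveE _ df).
Qed.

(** In the chain rule [f] is replaced by its partial derivatives while the inner map [T] stays the
    same; the induction on [k] therefore fixes [T] and varies [f]. *)
Lemma Ck_comp m p k (U : set 'rV[R]_m) (V : set 'rV[R]_p) (T : 'rV[R]_m -> 'rV[R]_p) f :
  open U -> (forall u, U u -> V (T u)) -> (forall j, Ck k U (fun u => T u 0 j)) ->
  Ck k V f -> Ck k U (fun u => f (T u)).
Proof.
move=> oU UV; elim: k f => [|k IH] f.
  move=> HT Hf u Uu; apply: (@continuous_comp _ _ _ T f); last exact: Hf (UV _ Uu).
  apply: (@cvg_mx _ (nbhs u) (nbhs_filter u)) => i j; rewrite (ord1 i); exact: (HT j u Uu).
move=> HT [f1 f2].
have dT u : U u -> differentiable T u by move=> Uu; apply: differentiable_row => j; have [/(_ u Uu)] := HT j.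
split=> [u Uu|i]; first by apply: (@differentiable_comp _ _ _ _ T f); [apply: dT|apply/f1/UV].
apply: (@Ck_ext _ _ _ _ (fun u => \sum_j 'D_(delta_mx 0 j) f (T u) * 'D_(delta_mx 0 i) (fun w => T w 0 j) u)) => //.
  by move=> u Uu; rewrite deriv_comp //; [apply: dT|apply/f1/UV].
apply: (Ck_sum oU) => j; have [_ Tj] := HT j.
exact: Ck_mul oU (IH _ (fun j' => Ck_prev (HT j')) (f2 j)) (Tj i).
Qed.
End SmoothComposition.

(** * Flat functions and bump functions *)

Section Bump.
Variable R : realType.

(** A smooth function of one variable is given by the sequence [psi] of its derivatives:
    differentiating the composite shifts the index, so the induction treats all [j] at once. *)
Lemma Ck_comp1 m k (U : set 'rV[R]_m) (psi : nat -> R -> R) (f : 'rV[R]_m -> R) j :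
  open U -> (forall j (x : R), is_derive x 1 (psi j) (psi j.+1 x)) ->
  Ck k U f -> Ck k U (fun u => psi j (f u)).
Proof.
move=> oU psiD; elim: k j => [|k IH] j F.
  move=> u Uu; apply: (@continuous_comp _ _ _ f (psi j)); first exact: (F u Uu).
  by apply: differentiable_continuous; apply/derivable1_diffP; have [] := psiD j (f u).
have [f1 f2] := F.
have dpsi u : differentiable (psi j) (f u) by apply/derivable1_diffP; have [] := psiD j (f u).
split=> [u Uu|i]; first by apply: (@differentiable_comp _ _ _ _ f (psi j)); [apply: f1|].
apply: (@Ck_ext _ _ _ _ (fun u => psi j.+1 (f u) * 'D_(delta_mx 0 i) f u)) => //; last first.
  exact: Ck_mul oU (IH _ (Ck_prev F)) (f2 i).
move=> u Uu; have dc : differentiable (psi j \o f) u by apply: differentiable_comp => //; apply: f1.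
have E : 'D_(delta_mx 0 i) (psi j \o f) u = 'd (psi j) (f u) ('d f u (delta_mx 0 i)).
  by rewrite deriveE // diff_comp //; apply: f1.
rewrite -[RHS]/('D_(delta_mx 0 i) (psi j \o f) u) {}E deriv1E; last by have [] := psiD j (f u).
rewrite derive1E (@derive_val _ _ _ _ _ _ _ (psiD j (f u))) deriveE; last exact: f1.
by rewrite /GRing.scale /= mulrC.
Qed.

(* This class of functions, smooth at 0, is closed under differentiation. *)
Definition flat (p : {poly R}) (x : R) : R := if 0 < x then p.[x^-1] * expR (- x^-1) else 0.

(** The inequality [1 + z <= expR z] at [z = y / (k + 1)], raised to the power [k + 1]. *)
Lemma expR_dominates k (y : R) : 0 <= y -> (y / k.+1%:R) ^+ k.+1 <= expR y.
Proof.
move=> y0; rewrite -[in leRHS](@divfK _ k.+1%:R _ y) ?pnatr_eq0// expRM_natr.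
rewrite lerXn2r ?nnegrE ?expR_ge0//; first by rewrite divr_ge0.
by apply: le_trans (expR_ge1Dx _); rewrite lerDr.
Qed.

Lemma poly_bound (p : {poly R}) : exists2 C, 0 <= C & forall y : R, 1 <= y -> `|p.[y]| <= C * y ^+ (size p).
Proof.
exists (\sum_(i < size p) `|p`_i|); first by rewrite sumr_ge0.
move=> y y1; rewrite horner_coef mulr_suml.
apply: le_trans (ler_norm_sum _ _ _) _; apply: ler_sum => i _.
rewrite normrM ler_wpM2l // normrX ger0_norm ?(le_trans _ y1)//.
by rewrite ler_weXn2l // ltnW.
Qed.

Lemma pow_cancel (x K : R) s : x != 0 ->
  x^-1 ^+ s * ((x^-1 * K^-1) ^+ s.+2)^-1 = K ^+ s.+2 * x ^+ 2.
Proof.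
move=> x0; rewrite -exprVn invfM !invrK exprMn -(addn2 s) !exprD exprVn.
have xs : x ^+ s != 0 by rewrite expf_neq0.
by rewrite -[x ^+ s * _ * _]mulrA mulKf // mulrC.
Qed.

(** The order [x ^+ 2] is what makes the difference quotient of [flat p] at 0 tend to 0. *)
Lemma flat_small (p : {poly R}) : exists2 C, 0 <= C & forall x : R, 0 < x -> x <= 1 -> `|flat p x| <= C * x ^+ 2.
Proof.
have [C C0 HC] := poly_bound p.
(* [expR_dominates] then has the exponent [size p + 2]: [size p] factors absorb the growth of [p],
   and two remain as [x ^+ 2]. *)
pose k := (size p).+1.
exists (C * k.+1%:R ^+ k.+1); first by rewrite mulr_ge0 // exprn_ge0.
move=> x x0 x1; rewrite /flat x0 normrM (ger0_norm (expR_ge0 _)) expRN.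
have y1 : 1 <= x^-1 by rewrite invf_ge1.
have y0 : 0 < x^-1 by rewrite invr_gt0.
have E := @expR_dominates k x^-1 (ltW y0).
have E0 : 0 < (x^-1 / k.+1%:R) ^+ k.+1 by rewrite exprn_gt0 // divr_gt0.
apply: (@le_trans _ _ (C * x^-1 ^+ size p * ((x^-1 / k.+1%:R) ^+ k.+1)^-1)).
  by apply: ler_pM; [| |exact: HC|rewrite lef_pV2 ?posrE ?expR_gt0].
rewrite -[leLHS]mulrA -[leRHS]mulrA ler_wpM2l // le_eqVlt; apply/orP; left; apply/eqP.
have xn : x != 0 by rewrite gt_eqF.
by rewrite pow_cancel.
Qed.

(** For [x > 0] this is the chain rule for [p(1/x) exp(-1/x)]; for [x < 0] everything is 0; at 0 the
    quadratic bound gives the derivative 0. *)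
Lemma flat_deriv (p : {poly R}) (x : R) : is_derive x 1 (flat p) (flat ('X^2 * (p - p^`())) x).
Proof.
have [x0|x0|->] := ltrgt0P x.
- have nx : x != 0 by rewrite gt_eqF.
  have near0 : \forall y \near x, p.[y^-1] * expR (- y^-1) = flat p y.
    near=> y; rewrite /flat; have -> // : 0 < y.
    by near: y; apply: lt_nbhsr.
  apply: near_eq_is_derive near0 _.
  have iv : is_derive x 1 (fun y : R => y^-1) (- x ^- 2).
    apply: DeriveDef; first exact: derivableV.
    by rewrite (@deriveV _ _ (@idfun R)) // derive_id /GRing.scale /= mulr1.
  have h1 : is_derive x 1 (fun y : R => p.[y^-1]) (p^`().[x^-1] * (- x ^- 2)).
    exact: (@is_derive1_comp _ (horner p) (fun y => y^-1)).
  have h2 : is_derive x 1 (fun y : R => expR (- y^-1)) (expR (- x^-1) * x ^- 2).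
    by apply: (@is_derive1_comp _ expR (fun y => - y^-1)); apply: is_derive_eq; rewrite opprK.
  apply: is_derive_eq; rewrite /flat x0 !hornerE /GRing.scale /= -exprVn.
  ring.
- have near0 : \forall y \near x, 0 = flat p y.
    near=> y; rewrite /flat ltNge ltW //; near: y; exact: lt_nbhsl.
  have -> : flat ('X^2 * (p - p^`())) x = 0 by rewrite /flat ltNge (ltW x0).
  exact: near_eq_is_derive near0 (is_derive_cst _ _ _).
- have [C C0 HC] := flat_small p.
  have -> : flat ('X^2 * (p - p^`())) 0 = 0 by rewrite /flat ltxx.
  have bd : \forall y \near (0 : R), `|flat p y| <= C * y ^+ 2.
    near=> y; have [y0|y0] := ltP 0 y.
      apply: HC => //; apply: ltW; near: y; exact: (lt_nbhsl ltr01).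
    have y0' : (0 < y) = false by apply/negbTE; rewrite -leNgt.
    by rewrite /flat y0' normr0 mulr_ge0 // sqr_ge0.
  have cv : (fun h : R => h^-1 *: ((flat p \o shift 0) (h *: 1) - flat p 0)) @ 0^' --> 0.
    have F0 : flat p 0 = 0 by rewrite /flat ltxx.
    apply/cvgrPdist_le => e e0; near=> h.
    have h0 : h != 0 by near: h; exact: nbhs_dnbhs_neq.
    rewrite F0 subr0 /= addr0 sub0r normrN normrZ normfV.
    rewrite [h *: 1]mulr1 ler_pdivrMl ?normr_gt0//.
    have Bh : `|flat p h| <= C * h ^+ 2 by near: h; exact: (nbhs_dnbhs bd).
    have hC : `|h| <= e / (C + 1) by near: h; apply: dnbhs0_le; rewrite divr_gt0 // ltr_wpDl.
    have h2 : h ^+ 2 = `|h| * `|h| by rewrite -expr2 real_normK ?num_real.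
    apply: le_trans Bh _; rewrite h2 mulrCA ler_wpM2l //.
    apply: (@le_trans _ _ ((C + 1) * `|h|)); first by rewrite ler_wpM2r // lerDl.
    by rewrite mulrC -ler_pdivlMr // ltr_wpDl.
  apply: DeriveDef; first by apply/cvg_ex; exists 0.
  exact/cvg_lim.
Unshelve. all: by end_near. Qed.

Definition flat_seq k := flat (iter k (fun p => 'X^2 * (p - p^`())) 1).

Lemma flat_seqD k (x : R) : is_derive x 1 (flat_seq k) (flat_seq k.+1 x).
Proof. exact: flat_deriv. Qed.

Lemma flat_seq0_gt0 x : 0 < x -> 0 < flat_seq 0 x.
Proof. by move=> x0; rewrite /flat_seq /flat x0 /= hornerC mul1r expR_gt0. Qed.

Lemma flat_seq0_le0 x : x <= 0 -> flat_seq 0 x = 0.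
Proof. by move=> x0; rewrite /flat_seq /flat ltNge x0. Qed.

Lemma flat_seq0_ge0 x : 0 <= flat_seq 0 x.
Proof. by case: (ltP 0 x) => [/flat_seq0_gt0/ltW//|/flat_seq0_le0->]. Qed.

(** The quotient [A / (A + B)], with [A] positive exactly inside radius [r] and [B] positive exactly
    outside radius [r / 2]: the denominator never vanishes, and the quotient is 1 near [u0], where
    [B] is 0. *)
Lemma smooth_bump m (u0 : 'rV[R]_m) (r : R) : 0 < r ->
  exists chi : 'rV[R]_m -> R, [/\ smooth_on setT chi,
    (\forall u \near u0, chi u = 1) &
    forall u, chi u != 0 -> forall i, `|u 0 i - u0 0 i| <= r].
Proof.
move=> r0.
pose q (u : 'rV[R]_m) := \sum_i (u 0 i - u0 0 i) * (u 0 i - u0 0 i).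
have q0 u : 0 <= q u by apply: sumr_ge0 => i _; rewrite -expr2 sqr_ge0.
pose A u := flat_seq 0 (r ^+ 2 - q u); pose B u := flat_seq 0 (q u - r ^+ 2 / 4).
have r20 : 0 < r ^+ 2 by rewrite exprn_gt0.
have AB u : 0 < A u + B u.
  rewrite /A /B; have [h|h] := ltP (q u) (r ^+ 2).
    by rewrite ltr_wpDr ?flat_seq0_ge0// flat_seq0_gt0// subr_gt0.
  by rewrite ltr_wpDl ?flat_seq0_ge0// flat_seq0_gt0//; lra.
have oT : open [set: 'rV[R]_m] by exact: openT.
have qs : smooth_on setT q.
  move=> k; apply: (Ck_sum oT) => i.
  have H : Ck k [set: 'rV[R]_m] (fun u => u 0 i - u0 0 i).
    exact: Ck_add oT (Ck_coord _ _ _) (Ck_cst _ _ _).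
  exact: Ck_mul.
have As : smooth_on setT A.
  move=> k; apply: (Ck_comp1 _ oT flat_seqD).
  apply: (@Ck_ext _ _ _ _ (fun u => r ^+ 2 + (-1) * q u)) => //; first by move=> u _; rewrite mulN1r.
  exact: Ck_add oT (Ck_cst _ _ _) (Ck_mul oT (Ck_cst _ _ _) (qs k)).
have Bs : smooth_on setT B.
  move=> k; apply: (Ck_comp1 _ oT flat_seqD).
  exact: Ck_add oT (qs k) (Ck_cst _ _ _).
exists (fun u => A u * (A u + B u)^-1); split.
- move=> k; apply: (Ck_mul oT (As k)); apply: (Ck_inv oT); first by move=> u _; rewrite gt_eqF.
  exact: Ck_add.
- have qc : q u @[u --> u0] --> 0.
    have := qs 0 u0 I; rewrite /prop_for /continuous_at.
    by rewrite [q u0]big1 // => i _; rewrite subrr mul0r.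
  have : \forall u \near u0, q u < r ^+ 2 / 4.
    by apply: (cvgr_lt _ qc); rewrite divr_gt0.
  apply: filterS => u qu; have -> : B u = 0 by apply: flat_seq0_le0; lra.
  by rewrite addr0 divff // gt_eqF // /A flat_seq0_gt0 //; lra.
- move=> u; have [|qu] := leP (r ^+ 2) (q u).
    by move=> h; rewrite /A flat_seq0_le0 ?mul0r ?eqxx //; lra.
  move=> _ i; rewrite -(ler_pXn2r (n := 2)) ?nnegrE// ?(ltW r0)// real_normK ?num_real//.
  apply: le_trans (ltW qu); rewrite /q (bigD1 i) //= -expr2 lerDl.
  by apply: sumr_ge0 => j _; rewrite -expr2 sqr_ge0.
Qed.
End Bump.

(** * Symmetry of second derivatives *)

Section Schwarz.
Variable R : realType.

Lemma line_deriv (V W : normedModType R) (f : V -> W) (w v : V) (r : R) :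
  differentiable f (w + r *: v) ->
  is_derive r 1 (fun r => f (w + r *: v)) ('D_v f (w + r *: v)).
Proof.
move=> df.
have H : is_diff r (fun r : R => w + r *: v) (fun s : R => s *: v).
  have := @is_diffD _ _ _ (cst w) (fun r : R => r *: v) 0 (fun s : R => s *: v) r _ _.
  by rewrite add0r; apply.
have dc : differentiable (f \o (fun r : R => w + r *: v)) r.
  by apply: differentiable_comp => //; apply: ex_diff.
apply: DeriveDef; first exact/derivable1_diffP.
have dw : differentiable (fun r : R => w + r *: v) r by case: H.
have dE : 'd (fun r : R => w + r *: v) r = (fun s : R => s *: v) :> (R -> V) by case: H.
rewrite -[LHS]/('D_1 (f \o (fun r : R => w + r *: v)) r) deriveE //.
by rewrite (diff_comp dw df) /= dE scale1r deriveE.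
Qed.

Lemma MVT_pos (f df : R -> R) (s : R) : 0 < s ->
  (forall r, 0 <= r <= s -> is_derive r 1 f (df r)) ->
  exists2 c, 0 < c < s & f s - f 0 = df c * s.
Proof.
move=> s0 H; have [||c] := @MVT R f df 0 s s0.
- by move=> x; rewrite in_itv /= => /andP[x0 xs]; apply: H; rewrite !ltW.
- apply: derivable_within_continuous => x; rewrite in_itv /= => xs.
  by have [] := H x xs.
- by rewrite in_itv /= subr0 => ? ?; exists c.
Qed.

(** Two applications of the mean value theorem: along [v] to the difference of [f] on two parallel
    segments, then along [w] to the derivative so obtained. *)
Lemma second_difference m (f : 'rV[R]_m -> R) (u v w : 'rV[R]_m) (s : R) : 0 < s ->
  (forall c d, 0 <= c <= s -> 0 <= d <= s -> differentiable f (u + c *: v + d *: w)) ->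
  (forall c d, 0 <= c <= s -> 0 <= d <= s -> differentiable ('D_v f) (u + c *: v + d *: w)) ->
  exists c d, [/\ 0 < c < s, 0 < d < s &
    f (u + s *: v + s *: w) - f (u + s *: v) - f (u + s *: w) + f u
    = 'D_w ('D_v f) (u + c *: v + d *: w) * s * s].
Proof.
move=> s0 H1 H2.
have s00 : 0 <= (0:R) <= s by rewrite lexx ltW.
have ss : 0 <= s <= s by rewrite lexx ltW.
have [|c cs E] := @MVT_pos (fun r => f ((u + s *: w) + r *: v) - f (u + r *: v))
   (fun r => 'D_v f ((u + s *: w) + r *: v) - 'D_v f (u + r *: v)) s s0; last first.
  have cs' : 0 <= c <= s by have /andP[? ?] := cs; rewrite !ltW.
  have [|d ds E'] := @MVT_pos (fun r => 'D_v f ((u + c *: v) + r *: w))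
     (fun r => 'D_w ('D_v f) ((u + c *: v) + r *: w)) s s0; last first.
    exists c, d; split=> //.
    rewrite -E' scale0r addr0 -[u + c *: v + s *: w]addrAC.
    rewrite -E !scale0r !addr0 -[u + s *: v + s *: w]addrAC; ring.
  by move=> r rs; apply: line_deriv; apply: H2.
move=> r rs; apply: is_deriveB; apply: line_deriv.
  by rewrite addrAC; apply: H1.
by have := H1 r 0 rs s00; rewrite scale0r addr0.
Qed.

Lemma dist_half (a b c e : R) : `|a - c| < e / 2 -> `|b - c| < e / 2 -> `|b - a| <= e.
Proof. by rewrite !ltr_norml ler_norml => /andP[? ?] /andP[? ?]; apply/andP; split; lra. Qed.

(** The second difference is symmetric in [v] and [w], so it equals [s * s] times either mixed
    derivative, each at some point near [u]; continuity at [u] compares the two. *)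
Lemma mixed_derivatives m (f : 'rV[R]_m -> R) (U : set 'rV[R]_m) (u v w : 'rV[R]_m) :
  open U -> U u -> (forall x, U x -> differentiable f x) ->
  (forall x, U x -> differentiable ('D_v f) x) -> (forall x, U x -> differentiable ('D_w f) x) ->
  {for u, continuous ('D_w ('D_v f))} -> {for u, continuous ('D_v ('D_w f))} ->
  'D_v ('D_w f) u = 'D_w ('D_v f) u.
Proof.
move=> oU Uu f1 fi fj ci cj.
apply/eqP; rewrite -subr_eq0 -normr_le0; apply/ler_addgt0Pr => e e0; rewrite add0r.
have e20 : 0 < e / 2 by rewrite divr_gt0.
have n1 : \forall x \near u, `|'D_w ('D_v f) u - 'D_w ('D_v f) x| < e / 2.
  by move/cvgrPdist_lt: ci; apply.
have n2 : \forall x \near u, `|'D_v ('D_w f) u - 'D_v ('D_w f) x| < e / 2.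
  by move/cvgrPdist_lt: cj; apply.
have n3 : \forall x \near u, U x by apply: open_nbhs_nbhs.
have /nbhs_normP[r /= r0 Hr] : \forall x \near u, [/\ U x,
   `|'D_w ('D_v f) u - 'D_w ('D_v f) x| < e / 2 & `|'D_v ('D_w f) u - 'D_v ('D_w f) x| < e / 2].
  by apply: filterS3 n3 n1 n2 => x h1 h2 h3; split.
pose K := `|v| + `|w| + 1.
have K0 : 0 < K by rewrite ltr_pwDr // addr_ge0.
(* With [s * K = r / 2] the parallelogram with sides [s *: v] and [s *: w] stays in the ball of
   radius [r] on which the estimates hold. *)
pose s := r / 2 / K.
have s0 : 0 < s by rewrite !divr_gt0.
have near_u c d a b : `|a| + `|b| + 1 = K -> 0 <= c <= s -> 0 <= d <= s -> `|u - (u + c *: a + d *: b)| < r.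
  move=> ab /andP[c0 cs] /andP[d0 ds].
  rewrite -addrA opprD addrA subrr add0r normrN.
  apply: le_lt_trans (ler_normD _ _) _; rewrite !normrZ (ger0_norm c0) (ger0_norm d0).
  have : s * K = r / 2 by rewrite /s divfK // gt_eqF.
  have : c * `|a| <= s * `|a| by rewrite ler_wpM2r.
  have : d * `|b| <= s * `|b| by rewrite ler_wpM2r.
  rewrite -ab; have := normr_ge0 a; have := normr_ge0 b; nra.
have Kc : `|w| + `|v| + 1 = K by rewrite /K [`|w| + _]addrC.
have [c [d [cs ds E1]]] := @second_difference _ f u v w s s0
  (fun c d hc hd => f1 _ (let: And3 h _ _ := Hr _ (near_u c d v w erefl hc hd) in h))
  (fun c d hc hd => fi _ (let: And3 h _ _ := Hr _ (near_u c d v w erefl hc hd) in h)).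
have [c' [d' [cs' ds' E2]]] := @second_difference _ f u w v s s0
  (fun c d hc hd => f1 _ (let: And3 h _ _ := Hr _ (near_u c d w v Kc hc hd) in h))
  (fun c d hc hd => fj _ (let: And3 h _ _ := Hr _ (near_u c d w v Kc hc hd) in h)).
have wk x : 0 < x < s -> 0 <= x <= s by move=> /andP[? ?]; rewrite !ltW.
have [_ B1 _] := Hr _ (near_u c d v w erefl (wk _ cs) (wk _ ds)).
have [_ _ B2] := Hr _ (near_u c' d' w v Kc (wk _ cs') (wk _ ds')).
have swap : f (u + s *: v + s *: w) - f (u + s *: v) - f (u + s *: w) + f u
     = f (u + s *: w + s *: v) - f (u + s *: w) - f (u + s *: v) + f u.
  by rewrite [u + s *: w + s *: v]addrAC; congr (_ + _); exact: addrAC.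
have := etrans (esym E1) (etrans swap E2).
move=> /(mulIf (lt0r_neq0 s0)) /(mulIf (lt0r_neq0 s0)) E.
rewrite E in B1.
exact: (dist_half B1 B2).
Qed.

Lemma Schwarz m (f : 'rV[R]_m -> R) (U : set 'rV[R]_m) (u : 'rV[R]_m) (i j : 'I_m) :
  open U -> U u -> Ck 2 U f ->
  'D_(delta_mx 0 i) ('D_(delta_mx 0 j) f) u = 'D_(delta_mx 0 j) ('D_(delta_mx 0 i) f) u.
Proof.
move=> oU Uu [f1 f2]; have [fi fij] := f2 i; have [fj fji] := f2 j.
by apply: (mixed_derivatives oU Uu); [| | |exact: (fij j u Uu)|exact: (fji i u Uu)].
Qed.
End Schwarz.

(** * Smooth functions and tangent vectors on a manifold *)

Lemma near_open (T : topologicalType) (x : T) (P : set T) : (\forall y \near x, P y) ->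
  exists W, [/\ open W, W x & W `<=` P].
Proof. by move=> h; exists P°; split; [exact: open_interior|exact: h|exact: interior_subset]. Qed.

Section Functions.
Variables (R : realType) (m : nat) (M : manifold R m).
Implicit Types (f g : M -> R) (x y : M).

(** Smoothness at one point, tested in one chart; [smooth_near_chart] transfers it to every other
    chart and [smooth_nearP] recovers [Cinf]. It applies to functions that are given by a formula in
    a local frame only. *)
Definition smooth_near x f := exists a : chart R m M, [/\ atlas M a, chart_dom a x &
  exists V, [/\ open V, V (chart_fun a x), V `<=` chart_cod a & smooth_on V (f \o chart_inv a)]].

Lemma chart_dom_near (a : chart R m M) x : chart_dom a x -> \forall y \near x, chart_dom a y.
Proof. by move=> ax; apply: open_nbhs_nbhs; split=> //; apply: chart_dom_open. Qed.

Lemma chart_cod_near (a : chart R m M) u : chart_cod a u -> \forall v \near u, chart_cod a v.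
Proof. by move=> ax; apply: open_nbhs_nbhs; split=> //; apply: chart_cod_open. Qed.

Lemma chart_near (a : chart R m M) x (P : set M) : chart_dom a x -> (\forall y \near x, P y) ->
  \forall u \near chart_fun a x, P (chart_inv a u).
Proof.
move=> ax Px; have := chart_inv_cont (chart_fun_cod ax).
by rewrite /prop_for /continuous_at chart_funK //; apply.
Qed.

Lemma chart_fun_near (a : chart R m M) x (P : set 'rV[R]_m) : chart_dom a x ->
  (\forall u \near chart_fun a x, P u) -> \forall y \near x, P (chart_fun a y).
Proof. by move=> ax Px; have := chart_fun_cont ax; apply. Qed.

Lemma smooth_near_chart (b : chart R m M) u f : atlas M b -> chart_cod b u ->
  smooth_near (chart_inv b u) f ->
  exists W, [/\ open W, W u, W `<=` chart_cod b & smooth_on W (f \o chart_inv b)].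
Proof.
move=> Mb bu [a [Ma ax [V [oV Vx Va Vs]]]].
pose W := [set w | [/\ chart_cod b w, chart_dom a (chart_inv b w) & V (chart_fun a (chart_inv b w))]].
have oW : open W.
  rewrite openE => w [bw aw Vw].
  have n1 := chart_cod_near bw.
  have n2 : \forall z \near w, chart_dom a (chart_inv b z).
    by have := chart_inv_cont bw; apply; apply: chart_dom_near.
  have n3 : \forall z \near w, V (chart_fun a (chart_inv b z)).
    exact: (chart_inv_cont bw (chart_fun_near aw (open_nbhs_nbhs (conj oV Vw)))).
  by near=> z; split; near: z.
exists W; split=> // [w []//|k].
have Es : forall w, W w -> (f \o chart_inv a) (chart_fun a (chart_inv b w)) = (f \o chart_inv b) w.
  by move=> w [_ aw _] /=; rewrite chart_funK.
apply: (Ck_ext oW Es).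
apply: (Ck_comp oW _ _ (Vs k)); first by move=> w [].
by move=> j; apply: Ck_sub (atlas_compat Mb Ma j k) => w [].
Unshelve. all: by end_near. Qed.

Lemma smooth_nearP f : (forall x, smooth_near x f) <-> Cinf f.
Proof.
split=> [H a Ma k|H x].
  apply: Ck_near => u au.
  have [W [oW Wu _ Ws]] := smooth_near_chart Ma au (H (chart_inv a u)).
  by exists W; split.
have [a Ma ax] := atlas_cover x; exists a; split=> //.
exists (chart_cod a); split=> //; [exact: chart_cod_open|exact: chart_fun_cod|exact: H].
Qed.

Lemma smooth_near_Cinf x f : Cinf f -> smooth_near x f.
Proof. by move/smooth_nearP. Qed.

Lemma smooth_near_ext x f g : (\forall y \near x, f y = g y) -> smooth_near x f -> smooth_near x g.
Proof.
move=> fg [a [Ma ax [V [oV Vx Va Vs]]]].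
exists a; split=> //.
have : \forall u \near chart_fun a x, V u /\ f (chart_inv a u) = g (chart_inv a u).
  apply: filterI; first exact: open_nbhs_nbhs.
  exact: chart_near ax fg.
move=> /near_open [W [oW Wx HW]].
exists W; split=> // [u /HW[/Va]//|k].
apply: (@Ck_ext _ _ _ _ (f \o chart_inv a)) => //; first by move=> u /HW[].
by apply: Ck_sub (Vs k) => u /HW[].
Qed.

Lemma smooth_near2 x f g : smooth_near x f -> smooth_near x g ->
  exists a : chart R m M, [/\ atlas M a, chart_dom a x &
  exists V, [/\ open V, V (chart_fun a x), V `<=` chart_cod a, smooth_on V (f \o chart_inv a) & smooth_on V (g \o chart_inv a)]].
Proof.
move=> [a [Ma ax [V [oV Vx Va Vs]]]].
rewrite -(chart_funK ax) => /(smooth_near_chart Ma (chart_fun_cod ax)) [W [oW Wx Wa Ws]].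
exists a; split=> //; first by rewrite chart_funK.
exists (V `&` W); split=> //; first exact: openI.
- by rewrite chart_funK.
- by move=> u [/Va].
- by move=> k; apply: Ck_sub (Vs k) => u [].
- by move=> k; apply: Ck_sub (Ws k) => u [].
Qed.

Lemma smooth_near_cst x (c : R) : smooth_near x (fun=> c).
Proof. by apply: smooth_near_Cinf => a Ma k; apply: Ck_cst. Qed.

Lemma smooth_near_add x f g : smooth_near x f -> smooth_near x g -> smooth_near x (fun y => f y + g y).
Proof.
move=> sf sg; have [a [Ma ax [V [oV Vx Va fs gs]]]] := smooth_near2 sf sg.
exists a; split=> //; exists V; split=> // k; exact: (Ck_add oV (fs k) (gs k)).
Qed.

Lemma smooth_near_mul x f g : smooth_near x f -> smooth_near x g -> smooth_near x (fun y => f y * g y).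
Proof.
move=> sf sg; have [a [Ma ax [V [oV Vx Va fs gs]]]] := smooth_near2 sf sg.
exists a; split=> //; exists V; split=> // k; exact: (Ck_mul oV (fs k) (gs k)).
Qed.

Lemma smooth_near_sum x n (f : 'I_n -> M -> R) : (forall i, smooth_near x (f i)) ->
  smooth_near x (fun y => \sum_i f i y).
Proof.
elim: n f => [|n IH] f H.
  by rewrite (_ : (fun _ => _) = fun=> 0); [apply: smooth_near_cst|apply/funext => u; rewrite big_ord0].
rewrite (_ : (fun _ => _) = fun u => f ord0 u + \sum_i f (lift ord0 i) u); last first.
  by apply/funext => u; rewrite big_ord_recl.
by apply: smooth_near_add => //; apply: IH.
Qed.

Lemma Cinf_cst (c : R) : Cinf (fun _ : M => c).
Proof. by apply/smooth_nearP => x; apply: smooth_near_cst. Qed.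
Lemma Cinf_add f g : Cinf f -> Cinf g -> Cinf (fun y => f y + g y).
Proof. by move=> /smooth_nearP F /smooth_nearP G; apply/smooth_nearP => x; apply: smooth_near_add. Qed.
Lemma Cinf_mul f g : Cinf f -> Cinf g -> Cinf (fun y => f y * g y).
Proof. by move=> /smooth_nearP F /smooth_nearP G; apply/smooth_nearP => x; apply: smooth_near_mul. Qed.
Lemma Cinf_sub f g : Cinf f -> Cinf g -> Cinf (fun y => f y - g y).
Proof.
move=> F G; rewrite (_ : (fun _ => _) = fun y => f y + (-1) * g y).
  by apply: Cinf_add => //; apply: Cinf_mul => //; apply: Cinf_cst.
by apply/funext => y; rewrite mulN1r.
Qed.

Lemma smooth_near_cont x f : smooth_near x f -> {for x, continuous f}.
Proof.
move=> [a [Ma ax [V [oV Vx Va Vs]]]].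
have fc : {for x, continuous ((f \o chart_inv a) \o chart_fun a)}.
  apply: continuous_comp; first exact: chart_fun_cont.
  exact: (Vs 0 _ Vx).
have E : \forall y \near x, ((f \o chart_inv a) \o chart_fun a) y = f y.
  by near=> y; rewrite /= chart_funK //; near: y; apply: chart_dom_near.
move: fc; rewrite /prop_for /continuous_at /= chart_funK //.
by apply: cvg_trans; exact: near_eq_cvg E.
Unshelve. all: by end_near. Qed.

Lemma smooth_near_inv x f : f x != 0 -> smooth_near x f -> smooth_near x (fun y => (f y)^-1).
Proof.
move=> f0 [a [Ma ax [V [oV Vx Va Vs]]]].
exists a; split=> //.
have fc := Vs 0 _ Vx.
have : \forall u \near chart_fun a x, V u /\ f (chart_inv a u) != 0.
  apply: filterI; first exact: open_nbhs_nbhs.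
  have f0' : (f \o chart_inv a) (chart_fun a x) != 0 by rewrite /= chart_funK.
  exact: (cvgr_neq0 _ fc f0').
move=> /near_open [W [oW Wx HW]].
exists W; split=> // [u /HW[/Va]//|k].
apply: (Ck_inv oW) => [u /HW[]//|]; by apply: Ck_sub (Vs k) => u /HW[].
Qed.

(** [K] is the image of a compact box under the inverse of a chart and is closed because [M] is
    Hausdorff; so the extension by zero is smooth also at the points outside the chart. *)
Lemma bump_function x (U : set M) : (\forall y \near x, U y) -> exists chi : M -> R, exists K : set M,
  [/\ Cinf chi, \forall y \near x, chi y = 1, closed K, K `<=` U & forall y, ~ K y -> chi y = 0].
Proof.
move=> Ux; have [a Ma ax] := atlas_cover x; set u0 := chart_fun a x.
have : \forall u \near u0, chart_cod a u /\ U (chart_inv a u).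
  by apply: filterI; [apply/chart_cod_near/chart_fun_cod|apply: chart_near ax Ux].
move=> /nbhs_ballP[e /= e0 He].
pose r := e / 2; have r0 : 0 < r by rewrite divr_gt0.
have [chi0 [chis chi1 chiB]] := smooth_bump u0 r0.
pose B := [set u : 'rV[R]_m | forall i, `[u0 0 i - r, u0 0 i + r]%classic (u 0 i)].
have BE (u : 'rV[R]_m) : (forall i, `|u 0 i - u0 0 i| <= r) -> B u.
  by move=> H i /=; have := H i; rewrite in_itv /= ler_norml => /andP[? ?]; apply/andP; split; lra.
have Bball (u : 'rV[R]_m) : B u -> ball u0 e u.
  move=> Bu; split=> // i j; rewrite (ord1 i); have /= := Bu j; rewrite in_itv /= => /andP[? ?].
  have er : e = r + r by exact: splitr.
  rewrite /ball /= ltr_norml; apply/andP; split; lra.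
have Bc : compact B.
  apply: (@rV_compact R m (fun i => `[u0 0 i - r, u0 0 i + r]%classic)) => i.
  exact: segment_compact.
pose K := chart_inv a @` B.
have Kc : closed K.
  apply: compact_closed; first exact: manifold_hausdorff.
  apply: continuous_compact => //; apply: continuous_in_subspaceT => u /set_mem Bu.
  by apply: chart_inv_cont; have [] := He _ (Bball _ Bu).
pose chi (y : M) := if `[< chart_dom a y >] then chi0 (chart_fun a y) else 0.
have chiK y : ~ K y -> chi y = 0.
  rewrite /chi; case: asboolP => // ay nK; apply/eqP/negPn/negP => /chiB /BE By; apply: nK.
  by exists (chart_fun a y) => //; rewrite chart_funK.
exists chi, K; split=> //.
- apply/smooth_nearP => y; have [ay|nay] := pselect (chart_dom a y).
    exists a; split=> //; exists (chart_cod a); split=> //; [exact: chart_cod_open|exact: chart_fun_cod|].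
    move=> k; apply: (@Ck_ext _ _ _ _ chi0); first exact: chart_cod_open.
      by move=> u au; rewrite /= /chi; case: asboolP; [rewrite chart_invK|move=> []; apply: chart_inv_dom].
    exact: Ck_sub (chis k).
  apply: (@smooth_near_ext _ (fun=> 0)); last exact: smooth_near_cst.
  have nK : (~` K) y by move=> [u Bu uy]; apply: nay; rewrite -uy; apply: chart_inv_dom; have [] := He _ (Bball _ Bu).
  have : \forall z \near y, (~` K) z by apply: open_nbhs_nbhs; split=> //; rewrite openC.
  by apply: filterS => z /chiK.
- apply: filterS2 (chart_dom_near ax) (chart_fun_near ax chi1) => y ay chiy.
  by rewrite /chi; case: asboolP.
- by move=> y [u Bu <-]; have [] := He _ (Bball _ Bu).
Qed.

Lemma near_nbhs_near x (P : set M) : (\forall y \near x, P y) -> \forall y \near x, \forall z \near y, P z.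
Proof. by move=> /nbhs_interior. Qed.

Lemma smooth_near_near x f : smooth_near x f -> \forall y \near x, smooth_near y f.
Proof.
move=> [a [Ma ax [V [oV Vx Va Vs]]]].
have n1 : \forall y \near x, V (chart_fun a y) by apply: (chart_fun_near ax); apply: open_nbhs_nbhs.
have n2 := chart_dom_near ax.
near=> y; exists a; split=> //; first by near: y.
by exists V; split=> //; near: y.
Unshelve. all: by end_near. Qed.

(** Tangent vectors act on globally smooth functions only; a function that is smooth near a point is
    therefore cut off by a bump function supported where it is smooth. *)
Lemma smooth_near_extend x f : smooth_near x f -> exists2 F, Cinf F & \forall y \near x, f y = F y.
Proof.
move=> fs; have [chi [K [chis chi1 Kc KU chi0]]] := bump_function (smooth_near_near fs).
exists (fun y => chi y * f y); last by apply: filterS chi1 => y ->; rewrite mul1r.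
apply/smooth_nearP => y; have [Ky|nKy] := pselect (K y).
  by apply: smooth_near_mul; [apply: smooth_near_Cinf|apply: KU].
apply: (@smooth_near_ext _ (fun=> 0)); last exact: smooth_near_cst.
have : \forall z \near y, (~` K) z by apply: open_nbhs_nbhs; split=> //; rewrite openC.
by apply: filterS => z /chi0 ->; rewrite mul0r.
Qed.

Definition smooth_mx x p q (A : M -> 'M[R]_(p, q)) := forall i j, smooth_near x (fun y => A y i j).

Lemma smooth_mx_mul x p q r (A : M -> 'M[R]_(p, q)) (B : M -> 'M[R]_(q, r)) :
  smooth_mx x A -> smooth_mx x B -> smooth_mx x (fun y => A y *m B y).
Proof.
move=> sA sB i j.
rewrite (_ : (fun _ => _) = fun y => \sum_k A y i k * B y k j); last by apply/funext => y; rewrite mxE.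
by apply: smooth_near_sum => k; apply: smooth_near_mul.
Qed.

Lemma smooth_mx_add x p q (A B : M -> 'M[R]_(p, q)) :
  smooth_mx x A -> smooth_mx x B -> smooth_mx x (fun y => A y + B y).
Proof.
move=> sA sB i j.
rewrite (_ : (fun _ => _) = fun y => A y i j + B y i j); last by apply/funext => y; rewrite mxE.
exact: smooth_near_add.
Qed.

Lemma smooth_mx_scale x p q (c : R) (A : M -> 'M[R]_(p, q)) :
  smooth_mx x A -> smooth_mx x (fun y => c *: A y).
Proof.
move=> sA i j.
rewrite (_ : (fun _ => _) = fun y => c * A y i j); last by apply/funext => y; rewrite mxE.
by apply: smooth_near_mul => //; apply: smooth_near_cst.
Qed.

Lemma smooth_mx_tr x p q (A : M -> 'M[R]_(p, q)) : smooth_mx x A -> smooth_mx x (fun y => (A y)^T).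
Proof.
move=> sA i j.
by rewrite (_ : (fun _ => _) = fun y => A y j i); last by apply/funext => y; rewrite mxE.
Qed.

Lemma smooth_det x p (A : M -> 'M[R]_p) : smooth_mx x A -> smooth_near x (fun y => \det (A y)).
Proof.
elim: p A => [|p IH] A sA.
  by rewrite (_ : (fun _ => _) = fun=> 1); [apply: smooth_near_cst|apply/funext => y; rewrite det_mx00].
rewrite (_ : (fun _ => _) = fun y => \sum_j A y ord0 j * cofactor (A y) ord0 j); last first.
  by apply/funext => y; rewrite (expand_det_row _ ord0).
apply: smooth_near_sum => j; apply: smooth_near_mul => //.
rewrite /cofactor; apply: smooth_near_mul; first exact: smooth_near_cst.
apply: IH => i k; rewrite (_ : (fun _ => _) = fun y => A y (lift ord0 i) (lift j k)) //.
by apply/funext => y; rewrite !mxE.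
Qed.

Lemma smooth_mx_inv x p (A : M -> 'M[R]_p) : A x \in unitmx -> smooth_mx x A -> smooth_mx x (fun y => invmx (A y)).
Proof.
move=> uA sA i j.
have d0 : \det (A x) != 0 by rewrite -unitfE -unitmxE.
have dn : \forall y \near x, \det (A y) != 0.
  exact: (cvgr_neq0 _ (smooth_near_cont (smooth_det sA)) d0).
apply: (@smooth_near_ext _ (fun y => (\det (A y))^-1 * cofactor (A y) j i)).
  apply: filterS dn => y dy; rewrite /invmx unitmxE unitfE dy.
  by rewrite !mxE.
apply: smooth_near_mul; first by apply: smooth_near_inv => //; apply: smooth_det.
apply: smooth_near_mul; first exact: smooth_near_cst.
apply: smooth_det => k l; rewrite (_ : (fun _ => _) = fun y => A y (lift j k) (lift i l)) //.
by apply/funext => y; rewrite !mxE.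
Qed.

Lemma near_unitmx x p (A : M -> 'M[R]_p) : A x \in unitmx -> smooth_mx x A -> \forall y \near x, A y \in unitmx.
Proof.
move=> uA sA; have d0 : \det (A x) != 0 by rewrite -unitfE -unitmxE.
have dn : \forall y \near x, \det (A y) != 0.
  exact: (cvgr_neq0 _ (smooth_near_cont (smooth_det sA)) d0).
by apply: filterS dn => y; rewrite unitmxE unitfE.
Qed.
Lemma smooth_mx_opp x p q (A : M -> 'M[R]_(p, q)) : smooth_mx x A -> smooth_mx x (fun y => - A y).
Proof.
move=> /(smooth_mx_scale (-1)) H i j; have := H i j.
by apply: smooth_near_ext; apply: nearW => y; rewrite scaleN1r.
Qed.

Lemma smooth_mx_fscale x p q (f : M -> R) (A : M -> 'M[R]_(p, q)) : smooth_near x f -> smooth_mx x A ->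
  smooth_mx x (fun y => f y *: A y).
Proof.
move=> sf sA i j; have := smooth_near_mul sf (sA i j).
by apply: smooth_near_ext; apply: nearW => y; rewrite mxE.
Qed.

End Functions.

(** * Derivations, coordinate vectors and brackets *)

Section Tangent.
Variables (R : realType) (m : nat) (M : manifold R m).
Implicit Types (f g : M -> R) (x y : M) (xi eta : tvec M).

Lemma tvec_sumE k (v : 'I_k -> tvec M) f : (\sum_i v i) f = \sum_i v i f.
Proof. by rewrite fct_sumE. Qed.

Lemma tvec_combE k (a : 'I_k -> R) (v : 'I_k -> tvec M) f : (\sum_i a i *: v i) f = \sum_i a i * v i f.
Proof. by rewrite tvec_sumE. Qed.

Lemma tangent_comb x (a : R) xi eta : tangent x xi -> tangent x eta -> tangent x (a *: xi + eta).
Proof.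
have E f : (a *: xi + eta) f = a * xi f + eta f by [].
move=> [x1 x2 x3] [e1 e2 e3]; split.
- by move=> f nf; rewrite E x1 // e1 // mulr0 addr0.
- by move=> c f g sf sg; rewrite !E x2 // e2 //; ring.
- by move=> f g sf sg; rewrite !E x3 // e3 //; ring.
Qed.

Lemma tangent0 x : tangent x (0 : tvec M).
Proof.
have E f : (0 : tvec M) f = 0 by [].
by split=> [f _|a f g _ _|f g _ _]; rewrite !E // ?mulr0 ?mul0r ?addr0.
Qed.

Lemma tangentZ x a xi : tangent x xi -> tangent x (a *: xi).
Proof. by move=> H; rewrite -[_ *: _]addr0; apply: tangent_comb => //; apply: tangent0. Qed.
Lemma tangentD x xi eta : tangent x xi -> tangent x eta -> tangent x (xi + eta).
Proof. by move=> H H'; rewrite -[xi]scale1r; apply: tangent_comb. Qed.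
Lemma tangentB x xi eta : tangent x xi -> tangent x eta -> tangent x (xi - eta).
Proof. by move=> H H'; rewrite addrC -scaleN1r; apply: tangent_comb. Qed.

Lemma tangent_sum x k (v : 'I_k -> tvec M) : (forall i, tangent x (v i)) -> tangent x (\sum_i v i).
Proof. by move=> H; elim/big_ind: _ => //; [exact: tangent0|exact: tangentD]. Qed.

Lemma tangent_lcomb x k (a : 'I_k -> R) (v : 'I_k -> tvec M) : (forall i, tangent x (v i)) -> tangent x (\sum_i a i *: v i).
Proof. by move=> H; apply: tangent_sum => i; apply: tangentZ. Qed.

Lemma tangent_ext x xi eta : tangent x xi -> tangent x eta -> (forall f, Cinf f -> xi f = eta f) -> xi = eta.
Proof.
move=> [x1 _ _] [e1 _ _] H; apply/funext => f.
by have [/H//|nf] := pselect (Cinf f); rewrite x1 // e1.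
Qed.

Lemma tangent_cst x xi (c : R) : tangent x xi -> xi (fun=> c) = 0.
Proof.
move=> [_ x2 x3].
have o : Cinf (fun _ : M => 1 : R) by apply: Cinf_cst.
have z : Cinf (fun _ : M => 0 : R) by apply: Cinf_cst.
have h1 : xi (fun=> 1) = 0.
  have := x3 _ _ o o; under eq_fun do rewrite mulr1.
  by move=> /eqP; rewrite mulr1 mul1r -subr_eq0 opprD addrA subrr add0r oppr_eq0 => /eqP.
have h0 : xi (fun=> 0) = 0.
  have := x2 1 _ _ z z; under eq_fun do rewrite mul1r addr0.
  by move=> /eqP; rewrite mul1r -subr_eq0 opprD addrA subrr add0r oppr_eq0 => /eqP.
have := x2 c _ _ o z; under eq_fun do rewrite mulr1 addr0.
by rewrite h1 h0 mulr0 addr0.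
Qed.

Lemma tangent_add x xi f g : tangent x xi -> Cinf f -> Cinf g -> xi (fun y => f y + g y) = xi f + xi g.
Proof.
move=> [_ x2 _] sf sg; have := x2 1 _ _ sf sg.
by under eq_fun do rewrite mul1r; rewrite mul1r.
Qed.

(** A bump function supported where [f = g] kills [g - f]; the Leibniz rule for this zero product at
    [x], where the bump function is 1, gives the equality. *)
Lemma tangent_local x xi f g : tangent x xi -> Cinf f -> Cinf g -> (\forall y \near x, f y = g y) -> xi f = xi g.
Proof.
move=> tx sf sg fg; have [_ x2 x3] := tx.
have [chi [K [chis chi1 Kc KU chi0]]] := bump_function fg.
have sd : Cinf (fun y => (-1) * f y + g y).
  by apply: Cinf_add => //; apply: Cinf_mul => //; apply: Cinf_cst.
have E : (fun y => chi y * ((-1) * f y + g y)) = fun=> 0.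
  apply/funext => y; have [Ky|/chi0->] := pselect (K y); last by rewrite mul0r.
  by rewrite (KU _ Ky) mulN1r addNr mulr0.
have := x3 _ _ chis sd; rewrite E (tangent_cst _ tx) (nbhs_singleton chi1) mul1r.
rewrite (nbhs_singleton fg) mulN1r addNr mulr0 add0r x2 // mulN1r => /eqP.
by rewrite eq_sym addrC subr_eq0 => /eqP.
Qed.

Lemma vector_field_mul (chi : M -> R) (X : M -> tvec M) : Cinf chi -> vector_field X ->
  vector_field (fun x => chi x *: X x).
Proof.
move=> sc [X1 X2]; split=> [x|f sf]; first exact: tangentZ.
by apply: Cinf_mul => //; apply: X2.
Qed.

Lemma vector_field_sum k (X : 'I_k -> M -> tvec M) : (forall i, vector_field (X i)) ->
  vector_field (fun x => \sum_i X i x).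
Proof.
move=> H; split=> [x|f sf]; first by apply: tangent_sum => i; have [] := H i.
rewrite (_ : (fun _ => _) = fun x => \sum_i X i x f); last by apply/funext => x; rewrite tvec_sumE.
apply/smooth_nearP => x; apply: smooth_near_sum => i; apply: smooth_near_Cinf.
by have [_] := H i; apply.
Qed.

Definition pd (a : chart R m M) (i : 'I_m) (x : M) : tvec M :=
  fun f => if `[< Cinf f >] then 'D_(delta_mx 0 i) (f \o chart_inv a) (chart_fun a x) else 0.

Lemma pdE a i x f : Cinf f -> pd a i x f = 'D_(delta_mx 0 i) (f \o chart_inv a) (chart_fun a x).
Proof. by rewrite /pd; case: asboolP. Qed.

Lemma chart_differentiable a x f : atlas M a -> chart_dom a x -> Cinf f ->
  differentiable (f \o chart_inv a) (chart_fun a x).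
Proof. by move=> Ma ax sf; have [+ _] := sf a Ma 1; apply; apply: chart_fun_cod. Qed.

Lemma pd_tangent a i x : atlas M a -> chart_dom a x -> tangent x (pd a i x).
Proof.
move=> Ma ax; split.
- by move=> f nf; rewrite /pd; case: asboolP.
- move=> c f g sf sg; rewrite !pdE //; last by apply: Cinf_add => //; apply: Cinf_mul => //; apply: Cinf_cst.
  have df := @diff_derivable _ _ _ _ _ (delta_mx 0 i) (chart_differentiable Ma ax sf).
  have dg := @diff_derivable _ _ _ _ _ (delta_mx 0 i) (chart_differentiable Ma ax sg).
  rewrite (_ : _ \o _ = c *: (f \o chart_inv a) + (g \o chart_inv a)) //.
  rewrite deriveD //; last exact: derivableZ.
  by rewrite deriveZ.
- move=> f g sf sg; rewrite !pdE //; last by apply: Cinf_mul.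
  have df := @diff_derivable _ _ _ _ _ (delta_mx 0 i) (chart_differentiable Ma ax sf).
  have dg := @diff_derivable _ _ _ _ _ (delta_mx 0 i) (chart_differentiable Ma ax sg).
  rewrite -[(fun y => f y * g y) \o chart_inv a]/((f \o chart_inv a) * (g \o chart_inv a)) (deriveM df dg).
  by rewrite /= chart_funK // /GRing.scale /= addrC [X in X + _]mulrC.
Qed.

(** Coordinates are defined on the chart only; global functions that agree with them near [x] can be
    given to tangent vectors. *)
Lemma chart_coords a x : atlas M a -> chart_dom a x -> exists yc : 'I_m -> M -> R,
  (forall j, Cinf (yc j)) /\ \forall y \near x, forall j, yc j y = chart_fun a y 0 j.
Proof.
move=> Ma ax.
have H j : exists F, Cinf F /\ \forall y \near x, chart_fun a y 0 j = F y.
  have [|F sF HF] := @smooth_near_extend R m M x (fun y => chart_fun a y 0 j); last by exists F.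
  exists a; split=> //; exists (chart_cod a); split=> //; [exact: chart_cod_open|exact: chart_fun_cod|].
  move=> k; apply: (@Ck_ext _ _ _ _ (fun u => u 0 j)); first exact: chart_cod_open.
    by move=> u au /=; rewrite chart_invK.
  exact: Ck_coord.
have [F HF] := choice H.
exists F; split=> [j|]; first by have [] := HF j.
by apply: filter_forall => j; have [_] := HF j; apply: filterS => y ->.
Qed.

Lemma pd_coord a x (yc : 'I_m -> M -> R) i j : atlas M a -> chart_dom a x -> (forall j, Cinf (yc j)) ->
  (\forall y \near x, forall j, yc j y = chart_fun a y 0 j) -> pd a i x (yc j) = (i == j)%:R.
Proof.
move=> Ma ax syc yE; rewrite pdE //.
have /near_eq_derive -> : \forall u \near chart_fun a x, (yc j \o chart_inv a) u = u 0 j.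
  have := chart_cod_near (chart_fun_cod ax); have := chart_near ax yE.
  by apply: filterS2 => u H au; rewrite /= H chart_invK.
rewrite deriveE; last exact: differentiable_coord.
pose l : 'rV[R]_m -> R := fun u => u 0 j.
have ll : linear l by move=> c u v; rewrite /l !mxE.
pose L : {linear 'rV[R]_m -> R} := HB.pack l (GRing.isLinear.Build _ _ _ _ l ll).
by rewrite (@diff_lin _ _ _ L) /= /l ?mxE ?eqxx 1?eq_sym //; apply: coord_continuous.
Qed.

Lemma pd_field a x i : atlas M a -> chart_dom a x -> exists2 Y, vector_field Y &
  \forall y \near x, Y y = pd a i y.
Proof.
move=> Ma ax.
have [chi [K [chis chi1 Kc KU chi0]]] := bump_function (chart_dom_near ax).
exists (fun y => chi y *: pd a i y); last by apply: filterS chi1 => y ->; rewrite scale1r.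
split=> [y|f sf].
  have [Ky|/chi0->] := pselect (K y); last by rewrite scale0r; apply: tangent0.
  by apply/tangentZ/pd_tangent => //; apply: KU.
apply/smooth_nearP => y; have [Ky|nKy] := pselect (K y); last first.
  apply: (@smooth_near_ext _ _ _ _ (fun=> 0)); last exact: smooth_near_cst.
  have : \forall z \near y, (~` K) z by apply: open_nbhs_nbhs; split=> //; rewrite openC.
  by apply: filterS => z /chi0 ->; rewrite scale0r.
have ay := KU _ Ky.
apply: (@smooth_near_mul _ _ _ _ chi (fun z => pd a i z f)); first exact: smooth_near_Cinf.
exists a; split=> //; exists (chart_cod a); split=> //; [exact: chart_cod_open|exact: chart_fun_cod|].
move=> k; apply: (@Ck_ext _ _ _ _ (fun u => 'D_(delta_mx 0 i) (f \o chart_inv a) u)); first exact: chart_cod_open.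
  by move=> u au /=; rewrite pdE // chart_invK.
by have [_] := sf a Ma k.+1; apply.
Qed.

(** The coefficients of the independent family [d] in the spanning family [w] form a square matrix
    with trivial kernel; its inverse expresses every [w k] through [d]. *)
Lemma span_transfer p (w : 'I_p -> tvec M) (d : 'I_m -> tvec M) (V : set (tvec M)) : p = m ->
  (forall z, V z -> exists c : 'I_p -> R, z = \sum_i c i *: w i) ->
  (forall i, V (d i)) -> (forall c : 'I_m -> R, \sum_i c i *: d i = 0 -> forall i, c i = 0) ->
  forall z, V z -> exists c : 'I_m -> R, z = \sum_i c i *: d i.
Proof.
move=> pm; subst p => Hw Vd dfree z Vz.
have [T HT] := choice (fun i => Hw _ (Vd i)).
pose A : 'M[R]_m := \matrix_(i, k) T i k.
have uA : A \in unitmx.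
  rewrite -row_free_unit -kermx_eq0; apply/eqP/row_matrixP => i; rewrite row0.
  set r := row i (kermx A).
  have rA : r *m A = 0 by apply/sub_kermxP; apply: row_sub.
  clearbody r.
  apply/rowP => j; rewrite [RHS]mxE; apply: (dfree (fun j => r 0 j)).
  under eq_bigr do rewrite HT scaler_sumr.
  rewrite exchange_big /= big1 // => k _.
  under eq_bigr do rewrite scalerA.
  rewrite -scaler_suml.
  have := congr1 (fun B : 'rV_m => B 0 k) rA; rewrite !mxE.
  by under eq_bigr do rewrite mxE; move=> ->; rewrite scale0r.
have S0 k l : \sum_i invmx A k i *: (T i l *: w l) = (k == l)%:R *: w l.
  under eq_bigr do rewrite scalerA.
  rewrite -scaler_suml.
  have := congr1 (fun B : 'M[R]_m => B k l) (mulVmx uA); rewrite !mxE.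
  by under eq_bigr do rewrite mxE; move=> ->.
have wd k : w k = \sum_i invmx A k i *: d i.
  transitivity (\sum_l (k == l)%:R *: w l).
    rewrite (bigD1 k) //= eqxx scale1r big1 ?addr0 // => l lk.
    by rewrite eq_sym (negPf lk) scale0r.
  transitivity (\sum_i \sum_l invmx A k i *: (T i l *: w l)).
    by rewrite exchange_big; apply: eq_bigr => l _; rewrite S0.
  by apply: eq_bigr => i _; rewrite HT scaler_sumr.
have [c ->] := Hw z Vz.
exists (fun i => \sum_k c k * invmx A k i).
under eq_bigr do rewrite wd scaler_sumr.
rewrite exchange_big /=; apply: eq_bigr => i _.
by rewrite scaler_suml; apply: eq_bigr => k _; rewrite scalerA.
Qed.

(* Together with the independence of coordinate vectors, a spanning family of
   m tangent vectors replaces Hadamard's lemma. *)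
Lemma tangent_coords a x p (w : 'I_p -> tvec M) (yc : 'I_m -> M -> R) : p = m ->
  (forall z, tangent x z -> exists c : 'I_p -> R, z = \sum_i c i *: w i) ->
  atlas M a -> chart_dom a x -> (forall j, Cinf (yc j)) ->
  (\forall y \near x, forall j, yc j y = chart_fun a y 0 j) ->
  forall z, tangent x z -> z = \sum_i z (yc i) *: pd a i x.
Proof.
move=> pm Hw Ma ax syc yE z tz.
have comb (c : 'I_m -> R) j : (\sum_i c i *: pd a i x) (yc j) = c j.
  rewrite tvec_combE (bigD1 j) //= (pd_coord _ _ Ma ax syc yE) eqxx mulr1 big1 ?addr0 // => i ij.
  by rewrite (pd_coord _ _ Ma ax syc yE) (negPf ij) mulr0.
have [||c Ec] := @span_transfer p w (fun i => pd a i x) (tangent x) pm Hw _ _ z tz.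
- by move=> i; apply: pd_tangent.
- by move=> c c0 i; rewrite -(comb c i) c0.
by rewrite {1}Ec; apply: eq_bigr => i _; rewrite Ec comb.
Qed.

Lemma lie_field (X Y : M -> tvec M) : vector_field X -> vector_field Y -> vector_field (lie X Y).
Proof.
move=> [X1 X2] [Y1 Y2]; split=> [x|f sf]; last first.
  by apply: Cinf_sub; [exact: X2 (Y2 _ sf)|exact: Y2 (X2 _ sf)].
have z : Cinf (fun _ : M => 0 : R) by apply: Cinf_cst.
split.
- move=> f nf; rewrite /lie.
  have -> : (fun y => Y y f) = fun=> 0 by apply/funext => y; have [+ _ _] := Y1 y; apply.
  have -> : (fun y => X y f) = fun=> 0 by apply/funext => y; have [+ _ _] := X1 y; apply.
  by rewrite (tangent_cst _ (X1 x)) (tangent_cst _ (Y1 x)) subrr.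
- move=> a f g sf sg; rewrite /lie.
  have -> : (fun y => Y y (fun z => a * f z + g z)) = fun y => a * Y y f + Y y g.
    by apply/funext => y; have [_ H _] := Y1 y; apply: H.
  have -> : (fun y => X y (fun z => a * f z + g z)) = fun y => a * X y f + X y g.
    by apply/funext => y; have [_ H _] := X1 y; apply: H.
  have [_ Hx _] := X1 x; have [_ Hy _] := Y1 x.
  rewrite (Hx a _ _ (Y2 _ sf) (Y2 _ sg)) (Hy a _ _ (X2 _ sf) (X2 _ sg)).
  by ring.
- move=> f g sf sg; rewrite /lie.
  have -> : (fun y => Y y (fun z => f z * g z)) = fun y => Y y f * g y + f y * Y y g.
    by apply/funext => y; have [_ _ H] := Y1 y; apply: H.
  have -> : (fun y => X y (fun z => f z * g z)) = fun y => X y f * g y + f y * X y g.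
    by apply/funext => y; have [_ _ H] := X1 y; apply: H.
  have [Xf Xg Yf Yg] : [/\ Cinf (fun y => X y f), Cinf (fun y => X y g), Cinf (fun y => Y y f) & Cinf (fun y => Y y g)].
    by split; [exact: X2|exact: X2|exact: Y2|exact: Y2].
  rewrite (tangent_add (X1 x)) ?(tangent_add (Y1 x)); try by apply: Cinf_mul.
  have [_ _ X3] := X1 x; have [_ _ Y3] := Y1 x.
  by rewrite !X3 // !Y3 //; ring.
Qed.

(** As long as there are fewer functions than vectors, a nontrivial combination of the [e i] kills
    all of them. It is a nonzero derivation, so some smooth function detects it, and adjoining that
    function raises the rank. *)
Lemma dual_functions x k (e : 'I_k -> tvec M) : (forall i, tangent x (e i)) ->
  (forall a : 'I_k -> R, \sum_i a i *: e i = 0 -> forall i, a i = 0) ->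
  exists f : 'I_k -> M -> R, (forall l, Cinf (f l)) /\ (\matrix_(l, i) e i (f l)) \in unitmx.
Proof.
move=> te free.
suff H j : (j <= k)%N -> exists f : 'I_j -> M -> R, (forall l, Cinf (f l)) /\ row_free (\matrix_(l, i) e i (f l)).
  by have [f [sf]] := H k (leqnn k); rewrite row_free_unit => uf; exists f.
elim: j => [_|j IH jk].
  exists (fun _ _ => 0); split; first by case.
  by rewrite /row_free -leqn0 rank_leq_row.
have [f [sf rf]] := IH (ltnW jk).
set A := \matrix_(l, i) e i (f l) in rf.
have : kermx A^T != 0.
  rewrite -mxrank_eq0 mxrank_ker mxrank_tr; move/eqP: rf => ->.
  by rewrite subn_eq0 -ltnNge.
case/rowV0Pn => r /sub_kermxP rA r0.
pose z := \sum_i r 0 i *: e i.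
have [g sg zg] : exists2 g, Cinf g & z g != 0.
  apply/not_exists2P => H; move/negP: r0; apply; apply/eqP/rowP => i; rewrite [RHS]mxE.
  apply: (free (fun i => r 0 i)); apply: (@tangent_ext x).
  - exact: tangent_lcomb.
  - exact: tangent0.
  by move=> g sg; apply/eqP/negPn/negP => gn; have [] := H g.
pose b : 'rV[R]_k := \row_i e i g.
have br : (b *m r^T) 0 0 = z g.
  by rewrite mxE /z tvec_combE; apply: eq_bigr => i _; rewrite !mxE mulrC.
have rfb : row_free (col_mx A b).
  suff : (\rank A < \rank (col_mx A b))%N.
    rewrite (eqP rf) => rk; rewrite /row_free eqn_leq rank_leq_row /=.
    by apply: leq_trans rk; rewrite addn1.
  apply: rank_ltmx.
  rewrite ltmxE col_mx_sub submx_refl /=; apply/andP; split.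
  - by rewrite -addsmxE addsmxSl.
  - apply/negP => /submxP [D Db].
    move: br; rewrite Db -mulmxA (_ : A *m r^T = 0) ?mulmx0 ?mxE; first by move/eqP; rewrite eq_sym (negPf zg).
    by apply: trmx_inj; rewrite trmx_mul trmxK trmx0.
rewrite -addn1.
exists (fun l => match fintype.split l with inl l => f l | inr _ => g end); split.
  by move=> l; case: (fintype.split l).
rewrite (_ : \matrix_(_, _) _ = col_mx A b) //.
apply/matrixP => l i; rewrite !mxE; case: (fintype.split l) => l'; by rewrite !mxE.
Qed.

End Tangent.

(** * Complete flows *)

Section Flow.
Variables (R : realType) (m : nat) (M : manifold R m) (phi : R -> M -> M).
Hypothesis phi_smooth : smooth_flow phi.
Implicit Types (f g : M -> R) (x y : M) (xi eta : tvec M) (t s r : R) (u : 'rV[R]_m).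

Lemma phi0 x : phi 0 x = x. Proof. by have [] := phi_smooth. Qed.
Lemma phiD s t x : phi (s + t) x = phi s (phi t x). Proof. by have [] := phi_smooth. Qed.
Lemma phiNK t x : phi (- t) (phi t x) = x. Proof. by rewrite -phiD addNr phi0. Qed.
Lemma phiKN t x : phi t (phi (- t) x) = x. Proof. by rewrite -phiD subrr phi0. Qed.

(** Coordinates on [R * M] as in [smooth_flow], time first; [e_t] and [e_x i] are the corresponding
    coordinate directions. *)
Definition trow (t : R) (u : 'rV[R]_m) : 'rV[R]_(1 + m) := row_mx t%:M u.
Definition Phi f (a : chart R m M) (w : 'rV[R]_(1 + m)) : R := f (phi (lsubmx w 0 0) (chart_inv a (rsubmx w))).
Definition Omega (a : chart R m M) := [set w : 'rV[R]_(1 + m) | chart_cod a (rsubmx w)].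
Definition e_t : 'rV[R]_(1 + m) := delta_mx 0 (lshift m ord0).
Definition e_x (i : 'I_m) : 'rV[R]_(1 + m) := delta_mx 0 (rshift 1 i).

Lemma Omega_open a : open (Omega a).
Proof.
apply: (@open_comp _ _ (@rsubmx R 1 1 m)); last exact: chart_cod_open.
by move=> w _; apply: continuous_rsubmx.
Qed.

Lemma Phi_trow f a t u : Phi f a (trow t u) = f (phi t (chart_inv a u)).
Proof. by rewrite /Phi /trow row_mxKl row_mxKr mxE eqxx mulr1n. Qed.

Lemma Omega_trow a t u : Omega a (trow t u) = chart_cod a u.
Proof. by rewrite /Omega /= /trow row_mxKr. Qed.

Lemma rV_combE p (A B : 'rV[R]_p) r j : (A + r *: B) 0 j = A 0 j + r * B 0 j.
Proof. by rewrite !mxE. Qed.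

Lemma trow_et t u r : trow t u + r *: e_t = trow (t + r) u.
Proof.
apply/rowP => j; rewrite rV_combE /e_t; case: (split_ordP j) => k ->; rewrite /trow.
  by rewrite !row_mxEl !mxE (ord1 k) !eqxx !mulr1n mulr1.
by rewrite !row_mxEr !mxE eq_rlshift andbF mulr0 addr0.
Qed.

Lemma trow_ex t u r i : trow t u + r *: e_x i = trow t (u + r *: delta_mx 0 i).
Proof.
apply/rowP => j; rewrite rV_combE /e_x; case: (split_ordP j) => k ->; rewrite /trow.
  by rewrite !row_mxEl !mxE eq_lrshift andbF mulr0 addr0.
by rewrite !row_mxEr !mxE eq_rshift.
Qed.

(** A directional derivative depends only on the restriction to a line, so agreement of the two
    functions along their lines suffices, without differentiability. *)
Lemma derive_transport (V W : normedModType R) (F : V -> R) (G : W -> R) (v e : V) (u d : W) :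
  (forall r, G (u + r *: d) = F (v + r *: e)) -> 'D_d G u = 'D_e F v.
Proof.
move=> H; have G0 : G u = F v by have := H 0; rewrite !scale0r !addr0.
rewrite /derive; set A := (X in lim (X @ _)); set B := (X in _ = lim (X @ _)).
suff -> : A = B by [].
by apply/funext => r; rewrite /A /B /= [r *: d + u]addrC [r *: e + v]addrC H G0.
Qed.

Lemma Phi_dx f a t u i : 'D_(delta_mx 0 i) (fun u => f (phi t (chart_inv a u))) u = 'D_(e_x i) (Phi f a) (trow t u).
Proof. by apply: derive_transport => r; rewrite trow_ex Phi_trow. Qed.

Lemma Phi_smooth f a : Cinf f -> atlas M a -> smooth_on (Omega a) (Phi f a).
Proof. by move=> sf Ma; have [_ _] := phi_smooth; apply. Qed.

Lemma trow_Ck k (U : set 'rV[R]_m) t j : Ck k U (fun u => trow t u 0 j).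
Proof.
case: (split_ordP j) => l ->.
  have -> : (fun u => trow t u 0 (lshift m l)) = fun=> t; last exact: Ck_cst.
  by apply/funext => u; rewrite /trow row_mxEl mxE (ord1 l) eqxx mulr1n.
have -> : (fun u => trow t u 0 (rshift 1 l)) = fun u => u 0 l; last exact: Ck_coord.
by apply/funext => u; rewrite /trow row_mxEr.
Qed.

Lemma trow_pull a t k F : Ck k (Omega a) F -> Ck k (chart_cod a) (fun u => F (trow t u)).
Proof.
move=> CF; have HU u : chart_cod a u -> Omega a (trow t u) by rewrite Omega_trow.
have HT j : Ck k (chart_cod a) (fun u => trow t u 0 j) by apply: trow_Ck.
exact: (Ck_comp (@chart_cod_open R m M a) HU HT CF).
Qed.

Lemma flow_Cinf f t : Cinf f -> Cinf (f \o phi t).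
Proof.
move=> sf a Ma k; have := trow_pull t (Phi_smooth sf Ma k).
by apply: Ck_ext; [exact: chart_cod_open|move=> u _; rewrite Phi_trow].
Qed.

Lemma flow_CinfN f t : Cinf (f \o phi t) -> Cinf f.
Proof.
move=> /(flow_Cinf (- t)); rewrite (_ : _ \o _ = f) //.
by apply/funext => y /=; rewrite phiKN.
Qed.

Lemma line_near_deriv (V : normedModType R) (F : V -> R) (G : R -> R) (v e : V) t :
  (forall r, G (t + r) = F (v + r *: e)) -> differentiable F v ->
  is_derive t 1 G ('D_e F v).
Proof.
move=> H dF.
have dF0 : differentiable F (v + 0 *: e) by rewrite scale0r addr0.
have := line_deriv dF0; rewrite scale0r addr0 => D0.
have D1 : is_derive (t - t) 1 (fun r => F (v + r *: e)) ('D_e F v) by rewrite subrr.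
have D2 : is_derive t 1 (fun s : R => s - t) (1 : R).
  by apply: is_derive_eq; rewrite subr0.
have := @is_derive1_comp R (fun r => F (v + r *: e)) (fun s : R => s - t) t _ _ D1 D2.
rewrite mulr1; suff -> : (fun r => F (v + r *: e)) \o (fun s : R => s - t) = G by [].
by apply/funext => s; rewrite /= -H addrC subrK.
Qed.

Lemma Phi_dt f a t u : Cinf f -> atlas M a -> chart_cod a u ->
  is_derive t 1 (fun t => f (phi t (chart_inv a u))) ('D_e_t (Phi f a) (trow t u)).
Proof.
move=> sf Ma au; apply: line_near_deriv; first by move=> r; rewrite trow_et Phi_trow.
by have [+ _] := Phi_smooth sf Ma 1; apply; rewrite Omega_trow.
Qed.

Lemma flow_deriv f x t : Cinf f -> is_derive t 1 (fun t => f (phi t x)) (velocity phi (phi t x) f).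
Proof.
move=> sf; have [a Ma ax] := atlas_cover x.
have := Phi_dt t sf Ma (chart_fun_cod ax); rewrite chart_funK // => D.
suff -> : velocity phi (phi t x) f = 'D_e_t (Phi f a) (trow t (chart_fun a x)) by [].
rewrite /velocity; case: asboolP => // _; rewrite derive1E -(@derive_val _ _ _ _ _ _ _ D).
apply: derive_transport => r; rewrite -phiD add0r addrC //.
Qed.

Lemma velocityE x f : Cinf f -> velocity phi x f = 'D_1 (fun t => f (phi t x)) 0.
Proof. by move=> sf; rewrite -[x in LHS]phi0 (@derive_val _ _ _ _ _ _ _ (flow_deriv x 0 sf)). Qed.

Lemma velocity_Phi a t u f : Cinf f -> atlas M a -> chart_cod a u ->
  velocity phi (phi t (chart_inv a u)) f = 'D_e_t (Phi f a) (trow t u).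
Proof.
move=> sf Ma au; rewrite -(@derive_val _ _ _ _ _ _ _ (Phi_dt t sf Ma au)).
by rewrite (@derive_val _ _ _ _ _ _ _ (flow_deriv _ t sf)).
Qed.

Lemma velocity_Cinf f : Cinf f -> Cinf (fun x => velocity phi x f).
Proof.
move=> sf a Ma k.
have [_ /(_ (lshift m ord0)) H] := Phi_smooth sf Ma k.+1.
have := trow_pull 0 H; apply: Ck_ext; first exact: chart_cod_open.
by move=> u au; rewrite /= -[in RHS](phi0 (chart_inv a u)) velocity_Phi.
Qed.

Lemma velocity_tangent x : tangent x (velocity phi x).
Proof.
split.
- by move=> f nf; rewrite /velocity; case: asboolP.
- move=> c f g sf sg; have sh : Cinf (fun y => c * f y + g y).
    by apply: Cinf_add => //; apply: Cinf_mul => //; apply: Cinf_cst.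
  rewrite !velocityE //.
  have Df := flow_deriv x 0 sf; have Dg := flow_deriv x 0 sg.
  rewrite (_ : (fun _ => _) = c *: (fun t => f (phi t x)) + (fun t => g (phi t x))) //.
  rewrite deriveD; [|apply: derivableZ|]; [by rewrite deriveZ; case: Df|by case: Df|by case: Dg].
- move=> f g sf sg; have sh : Cinf (fun y => f y * g y) by apply: Cinf_mul.
  rewrite !velocityE //.
  have Df := flow_deriv x 0 sf; have Dg := flow_deriv x 0 sg.
  rewrite (_ : (fun _ => _) = (fun t => f (phi t x)) * (fun t => g (phi t x))) //.
  rewrite deriveM; [|by case: Df|by case: Dg].
  by rewrite !phi0 /GRing.scale /= addrC; congr (_ + _); rewrite mulrC.
Qed.

Lemma velocity_field : vector_field (velocity phi).
Proof. by split; [exact: velocity_tangent|exact: velocity_Cinf]. Qed.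

Lemma push_tangent x t xi : tangent x xi -> tangent (phi t x) (push (phi t) xi).
Proof.
move=> [x1 x2 x3]; split=> [f nf|c f g sf sg|f g sf sg]; rewrite /push.
- by apply: x1 => /flow_CinfN.
- by apply: (x2 c (f \o phi t) (g \o phi t)); apply: flow_Cinf.
- by apply: (x3 (f \o phi t) (g \o phi t)); apply: flow_Cinf.
Qed.

Lemma pushD s t xi : push (phi (s + t)) xi = push (phi s) (push (phi t) xi).
Proof. by apply/funext => f; rewrite /push; congr xi; apply/funext => y /=; rewrite phiD. Qed.
Lemma push0 xi : push (phi 0) xi = xi.
Proof. by apply/funext => f; rewrite /push; congr xi; apply/funext => y /=; rewrite phi0. Qed.
Lemma pushNK t xi : push (phi (- t)) (push (phi t) xi) = xi.
Proof. by rewrite -pushD addNr push0. Qed.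
Lemma pushKN t xi : push (phi t) (push (phi (- t)) xi) = xi.
Proof. by rewrite -pushD subrr push0. Qed.
Lemma push_lcomb t k (a : 'I_k -> R) (v : 'I_k -> tvec M) :
  push (phi t) (\sum_i a i *: v i) = \sum_i a i *: push (phi t) (v i).
Proof. by apply/funext => f; rewrite {1}/push !tvec_combE. Qed.

Lemma push_velocity t x : push (phi t) (velocity phi x) = velocity phi (phi t x).
Proof.
apply: (@tangent_ext _ _ _ (phi t x)).
- by apply: push_tangent; apply: velocity_tangent.
- exact: velocity_tangent.
move=> f sf; rewrite /push !velocityE //; last exact: flow_Cinf.
suff E : (fun s => (f \o phi t) (phi s x)) = (fun s => f (phi s (phi t x))) by rewrite E.
by apply/funext => s /=; rewrite -!phiD addrC.
Qed.

Lemma is_derive_cont (F : R -> R) t d : is_derive t 1 F d -> {for t, continuous F}.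
Proof. by move=> [D _]; apply: differentiable_continuous; apply/derivable1_diffP. Qed.

(** The smoothness of [phi] is given through functions; continuity of an orbit in time is recovered
    by composing with a bump function that vanishes outside [P]. *)
Lemma flow_near x t (P : set M) : (\forall y \near phi t x, P y) -> \forall s \near t, P (phi s x).
Proof.
move=> Px; have [chi [K [chis chi1 Kc KP chi0]]] := bump_function Px.
have c1 := is_derive_cont (flow_deriv x t chis).
have h : 0 < chi (phi t x) by rewrite (nbhs_singleton chi1).
have : \forall s \near t, 0 < chi (phi s x) by apply: (cvgr_gt _ c1).
apply: filterS => s hs; apply: KP; apply/not_notP => /chi0 h0.
by rewrite h0 ltxx in hs.
Qed.

(** Symmetry of the mixed derivatives, in time and in coordinate [i], of the flow composed with
    [f]. *)
Lemma pd_flow_deriv a i x f t : atlas M a -> chart_dom a x -> Cinf f ->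
  is_derive t 1 (fun t => pd a i x (f \o phi t)) (pd a i x (fun y => velocity phi (phi t y) f)).
Proof.
move=> Ma ax sf; have au := chart_fun_cod ax; set u := chart_fun a x in au.
have sv : Cinf (fun y => velocity phi (phi t y) f).
  exact: (@flow_Cinf (fun y => velocity phi y f) t (velocity_Cinf sf)).
rewrite (pdE a i x sv).
have -> : 'D_(delta_mx 0 i) ((fun y => velocity phi (phi t y) f) \o chart_inv a) u
   = 'D_e_t ('D_(e_x i) (Phi f a)) (trow t u).
  have -> : 'D_e_t ('D_(e_x i) (Phi f a)) (trow t u) = 'D_(e_x i) ('D_e_t (Phi f a)) (trow t u).
    apply: (@Schwarz _ _ _ (Omega a) _ (lshift m ord0) (rshift 1 i)); first exact: Omega_open.
      by rewrite Omega_trow.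
    exact: Phi_smooth.
  have /near_eq_derive -> : \forall v \near u, ((fun y => velocity phi (phi t y) f) \o chart_inv a) v
       = 'D_e_t (Phi f a) (trow t v).
    by apply: filterS (chart_cod_near au) => v av; rewrite /= velocity_Phi.
  by apply: derive_transport => r; rewrite trow_ex.
rewrite (_ : (fun t => _) = fun t => 'D_(e_x i) (Phi f a) (trow t u)); last first.
  apply/funext => s; rewrite pdE; last exact: flow_Cinf.
  by rewrite -Phi_dx.
apply: line_near_deriv; first by move=> r; rewrite trow_et.
have [_ /(_ (rshift 1 i)) [+ _]] := Phi_smooth sf Ma 2; apply.
by rewrite Omega_trow.
Qed.

End Flow.

(** * Matrix-valued functions of one variable *)

Section MatrixDerivative.
Variable R : realType.
Implicit Types (t s : R).

Definition mder p q (F : R -> 'M[R]_(p, q)) t (F' : 'M[R]_(p, q)) :=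
  forall i j, is_derive t 1 (fun s => F s i j) (F' i j).

Lemma mder_eq p q (F : R -> 'M[R]_(p, q)) t F' F'' : mder F t F' -> F' = F'' -> mder F t F''.
Proof. by move=> ? <-. Qed.

Lemma mder_near p q (F G : R -> 'M[R]_(p, q)) t F' : (\forall s \near t, F s = G s) -> mder F t F' -> mder G t F'.
Proof.
move=> FG DF i j; have FG' : \forall s \near t, F s i j = G s i j by apply: filterS FG => s ->.
exact: near_eq_is_derive FG' (DF i j).
Qed.

Lemma mder_unique p q (F : R -> 'M[R]_(p, q)) t F' F'' : mder F t F' -> mder F t F'' -> F' = F''.
Proof.
move=> D1 D2; apply/matrixP => i j.
by rewrite -(@derive_val _ _ _ _ _ _ _ (D1 i j)) (@derive_val _ _ _ _ _ _ _ (D2 i j)).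
Qed.

Lemma mder_cst p q (A : 'M[R]_(p, q)) t : mder (fun=> A) t 0.
Proof. by move=> i j; rewrite mxE; apply: is_derive_cst. Qed.

Lemma mder_add p q (F G : R -> 'M[R]_(p, q)) t F' G' : mder F t F' -> mder G t G' ->
  mder (fun s => F s + G s) t (F' + G').
Proof.
move=> DF DG i j; rewrite mxE.
have -> : (fun s => (F s + G s) i j) = (fun s => F s i j) + (fun s => G s i j) by apply/funext => s; rewrite mxE.
exact: is_deriveD.
Qed.

Lemma mder_scale p q (F : R -> 'M[R]_(p, q)) (c : R -> R) t F' c' : is_derive t 1 c c' -> mder F t F' ->
  mder (fun s => c s *: F s) t (c' *: F t + c t *: F').
Proof.
move=> Dc DF i j; rewrite !mxE.
have -> : (fun s => (c s *: F s) i j) = c * (fun s => F s i j) by apply/funext => s; rewrite mxE.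
have D := DF i j; apply: is_derive_eq; rewrite /GRing.scale /=; ring.
Qed.

Lemma mder_scalec p q (F : R -> 'M[R]_(p, q)) (c : R) t F' : mder F t F' -> mder (fun s => c *: F s) t (c *: F').
Proof.
move=> DF; apply: (mder_eq (mder_scale (is_derive_cst c t 1) DF)).
by rewrite scale0r add0r.
Qed.

Lemma mder_mul p q r (F : R -> 'M[R]_(p, q)) (G : R -> 'M[R]_(q, r)) t F' G' : mder F t F' -> mder G t G' ->
  mder (fun s => F s *m G s) t (F' *m G t + F t *m G').
Proof.
move=> DF DG i j; rewrite !mxE -big_split /=.
have -> : (fun s => (F s *m G s) i j) = \sum_k ((fun s => F s i k) * (fun s => G s k j)).
  by apply/funext => s; rewrite mxE fct_sumE.
apply: is_derive_sum => k; have D1 := DF i k; have D2 := DG k j.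
apply: is_derive_eq; rewrite /GRing.scale /=; ring.
Qed.

Lemma mder_tr p q (F : R -> 'M[R]_(p, q)) t F' : mder F t F' -> mder (fun s => (F s)^T) t F'^T.
Proof.
move=> DF i j; rewrite mxE.
by have -> : (fun s => (F s)^T i j) = (fun s => F s j i) by apply/funext => s; rewrite mxE.
Qed.

Lemma mder_opp p q (F : R -> 'M[R]_(p, q)) t F' : mder F t F' -> mder (fun s => - F s) t (- F').
Proof.
move=> /(mder_scalec (-1)); rewrite scaleN1r.
by have -> : (fun s => -1 *: F s) = (fun s => - F s) by apply/funext => s; rewrite scaleN1r.
Qed.

Lemma row_mul_tr p q r (A : 'M[R]_(p, q)) (B : 'M[R]_(r, q)) i j : (row i A *m (row j B)^T) 0 0 = (A *m B^T) i j.
Proof. by rewrite !mxE; apply: eq_bigr => k _; rewrite !mxE. Qed.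

Lemma row_form p q q' r (A : 'M[R]_(p, q)) (S : 'M[R]_(q, q')) (B : 'M[R]_(r, q')) i j :
  (row i A *m S *m (row j B)^T) 0 0 = (A *m S *m B^T) i j.
Proof. by rewrite -row_mul row_mul_tr. Qed.

Lemma trZ p q (c : R) (A : 'M[R]_(p, q)) : (c *: A)^T = c *: A^T.
Proof. by apply/matrixP => i j; rewrite !mxE. Qed.

Lemma trB p q (A B : 'M[R]_(p, q)) : (A - B)^T = A^T - B^T.
Proof. by apply/matrixP => i j; rewrite !mxE. Qed.

Lemma mder_rows p q (F : R -> 'M[R]_(p, q)) t F' : (forall i, mder (fun s => row i (F s)) t (row i F')) -> mder F t F'.
Proof.
move=> H i j; have := H i 0 j; rewrite mxE.
by have -> : (fun s => row i (F s) 0 j) = (fun s => F s i j) by apply/funext => s; rewrite mxE.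
Qed.

End MatrixDerivative.

(** * Limits, inverses and orders of vanishing of matrix functions *)

Section MatrixAnalysis.
Variable R : realType.
Implicit Types (t s : R).

Lemma cvg_sum_ord (T : Type) (F : set_system T) (FF : Filter F) n (f : 'I_n -> T -> R) (l : 'I_n -> R) :
  (forall i, f i x @[x --> F] --> l i) -> \sum_i f i x @[x --> F] --> \sum_i l i.
Proof.
elim: n f l => [|n IH] f l H.
  have -> : (fun x => \sum_(i < 0) f i x) = fun=> 0 by apply/funext => x; rewrite big_ord0.
  by rewrite big_ord0; apply: cvg_cst.
have -> : (fun x => \sum_(i < n.+1) f i x) = fun x => f ord0 x + \sum_i f (lift ord0 i) x.
  by apply/funext => x; rewrite big_ord_recl.
by rewrite big_ord_recl; apply: cvgD => //; apply: IH.
Qed.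

Definition mcvg (T : Type) (F : set_system T) p q (A : T -> 'M[R]_(p, q)) (l : 'M[R]_(p, q)) :=
  forall i j, A x i j @[x --> F] --> l i j.

Lemma mcvg_mul (T : Type) (F : set_system T) (FF : Filter F) p q r (A : T -> 'M[R]_(p, q)) (B : T -> 'M[R]_(q, r)) a b :
  mcvg F A a -> mcvg F B b -> mcvg F (fun x => A x *m B x) (a *m b).
Proof.
move=> HA HB i j; rewrite mxE.
have -> : (fun x => (A x *m B x) i j) = fun x => \sum_k A x i k * B x k j by apply/funext => x; rewrite mxE.
by apply: cvg_sum_ord => k; apply: cvgM.
Qed.

Lemma cvg_det (T : Type) (F : set_system T) (FF : Filter F) p (A : T -> 'M[R]_p) l :
  mcvg F A l -> \det (A x) @[x --> F] --> \det l.
Proof.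
elim: p A l => [|p IH] A l H.
  have -> : (fun x => \det (A x)) = fun=> 1 by apply/funext => x; rewrite det_mx00.
  by rewrite det_mx00; apply: cvg_cst.
have -> : (fun x => \det (A x)) = fun x => \sum_j A x ord0 j * cofactor (A x) ord0 j.
  by apply/funext => x; rewrite (expand_det_row _ ord0).
rewrite (expand_det_row _ ord0); apply: cvg_sum_ord => j; apply: cvgM => //.
rewrite /cofactor; apply: cvgM; first exact: cvg_cst.
apply: IH => i k; rewrite !mxE.
by have -> : (fun x => row' ord0 (col' j (A x)) i k) = fun x => A x (lift ord0 i) (lift j k) by apply/funext => x; rewrite !mxE.
Qed.

Lemma cvg_unit (T : Type) (F : set_system T) (FF : Filter F) p (A : T -> 'M[R]_p) l :
  l \in unitmx -> mcvg F A l -> \forall x \near F, A x \in unitmx.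
Proof.
move=> ul HA; have d0 : \det l != 0 by rewrite -unitfE -unitmxE.
have := cvg_det FF HA => Hd.
have H : \forall x \near F, \det (A x) != 0 by exact: (cvgr_neq0 _ Hd d0).
by apply: filterS H => x; rewrite unitmxE unitfE.
Qed.

Lemma mcvg_inv (T : Type) (F : set_system T) (FF : Filter F) p (A : T -> 'M[R]_p) l :
  l \in unitmx -> mcvg F A l -> mcvg F (fun x => invmx (A x)) (invmx l).
Proof.
move=> ul HA i j.
have d0 : \det l != 0 by rewrite -unitfE -unitmxE.
have E (B : 'M[R]_p) : B \in unitmx -> invmx B i j = (\det B)^-1 * cofactor B j i.
  by move=> uB; rewrite /invmx uB !mxE.
have nE : \forall x \near F, (\det (A x))^-1 * cofactor (A x) j i = invmx (A x) i j.
  by apply: filterS (cvg_unit FF ul HA) => x ux; rewrite E.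
rewrite E //; apply: cvg_trans; first exact: near_eq_cvg nE.
apply: cvgM; first by apply: cvgV => //; apply: cvg_det.
rewrite /cofactor; apply: cvgM; first exact: cvg_cst.
apply: cvg_det => k m; rewrite !mxE.
by have -> : (fun x => row' j (col' i (A x)) k m) = fun x => A x (lift j k) (lift i m) by apply/funext => x; rewrite !mxE.
Qed.

Lemma mder_cont p q (A : R -> 'M[R]_(p, q)) t A' : mder A t A' -> mcvg (nbhs t) A (A t).
Proof. by move=> D i j; apply: (is_derive_cont (D i j)). Qed.

Lemma is_deriveP (f : R -> R) t d : is_derive t 1 f d <-> (fun s => s^-1 * (f (t + s) - f t)) @ 0^' --> d.
Proof.
have E : (fun s => s^-1 *: ((f \o shift t) (s *: 1) - f t)) = (fun s => s^-1 * (f (t + s) - f t)).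
  by apply/funext => s; rewrite /= [s%:A]mulr1 [s + t]addrC.
split=> [[D1 D2]|H].
  by move: D1 D2; rewrite /derivable /derive E => D1 <-.
apply: DeriveDef; first by rewrite /derivable E; apply/cvg_ex; exists d.
by rewrite /derive E; apply/cvg_lim.
Qed.

(** The difference [A(s)^-1 - A(t)^-1] equals [- A(s)^-1 (A(s) - A(t)) A(t)^-1]; divide by the
    increment and use continuity of the inverse. *)
Lemma mder_inv p (A : R -> 'M[R]_p) t A' : A t \in unitmx -> mder A t A' ->
  mder (fun s => invmx (A s)) t (- (invmx (A t) *m A' *m invmx (A t))).
Proof.
move=> uA D.
have C0 : mcvg (0^') (fun s => A (t + s)) (A t).
  move=> i j; have c := (mder_cont D : mcvg _ _ _) i j.
  have c2 : (fun s => t + s) @ 0^' --> t.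
    rewrite -[X in _ --> X]addr0; apply: cvgD; first exact: cvg_cst.
    exact: nbhs_dnbhs.
  exact: (cvg_comp _ _ c2 c).
have FF : Filter ((0 : R)^') by exact: dnbhs_filter.
have U := cvg_unit FF uA C0.
have I := mcvg_inv FF uA C0.
have Dq : mcvg (0^') (fun s => s^-1 *: (A (t + s) - A t)) A'.
  move=> i j; have /is_deriveP := D i j.
  by have -> // : (fun s => (s^-1 *: (A (t + s) - A t)) i j) = (fun s => s^-1 * (A (t + s) i j - A t i j)) by apply/funext => s; rewrite !mxE.
have cst : mcvg ((0 : R)^') (fun=> invmx (A t)) (invmx (A t)) by move=> i j; exact: cvg_cst.
have H := mcvg_mul FF (mcvg_mul FF I Dq) cst.
move=> i j; apply/is_deriveP.
have nE : \forall s \near 0^', - (invmx (A (t + s)) *m (s^-1 *: (A (t + s) - A t)) *m invmx (A t)) i j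
   = s^-1 * (invmx (A (t + s)) i j - invmx (A t) i j).
  apply: filterS U => s us.
  rewrite -scalemxAr -scalemxAl mulmxBr mulVmx // mulmxBl mul1mx -mulmxA mulmxV // mulmx1.
  by rewrite !mxE; ring.
apply: cvg_trans; first exact: near_eq_cvg nE.
by rewrite mxE; apply: cvgN; exact: H.
Qed.

(** The order symbol O(t^k) at 0. The point [t = 0] is included, so for [k > 0] the bound forces
    [F 0 = 0]. *)
Definition mO k p q (F : R -> 'M[R]_(p, q)) :=
  exists2 C, 0 <= C & \forall t \near (0 : R), forall i j, `|F t i j| <= C * `|t| ^+ k.

Lemma mO_near k p q (F G : R -> 'M[R]_(p, q)) : (\forall t \near (0 : R), F t = G t) -> mO k F -> mO k G.
Proof. by move=> FG [C C0 H]; exists C => //; apply: filterS2 FG H => t ->. Qed.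

Lemma mO_ext k p q (F G : R -> 'M[R]_(p, q)) : (forall t, F t = G t) -> mO k F -> mO k G.
Proof. by move=> FG [C C0 H]; exists C => //; apply: filterS H => t; rewrite FG. Qed.

Lemma mO_add k p q (F G : R -> 'M[R]_(p, q)) : mO k F -> mO k G -> mO k (fun t => F t + G t).
Proof.
move=> [C C0 H] [D D0 K]; exists (C + D); first exact: addr_ge0.
apply: filterS2 H K => t H K i j; rewrite mxE mulrDl.
by apply: le_trans (ler_normD _ _) _; apply: lerD.
Qed.

Lemma mO_scale k p q (c : R) (F : R -> 'M[R]_(p, q)) : mO k F -> mO k (fun t => c *: F t).
Proof.
move=> [C C0 H]; exists (`|c| * C); first exact: mulr_ge0.
by apply: filterS H => t H i j; rewrite mxE normrM -mulrA ler_wpM2l.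
Qed.

Lemma mO_opp k p q (F : R -> 'M[R]_(p, q)) : mO k F -> mO k (fun t => - F t).
Proof. by move=> /(mO_scale (-1)); apply: mO_ext => t; rewrite scaleN1r. Qed.

Lemma mO_sub k p q (F G : R -> 'M[R]_(p, q)) : mO k F -> mO k G -> mO k (fun t => F t - G t).
Proof. by move=> HF HG; apply: mO_add => //; apply: mO_opp. Qed.

Lemma mO_tr k p q (F : R -> 'M[R]_(p, q)) : mO k F -> mO k (fun t => (F t)^T).
Proof. by move=> [C C0 H]; exists C => //; apply: filterS H => t H i j; rewrite mxE. Qed.

Lemma mO_mul k l p q r (F : R -> 'M[R]_(p, q)) (G : R -> 'M[R]_(q, r)) : mO k F -> mO l G ->
  mO (k + l) (fun t => F t *m G t).
Proof.
move=> [C C0 H] [D D0 K]; exists (q%:R * (C * D)); first by rewrite !mulr_ge0.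
apply: filterS2 H K => t H K i j; rewrite mxE.
apply: le_trans (ler_norm_sum _ _ _) _.
apply: (@le_trans _ _ (\sum_(m < q) (C * D) * `|t| ^+ (k + l))).
  by apply: ler_sum => m _; rewrite normrM exprD mulrACA ler_pM.
by rewrite sumr_const card_ord -[leRHS]mulrA mulr_natl.
Qed.

Lemma mO_t k p q (F : R -> 'M[R]_(p, q)) : mO k F -> mO k.+1 (fun t => t *: F t).
Proof.
move=> [C C0 H]; exists C => //; apply: filterS H => t H i j.
by rewrite mxE normrM exprS mulrCA ler_wpM2l.
Qed.

Lemma mO_le k l p q (F : R -> 'M[R]_(p, q)) : (l <= k)%N -> mO k F -> mO l F.
Proof.
move=> lk [C C0 H]; exists C => //.
have n1 : \forall t \near (0 : R), `|t| <= 1 by apply: nbhs0_le.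
apply: filterS2 H n1 => t H t1 i j; apply: le_trans (H i j) _.
by rewrite ler_wpM2l // ler_wiXn2l.
Qed.

Lemma mO_cont p q (F : R -> 'M[R]_(p, q)) l : mcvg (nbhs (0 : R)) F l -> mO 0 F.
Proof.
move=> H; exists (\sum_i \sum_j (`|l i j| + 1)); first by do 2! (apply: sumr_ge0 => ? _); rewrite addr_ge0.
have : \forall t \near (0 : R), forall i j, `|l i j - F t i j| <= 1.
  have H' i j : \forall t \near (0 : R), `|l i j - F t i j| <= 1.
    by have /cvgrPdist_le := H i j; apply.
  have FF : Filter (nbhs (0 : R)) by exact: nbhs_filter.
  by apply: (@filter_forall _ _ _ _ FF) => i; apply: (@filter_forall _ _ _ _ FF) => j; exact: H'.
apply: filterS => t Ht i j; rewrite expr0 mulr1.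
rewrite (bigD1 i) //= (bigD1 j) //= -addrA ler_wpDr //.
  apply: addr_ge0; first by apply: sumr_ge0 => ? _; rewrite addr_ge0.
  by do 2! (apply: sumr_ge0 => ? _); rewrite addr_ge0.
rewrite -{1}[F t i j](subrK (l i j)) addrC; apply: le_trans (ler_normD _ _) _.
by rewrite lerD2l distrC.
Qed.

Lemma mO_cst p q (A : 'M[R]_(p, q)) : mO 0 (fun=> A).
Proof. by apply: (@mO_cont _ _ _ A) => i j; apply: cvg_cst. Qed.

Lemma mO_mder p q (F : R -> 'M[R]_(p, q)) F' : mder F 0 F' -> mO 0 F.
Proof. by move=> /mder_cont /mO_cont. Qed.

Lemma lip_bound (f f' : R -> R) (B e : R) : 0 < e ->
  (forall s, `|s| < e -> is_derive s 1 f (f' s)) ->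
  forall t, `|t| < e -> (forall s, `|s| <= `|t| -> `|f' s| <= B) -> `|f t - f 0| <= B * `|t|.
Proof.
move=> e0 D.
have pos (g g' : R -> R) t : 0 < t -> (forall r, 0 <= r <= t -> is_derive r 1 g (g' r)) ->
    (forall r, 0 <= r <= t -> `|g' r| <= B) -> `|g t - g 0| <= B * t.
  move=> t0 Dg Bg; have [c /andP[c0 ct] ->] := MVT_pos t0 Dg.
  by rewrite normrM (gtr0_norm t0); apply: ler_wpM2r; [exact: ltW|apply: Bg; rewrite !ltW].
move=> t te Bf; have [t0|t0|->] := ltrgt0P t; last by rewrite subrr normr0 mulr0.
- have E := gtr0_norm t0; rewrite E in te *.
  apply: (pos f f') => // r /andP[r0 rt]; first by apply: D; rewrite ger0_norm //; apply: le_lt_trans te.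
  by apply: Bf; rewrite E ger0_norm.
- have nt : 0 < - t by rewrite oppr_gt0.
  have te' : - t < e by rewrite -(ltr0_norm t0).
  have := @pos (fun s => f (- s)) (fun s => - f' (- s)) (- t) nt.
  rewrite opprK oppr0; apply=> r /andP[r0 rt].
    have Dr : is_derive (- r) 1 f (f' (- r)) by apply: D; rewrite normrN ger0_norm // (le_lt_trans rt).
    have DN : is_derive r 1 (fun s : R => - s) (-1 : R) by apply: is_derive_eq.
    have := @is_derive1_comp R f (fun s => - s) r _ _ Dr DN.
    by rewrite mulrN1.
  by rewrite normrN; apply: Bf; rewrite normrN ger0_norm // ltr0_norm.
Qed.

(** The mean value theorem plays the part of integration: between 0 and [t] the derivative is
    bounded by [C * |t|^k], and the constant [C] is kept. *)
Lemma mO_int k p q (F F' : R -> 'M[R]_(p, q)) : (\forall t \near (0 : R), mder F t (F' t)) ->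
  F 0 = 0 -> mO k F' -> mO k.+1 F.
Proof.
move=> D F0 [C C0 H]; exists C => //.
have /nbhs_normP[e /= e0 He] : \forall t \near (0 : R), mder F t (F' t) /\ forall i j, `|F' t i j| <= C * `|t| ^+ k.
  by apply: filterI.
apply/nbhs_normP; exists e => // t; rewrite /= sub0r normrN => te i j.
have Hs s : `|s| < e -> mder F s (F' s) /\ forall i j, `|F' s i j| <= C * `|s| ^+ k.
  by move=> se; apply: He; rewrite /= sub0r normrN.
have := @lip_bound (fun s => F s i j) (fun s => F' s i j) (C * `|t| ^+ k) e e0 _ t te _.
rewrite F0 mxE subr0 -mulrA -exprSr; apply.
  by move=> s se; have [+ _] := Hs s se; apply.
move=> s st; have [_ Hb] := Hs s (le_lt_trans st te).
apply: le_trans (Hb i j) _; rewrite ler_wpM2l //.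
by apply: lerXn2r; rewrite ?nnegrE.
Qed.

End MatrixAnalysis.

Section Expansion.
Variable R : realType.

Lemma mO_div2 k p q (F : R -> 'M[R]_(p, q)) : mO k.+2 F -> mO k (fun t => t ^- 2 *: F t).
Proof.
move=> [C C0 H]; exists C => //; apply: filterS H => t H i j; rewrite mxE.
(* At [t = 0] the left side is 0 by the convention that the inverse of 0 is 0. *)
have [->|t0] := eqVneq t 0; first by rewrite expr2 mulr0 invr0 mul0r normr0 mulr_ge0 // exprn_ge0.
rewrite normrM normfV normrX ler_pdivrMl ?exprn_gt0 ?normr_gt0 //.
by apply: le_trans (H i j) _; rewrite [leRHS]mulrCA -exprD add2n.
Qed.

Lemma is_derive_pow k (t : R) : is_derive t 1 (fun s : R => s ^+ k.+1) (k.+1%:R * t ^+ k).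
Proof.
have H := is_derive_id t (1 : R).
have := @is_deriveX _ _ id k.+1 t 1 1 H.
have -> : (id : R -> R) ^+ k.+1 = (fun s => s ^+ k.+1) by apply/funext => s; elim: (k.+1) => [|m IH]; rewrite ?expr0 // !exprS -IH.
by move=> D; apply: (is_derive_eq D); rewrite /GRing.scale /= mulr1 mulr_natl.
Qed.

Lemma mder_pow k p q (A : 'M[R]_(p, q)) c t : mder (fun s => (c * s ^+ k.+1) *: A) t ((c * (k.+1%:R * t ^+ k)) *: A).
Proof.
have D : is_derive t 1 (fun s : R => c * s ^+ k.+1) (c * (k.+1%:R * t ^+ k)).
  exact: (@is_deriveZ _ _ _ (fun s : R => s ^+ k.+1) c t 1 _ (is_derive_pow k t)).
by apply: (mder_eq (mder_scale D (mder_cst A t))); rewrite scaler0 addr0.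
Qed.

Lemma mO_pow k p q (A : 'M[R]_(p, q)) c : mO k (fun t => (c * t ^+ k) *: A).
Proof.
have [C C0 H] := mO_cst (c *: A); exists C => //; apply: filterS H => t H i j.
have := H i j; rewrite expr0 mulr1 !mxE => Hc.
by rewrite -mulrA mulrCA normrM normrX mulrC ler_wpM2r // exprn_ge0.
Qed.

Lemma tr_mul3 p q r k (A : 'M[R]_(p, q)) (S : 'M[R]_(q, r)) (B : 'M[R]_(r, k)) : (A *m S *m B)^T = B^T *m S^T *m A^T.
Proof. by rewrite !trmx_mul mulmxA. Qed.
End Expansion.

Section MatrixLimit.
Variable R : realType.

Lemma mO_cvg k p q (F : R -> 'M[R]_(p, q)) l : mO k.+1 (fun t => F t - l) -> mcvg (nbhs (0 : R)) F l.
Proof.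
move=> /(@mO_le _ _ 1) [] // C C0 H i j; apply/cvgrPdist_le => e e0.
have n1 : \forall t \near (0 : R), `|t| <= e / (C + 1) by apply: nbhs0_le; rewrite divr_gt0 // ltr_wpDl.
apply: filterS2 H n1 => t H t1; rewrite distrC; have := H i j; rewrite !mxE expr1 => /le_trans; apply.
apply: (@le_trans _ _ ((C + 1) * (e / (C + 1)))).
  by apply: ler_pM => //; rewrite lerDl.
by rewrite mulrCA divff ?mulr1 // gt_eqF // ltr_wpDl.
Qed.

Lemma invmx_unique m (A B : 'M[R]_m) : A *m B = 1%:M -> invmx B = A.
Proof. by move=> E; have [_ uB] := mulmx1_unit E; rewrite -[A](mulmxK uB) E mul1mx. Qed.
End MatrixLimit.

Section BilinearForms.
Variable R : realType.
Implicit Types (t s : R).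

Definition bilf p (g : 'M[R]_p) (a b : 'rV[R]_p) : R := (a *m g *m b^T) 0 0.

Lemma addmx00 (c : R) (A B : 'M[R]_1) : (c *: A + B) 0 0 = c * A 0 0 + B 0 0.
Proof. by rewrite !mxE. Qed.

Lemma submx00 (A B : 'M[R]_1) : (A - B) 0 0 = A 0 0 - B 0 0.
Proof. by rewrite !mxE. Qed.

(** The rule for a change of frame: coordinate rows are multiplied by [X^T] and the dual form by
    inverses, so its values do not change. *)
Lemma bilf_change p (X g : 'M[R]_p) a b : X \in unitmx ->
  bilf (invmx X^T *m g *m invmx X) (a *m X^T) (b *m X^T) = bilf g a b.
Proof.
move=> uX; rewrite /bilf trmx_mul trmxK !mulmxA mulmxK ?unitmx_tr //.
by rewrite mulmxKV.
Qed.

Lemma bilf_sym p (g : 'M[R]_p) a b : g^T = g -> bilf g a b = bilf g b a.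
Proof.
move=> gT; rewrite /bilf -[in RHS]gT -[LHS](mxE trmx_key (fun i j => (a *m g *m b^T) j i)).
by rewrite -/(trmx _) !trmx_mul trmxK mulmxA.
Qed.

Lemma bilf_linl p (g : 'M[R]_p) c a b d : bilf g (c *: a + b) d = c * bilf g a d + bilf g b d.
Proof. by rewrite /bilf !mulmxDl -!scalemxAl addmx00. Qed.

Lemma bilf_linr p (g : 'M[R]_p) c a b d : bilf g d (c *: a + b) = c * bilf g d a + bilf g d b.
Proof. by rewrite /bilf linearD linearZ /= mulmxDr -scalemxAr addmx00. Qed.

Lemma deriv_bilf (A B : R -> 'M[R]_1) t A' B' : (\forall s \near t, A s 0 0 = B s 0 0) ->
  mder A t A' -> mder B t B' -> A' 0 0 = B' 0 0.
Proof.
move=> nE D1 D2; have D1' := near_eq_is_derive nE (D1 0 0).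
by rewrite -(@derive_val _ _ _ _ _ _ _ D1') (@derive_val _ _ _ _ _ _ _ (D2 0 0)).
Qed.

Lemma bilfZ k (g : 'M[R]_k) (r : R) a b : bilf g (r *: a) b = r * bilf g a b.
Proof. by rewrite /bilf -!scalemxAl mxE. Qed.

Lemma bilfZr k (g : 'M[R]_k) (r : R) a b : bilf g a (r *: b) = r * bilf g a b.
Proof. by rewrite /bilf linearZ /= -scalemxAr mxE. Qed.

Lemma bilf0l k (g : 'M[R]_k) a : bilf g 0 a = 0.
Proof. by rewrite /bilf !mul0mx mxE. Qed.

Lemma bilf0r k (g : 'M[R]_k) a : bilf g a 0 = 0.
Proof. by rewrite /bilf trmx0 mulmx0 mxE. Qed.

Lemma mcvg_bilf (T : Type) (F : set_system T) (FF : Filter F) k (g : T -> 'M[R]_k) (a b : T -> 'rV[R]_k) g' a' b' :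
  mcvg F g g' -> mcvg F a a' -> mcvg F b b' -> bilf (g w) (a w) (b w) @[w --> F] --> bilf g' a' b'.
Proof.
move=> Hg Ha Hb; have Hb' : mcvg F (fun w => (b w)^T) b'^T.
  move=> i j; rewrite mxE.
  by have -> : (fun w => (b w)^T i j) = (fun w => b w j i) by apply/funext => w; rewrite mxE.
exact: (mcvg_mul FF (mcvg_mul FF Ha Hg) Hb').
Qed.

End BilinearForms.

(** * Exponential decay from a monotone quantity *)

Section Scalar.
Variable R : realType.
Implicit Types (t s a : R).

Lemma shift_deriv (F : R -> R) t d : is_derive (0 : R) 1 (fun s => F (t + s)) d -> is_derive t 1 F d.
Proof.
move=> D.
have D1 : is_derive (t - t) 1 (fun s => F (t + s)) d by rewrite subrr.
have D2 : is_derive t 1 (fun s : R => s - t) (1 : R) by apply: is_derive_eq; rewrite subr0.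
have := @is_derive1_comp R (fun s => F (t + s)) (fun s : R => s - t) t _ _ D1 D2.
rewrite mulr1; suff -> : (fun s => F (t + s)) \o (fun s : R => s - t) = F by [].
by apply/funext => s /=; rewrite addrC subrK.
Qed.

Lemma deriv_incr (f : R -> R) a b : a <= b ->
  (forall s, a <= s <= b -> exists2 d, is_derive s 1 f d & 0 <= d) -> f a <= f b.
Proof.
rewrite le_eqVlt => /orP[/eqP->//|ab] H.
have [||r /andP[r0 r1]] := @MVT_pos _ (fun s => f (s + a)) (fun s => 'D_1 f (s + a)) (b - a); first by rewrite subr_gt0.
  move=> r /andP[r0 r1].
  have [|d D d0] := H (r + a); first by rewrite lerDr r0 -lerBrDr.
  have DN : is_derive r 1 (fun s : R => s + a) (1 : R) by apply: is_derive_eq; rewrite addr0.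
  have := @is_derive1_comp R f (fun s => s + a) r _ _ D DN.
  by rewrite mulr1 (@derive_val _ _ _ _ _ _ _ D).
rewrite subrK add0r => E.
have [|d D d0] := H (r + a); first by rewrite lerDr (ltW r0) /= -lerBrDr ltW.
rewrite -subr_ge0 E (@derive_val _ _ _ _ _ _ _ D) mulr_ge0 // subr_ge0 ltW //.
Qed.

Lemma is_derive_expl (k a : R) t : is_derive t 1 (fun s => expR (k * (s - a))) (k * expR (k * (t - a))).
Proof.
have D : is_derive t 1 (fun s : R => k * (s - a)) k.
  have D0 : is_derive t 1 (fun s : R => s - a) (1 : R) by apply: is_derive_eq; rewrite subr0.
  have := @is_deriveZ _ _ _ (fun s : R => s - a) k t 1 _ D0.
  by rewrite /GRing.scale /= mulr1.
have := @is_derive1_comp R expR (fun s => k * (s - a)) t _ _ (is_derive_expR _) D.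
by rewrite mulrC.
Qed.

Lemma expl_mul (f : R -> R) (k a : R) t d : is_derive t 1 f d ->
  is_derive t 1 (fun s => f s * expR (k * (s - a))) ((d + k * f t) * expR (k * (t - a))).
Proof.
move=> D; have := @is_deriveM _ _ f (fun s => expR (k * (s - a))) t 1 _ _ D (is_derive_expl k a t).
by move=> D'; apply: (is_derive_eq D'); rewrite /GRing.scale /=; ring.
Qed.

(** From [1 + z <= expR z]: for [s >= s0] one has [expR (k * s) > k * s >= |A| / eps]. *)
Lemma expl_small (A k eps : R) : 0 < k -> 0 < eps -> exists2 s0, 0 <= s0 & forall s, s0 <= s -> A * expR (- (k * s)) < eps.
Proof.
move=> k0 e0; exists (`|A| / (eps * k)); first by rewrite divr_ge0 // mulr_ge0 // ltW.
move=> s Hs; apply: le_lt_trans (_ : `|A| * expR (- (k * s)) < _).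
  by rewrite ler_wpM2r ?ler_norm // ltW // expR_gt0.
rewrite expRN ltr_pdivrMr ?expR_gt0 //.
apply: le_lt_trans (_ : eps * (k * s) < _).
  by rewrite mulrA mulrC -ler_pdivrMr // mulr_gt0.
rewrite ltr_pM2l //; apply: lt_le_trans (expR_ge1Dx _).
by rewrite ltrDr.
Qed.

Lemma bigO_id (F : R -> R) C : 0 < C -> (\forall t \near (0 : R)^', `|F t| <= C * `|t|) ->
  F =O_ ((0 : R)^') (@idfun R).
Proof. by move=> C0 H; apply/eqO_exP; exists C. Qed.

Lemma bigO_idP (F : R -> R) : F =O_ ((0 : R)^') (@idfun R) ->
  exists2 C, 0 < C & \forall t \near (0 : R)^', `|F t| <= C * `|t|.
Proof. by move=> /eqO_exP [C C0 H]; exists C. Qed.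

(* Along an orbit, N will be the square of the norm of (p, q), N0 that of p,
   Q the pairing of q and p, and b the component along the flow. *)
Record lyapunov (c C : R) (N N0 Q b : R -> R) : Prop := Lyapunov {
  ly_N0 : forall t, is_derive t 1 N0 (2 * Q t);
  ly_N : forall t, exists2 d, is_derive t 1 N d & `|d| <= C * N t;
  ly_Q : forall t, exists2 d, is_derive t 1 Q d & c * N t <= d;
  ly_b : forall t, exists2 d, is_derive t 1 b d & d ^+ 2 <= C * N t;
  ly_QN : forall t, `|Q t| <= C * N t;
  ly_ge0 : forall t, 0 <= N0 t <= N t }.

Lemma is_derive_revN (f : R -> R) t d : is_derive (- t) 1 f d -> is_derive t 1 (fun s => f (- s)) (- d).
Proof.
move=> D; have DN : is_derive t 1 (fun s : R => - s) (-1 : R) by apply: is_derive_eq.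
by have := @is_derive1_comp R f (fun s => - s) t _ _ D DN; rewrite mulrN1.
Qed.

(** Reversing time changes the sign of all derivatives; changing that of [Q] as well restores
    [N0' = 2 Q] and [Q' >= c N]. Thus the estimates for stable vectors also serve the unstable
    ones. *)
Lemma lyapunov_rev c C N N0 Q b : lyapunov c C N N0 Q b ->
  lyapunov c C (fun t => N (- t)) (fun t => N0 (- t)) (fun t => - Q (- t)) (fun t => b (- t)).
Proof.
move=> H; split=> t.
- by apply: (is_derive_eq (is_derive_revN (ly_N0 H (- t)))); rewrite mulrN.
- by have [d D Hd] := ly_N H (- t); exists (- d); [exact: is_derive_revN|rewrite normrN].
- have [d D Hd] := ly_Q H (- t); exists d => //.
  by have := is_deriveN (is_derive_revN D); rewrite opprK.
- by have [d D Hd] := ly_b H (- t); exists (- d); [exact: is_derive_revN|rewrite sqrrN].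
- by rewrite normrN; apply: (ly_QN H).
- exact: (ly_ge0 H).
Qed.

Section Estimates.
Variables (c C : R) (N N0 Q b : R -> R).
Hypotheses (c0 : 0 < c) (C0 : 0 < C) (H : lyapunov c C N N0 Q b).

Lemma ly_Nge0 t : 0 <= N t.
Proof. by have /andP[h1 h2] := ly_ge0 H t; exact: le_trans h1 h2. Qed.

(** The bound [|N'| <= C N] makes [N(s) exp(C s)] nondecreasing. *)
Lemma N_lower t s : t <= s -> N t * expR (- C * (s - t)) <= N s.
Proof.
move=> ts; rewrite mulNr expRN ler_pdivrMr ?expR_gt0 //.
have -> : N t = N t * expR (C * (t - t)) by rewrite subrr mulr0 expR0 mulr1.
apply: (@deriv_incr (fun s => N s * expR (C * (s - t)))) => // r _.
have [d D Hd] := ly_N H r; exists ((d + C * N r) * expR (C * (r - t))); first exact: expl_mul.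
apply: mulr_ge0; last exact/ltW/expR_gt0.
by rewrite -lerBlDr sub0r; move: Hd; rewrite ler_norml => /andP[].
Qed.

Lemma Q_incr t s : t <= s -> Q t <= Q s.
Proof.
move=> ts; apply: deriv_incr => // r _; have [d D Hd] := ly_Q H r; exists d => //.
by apply: le_trans Hd; rewrite mulr_ge0 ?(ltW c0) // ly_Nge0.
Qed.

(** The condition on [b] is separate because [N] does not see the flow direction: the Hamiltonian
    field itself will have [N = 0] and [b = 1]. *)
Definition stable := (forall eps, 0 < eps -> exists2 T, 0 <= T & forall t, T <= t -> N t < eps) /\
  (forall eps, 0 < eps -> exists2 T, 0 <= T & forall t, T <= t -> `|b t| < eps).

(** [Q] is nondecreasing, so a positive value would persist and, through [|Q| <= C N], keep [N] away
    from 0. *)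
Lemma stable_Q : (forall eps, 0 < eps -> exists2 T, 0 <= T & forall t, T <= t -> N t < eps) -> forall t, Q t <= 0.
Proof.
move=> S t; rewrite leNgt; apply/negP => Qt.
have [|T T0 HT] := S (Q t / C); first by rewrite divr_gt0.
have := HT (Num.max t T); rewrite le_max lexx orbT => /(_ isT).
rewrite ltNge => /negP; apply; rewrite ler_pdivrMr // mulrC.
apply: le_trans (ly_QN H _); apply: le_trans (ler_norm _).
by apply: Q_incr; rewrite le_max lexx.
Qed.

Hypothesis Qneg : forall t, Q t <= 0.

(** Integrating [Q' >= c N] from [t] to infinity with [N(s) >= N(t) exp(-C (s - t))] shows that [Q]
    grows by at least [(c / C) N(t)]; since [Q] stays nonpositive, [- Q(t)] is at least this
    large. *)
Lemma N_upper t : c * N t <= C * - Q t.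
Proof.
suff F : Q t + c / C * N t <= 0.
  rewrite -subr_le0; have -> : c * N t - C * - Q t = C * (Q t + c / C * N t) by field; rewrite gt_eqF.
  by rewrite pmulr_rle0.
rewrite leNgt; apply/negP => F.
(* At time [t + s0] the exponential remainder is smaller than the value assumed positive, which
   would force [Q (t + s0) > 0]. *)
have [s0 s00 Hs] := expl_small (c / C * N t) C0 F.
have := Hs s0 (lexx _); rewrite ltNge => /negP; apply.
apply: (@le_trans _ _ (Q (t + s0) + c / C * N t * expR (- C * (t + s0 - t)))); last first.
  have -> : t + s0 - t = s0 by ring.
  by rewrite mulNr gerDr.
have -> : Q t + c / C * N t = Q t + c / C * N t * expR (- C * (t - t)) by rewrite subrr mulr0 expR0 mulr1.
apply: (@deriv_incr (fun s => Q s + c / C * N t * expR (- C * (s - t)))); first by rewrite lerDl.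
move=> r /andP[tr _]; have [d D Hd] := ly_Q H r.
exists (d - c * N t * expR (- C * (r - t))).
  have D2 := @is_deriveZ _ _ _ (fun s => expR (- C * (s - t))) (c / C * N t) r 1 _ (is_derive_expl (- C) t r).
  apply: (is_derive_eq (@is_deriveD _ _ _ Q _ r 1 _ _ D D2)).
  by rewrite /GRing.scale /=; field; rewrite gt_eqF.
by rewrite subr_ge0; apply: le_trans Hd; rewrite -mulrA ler_wpM2l ?(ltW c0) // N_lower.
Qed.

Local Notation a := (c / C).

Lemma a_gt0 : 0 < a. Proof. exact: divr_gt0. Qed.

(** From [Q' >= c N >= a |Q|], the function [Q(s) exp(a s)] is nondecreasing. *)
Lemma Q_decay t s : t <= s -> - Q s <= - Q t * expR (- (a * (s - t))).
Proof.
move=> ts; rewrite expRN ler_pdivlMr ?expR_gt0 // mulNr lerN2.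
have -> : Q t = Q t * expR (a * (t - t)) by rewrite subrr mulr0 expR0 mulr1.
apply: (@deriv_incr (fun s => Q s * expR (a * (s - t)))) => // r _.
have [d D Hd] := ly_Q H r; exists ((d + a * Q r) * expR (a * (r - t))); first exact: expl_mul.
apply: mulr_ge0; last exact/ltW/expR_gt0.
rewrite -lerBlDr sub0r; apply: le_trans Hd.
have := ly_QN H r; rewrite ler0_norm // => HQ.
rewrite -mulrN mulrAC ler_pdivrMr // -mulrA [_ * C]mulrC ler_wpM2l ?(ltW c0) //.
Qed.

Lemma N_decay t s : t <= s -> N s <= C / c * - Q t * expR (- (a * (s - t))).
Proof.
move=> ts; rewrite -mulrA -ler_pdivrMl ?divr_gt0 // invf_div.
apply: le_trans (Q_decay ts); rewrite mulrAC ler_pdivrMr // mulrC [leRHS]mulrC.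
by have := N_upper s; rewrite [c * _]mulrC.
Qed.

(** The bounds [b'^2 <= C N] and [N_decay] give [|b'(s)| <= Wb t * exp(-(a / 2) (s - t))] for
    [s >= t]. *)
Definition Wb t := Num.sqrt (C * (C / c * - Q t)).

Lemma CQ_ge0 t : 0 <= C * (C / c * - Q t).
Proof.
apply: mulr_ge0; first exact: ltW.
by apply: mulr_ge0; [exact/ltW/divr_gt0|rewrite oppr_ge0].
Qed.

(** The factor [2 / a] is the integral of [exp(-(a / 2) r)] over the half line. *)
Lemma b_var t s : t <= s -> `|b s - b t| <= 2 / a * Wb t.
Proof.
move=> ts; have W0 : 0 <= Wb t by exact: sqrtr_ge0.
have a0 := a_gt0.
pose e r := expR (- (a / 2) * (r - t)).
have dW (r d : R) : t <= r -> is_derive r 1 b d -> d ^+ 2 <= C * N r -> `|d| <= Wb t * e r.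
  move=> tr D Hd; rewrite -[leRHS]ger0_norm; last by rewrite mulr_ge0 // ltW // expR_gt0.
  rewrite -ler_sqr ?nnegrE // !real_normK ?num_real // exprMn sqr_sqrtr ?CQ_ge0 //.
  apply: le_trans Hd _; rewrite -[leRHS]mulrA ler_pM2l //.
  have -> : e r ^+ 2 = expR (- (a * (r - t))).
    by rewrite /e expr2 -expRD; congr expR; field; rewrite !gt_eqF.
  exact: N_decay.
have De (k r : R) : is_derive r 1 (fun s => k * (2 / a * Wb t) * e s) (- k * (Wb t * e r)).
  have D2 := @is_deriveZ _ _ _ e (k * (2 / a * Wb t)) r 1 _ (is_derive_expl (- (a / 2)) t r).
  by apply: (is_derive_eq D2); rewrite /GRing.scale /= -/(e r); field; rewrite !gt_eqF.
have et : e t = 1 by rewrite /e subrr mulr0 expR0.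
have es : 0 <= 2 / a * Wb t * e s by apply: mulr_ge0; [apply: mulr_ge0 => //; exact/ltW/divr_gt0|exact/ltW/expR_gt0].
(* Used for [k = 1] and [k = -1]; the two monotone quantities give the two halves of the bound on
   the absolute value. *)
have I (k : R) : k ^+ 2 = 1 -> k * b t - 2 / a * Wb t <= k * b s - 2 / a * Wb t * e s.
  move=> k2.
  suff F : k * b t + -1 * (2 / a * Wb t) * e t <= k * b s + -1 * (2 / a * Wb t) * e s.
    by move: F; rewrite et; lra.
  apply: (@deriv_incr (fun s => k * b s + -1 * (2 / a * Wb t) * e s)) => // r /andP[tr _].
  have [d D Hd] := ly_b H r; exists (k * d + Wb t * e r).
    have D1 := @is_deriveZ _ _ _ b k r 1 _ D.
    apply: (is_derive_eq (@is_deriveD _ _ _ (fun s => k * b s) (fun s => -1 * (2 / a * Wb t) * e s) r 1 _ _ D1 (De (-1) r))).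
    by rewrite opprK mul1r.
  have := dW r d tr D Hd.
  have : `|k * d| = `|d|.
    by rewrite normrM; have /eqP := k2; rewrite sqrf_eq1 => /orP[] /eqP ->; rewrite ?normrN normr1 mul1r.
  by move=> <-; rewrite ler_norml => /andP[Hl _]; rewrite -lerBlDr sub0r.
rewrite ler_norml; have := I 1 (expr1n _ _); have := I (-1) (etrans (sqrrN 1) (expr1n _ _)).
rewrite !mul1r !mulN1r => H1 H2; apply/andP; split; lra.
Qed.

Lemma Wb_small eps : 0 < eps -> exists2 T, 0 <= T & 2 / a * Wb T < eps.
Proof.
move=> e0; have a0 := a_gt0.
have [|T T0 HT] := @expl_small (C * (C / c * - Q 0)) a ((a / 2 * eps) ^+ 2) a0; first by rewrite exprn_gt0 // mulr_gt0 // divr_gt0.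
exists T => //; rewrite -ltr_pdivlMl ?divr_gt0 // invf_div.
rewrite -[ltRHS]ger0_norm; last by rewrite mulr_ge0 ?ltW // divr_gt0.
rewrite -sqrtr_sqr ltr_sqrt ?exprn_gt0 ?mulr_gt0 ?divr_gt0 //.
apply: le_lt_trans (HT T (lexx _)).
rewrite -[leRHS]mulrA ler_pM2l // -[leRHS]mulrA ler_wpM2l ?divr_ge0 ?(ltW C0) ?(ltW c0) //.
  by have := Q_decay T0; rewrite subr0.
by rewrite invr_gt0.
Qed.

Lemma N_small eps : 0 < eps -> exists2 T, 0 <= T & forall t, T <= t -> N t < eps.
Proof.
move=> e0; have [T T0 HT] := @expl_small (C / c * - Q 0) a eps a_gt0 e0.
exists T => // t Tt; apply: le_lt_trans (HT t Tt).
by have := N_decay (le_trans T0 Tt); rewrite subr0.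
Qed.

(** The Cauchy criterion: after time [T] the variation of [b] is at most [2 / a * Wb T], which is
    small for suitable [T]. The limit is the flow component that is later subtracted. *)
Lemma b_limit : exists l, forall eps, 0 < eps -> exists2 T, 0 <= T & forall t, T <= t -> `|b t - l| < eps.
Proof.
have FF : ProperFilter (b t @[t --> +oo]) by exact: fmap_proper_filter.
have CC : cauchy (b t @[t --> +oo]).
  apply: cauchy_exP => eps e0; have [T T0 HT] := Wb_small e0.
  exists (b T); apply: filterS (nbhs_pinfty_ge (num_real T)) => s Ts.
  by rewrite -ball_normE /ball_ /= distrC; apply: le_lt_trans HT; exact: b_var.
have CV : b t @[t --> +oo] --> lim (b t @[t --> +oo]) := @cauchy_cvg _ _ FF CC.
exists (lim (b t @[t --> +oo])) => eps e0; have [T [_ HT]] := (@cvgrPdist_lt R R R (pinfty_nbhs R) _ b (lim (b t @[t --> +oo]))).1 CV _ e0.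
exists (Num.max (T + 1) 0); first by rewrite le_max lexx orbT.
move=> t; rewrite ge_max => /andP[Tt _]; rewrite distrC; apply: HT => /=.
by apply: lt_le_trans Tt; rewrite ltrDl.
Qed.

(** Let [s] tend to infinity in [b_var], where [b(s)] tends to 0, and square:
    [(2 / a)^2 * C * (C / c) = 4 C^4 / c^3]. *)
Lemma b_bound t : (forall eps, 0 < eps -> exists2 T, 0 <= T & forall t, T <= t -> `|b t| < eps) ->
  b t ^+ 2 <= 4 * C ^+ 4 / c ^+ 3 * - Q t.
Proof.
move=> bz.
have B : `|b t| <= 2 / a * Wb t.
  apply/ler_addgt0Pr => eps e0; have [T T0 HT] := bz _ e0.
  have sT : T <= Num.max T t by rewrite le_max lexx.
  have st : t <= Num.max T t by rewrite le_max lexx orbT.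
  have := b_var st; have := HT _ sT; move: (Num.max T t) => s H1 H2.
  have := ler_normB (b s) (b s - b t); rewrite subKr => /le_trans; apply.
  by rewrite addrC lerD // ltW.
have W0 : 0 <= 2 / a * Wb t by apply: le_trans B.
rewrite -(real_normK (num_real (b t))).
apply: (@le_trans _ _ ((2 / a * Wb t) ^+ 2)); first by rewrite ler_sqr ?nnegrE.
rewrite exprMn sqr_sqrtr ?CQ_ge0 // le_eqVlt; apply/orP; left; apply/eqP.
by field; rewrite !gt_eqF.
Qed.

End Estimates.

(* Integrate Q' >= c N and N0' = 2 Q over [0, 1]: since Q(1) <= 0, a large
   N(0) forces N0 to drop by a multiple of N(0). *)
Lemma N_bound c C N N0 Q b : 0 < c -> 0 < C -> lyapunov c C N N0 Q b -> Q 1 <= 0 -> N 0 <= expR C / c * N0 0.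
Proof.
(* [k] is a lower bound of [Q'] on the interval from 0 to 1, because [N >= N(0) exp(-C)] there. *)
move=> c0 C0 H Q1; pose k := c * (N 0 * expR (- C)).
have k0 : 0 <= k by apply: mulr_ge0; [exact: ltW|apply: mulr_ge0; [exact: (ly_Nge0 H)|exact/ltW/expR_gt0]].
suff kN : k <= N0 0.
  have e0 := expR_gt0 C; rewrite mulrAC ler_pdivlMr //.
  by move: kN; rewrite /k expRN mulrA ler_pdivrMr // mulrC [leRHS]mulrC.
have Qk s : 0 <= s <= 1 -> Q s <= - k * (1 - s).
  move=> /andP[s0 s1]; have := @deriv_incr (fun s => Q s - k * s) s 1 s1.
  rewrite mulr1 => F; have {}F : Q s - k * s <= Q 1 - k.
    apply: F => r /andP[sr r1]; have [d D Hd] := ly_Q H r; exists (d - k).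
      have D2 := @is_deriveZ _ _ _ (fun s : R => s) k r 1 _ (is_derive_id r 1).
      apply: (is_derive_eq (@is_deriveB _ _ _ _ _ r 1 _ _ D D2)).
      by rewrite /GRing.scale /= mulr1.
    rewrite subr_ge0; apply: le_trans Hd; rewrite ler_pM2l //.
    have r0 := le_trans s0 sr; apply: le_trans (N_lower H r0).
    by rewrite ler_wpM2l ?(ly_Nge0 H) // ler_expR subr0 mulNr lerN2 ler_piMr // ltW.
  by lra.
(* [2 s - s^2] is a primitive of [2 (1 - s)] with values 0 at 0 and 1 at 1; so [N0] drops by at
   least [k], and [N0(1) >= 0] gives [k <= N0(0)]. *)
have := @deriv_incr (fun s => - N0 s + - k * (2 * s - s ^+ 2)) 0 1 ler01.
move=> F; have {}F : - N0 0 + - k * (2 * 0 - 0 ^+ 2) <= - N0 1 + - k * (2 * 1 - 1 ^+ 2).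
  apply: F => u r01; exists (- (2 * Q u) + - k * (2 - 2 * u)).
    have D2 : is_derive u 1 (fun s : R => 2 * s - s ^+ 2) (2 - 2 * u).
      have D3 := @is_deriveZ _ _ _ (fun s : R => s) 2 u 1 _ (is_derive_id u 1).
      have D4 := is_derive_pow 1 u.
      apply: (is_derive_eq (@is_deriveB _ _ _ _ _ u 1 _ _ D3 D4)).
      by rewrite /GRing.scale /= mulr1 expr1.
    have D3 := @is_deriveZ _ _ _ _ (- k) u 1 _ D2.
    exact: (@is_deriveD _ _ _ (fun s => - N0 s) (fun s => - k * (2 * s - s ^+ 2)) u 1 _ _ (is_deriveN (ly_N0 H u)) D3).
  by have := Qk _ r01; lra.
have /andP[N1 _] := ly_ge0 H 1.
move: F; rewrite expr0n expr1n /=; lra.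
Qed.

(** The combination [rho] satisfies [rho' <= Q] and [rho <= K4 (- Q)], hence [rho' <= - rho / K4].
    It decays with initial factor 1, so it can serve as the square of an adapted norm. *)
Lemma stable_decay (c C : R) : 0 < c -> 0 < C -> exists kap del gam : R, [/\ 0 < kap, 0 < del, 0 < gam &
  forall N N0 Q b, lyapunov c C N N0 Q b -> stable N b -> forall t, 0 <= t ->
    N0 t + kap * N t + del * b t ^+ 2 <= expR (- (gam * t)) * (N0 0 + kap * N 0 + del * b 0 ^+ 2)].
Proof.
move=> c0 C0; pose K2 := C / c; pose K3 := 4 * C ^+ 4 / c ^+ 3.
have K20 : 0 < K2 by exact: divr_gt0.
have K30 : 0 < K3 by rewrite divr_gt0 ?mulr_gt0 ?exprn_gt0.
(* Chosen so that [kap N'] and [del (b^2)'] are each at most [- Q / 2]; together they consume one of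
   the two [Q] in [N0' = 2 Q]. *)
pose kap := (2 * C * K2)^-1; pose del := (2 * (K3 + C * K2))^-1; pose K4 := K2 + kap * K2 + del * K3.
have kap0 : 0 < kap by rewrite invr_gt0; apply: mulr_gt0 => //; apply: mulr_gt0.
have del0 : 0 < del by rewrite invr_gt0 mulr_gt0 // addr_gt0 // mulr_gt0.
have K40 : 0 < K4 by apply: addr_gt0; [apply: addr_gt0 => //; exact: mulr_gt0|exact: mulr_gt0].
exists kap, del, K4^-1; split=> //; first by rewrite invr_gt0.
move=> N N0 Q b H [S1 S2] t t0; set rho := fun t => N0 t + kap * N t + del * b t ^+ 2.
have Qn := stable_Q c0 C0 H S1.
have HN s : N s <= K2 * - Q s by rewrite mulrAC ler_pdivlMr // mulrC; exact: (N_upper c0 C0 H Qn).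
have Hb s : b s ^+ 2 <= K3 * - Q s by exact: (b_bound c0 C0 H Qn).
have Dr s : exists2 d, is_derive s 1 rho d & d <= Q s.
  have [dN DN HdN] := ly_N H s; have [db Db Hdb] := ly_b H s.
  exists (2 * Q s + kap * dN + del * (2 * b s * db)).
    have D1 := @is_deriveD _ _ _ _ _ s 1 _ _ (ly_N0 H s) (@is_deriveZ _ _ _ N kap s 1 _ DN).
    have D2 : is_derive s 1 (fun s => b s ^+ 2) (2 * b s * db).
      apply: (is_derive_eq (@is_deriveM _ _ b b s 1 _ _ Db Db)).
      by rewrite /GRing.scale /=; ring.
    exact: (@is_deriveD _ _ _ _ _ s 1 _ _ D1 (@is_deriveZ _ _ _ _ del s 1 _ D2)).
  have A1 : kap * dN <= 2^-1 * - Q s.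
    have -> : 2^-1 = kap * (C * K2) by rewrite /kap; field; rewrite !gt_eqF.
    rewrite -mulrA ler_pM2l //; apply: le_trans (ler_norm _) _; apply: le_trans HdN _.
    by rewrite -[leRHS]mulrA ler_pM2l.
  have A2 : del * (2 * b s * db) <= 2^-1 * - Q s.
    have -> : 2^-1 = del * (K3 + C * K2) by rewrite /del; field; rewrite gt_eqF // addr_gt0 // mulr_gt0.
    rewrite -[leRHS]mulrA ler_pM2l //; apply: (@le_trans _ _ (b s ^+ 2 + db ^+ 2)).
      by rewrite -subr_ge0 (_ : _ - _ = (b s - db) ^+ 2) ?sqr_ge0 //; ring.
    rewrite mulrDl lerD //; apply: le_trans Hdb _.
    by rewrite -[leRHS]mulrA ler_pM2l.
  by lra.
have rK s : rho s <= K4 * - Q s.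
  have -> : K4 * - Q s = K2 * - Q s + kap * (K2 * - Q s) + del * (K3 * - Q s) by rewrite /K4; ring.
  have /andP[_ h] := ly_ge0 H s.
  by apply: lerD; [apply: lerD; [exact: le_trans h (HN s)|rewrite ler_pM2l]|rewrite ler_pM2l].
have e0 := expR_gt0 (K4^-1 * t).
rewrite expRN ler_pdivlMl // mulrC -lerN2.
have := @deriv_incr (fun s => - (rho s * expR (K4^-1 * (s - 0)))) 0 t t0.
rewrite !subr0 mulr0 expR0 mulr1; apply=> s _.
have [d D Hd] := Dr s; exists (- ((d + K4^-1 * rho s) * expR (K4^-1 * (s - 0)))).
  exact: (is_deriveN (expl_mul _ _ D)).
rewrite oppr_ge0 pmulr_lle0 ?expR_gt0 //.
have : K4^-1 * rho s <= - Q s by rewrite ler_pdivrMl.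
by lra.
Qed.

End Scalar.

(** * Hyperplanes and definite forms *)

Section Rank.
Variables (F : fieldType) (n : nat).

Lemma hyperplane_rank (v : 'rV[F]_n) : v != 0 -> (\rank (kermx v^T)).+1 = n.
Proof.
move=> v0; rewrite mxrank_ker mxrank_tr rank_rV v0 subn1 prednK //.
by case: n v v0 => // v /eqP[]; apply/matrixP => i [].
Qed.

(** [A] is injective on the hyperplane orthogonal to [u], and the image meets the line of [v] only
    in 0; the dimensions [n - 1] and 1 add up to [n]. *)
Lemma hyperplane_complement (A : 'M[F]_n) (u v p : 'rV[F]_n) : u != 0 -> v != 0 ->
  (forall a g, a *m u^T = 0 -> a *m A = g *: v -> a = 0) ->
  exists a g, a *m u^T = 0 /\ p = a *m A + g *: v.
Proof.
move=> u0 v0 H.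
have K0 : (kermx u^T :&: kermx A)%MS == 0.
  apply/rowV0P => w; rewrite sub_capmx => /andP[/sub_kermxP w1 /sub_kermxP w2].
  by apply: (H w 0) => //; rewrite scale0r.
have rK : \rank (kermx u^T *m A) = \rank (kermx u^T) by apply/mxrank_injP.
have C0 : (kermx u^T *m A :&: v)%MS = 0.
  apply/eqP/rowV0P => w; rewrite sub_capmx => /andP[/submxP[D ->] /sub_rVP[g E]].
  rewrite mulmxA; have -> : D *m kermx u^T = 0 by apply: (H _ g); rewrite -mulmxA; [rewrite mulmx_ker mulmx0|exact: E].
  by rewrite mul0mx.
have full : row_full (kermx u^T *m A + v)%MS.
  by rewrite /row_full mxrank_disjoint_sum // rK rank_rV v0 addn1 hyperplane_rank.
have /sub_addsmxP[[w1 w2] /= E] := submx_full p full.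
exists (w1 *m kermx u^T), (w2 0 0); split; first by rewrite -mulmxA mulmx_ker mulmx0.
by rewrite E mulmxA [w2]mx11_scalar mul_scalar_mx !mxE eqxx mulr1n.
Qed.

(** The kernel of [D] is at most a line, so its rank is at least [n - 1], the dimension of the
    hyperplane that contains its image. *)
Lemma hyperplane_image (D : 'M[F]_n) (v r : 'rV[F]_n) : v != 0 -> D *m v^T = 0 ->
  (forall a, a *m D = 0 -> exists g, a = g *: v) -> r *m v^T = 0 -> exists a, r = a *m D.
Proof.
move=> v0 Dv H rv; apply/submxP.
have DK : (D <= kermx v^T)%MS by apply/sub_kermxP.
have rk : (\rank (kermx D) <= 1)%N.
  rewrite -[1%N]/(nat_of_bool true) -v0 -rank_rV; apply: mxrankS.
  apply/row_subP => i; apply/sub_rVP; apply: H.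
  by rewrite -row_mul mulmx_ker row0.
have le : (\rank (kermx v^T) <= \rank D)%N.
  by move: rk; rewrite mxrank_ker leq_subLR addn1 => rk; rewrite -ltnS (hyperplane_rank v0).
have : (kermx v^T <= D)%MS by rewrite -(geq_leqif (mxrank_leqif_sup DK)).
by apply: submx_trans; apply/sub_kermxP.
Qed.

End Rank.

Section DefiniteBound.
Variables (R : realType) (n : nat).

Lemma rV_sphere_compact : compact [set v : 'rV[R]_n | `|v| = 1].
Proof.
apply: bounded_closed_compact.
  by exists 1; split=> // r r1 v /= ->; apply: ltW.
apply: (@closed_comp _ _ (fun v : 'rV[R]_n => `|v|) [set 1 : R]); last exact: closed_eq.
by move=> v _; exact: norm_continuous.
Qed.

(** Near each unit vector all small [c] work; compactness of the sphere makes [c] uniform, and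
    homogeneity extends the bound to all vectors. *)
Lemma definite_bound (G : 'M[R]_n) : (forall a : 'rV[R]_n, a != 0 -> 0 < bilf G a a) ->
  exists2 c, 0 < c & forall a : 'rV[R]_n, c * `|a| ^+ 2 <= bilf G a a.
Proof.
move=> H; have [+ _] := compact_near_coveringP [set v : 'rV[R]_n | `|v| = 1].
move=> /(_ rV_sphere_compact) /(_ _ ((0 : R)^'+) (fun c v => c <= bilf G v v)) K.
have FF : ProperFilter ((0 : R)^'+) by exact: at_right_proper_filter.
have n1 : \forall c \near (0 : R)^'+, [set v : 'rV[R]_n | `|v| = 1] `<=` (fun v => c <= bilf G v v).
  apply: K => v /= v1.
  have FV : Filter (filter_prod (nbhs v) ((0 : R)^'+)) by exact: filter_prod_filter.
  have c1 : w.2 @[w --> filter_prod (nbhs v) ((0 : R)^'+)] --> (0 : R).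
    exact: (cvg_trans cvg_snd (cvg_within _)).
  have c2 : w.1 @[w --> filter_prod (nbhs v) ((0 : R)^'+)] --> nbhs v by exact: cvg_fst.
  have c3 : bilf G w.1 w.1 @[w --> filter_prod (nbhs v) ((0 : R)^'+)] --> bilf G v v.
    have cst : mcvg (filter_prod (nbhs v) ((0 : R)^'+)) (fun=> G) G by move=> i j; exact: cvg_cst.
    have c4 : mcvg (filter_prod (nbhs v) ((0 : R)^'+)) (fun w => w.1) v.
      by move=> i j; exact: (cvg_comp _ _ c2 (@coord_continuous _ _ _ i j v)).
    exact: (mcvg_bilf FV cst c4 c4).
  have p0 : 0 < bilf G v v - 0 by rewrite subr0 H // -normr_gt0 v1.
  have W : \forall w \near filter_prod (nbhs v) ((0 : R)^'+), w.2 <= bilf G w.1 w.1.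
    have c5 : bilf G w.1 w.1 - w.2 @[w --> filter_prod (nbhs v) ((0 : R)^'+)] --> bilf G v v - 0 by exact: cvgB.
    have W := cvgr_gt _ c5 _ p0.
    apply: (@filterS _ _ FV _ _ _ (W FV)) => w.
    by rewrite /= subr_gt0 => /ltW.
  exact: W.
have [c [c0 Hc]] := filter_ex (filterI (nbhs_right_gt (0 : R)) n1).
exists c => // a; have [->|a0] := eqVneq a 0; first by rewrite normr0 expr0n mulr0 bilf0l.
have na : 0 < `|a| by rewrite normr_gt0.
have := Hc (`|a|^-1 *: a); rewrite /= normrZ normfV normr_id mulVf ?gt_eqF // => /(_ erefl).
by rewrite bilfZ bilfZr mulrA -expr2 exprVn mulrC ler_pdivlMr // exprn_gt0.
Qed.

End DefiniteBound.

(** * Lagrangian frames *)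

Section MonotoneField.
Variables (R : realType) (n : nat) (M : manifold R (2 * n)).
Variables (sigma : M -> tvec M -> tvec M -> R) (Delta : M -> set (tvec M)).
Variables (h : M -> R) (phi : R -> M -> M).
Hypothesis sigma_symplectic : symplectic_form sigma.
Hypothesis Delta_lagrange : lagrange_distribution n sigma Delta.
Hypothesis h_smooth : Cinf h.
Hypothesis phi_flow : flow_of (hamiltonian_field sigma h) phi.
Hypothesis hv_monotone : forall x, monotone_at sigma Delta h x.

Local Notation hv := (velocity phi).
Local Notation L := (lie hv).
Local Notation gform := (gform sigma Delta h).
Implicit Types (x y : M) (xi eta zeta : tvec M) (f g : M -> R) (t s tau : R).
Implicit Types (X Y Z : M -> tvec M) (e : 'I_n -> M -> tvec M).

Lemma smf : smooth_flow phi. Proof. by have [] := phi_flow. Qed.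
Lemma hvE : hamiltonian_field sigma h = hv. Proof. by have [_] := phi_flow. Qed.
Lemma hvF : vector_field hv. Proof. exact: velocity_field smf. Qed.

(** Global fields that form a basis of [Delta] near [x] only; a frame over all of [M] may fail to
    exist. *)
Definition frame x (e : 'I_n -> M -> tvec M) :=
  (forall i, vector_field (e i)) /\ \forall y \near x, is_basis (fun i => e i y) (Delta y).

Lemma frame_near x e : frame x e -> \forall y \near x, frame y e.
Proof. by move=> [e1 e2]; apply: filterS (near_nbhs_near e2) => y H; split. Qed.

Lemma frame_basis x e : frame x e -> is_basis (fun i => e i x) (Delta x).
Proof. by move=> [_ /nbhs_singleton]. Qed.

Lemma frame_ex x : exists e, frame x e.
Proof. by have [/(_ x)[e e1 e2] _] := Delta_lagrange; exists e. Qed.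

Lemma DeltaP x e xi : frame x e -> (Delta x xi <-> exists a : 'rV[R]_n, xi = \sum_i a 0 i *: e i x).
Proof.
move=> /frame_basis [_ ->]; split=> [[a _ <-]|[a ->]]; last by exists (fun i => a 0 i).
by exists (\row_i a i); apply: eq_bigr => i _; rewrite mxE.
Qed.

Lemma Delta_tangent x xi : Delta x xi -> tangent x xi.
Proof.
have [e fe] := frame_ex x; move/(DeltaP _ fe) => [a ->]; apply: tangent_lcomb => i.
by have [/(_ i)[+ _] _] := fe; apply.
Qed.

Lemma Delta_comb x a xi eta : Delta x xi -> Delta x eta -> Delta x (a *: xi + eta).
Proof.
have [e fe] := frame_ex x => /(DeltaP _ fe)[b ->] /(DeltaP _ fe)[c ->]; apply/(DeltaP _ fe).
exists (a *: b + c); rewrite scaler_sumr -big_split /=; apply: eq_bigr => i _.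
by rewrite !mxE scalerDl scalerA.
Qed.

Lemma Delta0 x : Delta x 0.
Proof.
have [e fe] := frame_ex x; apply/(DeltaP _ fe); exists 0.
by rewrite big1 // => i _; rewrite mxE scale0r.
Qed.

Lemma Delta_frame x e i : frame x e -> Delta x (e i x).
Proof.
move=> fe; apply/(DeltaP _ fe); exists (delta_mx 0 i).
rewrite (bigD1 i) //= mxE !eqxx scale1r big1 ?addr0 // => j ji.
by rewrite mxE (negPf ji) andbF scale0r.
Qed.

(** The coefficients solve a linear system whose matrix, the frame applied to dual functions, is
    invertible at [x] and hence nearby; this gives their smoothness. *)
Lemma section_coef x e v : frame x e -> vector_field v -> (\forall y \near x, Delta y (v y)) ->
  exists2 c : M -> 'rV[R]_n, smooth_mx x c & \forall y \near x, v y = \sum_i c y 0 i *: e i y.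
Proof.
move=> fe vv vD; have [e1 e2] := fe.
have [f [sf uf]] := dual_functions (fun i => (e1 i).1 x) (frame_basis fe).1.
pose A y : 'M[R]_n := \matrix_(l, i) e i y (f l).
have sA : smooth_mx x (fun y => (A y)^T).
  apply: smooth_mx_tr => l i; apply: smooth_near_Cinf.
  rewrite (_ : (fun _ => _) = fun y => e i y (f l)); last by apply/funext => y; rewrite mxE.
  by have [_] := e1 i; apply.
have uA : (A x)^T \in unitmx by rewrite unitmx_tr.
pose b y : 'rV[R]_n := \row_l v y (f l).
have sb : smooth_mx x b.
  move=> i l; apply: smooth_near_Cinf; rewrite (_ : (fun _ => _) = fun y => v y (f l)); last by apply/funext => y; rewrite mxE.
  by have [_] := vv; apply.
exists (fun y => b y *m invmx (A y)^T); first by apply: smooth_mx_mul => //; apply: smooth_mx_inv.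
have n1 := near_unitmx uA sA; have n2 := frame_near fe.
apply: filterS3 n1 n2 vD => y uy fy /(DeltaP _ fy) [a va].
suff E : a = b y *m invmx (A y)^T by rewrite va E.
suff -> : b y = a *m (A y)^T by rewrite mulmxK.
apply/rowP => l; rewrite !mxE va tvec_combE; apply: eq_bigr => i _; by rewrite !mxE.
Qed.

(** [hv x f] is 0 by encoding when [f] is not in [Cinf]; differentiating along the orbit extends it
    to functions that are smooth only near [x]. *)
Definition fd f x : R := 'D_1 (fun t => f (phi t x)) 0.

Lemma flow_near0 x (P : set M) : (\forall y \near x, P y) -> \forall t \near (0 : R), P (phi t x).
Proof. by move=> Px; apply: (flow_near smf); rewrite (phi0 smf). Qed.

Lemma fd_deriv x f : smooth_near x f -> is_derive (0 : R) 1 (fun t => f (phi t x)) (fd f x).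
Proof.
move=> /smooth_near_extend [F sF FE].
have D := flow_deriv smf x 0 sF.
have nE : \forall t \near (0 : R), F (phi t x) = f (phi t x).
  by apply: filterS (flow_near0 FE) => t ->.
have D' := near_eq_is_derive nE D.
by rewrite /fd (@derive_val _ _ _ _ _ _ _ D').
Qed.

Lemma fd_val x f d : is_derive (0 : R) 1 (fun t => f (phi t x)) d -> fd f x = d.
Proof. by move=> D; rewrite /fd (@derive_val _ _ _ _ _ _ _ D). Qed.

Lemma fd_Cinf x f : Cinf f -> fd f x = hv x f.
Proof. by move=> sf; rewrite (velocityE smf). Qed.

Lemma fd_ext x f g : (\forall y \near x, f y = g y) -> fd f x = fd g x.
Proof. by move=> fg; apply: near_eq_derive; apply: (flow_near0 fg). Qed.

Lemma fd_smooth x f : smooth_near x f -> smooth_near x (fd f).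
Proof.
move=> /smooth_near_extend [F sF FE].
apply: (@smooth_near_ext _ _ _ _ (fun y => hv y F)); last first.
  by apply: smooth_near_Cinf; apply: (velocity_Cinf smf).
apply: filterS (near_nbhs_near FE) => y Fy.
by rewrite -fd_Cinf //; apply: fd_ext; apply: filterS Fy => z ->.
Qed.

Lemma lie_coef x e v c : frame x e -> vector_field v -> smooth_mx x c ->
  (\forall y \near x, v y = \sum_i (c y : 'rV[R]_n) 0 i *: e i y) ->
  lie hv v x = \sum_i (fd (fun y => c y 0 i) x *: e i x + c x 0 i *: lie hv (e i) x).
Proof.
move=> [e1 _] vv sc vE; apply: (@tangent_ext _ _ _ x).
- by have [+ _] := lie_field hvF vv; apply.
- apply: tangent_sum => i; apply: tangentD; apply: tangentZ; first by have [+ _] := e1 i; apply.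
  by have [+ _] := lie_field hvF (e1 i); apply.
move=> f sf; rewrite tvec_sumE /lie.
have sev i : Cinf (fun y => e i y f) by have [_] := e1 i; apply.
have shf : Cinf (fun y => hv y f) by apply: (velocity_Cinf smf).
rewrite -fd_Cinf; last by have [_] := vv; apply.
rewrite (nbhs_singleton vE) tvec_combE.
have -> : fd (fun y => v y f) x = \sum_i (fd (fun y => c y 0 i) x * e i x f + c x 0 i * fd (fun y => e i y f) x).
  rewrite (@fd_ext _ _ (fun y => \sum_i c y 0 i * e i y f)); last by apply: filterS vE => y ->; rewrite tvec_combE.
  apply: fd_val.
  have -> : (fun t => \sum_i c (phi t x) 0 i * e i (phi t x) f) =
      \sum_i ((fun t => c (phi t x) 0 i) * (fun t => e i (phi t x) f)).
    by apply/funext => t; rewrite fct_sumE.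
  apply: is_derive_sum => i.
  have D1 := fd_deriv (sc 0 i); have D2 := fd_deriv (smooth_near_Cinf x (sev i)).
  apply: is_derive_eq; rewrite (phi0 smf) /GRing.scale /=; ring.
rewrite -sumrB; apply: eq_bigr => i _.
rewrite [fd (fun y => e i y f) x]fd_Cinf // -[RHS]/(fd (fun y => c y 0 i) x * e i x f + c x 0 i * (hv x (fun y => e i y f) - e i x (fun y => hv y f))).
by ring.
Qed.

Definition eLe (e : 'I_n -> M -> tvec M) x (k : 'I_(n + n)) : tvec M :=
  match fintype.split k with inl i => e i x | inr i => lie hv (e i) x end.

Lemma eLe_field e k : (forall i, vector_field (e i)) -> vector_field (fun x => eLe e x k).
Proof. by move=> He; rewrite /eLe; case: (fintype.split k) => i //; apply: lie_field => //; exact: hvF. Qed.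

Lemma eLe_sum e x (c : 'I_(n + n) -> R) :
  \sum_k c k *: eLe e x k = \sum_i c (lshift n i) *: e i x + \sum_i c (rshift n i) *: lie hv (e i) x.
Proof.
rewrite big_split_ord /= /eLe; congr (_ + _); apply: eq_bigr => i _.
  by case: split_ordP => j /eqP; rewrite ?eq_lshift ?eq_lrshift // => /eqP ->.
by case: split_ordP => j /eqP; rewrite ?eq_rshift ?eq_rlshift // => /eqP ->.
Qed.

(** Regularity writes a tangent vector as [lie hv v x] for a section [v]; the Leibniz rule for the
    coefficients of [v] expands it in the [e i] and their brackets with [hv]. *)
Lemma tangent_span x e z : frame x e -> tangent x z -> exists c : 'I_(n + n) -> R, z = \sum_k c k *: eLe e x k.
Proof.
move=> fe; have [+ _] := hv_monotone x; rewrite /regular hvE => <- [v [vv vD] <-].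
have [c sc vE] := section_coef fe vv (nearW _ vD).
rewrite (lie_coef fe vv sc vE) big_split /=.
exists (fun k => match fintype.split k with inl i => fd (fun y => c y 0 i) x | inr i => c x 0 i end).
rewrite eLe_sum; congr (_ + _); apply: eq_bigr => i _.
  by case: split_ordP => j /eqP; rewrite ?eq_lshift ?eq_lrshift // => /eqP ->.
by case: split_ordP => j /eqP; rewrite ?eq_rshift ?eq_rlshift // => /eqP ->.
Qed.

Lemma coords x (a : chart R (2 * n) M) yc : atlas M a -> chart_dom a x -> (forall j, Cinf (yc j)) ->
  (\forall y \near x, forall j, yc j y = chart_fun a y 0 j) ->
  forall z, tangent x z -> z = \sum_i z (yc i) *: pd a i x.
Proof.
have [e fe] := frame_ex x.
apply: (@tangent_coords _ _ _ _ _ (n + n) (eLe e x)); first by rewrite mul2n addnn.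
by move=> z; apply: tangent_span.
Qed.

(** Differentiation under an abstract derivation [z] is legitimate because [z] is a finite
    combination of coordinate vectors, for which it is [pd_flow_deriv]. *)
Lemma tangent_flow_deriv x z f t : tangent x z -> Cinf f ->
  is_derive t 1 (fun t => z (f \o phi t)) (z (fun y => hv (phi t y) f)).
Proof.
move=> tz sf; have [a Ma ax] := atlas_cover x.
have [yc [syc yE]] := chart_coords Ma ax.
have E f' : z f' = \sum_i z (yc i) * pd a i x f'.
  by rewrite {1}(coords Ma ax syc yE tz) tvec_combE.
rewrite E (_ : (fun _ => _) = \sum_i (fun t => z (yc i) * pd a i x (f \o phi t))); last first.
  by apply/funext => s; rewrite E fct_sumE.
apply: is_derive_sum => i.
have D := pd_flow_deriv smf i t Ma ax sf.
exact: (@is_deriveZ _ _ _ (fun t => pd a i x (f \o phi t)) (z (yc i)) t 1 _ D).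
Qed.

(** * Symplectic linear algebra in a frame *)

Lemma sg_linl x a u v w : tangent x u -> tangent x v -> tangent x w ->
  sigma x (a *: u + v) w = a * sigma x u w + sigma x v w.
Proof. by move=> tu tv tw; have [H _ _ _] := sigma_symplectic; have [/(_ a u v w tu tv tw)[]] := H x. Qed.

Lemma sg_linr x a u v w : tangent x u -> tangent x v -> tangent x w ->
  sigma x w (a *: u + v) = a * sigma x w u + sigma x w v.
Proof. by move=> tu tv tw; have [H _ _ _] := sigma_symplectic; have [/(_ a u v w tu tv tw)[]] := H x. Qed.

Lemma sg_alt x u : tangent x u -> sigma x u u = 0.
Proof. by move=> tu; have [H _ _ _] := sigma_symplectic; have [_] := H x; apply. Qed.

Lemma sg_anti x u v : tangent x u -> tangent x v -> sigma x u v = - sigma x v u.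
Proof.
move=> tu tv; have tuv : tangent x (1 *: u + v) by apply: tangent_comb.
have := sg_alt tuv; rewrite sg_linl // !sg_linr // !sg_alt // !mul1r addr0 add0r => /eqP.
by rewrite addr_eq0 => /eqP.
Qed.

Lemma sg0l x w : tangent x w -> sigma x 0 w = 0.
Proof.
move=> tw; have := @sg_linl x (-1) 0 0 w (tangent0 x) (tangent0 x) tw.
by rewrite scaler0 addr0 mulN1r addNr.
Qed.
Lemma sg0r x w : tangent x w -> sigma x w 0 = 0.
Proof. by move=> tw; rewrite sg_anti // ?sg0l ?oppr0 //; apply: tangent0. Qed.

Lemma sg_suml x k (c : 'I_k -> R) (v : 'I_k -> tvec M) w : (forall i, tangent x (v i)) -> tangent x w ->
  sigma x (\sum_i c i *: v i) w = \sum_i c i * sigma x (v i) w.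
Proof.
move=> tv tw; elim: k c v tv => [|k IH] c v tv; first by rewrite !big_ord0 sg0l.
by rewrite !big_ord_recl sg_linl // ?IH //; apply: tangent_lcomb.
Qed.

Lemma sg_sumr x k (c : 'I_k -> R) (v : 'I_k -> tvec M) w : (forall i, tangent x (v i)) -> tangent x w ->
  sigma x w (\sum_i c i *: v i) = \sum_i c i * sigma x w (v i).
Proof.
move=> tv tw; rewrite sg_anti // ?sg_suml //; last exact: tangent_lcomb.
by rewrite -sumrN; apply: eq_bigr => i _; rewrite -mulrN -sg_anti.
Qed.

Lemma sgZl x a u w : tangent x u -> tangent x w -> sigma x (a *: u) w = a * sigma x u w.
Proof. by move=> tu tw; rewrite -[_ *: _]addr0 sg_linl // ?sg0l ?addr0 //; apply: tangent0. Qed.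
Lemma sgDl x u v w : tangent x u -> tangent x v -> tangent x w -> sigma x (u + v) w = sigma x u w + sigma x v w.
Proof. by move=> tu tv tw; rewrite -[u]scale1r sg_linl // mul1r scale1r. Qed.
Lemma sgDr x u v w : tangent x u -> tangent x v -> tangent x w -> sigma x w (u + v) = sigma x w u + sigma x w v.
Proof. by move=> tu tv tw; rewrite -[u]scale1r sg_linr // mul1r scale1r. Qed.

Lemma sg_nondeg x u : tangent x u -> (forall w, tangent x w -> sigma x u w = 0) -> u = 0.
Proof. by have [_ H _ _] := sigma_symplectic; apply: H. Qed.

Lemma sg_smooth X Y : vector_field X -> vector_field Y -> Cinf (fun x => sigma x (X x) (Y x)).
Proof. by have [_ _ H _] := sigma_symplectic; apply: H. Qed.

Lemma field_tangent X x : vector_field X -> tangent x (X x).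
Proof. by case. Qed.

Lemma frame_field x e i : frame x e -> vector_field (e i).
Proof. by case. Qed.

Lemma L_field X : vector_field X -> vector_field (L X).
Proof. by move=> HX; apply: lie_field => //; exact: hvF. Qed.

Lemma frame_tangent x e i y : frame x e -> tangent y (e i y).
Proof. by move=> /(@frame_field x e i) /field_tangent. Qed.
Lemma frameL_tangent x e i y : frame x e -> tangent y (L (e i) y).
Proof. by move=> /(@frame_field x e i) /L_field /field_tangent. Qed.

Lemma eLe_tangent x e k : frame x e -> tangent x (eLe e x k).
Proof. by move=> [H _]; exact: (field_tangent x (eLe_field k H)). Qed.

Lemma eLe_l e x i : eLe e x (lshift n i) = e i x.
Proof. by rewrite /eLe; case: split_ordP => j /eqP; rewrite ?eq_lshift ?eq_lrshift // => /eqP ->. Qed.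
Lemma eLe_r e x i : eLe e x (rshift n i) = L (e i) x.
Proof. by rewrite /eLe; case: split_ordP => j /eqP; rewrite ?eq_rshift ?eq_rlshift // => /eqP ->. Qed.

Lemma span_ind x e (P : tvec M -> Prop) : frame x e -> P 0 ->
  (forall a u v, tangent x u -> tangent x v -> P u -> P v -> P (a *: u + v)) ->
  (forall i, P (e i x)) -> (forall i, P (L (e i) x)) -> forall z, tangent x z -> P z.
Proof.
move=> fe P0 PD Pe PL z tz; have [c ->] := tangent_span fe tz.
have Pk k : P (eLe e x k) by case: (split_ordP k) => i ->; rewrite ?eLe_l ?eLe_r.
suff [] : P (\sum_k c k *: eLe e x k) /\ tangent x (\sum_k c k *: eLe e x k) by [].
elim/big_ind: _ => [|u v [Pu tu] [Pv tv]|k _].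
- by split=> //; apply: tangent0.
- by split; [rewrite -[u]scale1r; apply: PD|apply: tangentD].
- have tk := eLe_tangent k fe.
  by split; [rewrite -[_ *: _]addr0; apply: PD => //; apply: tangent0|apply: tangentZ].
Qed.

Lemma sg_ext x e z : frame x e -> tangent x z -> (forall i, sigma x z (e i x) = 0) ->
  (forall i, sigma x z (L (e i) x) = 0) -> z = 0.
Proof.
move=> fe tz z1 z2; apply: (sg_nondeg tz).
apply: (span_ind fe) => //; first exact: sg0r.
by move=> a u v tu tv Hu Hv; rewrite sg_linr // Hu Hv mulr0 addr0.
Qed.

Lemma sg_Delta x xi eta : Delta x xi -> Delta x eta -> sigma x xi eta = 0.
Proof. by have [_ H] := Delta_lagrange; apply: H. Qed.

(** The matrix of [g^h] in the frame [e], see [gformE]. *)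
Definition Gm (e : 'I_n -> M -> tvec M) y : 'M[R]_n := \matrix_(i, j) sigma y (L (e i) y) (e j y).

(** A kernel row gives a vector of [Delta] that [sigma] pairs to 0 with all [L (e i)], and with
    [Delta] because [Delta] is Lagrangian. These span the tangent space, so the vector is 0. *)
Lemma Gm_unit x e : frame x e -> Gm e x \in unitmx.
Proof.
move=> fe; rewrite -unitmx_tr -row_free_unit -kermx_eq0; apply/eqP/row_matrixP => i; rewrite row0.
set r := row i _.
have rA : r *m (Gm e x)^T = 0 by apply/sub_kermxP; apply: row_sub.
clearbody r.
pose z := \sum_j r 0 j *: e j x.
have te j := @frame_tangent x e j x fe.
have tz : tangent x z by apply: tangent_lcomb.
have z0 : z = 0.
  apply: (sg_ext fe tz) => k; rewrite sg_suml //; try exact: frameL_tangent fe.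
    by rewrite big1 // => j _; rewrite sg_Delta ?mulr0 //; exact: (Delta_frame _ fe).
  have := congr1 (fun A : 'rV[R]_n => A 0 k) rA; rewrite !mxE => H.
  apply/eqP; rewrite -oppr_eq0 -sumrN; apply/eqP; apply: etrans H; apply: eq_bigr => j _.
  by rewrite !mxE (sg_anti (te j) (frameL_tangent k x fe)) mulrN opprK.
apply/rowP => j; rewrite [RHS]mxE; exact: (frame_basis fe).1 (fun j => r 0 j) z0 j.
Qed.

Lemma frame_indep x e (a b : 'rV[R]_n) : frame x e ->
  \sum_i a 0 i *: e i x + \sum_i b 0 i *: L (e i) x = 0 -> a = 0 /\ b = 0.
Proof.
move=> fe E; have te j := @frame_tangent x e j x fe; have tL j := @frameL_tangent x e j x fe.
have b0 : b = 0.
  suff bG : b *m Gm e x = 0 by rewrite -[b](mulmxK (Gm_unit fe)) bG mul0mx.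
  apply/rowP => j; have := congr1 (fun z => sigma x z (e j x)) E.
  rewrite sgDl //; try exact: tangent_lcomb.
  rewrite !sg_suml // sg0l // big1 ?add0r; last by move=> i _; rewrite sg_Delta ?mulr0 //; exact: (Delta_frame _ fe).
  by move=> H; rewrite !mxE; apply: etrans H; apply: eq_bigr => i _; rewrite !mxE.
split=> //; move: E; rewrite b0 [X in _ + X]big1 ?addr0; last by move=> i _; rewrite mxE scale0r.
move=> E; apply/rowP => j; rewrite [RHS]mxE; exact: (frame_basis fe).1 (fun j => a 0 j) E j.
Qed.

(** The Gram matrix of [sigma] on the basis [eLe] is invertible. For [f = h] this proves the
    existence of the Hamiltonian vector; for other [f] it turns the evaluation of projectors on
    functions into matrix algebra. *)
Lemma dual_vector x f : exists2 eta, tangent x eta & forall xi, tangent x xi -> xi f = sigma x xi eta.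
Proof.
have [e fe] := frame_ex x.
have te k := eLe_tangent k fe.
pose A : 'M[R]_(n + n) := \matrix_(k, l) sigma x (eLe e x k) (eLe e x l).
have uA : A \in unitmx.
  rewrite -row_free_unit -kermx_eq0; apply/eqP/row_matrixP => i; rewrite row0.
  set r := row i _.
  have rA : r *m A = 0 by apply/sub_kermxP; apply: row_sub.
  clearbody r.
  pose z := \sum_k r 0 k *: eLe e x k.
  have zl l : sigma x z (eLe e x l) = 0.
    rewrite sg_suml //; have := congr1 (fun A : 'rV[R]_(n + n) => A 0 l) rA; rewrite !mxE => H.
    by apply: etrans H; apply: eq_bigr => k _; rewrite mxE.
  have z0 : z = 0.
    apply: (sg_ext fe); first exact: tangent_lcomb.
    - by move=> j; rewrite -eLe_l.
    - by move=> j; rewrite -eLe_r.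
  have [|h1 h2] := @frame_indep x e (\row_i r 0 (lshift n i)) (\row_i r 0 (rshift n i)) fe.
    apply: etrans z0; rewrite /z [RHS](eLe_sum e x (fun k => r 0 k)).
    by congr (_ + _); apply: eq_bigr => j _; rewrite mxE.
  apply/rowP => k; rewrite [RHS]mxE; case: (split_ordP k) => j ->.
    by have := congr1 (fun v : 'rV[R]_n => v 0 j) h1; rewrite !mxE.
  by have := congr1 (fun v : 'rV[R]_n => v 0 j) h2; rewrite !mxE.
pose b := invmx A *m \col_k (eLe e x k) f.
have Ab : A *m b = \col_k (eLe e x k) f by rewrite mulKVmx.
exists (\sum_l b l 0 *: eLe e x l); first exact: tangent_lcomb.
have Pk k : eLe e x k f = sigma x (eLe e x k) (\sum_l b l 0 *: eLe e x l).
  rewrite sg_sumr //; have := congr1 (fun A : 'cV[R]_(n + n) => A k 0) Ab; rewrite !mxE => <-.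
  by apply: eq_bigr => l _; rewrite mxE mulrC.
apply: (span_ind fe) => [|a u v tu tv Hu Hv|i|i].
- by rewrite sg0l //; apply: tangent_lcomb.
- rewrite sg_linl //; last exact: tangent_lcomb.
  by rewrite -Hu -Hv.
- by have := Pk (lshift n i); rewrite eLe_l.
- by have := Pk (rshift n i); rewrite eLe_r.
Qed.

Lemma hamP x xi : tangent x xi -> xi h = sigma x xi (hv x).
Proof.
rewrite -hvE /hamiltonian_field.
have [eta teta Heta] := dual_vector x h.
have : exists z, [set eta | tangent x eta /\ forall xi, tangent x xi -> xi h = sigma x xi eta] z by exists eta.
by case/(xgetPex 0) => _; apply.
Qed.

Lemma hv_h x : hv x h = 0.
Proof. by rewrite (hamP (field_tangent x hvF)) sg_alt //; exact: (field_tangent x hvF). Qed.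

(** Closedness for the fields [hv], [Y], [Z]: the terms containing [h] add up to
    [Y (Z h) - Z (Y h) - lie Y Z h = 0], and what remains is the invariance of [sigma] under
    [hv]. *)
Lemma lie_sigma Y Z x : vector_field Y -> vector_field Z ->
  hv x (fun y => sigma y (Y y) (Z y)) = sigma x (L Y x) (Z x) + sigma x (Y x) (L Z x).
Proof.
move=> HY HZ; have [_ _ _ H] := sigma_symplectic.
have := H hv Y Z hvF HY HZ x.
have -> : (fun y => sigma y (Z y) (hv y)) = fun y => Z y h.
  by apply/funext => y; rewrite (hamP (field_tangent y HZ)).
have -> : (fun y => sigma y (hv y) (Y y)) = fun y => (-1) * Y y h + 0.
  apply/funext => y; rewrite (hamP (field_tangent y HY)).
  by rewrite addr0 mulN1r sg_anti //; [exact: (field_tangent y hvF)|exact: (field_tangent y HY)].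
have [_ Zl _] := field_tangent x HZ.
rewrite Zl; [|by have [_] := HY; apply; exact: h_smooth|exact: Cinf_cst].
rewrite (tangent_cst _ (field_tangent x HZ)).
have -> : sigma x (lie Y Z x) (hv x) = Y x (fun y => Z y h) - Z x (fun y => Y y h).
  by rewrite -(hamP (field_tangent x (lie_field HY HZ))).
have -> : lie Z hv x = (-1) *: L Z x.
  by apply/funext => f; rewrite -[RHS]/((-1) * (L Z x f)) /lie mulN1r opprB.
have tLZ : tangent x (L Z x) by apply/field_tangent/L_field.
rewrite sgZl //; last exact: (field_tangent x HY).
rewrite (sg_anti (field_tangent x HY) tLZ) => E.
apply/eqP; rewrite -subr_eq0 -[X in _ == X]E; apply/eqP; ring.
Qed.

(** * Transport of vectors and of the symplectic form by the flow *)

Lemma coordinate_fields x : exists (yc : 'I_(2 * n) -> M -> R) (Y : 'I_(2 * n) -> M -> tvec M),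
  [/\ forall j, Cinf (yc j), forall i, vector_field (Y i),
      \forall y \near x, forall i j, Y i y (yc j) = (i == j)%:R &
      \forall y \near x, forall z, tangent y z -> z = \sum_i z (yc i) *: Y i y].
Proof.
have [a Ma ax] := atlas_cover x.
have [yc [syc yE]] := chart_coords Ma ax.
have H i : exists Y, vector_field Y /\ \forall y \near x, Y y = pd a i y.
  by have [Y] := pd_field i Ma ax; exists Y.
have [Y HY] := choice H.
have Yn : \forall y \near x, forall i, Y i y = pd a i y.
  by apply: filter_forall => i; have [] := HY i.
exists yc, Y; split=> //; first by move=> i; have [] := HY i.
- apply: filterS3 (near_nbhs_near yE) Yn (chart_dom_near ax) => y yEy Yy ay i j.
  by rewrite Yy (pd_coord _ _ Ma ay syc yEy).
- apply: filterS3 (near_nbhs_near yE) Yn (chart_dom_near ax) => y yEy Yy ay z tz.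
  by rewrite {1}(coords Ma ay syc yEy tz); apply: eq_bigr => i _; rewrite Yy.
Qed.

(** The sum is the Lie derivative of [push (phi t) eta] at time 0, expanded in the fields [Y i]; it
    vanishes because the vector is carried by the flow. In coordinates, [L (Y i)] has the components
    [- Y i (hv (yc k))]. *)
Lemma transport_cancel x eta (yc : 'I_(2 * n) -> M -> R) (Y : 'I_(2 * n) -> M -> tvec M) :
  (forall j, Cinf (yc j)) -> (forall i, vector_field (Y i)) ->
  (\forall y \near x, forall i j, Y i y (yc j) = (i == j)%:R) ->
  (\forall y \near x, forall z, tangent y z -> z = \sum_i z (yc i) *: Y i y) ->
  tangent x eta ->
  \sum_i (eta (fun y => hv y (yc i)) *: Y i x + eta (yc i) *: L (Y i) x) = 0.
Proof.
move=> syc vY Yyc Yspan teta.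
set z := \sum_i _.
have tz : tangent x z.
  by apply: tangent_sum => i; apply: tangentD; apply: tangentZ; apply: field_tangent => //; apply: L_field.
rewrite (nbhs_singleton Yspan z tz); apply: big1 => k _; suff -> : z (yc k) = 0 by rewrite scale0r.
have svk : Cinf (fun y => hv y (yc k)) by apply: (velocity_Cinf smf).
have E i : L (Y i) x (yc k) = - Y i x (fun y => hv y (yc k)).
  have sY : Cinf (fun y => Y i y (yc k)) by have [_ H] := vY i; apply: H.
  have n1 : \forall y \near x, Y i y (yc k) = (i == k)%:R by apply: filterS Yyc => y ->.
  rewrite /lie (tangent_local (field_tangent x hvF) sY (@Cinf_cst R _ M _) n1).
  by rewrite (tangent_cst _ (field_tangent x hvF)) sub0r.
rewrite /z tvec_sumE.
under eq_bigr => i _.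
  rewrite -[(_ + _) (yc k)]/(eta (fun y => hv y (yc i)) * Y i x (yc k) + eta (yc i) * L (Y i) x (yc k)).
  rewrite E (nbhs_singleton Yyc) mulrN.
  over.
rewrite sumrB (bigD1 k) //= eqxx mulr1 big1 ?addr0; last by move=> i ik; rewrite (negPf ik) mulr0.
have := congr1 (fun v : tvec M => v (fun y => hv y (yc k))) (nbhs_singleton Yspan eta teta).
by rewrite tvec_combE => <-; rewrite subrr.
Qed.

(** Expand the transported vector in the fields [Y i]. The product rule and [lie_sigma] give the
    claimed term plus the pairing of [X] with the zero sum of [transport_cancel]. *)
Lemma sigma_flow0 X x eta : vector_field X -> tangent x eta ->
  is_derive (0 : R) 1 (fun t => sigma (phi t x) (push (phi t) eta) (X (phi t x))) (sigma x eta (L X x)).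
Proof.
move=> vX teta; have [yc [Y [syc vY Yyc Yspan]]] := coordinate_fields x.
have sYX i : Cinf (fun y => sigma y (Y i y) (X y)) by apply: sg_smooth.
have nE : \forall t \near (0 : R), (\sum_i ((fun t => eta (yc i \o phi t)) * (fun t => sigma (phi t x) (Y i (phi t x)) (X (phi t x))))) t
   = sigma (phi t x) (push (phi t) eta) (X (phi t x)).
  apply: filterS (flow_near0 Yspan) => t Ht.
  rewrite (Ht _ (push_tangent smf t teta)) sg_suml ?fct_sumE //.
  - by move=> i; apply: field_tangent.
  - exact: field_tangent.
apply: near_eq_is_derive nE _.
have -> : sigma x eta (L X x) = \sum_i (eta (yc i) *: (sigma x (L (Y i) x) (X x) + sigma x (Y i x) (L X x))
     + sigma x (Y i x) (X x) *: eta (fun y => hv y (yc i))).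
  have tX := field_tangent x vX; have tLX := field_tangent x (L_field vX).
  have tY i := field_tangent x (vY i); have tLY i := field_tangent x (L_field (vY i)).
  have := congr1 (fun z => sigma x z (X x)) (transport_cancel syc vY Yyc Yspan teta).
  rewrite big_split /= sgDl ?sg_suml //; try exact: tangent_lcomb.
  rewrite sg0l // => E.
  rewrite {1}(nbhs_singleton Yspan _ teta) sg_suml //.
  transitivity (\sum_i eta (yc i) * sigma x (Y i x) (L X x) + (\sum_i eta (fun y => hv y (yc i)) * sigma x (Y i x) (X x) +
    \sum_i eta (yc i) * sigma x (L (Y i) x) (X x))); first by rewrite E addr0.
  rewrite -!big_split /=; apply: eq_bigr => i _; rewrite /GRing.scale /=; ring.
apply: is_derive_sum => i.
have D1 := tangent_flow_deriv 0 teta (syc i).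
have D2 := flow_deriv smf x 0 (sYX i).
have D := @is_deriveM _ _ (fun t => eta (yc i \o phi t)) (fun t => sigma (phi t x) (Y i (phi t x)) (X (phi t x))) 0 1 _ _ D1 D2.
move: D; rewrite (phi0 smf) lie_sigma //.
have -> : yc i \o phi 0 = yc i by apply/funext => y /=; rewrite (phi0 smf).
by have -> : (fun y => hv (phi 0 y) (yc i)) = (fun y => hv y (yc i)) by apply/funext => y /=; rewrite (phi0 smf).
Qed.

Lemma sigma_flow X x eta t : vector_field X -> tangent x eta ->
  is_derive t 1 (fun t => sigma (phi t x) (push (phi t) eta) (X (phi t x)))
    (sigma (phi t x) (push (phi t) eta) (L X (phi t x))).
Proof.
move=> vX teta; apply: shift_deriv.
have := sigma_flow0 vX (push_tangent smf t teta).
suff -> : (fun s => sigma (phi (t + s) x) (push (phi (t + s)) eta) (X (phi (t + s) x))) =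
  (fun s => sigma (phi s (phi t x)) (push (phi s) (push (phi t) eta)) (X (phi s (phi t x)))) by [].
by apply/funext => s; rewrite addrC (pushD smf) (phiD smf).
Qed.

(** With [zeta] expanded in the fields [Y i] and [sigma_flow0] applied to each of them, the
    derivative is again a pairing with a zero sum; the group law carries this from time 0 to all
    times. *)
Lemma sigma_const x eta zeta t : tangent x eta -> tangent x zeta ->
  sigma (phi t x) (push (phi t) eta) (push (phi t) zeta) = sigma x eta zeta.
Proof.
move=> teta tzeta.
have D0 y u v : tangent y u -> tangent y v ->
    is_derive (0 : R) 1 (fun t => sigma (phi t y) (push (phi t) u) (push (phi t) v)) 0.
  move=> tu tv; have [yc [Y [syc vY Yyc Yspan]]] := coordinate_fields y.
  have nE : \forall t \near (0 : R), (\sum_i ((fun t => v (yc i \o phi t)) * (fun t => sigma (phi t y) (push (phi t) u) (Y i (phi t y))))) t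
     = sigma (phi t y) (push (phi t) u) (push (phi t) v).
    apply: filterS (flow_near0 Yspan) => s Hs.
    rewrite [X in sigma _ _ X](Hs _ (push_tangent smf s tv)) sg_sumr ?fct_sumE //.
    - by move=> i; apply: field_tangent.
    - exact: (push_tangent smf).
  apply: near_eq_is_derive nE _.
  have tY i := field_tangent y (vY i); have tLY i := field_tangent y (L_field (vY i)).
  have := congr1 (fun z => sigma y u z) (transport_cancel syc vY Yyc Yspan tv).
  rewrite big_split /= sgDr ?sg_sumr //; try exact: tangent_lcomb.
  rewrite sg0r // => E; rewrite -[X in is_derive _ _ _ X]E -big_split /=.
  apply: is_derive_sum => i.
  have D1 := tangent_flow_deriv 0 tv (syc i).
  have D2 := sigma_flow0 (vY i) tu.
  have D := @is_deriveM _ _ (fun t => v (yc i \o phi t)) (fun t => sigma (phi t y) (push (phi t) u) (Y i (phi t y))) 0 1 _ _ D1 D2.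
  move: D; rewrite (phi0 smf) (push0 smf).
  have -> : yc i \o phi 0 = yc i by apply/funext => z /=; rewrite (phi0 smf).
  have -> : (fun z => hv (phi 0 z) (yc i)) = (fun z => hv z (yc i)) by apply/funext => z /=; rewrite (phi0 smf).
  move=> D'; apply: (is_derive_eq D'); rewrite /GRing.scale /=; ring.
have D s : is_derive s 1 (fun t => sigma (phi t x) (push (phi t) eta) (push (phi t) zeta)) 0.
  apply: shift_deriv; have := D0 _ _ _ (push_tangent smf s teta) (push_tangent smf s tzeta).
  suff -> : (fun r => sigma (phi (s + r) x) (push (phi (s + r)) eta) (push (phi (s + r)) zeta)) =
    (fun r => sigma (phi r (phi s x)) (push (phi r) (push (phi s) eta)) (push (phi r) (push (phi s) zeta))) by [].
  by apply/funext => r; rewrite addrC !(pushD smf) (phiD smf).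
have := is_derive_0_is_cst t 0 D; rewrite /= => ->.
by rewrite (phi0 smf) !(push0 smf).
Qed.

(** * The canonical connection and its curvature matrix *)

Definition fdm p q (A : M -> 'M[R]_(p, q)) x := \matrix_(i, j) fd (fun y => A y i j) x.

Lemma mder_flow p q (A : M -> 'M[R]_(p, q)) x t : smooth_mx (phi t x) A ->
  mder (fun s => A (phi s x)) t (fdm A (phi t x)).
Proof.
move=> sA i j; rewrite mxE; apply: shift_deriv.
have D := fd_deriv (sA i j).
have -> // : (fun s => A (phi (t + s) x) i j) = (fun s => A (phi s (phi t x)) i j).
by apply/funext => s; rewrite addrC (phiD smf).
Qed.

Lemma fdm_smooth p q (A : M -> 'M[R]_(p, q)) x : smooth_mx x A -> smooth_mx x (fdm A).
Proof.
move=> sA i j; have := fd_smooth (sA i j).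
by have -> : (fun y => fdm A y i j) = fd (fun y => A y i j) by apply/funext => y; rewrite mxE.
Qed.

(* A tangent vector eta carried by the flow has the coordinates
   p_j = sigma(eta, e_j), and p'' = p A + p' B.  The substitution
   q = p' - p B / 2 removes the first order term: in terms of the covariant
   derivative [cder] one has Dp = q and Dq = - p R. *)
Definition pv e y eta : 'rV[R]_n := \row_j sigma y eta (e j y).
Definition dpv e y eta : 'rV[R]_n := \row_j sigma y eta (L (e j) y).
Definition ddpv e y eta : 'rV[R]_n := \row_j sigma y eta (L (L (e j)) y).
Definition Km e y : 'M[R]_n := \matrix_(i, j) sigma y (L (L (e i)) y) (e j y).
Definition Om e y : 'M[R]_n := \matrix_(i, j) sigma y (L (e i) y) (L (e j) y).
Definition Th e y : 'M[R]_n := \matrix_(i, j) sigma y (L (e i) y) (L (L (e j)) y).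
Definition Gi e y := invmx (Gm e y).
Definition Bm e y := Gi e y *m (Km e y)^T.
Definition Am e y := Gi e y *m (Th e y - Om e y *m Bm e y).
(** What remains after the substitution for [q]: from [p'' = p A + p' B] one gets [Dq = q' - q B / 2
    = - p (B' / 2 - B^2 / 4 - A)]. *)
Definition Rm e y := 2^-1 *: fdm (Bm e) y - 4^-1 *: (Bm e y *m Bm e y) - Am e y.
Definition qv e y eta := dpv e y eta - 2^-1 *: (pv e y eta *m Bm e y).

Section FrameSmoothness.
Variables (x : M) (e : 'I_n -> M -> tvec M).
Hypothesis fe : frame x e.

Let ve i : vector_field (e i) := frame_field i fe.
Let vLe i : vector_field (L (e i)) := L_field (ve i).
Let vLLe i : vector_field (L (L (e i))) := L_field (vLe i).
Let te i : tangent x (e i x) := field_tangent x (ve i).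
Let tLe i : tangent x (L (e i) x) := field_tangent x (vLe i).

Lemma smooth_sg X Y : vector_field X -> vector_field Y -> smooth_near x (fun y => sigma y (X y) (Y y)).
Proof. by move=> vX vY; apply/smooth_near_Cinf/sg_smooth. Qed.

Lemma Gm_smooth : smooth_mx x (Gm e).
Proof.
move=> i j; have := smooth_sg (vLe i) (ve j).
by apply: smooth_near_ext; apply: nearW => y; rewrite mxE.
Qed.
Lemma Km_smooth : smooth_mx x (Km e).
Proof.
move=> i j; have := smooth_sg (vLLe i) (ve j).
by apply: smooth_near_ext; apply: nearW => y; rewrite mxE.
Qed.
Lemma Om_smooth : smooth_mx x (Om e).
Proof.
move=> i j; have := smooth_sg (vLe i) (vLe j).
by apply: smooth_near_ext; apply: nearW => y; rewrite mxE.
Qed.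
Lemma Th_smooth : smooth_mx x (Th e).
Proof.
move=> i j; have := smooth_sg (vLe i) (vLLe j).
by apply: smooth_near_ext; apply: nearW => y; rewrite mxE.
Qed.
Lemma Gi_smooth : smooth_mx x (Gi e).
Proof. by apply: smooth_mx_inv; [apply: (Gm_unit fe)|exact: Gm_smooth]. Qed.
Lemma Bm_smooth : smooth_mx x (Bm e).
Proof. by apply: smooth_mx_mul; [exact: Gi_smooth|apply: smooth_mx_tr; exact: Km_smooth]. Qed.
Lemma Am_smooth : smooth_mx x (Am e).
Proof.
apply: smooth_mx_mul; first exact: Gi_smooth.
apply: smooth_mx_add; first exact: Th_smooth.
by apply: smooth_mx_opp; apply: smooth_mx_mul; [exact: Om_smooth|exact: Bm_smooth].
Qed.
Lemma Rm_smooth : smooth_mx x (Rm e).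
Proof.
apply: smooth_mx_add; last by apply: smooth_mx_opp; exact: Am_smooth.
apply: smooth_mx_add; first by apply/smooth_mx_scale/fdm_smooth; exact: Bm_smooth.
by apply: smooth_mx_opp; apply/smooth_mx_scale/smooth_mx_mul; exact: Bm_smooth.
Qed.

Lemma fd_sg X Y : vector_field X -> vector_field Y ->
  fd (fun y => sigma y (X y) (Y y)) x = sigma x (L X x) (Y x) + sigma x (X x) (L Y x).
Proof. by move=> vX vY; rewrite fd_Cinf ?lie_sigma //; apply: sg_smooth. Qed.

(** Differentiate along the flow the identity [sigma (e i) (e j) = 0], which holds near [x]. *)
Lemma Gm_tr : (Gm e x)^T = Gm e x.
Proof.
apply/matrixP => i j; rewrite !mxE.
have := fd_sg (ve i) (ve j).
rewrite (@fd_ext _ _ (fun=> 0)); last first.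
  by apply: filterS (frame_near fe) => y fy; rewrite sg_Delta //; apply: (Delta_frame _ fy).
rewrite fd_Cinf ?(tangent_cst _ (field_tangent x hvF)); last exact: Cinf_cst.
rewrite (sg_anti (te i) (tLe j)) => /eqP.
by rewrite eq_sym subr_eq0 => /eqP ->.
Qed.

End FrameSmoothness.

Section FrameIdentities.
Variables (x : M) (e : 'I_n -> M -> tvec M).
Hypothesis fe : frame x e.

Let ve i : vector_field (e i) := frame_field i fe.
Let vLe i : vector_field (L (e i)) := L_field (ve i).
Let vLLe i : vector_field (L (L (e i))) := L_field (vLe i).
Let te i : tangent x (e i x) := field_tangent x (ve i).
Let tLe i : tangent x (L (e i) x) := field_tangent x (vLe i).
Let tLLe i : tangent x (L (L (e i)) x) := field_tangent x (vLLe i).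

Lemma Gi_tr : (Gi e x)^T = Gi e x.
Proof. by rewrite /Gi trmx_inv Gm_tr. Qed.

Lemma GiG : Gi e x *m Gm e x = 1%:M.
Proof. by apply: mulVmx; exact: (Gm_unit fe). Qed.
Lemma GGi : Gm e x *m Gi e x = 1%:M.
Proof. by apply: mulmxV; exact: (Gm_unit fe). Qed.

Lemma GB : Gm e x *m Bm e x = (Km e x)^T.
Proof. by rewrite /Bm mulmxA GGi mul1mx. Qed.

Lemma BTG : (Bm e x)^T *m Gm e x = Km e x.
Proof. by rewrite /Bm trmx_mul trmxK Gi_tr -mulmxA GiG mulmx1. Qed.

Lemma fdm_G : fdm (Gm e) x = Km e x + Om e x.
Proof.
apply/matrixP => i j; rewrite !mxE -fd_sg //.
by apply: fd_ext; apply: nearW => y; rewrite mxE.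
Qed.

Lemma Om_tr : (Om e x)^T = - Om e x.
Proof. by apply/matrixP => i j; rewrite !mxE sg_anti. Qed.

Lemma fdm_G_tr : (fdm (Gm e) x)^T = fdm (Gm e) x.
Proof.
apply/matrixP => i j; rewrite !mxE; apply: fd_ext.
apply: filterS (frame_near fe) => y fy.
by have := congr1 (fun A : 'M[R]_n => A i j) (Gm_tr fy); rewrite mxE.
Qed.

Lemma Km_tr : (Km e x)^T = Km e x + Om e x + Om e x.
Proof.
have := fdm_G_tr; rewrite fdm_G linearD /= Om_tr => E.
by rewrite -E subrK.
Qed.

(** Compatibility of the connection with [g^h]. The right side is [(K + K^T) / 2]; symmetry of the
    derivative [K + Om] of [G] gives [K^T = K + 2 Om]. *)
Lemma fdm_GB : fdm (Gm e) x = 2^-1 *: ((Bm e x)^T *m Gm e x + Gm e x *m Bm e x).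
Proof.
rewrite BTG GB Km_tr fdm_G; move: (Km e x) (Om e x) => K O.
by apply/matrixP => i j; rewrite !mxE; field.
Qed.

Lemma fdm_Gi : fdm (Gi e) x = - (2^-1 *: (Bm e x *m Gi e x + Gi e x *m (Bm e x)^T)).
Proof.
have s0 : smooth_mx (phi 0 x) (Gi e) by rewrite (phi0 smf); exact: Gi_smooth.
have g0 : smooth_mx (phi 0 x) (Gm e) by rewrite (phi0 smf); exact: Gm_smooth.
have D := mder_mul (mder_flow s0) (mder_flow g0).
have D1 : mder (fun s => Gi e (phi s x) *m Gm e (phi s x)) 0 0.
  apply: mder_near (mder_cst (1%:M : 'M[R]_n) 0).
  by apply: filterS (flow_near0 (frame_near fe)) => s fs; rewrite /Gi mulVmx // (Gm_unit fs).
have := mder_unique D D1; rewrite (phi0 smf) => /eqP; rewrite addr_eq0 => /eqP E.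
have : fdm (Gi e) x *m Gm e x *m Gi e x = fdm (Gi e) x by rewrite -mulmxA GGi mulmx1.
rewrite E mulNmx => <-; congr (- _).
rewrite fdm_GB -scalemxAr -scalemxAl; congr (_ *: _).
rewrite mulmxDr mulmxDl addrC; congr (_ + _).
  by rewrite mulmxA GiG mul1mx.
by rewrite -!mulmxA GGi mulmx1.
Qed.

Lemma pv_lin a u v : tangent x u -> tangent x v -> pv e x (a *: u + v) = a *: pv e x u + pv e x v.
Proof. by move=> tu tv; apply/rowP => j; rewrite !mxE sg_linl. Qed.
Lemma dpv_lin a u v : tangent x u -> tangent x v -> dpv e x (a *: u + v) = a *: dpv e x u + dpv e x v.
Proof. by move=> tu tv; apply/rowP => j; rewrite !mxE sg_linl. Qed.
Lemma ddpv_lin a u v : tangent x u -> tangent x v -> ddpv e x (a *: u + v) = a *: ddpv e x u + ddpv e x v.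
Proof. by move=> tu tv; apply/rowP => j; rewrite !mxE sg_linl. Qed.
Lemma qv_lin a u v : tangent x u -> tangent x v -> qv e x (a *: u + v) = a *: qv e x u + qv e x v.
Proof.
move=> tu tv; rewrite /qv pv_lin // dpv_lin // mulmxDl -scalemxAl !scalerDr !opprD.
move: (dpv e x u) (dpv e x v) (_ *m _) (_ *m _) => A1 A2 A3 A4.
by apply/matrixP => i j; rewrite !mxE; ring.
Qed.

Lemma pv0 : pv e x 0 = 0. Proof. by apply/rowP => j; rewrite !mxE sg0l. Qed.
Lemma dpv0 : dpv e x 0 = 0. Proof. by apply/rowP => j; rewrite !mxE sg0l. Qed.
Lemma ddpv0 : ddpv e x 0 = 0. Proof. by apply/rowP => j; rewrite !mxE sg0l. Qed.
Lemma qv0 : qv e x 0 = 0. Proof. by rewrite /qv pv0 dpv0 mul0mx scaler0 subr0. Qed.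

Lemma pv_e i : pv e x (e i x) = 0.
Proof. by apply/rowP => j; rewrite !mxE sg_Delta //; apply: (Delta_frame _ fe). Qed.
Lemma dpv_e i : dpv e x (e i x) = - row i (Gm e x).
Proof. by rewrite -Gm_tr //; apply/rowP => j; rewrite !mxE sg_anti. Qed.
Lemma ddpv_e i : ddpv e x (e i x) = - row i (Km e x)^T.
Proof. by apply/rowP => j; rewrite !mxE sg_anti. Qed.
Lemma pv_Le i : pv e x (L (e i) x) = row i (Gm e x).
Proof. by apply/rowP => j; rewrite !mxE. Qed.
Lemma dpv_Le i : dpv e x (L (e i) x) = row i (Om e x).
Proof. by apply/rowP => j; rewrite !mxE. Qed.
Lemma ddpv_Le i : ddpv e x (L (e i) x) = row i (Th e x).
Proof. by apply/rowP => j; rewrite !mxE. Qed.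
Lemma qv_e i : qv e x (e i x) = - row i (Gm e x).
Proof. by rewrite /qv pv_e mul0mx scaler0 subr0 dpv_e. Qed.

(** On the vectors [e i] and [L (e i)] the relation reads [G B = K^T] and [G A + Om B = Th], the
    equations that define [Bm] and [Am]. *)
Lemma ddpvE eta : tangent x eta -> ddpv e x eta = pv e x eta *m Am e x + dpv e x eta *m Bm e x.
Proof.
move: eta; apply: (span_ind fe) => [|a u v tu tv Hu Hv|i|i].
- by rewrite pv0 dpv0 ddpv0 !mul0mx addr0.
- rewrite pv_lin // dpv_lin // ddpv_lin // Hu Hv !mulmxDl -!scalemxAl scalerDr.
  by rewrite -!addrA; congr (_ + _); rewrite addrCA.
- by rewrite pv_e dpv_e ddpv_e mul0mx add0r mulNmx -row_mul GB.
- by rewrite pv_Le dpv_Le ddpv_Le -!row_mul /Am mulmxA GGi mul1mx -linearD /= subrK.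
Qed.

(** So [(p, q)] are canonical coordinates. On the vectors [L (e i)] this rests on
    [Om - K^T / 2 = - K / 2], which is where the half of [B] in [q] matters. *)
Lemma sgE eta zeta : tangent x eta -> tangent x zeta ->
  (sigma x eta zeta)%:M = qv e x eta *m Gi e x *m (pv e x zeta)^T - pv e x eta *m Gi e x *m (qv e x zeta)^T.
Proof.
move=> teta tzeta; move: eta teta; apply: (span_ind fe) => [|a u v tu tv Hu Hv|i|i].
- by rewrite sg0l // pv0 qv0 !mul0mx subrr; apply/matrixP => k l; rewrite !mxE mul0rn.
- rewrite sg_linl // pv_lin // qv_lin // raddfD /= -scale_scalar_mx Hu Hv.
  move: (qv e x u) (qv e x v) (pv e x u) (pv e x v) (qv e x zeta) (pv e x zeta) (Gi e x) => q1 q2 p1 p2 q3 p3 g.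
  by rewrite !mulmxDl -!scalemxAl scalerBr opprD addrACA.
- rewrite pv_e qv_e !mul0mx subr0 mulNmx -row_mul GGi mulNmx -row_mul mul1mx.
  by apply/matrixP => k l; rewrite !mxE (ord1 k) (ord1 l) /= mulr1n sg_anti.
- have E : qv e x (L (e i) x) = row i (Om e x - 2^-1 *: (Km e x)^T).
    by rewrite /qv pv_Le dpv_Le -row_mul GB; apply/rowP => j; rewrite !mxE.
  rewrite E pv_Le -!row_mul GGi mul1mx -linearB /=.
  suff -> : (Om e x - 2^-1 *: (Km e x)^T) *m Gi e x *m (pv e x zeta)^T - (qv e x zeta)^T = - (dpv e x zeta)^T.
    by apply/matrixP => k l; rewrite !mxE (ord1 k) (ord1 l) /= mulr1n sg_anti.
  have BT : (Bm e x)^T = Km e x *m Gi e x by rewrite /Bm trmx_mul trmxK Gi_tr.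
  rewrite /qv trB trZ trmx_mul BT opprB addrA.
  suff -> : (Om e x - 2^-1 *: (Km e x)^T) = - (2^-1 *: Km e x).
    by rewrite !mulNmx -!scalemxAl addNr add0r.
  by rewrite Km_tr; move: (Km e x) (Om e x) => K O; apply/matrixP => k l; rewrite !mxE; field.
Qed.

End FrameIdentities.

Lemma mder_pv x e eta t : (forall i, vector_field (e i)) -> tangent x eta ->
  mder (fun s => pv e (phi s x) (push (phi s) eta)) t (dpv e (phi t x) (push (phi t) eta)).
Proof.
move=> ve teta i j; rewrite mxE.
have -> : (fun s => pv e (phi s x) (push (phi s) eta) i j) = (fun s => sigma (phi s x) (push (phi s) eta) (e j (phi s x))).
  by apply/funext => s; rewrite mxE.
exact: sigma_flow.
Qed.

Lemma mder_dpv x e eta t : (forall i, vector_field (e i)) -> tangent x eta ->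
  mder (fun s => dpv e (phi s x) (push (phi s) eta)) t (ddpv e (phi t x) (push (phi t) eta)).
Proof.
move=> ve teta; apply: (mder_pv (e := fun i => L (e i)) t _ teta) => i.
exact: L_field.
Qed.

(* alpha is the covariant derivative of a: the connection matrix in the frame e
   is B / 2. *)
Definition cder k e x (a : R -> 'M[R]_(k, n)) t (alpha : 'M[R]_(k, n)) :=
  mder a t (alpha + 2^-1 *: (a t *m Bm e (phi t x))).

Lemma cder_pv x e eta t : frame (phi t x) e -> tangent x eta ->
  cder e x (fun s => pv e (phi s x) (push (phi s) eta)) t (qv e (phi t x) (push (phi t) eta)).
Proof.
move=> fe teta; apply: (mder_eq (mder_pv t _ teta)); first by case: fe.
by rewrite /qv subrK.
Qed.

Lemma cder_qv x e eta t : frame (phi t x) e -> tangent x eta ->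
  cder e x (fun s => qv e (phi s x) (push (phi s) eta)) t
    (- (pv e (phi t x) (push (phi t) eta) *m Rm e (phi t x))).
Proof.
move=> fe teta; have ve i : vector_field (e i) by case: fe.
have D1 := mder_dpv t ve teta; have D2 := mder_pv t ve teta.
have D3 := mder_flow (Bm_smooth fe).
have D := mder_add D1 (mder_opp (mder_scalec 2^-1 (mder_mul D2 D3))).
apply: (mder_eq D) => {D D1 D2 D3}.
rewrite (ddpvE fe (push_tangent smf t teta)) /qv /Rm.
move: (pv _ _ _) (dpv _ _ _) (Bm _ _) (Am _ _) (fdm _ _) => p dp B A B'.
rewrite !mulmxBr !mulmxBl !scalerBr -!scalemxAr -!scalemxAl !scalerDr !mulmxA !opprB !scalerA.
have q4 : 2^-1 * 2^-1 = 4^-1 :> R by field.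
rewrite q4; apply/matrixP => i j; rewrite !mxE.
by field.
Qed.

Lemma mder_Gi x e t : frame (phi t x) e -> mder (fun s => Gi e (phi s x)) t
  (- (2^-1 *: (Bm e (phi t x) *m Gi e (phi t x) + Gi e (phi t x) *m (Bm e (phi t x))^T))).
Proof. by move=> fe; apply: (mder_eq (mder_flow (Gi_smooth fe))); rewrite fdm_Gi. Qed.

(** The connection terms of [a] and [b] cancel against the derivative of the dual form [Gi], which
    the connection preserves. *)
Lemma cov_leibniz k l x e t (a : R -> 'M[R]_(k, n)) (b : R -> 'M[R]_(l, n)) alpha beta : frame (phi t x) e ->
  cder e x a t alpha -> cder e x b t beta ->
  mder (fun s => a s *m Gi e (phi s x) *m (b s)^T) t
    (alpha *m Gi e (phi t x) *m (b t)^T + a t *m Gi e (phi t x) *m beta^T).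
Proof.
move=> fe Da Db.
have D := mder_mul (mder_mul Da (mder_Gi fe)) (mder_tr Db).
apply: (mder_eq D) => {D Da Db}.
move: (a t) (b t) (Bm _ _) (Gi _ _) => {a b} a b B g.
have -> : (beta + 2^-1 *: (b *m B))^T = beta^T + 2^-1 *: (B^T *m b^T).
  by rewrite -trmx_mul; apply/matrixP => i j; rewrite !mxE.
rewrite !(mulmxDl, mulmxDr, mulmxN, mulNmx, mulmxA, =^~ scalemxAl, =^~ scalemxAr).
move: (_ *m _) (_ *m _) (_ *m _) (_ *m _) => A1 A2 A3 A4.
by apply/matrixP => i j; rewrite !mxE; ring.
Qed.

(** For two transported vectors the constant [sigma] equals [<q1, p2> - <p1, q2>], whose derivative
    is [<p1, p2 R> - <p1 R, p2>]. The rows [p] of the [L (e i)] exhaust all rows. *)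
Lemma Sm_sym x e : frame x e -> (Rm e x *m Gi e x)^T = Rm e x *m Gi e x.
Proof.
move=> fe.
have fe0 : frame (phi 0 x) e by rewrite (phi0 smf).
have key eta zeta : tangent x eta -> tangent x zeta ->
   pv e x eta *m (Rm e x *m Gi e x) *m (pv e x zeta)^T = pv e x eta *m (Rm e x *m Gi e x)^T *m (pv e x zeta)^T.
  move=> te tz.
  have D1 := cov_leibniz fe0 (cder_qv fe0 te) (cder_pv fe0 tz).
  have D2 := cov_leibniz fe0 (cder_pv fe0 te) (cder_qv fe0 tz).
  have D := mder_add D1 (mder_opp D2).
  have Dc : mder (fun s => (sigma x eta zeta)%:M : 'M[R]_1) 0 0 by apply: mder_cst.
  have nE : \forall s \near (0 : R), qv e (phi s x) (push (phi s) eta) *m Gi e (phi s x) *m (pv e (phi s x) (push (phi s) zeta))^T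
      - pv e (phi s x) (push (phi s) eta) *m Gi e (phi s x) *m (qv e (phi s x) (push (phi s) zeta))^T
      = (sigma x eta zeta)%:M.
    apply: filterS (flow_near0 (frame_near fe)) => s fs.
    by rewrite -(sgE fs (push_tangent smf s te) (push_tangent smf s tz)) sigma_const.
  have D' := mder_near nE D.
  have := mder_unique Dc D'; rewrite (phi0 smf) !(push0 smf) => /esym.
  move: (qv _ _ _) (qv _ _ _) => q q'.
  have E3 (a b c : 'M[R]_1) : - a + b - (b + - c) = 0 -> a = c.
    by move=> /matrixP E; apply/matrixP => i j; have := E i j; rewrite !mxE; lra.
  have Nt (a : 'rV[R]_n) : (- a)^T = - a^T by apply/matrixP => i j; rewrite !mxE.
  by rewrite Nt mulmxN !mulNmx => /E3; rewrite !trmx_mul (Gi_tr fe) !mulmxA.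
have tL i : tangent x (L (e i) x) by exact: (frameL_tangent i x fe).
have E : Gm e x *m (Rm e x *m Gi e x) *m (Gm e x)^T = Gm e x *m (Rm e x *m Gi e x)^T *m (Gm e x)^T.
  apply/matrixP => i j; have := congr1 (fun A : 'M[R]_1 => A 0 0) (key _ _ (tL i) (tL j)).
  by rewrite !pv_Le // !row_form.
have uG := Gm_unit fe.
have := congr1 (fun A => invmx (Gm e x) *m A *m invmx (Gm e x)^T) E.
by rewrite !mulmxA mulVmx // !mul1mx -!mulmxA mulmxV ?unitmx_tr // !mulmx1.
Qed.

(** * The objects of the statement computed in a frame *)

Definition comb e y (a : 'rV[R]_n) : tvec M := \sum_i a 0 i *: e i y.

Lemma comb_tangent x e a : frame x e -> tangent x (comb e x a).
Proof. by move=> fe; apply: tangent_lcomb => i; apply: frame_tangent fe. Qed.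

Lemma comb_lin x e c a b : comb e x (c *: a + b) = c *: comb e x a + comb e x b.
Proof.
rewrite /comb scaler_sumr -big_split /=; apply: eq_bigr => i _.
by rewrite !mxE scalerDl scalerA.
Qed.

Lemma comb0 x e : comb e x 0 = 0.
Proof. by rewrite /comb big1 // => i _; rewrite mxE scale0r. Qed.

Lemma comb_inj x e a b : frame x e -> comb e x a = comb e x b -> a = b.
Proof.
move=> fe E; apply/rowP => j; apply/eqP; rewrite -subr_eq0; apply/eqP.
apply: ((frame_basis fe).1 (fun i => a 0 i - b 0 i)).
under eq_bigr do rewrite scalerBl.
by rewrite sumrB; apply/eqP; rewrite subr_eq0; apply/eqP.
Qed.

Lemma DeltaE x e xi : frame x e -> Delta x xi <-> exists a, xi = comb e x a.
Proof. exact: DeltaP. Qed.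

Lemma pv_comb x e a : frame x e -> pv e x (comb e x a) = 0.
Proof.
move=> fe; apply/rowP => j; rewrite !mxE sg_Delta //; last exact: (Delta_frame _ fe).
by apply/(DeltaE _ fe); exists a.
Qed.

Lemma dpv_comb x e a : frame x e -> dpv e x (comb e x a) = - (a *m Gm e x).
Proof.
move=> fe; apply/rowP => j; rewrite !mxE sg_suml; last exact: (frameL_tangent j x fe).
  rewrite -sumrN; apply: eq_bigr => i _.
  have := congr1 (fun A : 'M[R]_n => A i j) (Gm_tr fe); rewrite !mxE => <-.
  by rewrite -mulrN sg_anti //; [exact: (frame_tangent i x fe)|exact: (frameL_tangent j x fe)].
by move=> i; exact: (frame_tangent i x fe).
Qed.

Lemma qv_comb x e a : frame x e -> qv e x (comb e x a) = - (a *m Gm e x).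
Proof. by move=> fe; rewrite /qv pv_comb // dpv_comb // mul0mx scaler0 subr0. Qed.

Lemma tangent_decomp x e z : frame x e -> tangent x z ->
  exists a b : 'rV[R]_n, z = comb e x a + \sum_i b 0 i *: L (e i) x.
Proof.
move=> fe tz; have [c ->] := tangent_span fe tz.
exists (\row_i c (lshift n i)), (\row_i c (rshift n i)); rewrite eLe_sum.
by congr (_ + _); apply: eq_bigr => i _; rewrite mxE.
Qed.

Lemma sg_comb_r x e z b : frame x e -> tangent x z -> sigma x z (comb e x b) = (pv e x z *m b^T) 0 0.
Proof.
move=> fe tz; rewrite sg_sumr //; last by move=> i; exact: (frame_tangent i x fe).
by rewrite mxE; apply: eq_bigr => j _; rewrite !mxE mulrC.
Qed.

Lemma pv_Lsum x e (b : 'rV[R]_n) : frame x e -> pv e x (\sum_i b 0 i *: L (e i) x) = b *m Gm e x.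
Proof.
move=> fe; apply/rowP => j; rewrite !mxE sg_suml; last exact: (frame_tangent j x fe).
  by apply: eq_bigr => i _; rewrite !mxE.
by move=> i; exact: (frameL_tangent i x fe).
Qed.

Lemma dpv_Lsum x e (b : 'rV[R]_n) : frame x e -> dpv e x (\sum_i b 0 i *: L (e i) x) = b *m Om e x.
Proof.
move=> fe; apply/rowP => j; rewrite !mxE sg_suml; last exact: (frameL_tangent j x fe).
  by apply: eq_bigr => i _; rewrite !mxE.
by move=> i; exact: (frameL_tangent i x fe).
Qed.

Lemma pvD x e u v : frame x e -> tangent x u -> tangent x v -> pv e x (u + v) = pv e x u + pv e x v.
Proof. by move=> fe tu tv; rewrite -[u]scale1r (pv_lin fe) // !scale1r. Qed.
Lemma dpvD x e u v : frame x e -> tangent x u -> tangent x v -> dpv e x (u + v) = dpv e x u + dpv e x v.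
Proof. by move=> fe tu tv; rewrite -[u]scale1r (dpv_lin fe) // !scale1r. Qed.

Lemma Lsum_tangent x e (b : 'rV[R]_n) : frame x e -> tangent x (\sum_i b 0 i *: L (e i) x).
Proof. by move=> fe; apply: tangent_lcomb => i; exact: (frameL_tangent i x fe). Qed.

Lemma Delta_pv x e z : frame x e -> tangent x z -> (Delta x z <-> pv e x z = 0).
Proof.
move=> fe tz; split=> [/(DeltaE _ fe)[a ->]|]; first exact: pv_comb.
have [a [b ->]] := tangent_decomp fe tz.
rewrite pvD ?pv_comb ?pv_Lsum ?add0r //; [|exact: comb_tangent|exact: Lsum_tangent].
move=> bG; have -> : b = 0 by rewrite -[b](mulmxK (Gm_unit fe)) bG mul0mx.
by apply/(DeltaE _ fe); exists a; rewrite [X in _ + X]big1 ?addr0 // => i _; rewrite mxE scale0r.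
Qed.

Lemma section_ext x e : frame x e -> exists s : 'I_n -> M -> tvec M,
  (forall i, sections Delta (s i)) /\ \forall y \near x, forall i, s i y = e i y.
Proof.
move=> fe; have [chi [K [chis chi1 Kc KU chi0]]] := bump_function (frame_near fe).
exists (fun i y => chi y *: e i y); split=> [i|]; last by apply: filterS chi1 => y -> i; rewrite scale1r.
split=> [|y]; first by apply: vector_field_mul => //; exact: (frame_field i fe).
have [Ky|/chi0->] := pselect (K y); last by rewrite scale0r; apply: Delta0.
rewrite -[_ *: _]addr0; apply: Delta_comb; last exact: Delta0.
exact: (Delta_frame _ (KU _ Ky)).
Qed.

Lemma section_through x e a : frame x e -> exists2 v, sections Delta v & v x = comb e x a.
Proof.
move=> fe; have [s [sD sE]] := section_ext fe.
exists (fun y => \sum_i a 0 i *: s i y); last by apply: eq_bigr => i _; rewrite (nbhs_singleton sE).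
split=> [|y].
  apply: vector_field_sum => i; apply: (@vector_field_mul _ _ _ (fun=> a 0 i)); first exact: Cinf_cst.
  by have [] := sD i.
elim/big_ind: _ => [|u v Du Dv|i _]; first exact: Delta0.
  by rewrite -[u]scale1r; apply: Delta_comb.
rewrite -[_ *: _]addr0; apply: Delta_comb; last exact: Delta0.
by have [_] := sD i; apply.
Qed.

Lemma L_section x e v : frame x e -> sections Delta v ->
  exists c' c : 'rV[R]_n, v x = comb e x c /\ L v x = comb e x c' + \sum_i c 0 i *: L (e i) x.
Proof.
move=> fe [vv vD]; have [c sc vE] := section_coef fe vv (nearW _ vD).
exists (\row_i fd (fun y => c y 0 i) x), (c x); split; first exact: (nbhs_singleton vE).
by rewrite (lie_coef fe vv sc vE) big_split /=; congr (_ + _); apply: eq_bigr => i _; rewrite mxE.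
Qed.

(** The selected number is unique: derivatives of the coefficients of [v1] contribute only a vector
    of [Delta], which [sigma] pairs to 0 with [v2 x]. *)
Lemma gformE x e a b : frame x e -> gform x (comb e x a) (comb e x b) = (a *m Gm e x *m b^T) 0 0.
Proof.
move=> fe; rewrite /Defs.gform hvE; set P := [set r | _].
have uniq r : P r -> r = (a *m Gm e x *m b^T) 0 0.
  move=> [v1 [v2 [s1 s2 v1x v2x ->]]].
  have [c' [c [vc ->]]] := L_section fe s1.
  have -> : a = c by apply: (comb_inj fe); rewrite -v1x vc.
  have tc := comb_tangent c' fe; have tL := Lsum_tangent c fe.
  by rewrite v2x sg_comb_r // ?pvD ?pv_comb ?pv_Lsum ?add0r //; exact: tangentD.
have [v1 s1 e1] := section_through a fe; have [v2 s2 e2] := section_through b fe.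
have Pex : exists r, P r by exists (sigma x (L v1 x) (v2 x)), v1, v2.
exact: uniq (xgetPex 0 Pex).
Qed.

Lemma gform_definite x e : frame x e ->
  (forall a : 'rV[R]_n, a != 0 -> 0 < (a *m Gm e x *m a^T) 0 0) \/
  (forall a : 'rV[R]_n, a != 0 -> (a *m Gm e x *m a^T) 0 0 < 0).
Proof.
move=> fe; have [_ H] := hv_monotone x.
have D a : Delta x (comb e x a) by apply/(DeltaE _ fe); exists a.
have nz a : a != 0 -> comb e x a <> 0.
  by move=> /eqP a0 c0; apply: a0; apply: (comb_inj fe); rewrite c0 comb0.
by case: H => H; [left|right] => a /nz a0; rewrite -gformE //; apply: H.
Qed.

(** A coset modulo [Delta] is determined by its row [p], so the equality of cosets becomes the
    linear equation [c G = p(hv)]. *)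
Lemma vfieldE x e : frame x e -> vfield sigma Delta h x = comb e x (pv e x (hv x) *m Gi e x).
Proof.
move=> fe; rewrite /vfield hvE; set P := [set xi | _].
have thv := field_tangent x hvF.
have gm c z : gmap sigma Delta h x (comb e x c) z <-> tangent x z /\ pv e x z = c *m Gm e x.
  split=> [[tz Hz]|[tz Hz]]; split=> //.
    apply/rowP => j; have Dj : Delta x (comb e x (delta_mx 0 j)) by apply/(DeltaE _ fe); exists (delta_mx 0 j).
    have := Hz _ Dj; rewrite gformE // sg_comb_r //.
    have E (r : 'rV[R]_n) : (r *m (delta_mx 0 j : 'rV[R]_n)^T) 0 0 = r 0 j.
      rewrite mxE (bigD1 j) //= !mxE !eqxx mulr1 big1 ?addr0 // => k kj.
      by rewrite !mxE (negPf kj) andbF mulr0.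
    by rewrite !E.
  by move=> eta /(DeltaE _ fe)[b ->]; rewrite gformE // sg_comb_r // Hz.
have qp z : quot_proj Delta x (hv x) z <-> tangent x z /\ pv e x z = pv e x (hv x).
  split=> [[tz Dz]|[tz Hz]]; split=> //.
    have := Dz => /(Delta_pv fe (tangentB tz thv)).
    by rewrite addrC -scaleN1r (pv_lin fe) // scaleN1r => /eqP; rewrite addrC subr_eq0 => /eqP.
  apply/(Delta_pv fe (tangentB tz thv)).
  by rewrite addrC -scaleN1r (pv_lin fe) // scaleN1r Hz addNr.
have Pc c : P (comb e x c) <-> c *m Gm e x = pv e x (hv x).
  split=> [[_ E]|E].
    have : quot_proj Delta x (hv x) (hv x) by apply/qp.
    by rewrite -E => /gm [_ ->].
  split; first by apply/(DeltaE _ fe); exists c.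
  by apply/seteqP; split=> z; [move/gm; rewrite E => ?; apply/qp|move/qp; rewrite -E => ?; apply/gm].
have Pex : exists xi, P xi.
  by exists (comb e x (pv e x (hv x) *m Gi e x)); apply/Pc; rewrite -mulmxA (GiG fe) mulmx1.
have Px := xgetPex 0 Pex; have [/(DeltaE _ fe)[c Ec] _] := Px.
rewrite Ec in Px *; move/Pc: Px => <-.
by rewrite -mulmxA (GGi fe) mulmx1.
Qed.

Definition cv e y := pv e y (hv y) *m Gi e y.

Lemma pv_smooth X x e : vector_field X -> frame x e -> smooth_mx x (fun y => pv e y (X y)).
Proof.
move=> vX fe i j; apply: smooth_near_Cinf.
have -> : (fun y => pv e y (X y) i j) = fun y => sigma y (X y) (e j y) by apply/funext => y; rewrite mxE.
by apply: sg_smooth => //; exact: (frame_field j fe).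
Qed.

Lemma cv_smooth x e : frame x e -> smooth_mx x (cv e).
Proof. by move=> fe; apply: smooth_mx_mul; [exact: (pv_smooth hvF)|exact: Gi_smooth]. Qed.

Lemma vfield_near x e : frame x e -> \forall y \near x, vfield sigma Delta h y = comb e y (cv e y).
Proof. by move=> /frame_near; apply: filterS => y fy; rewrite (vfieldE fy). Qed.

Lemma vfield_field : vector_field (vfield sigma Delta h).
Proof.
split=> [x|f sf].
  by have [e fe] := frame_ex x; rewrite (vfieldE fe); exact: comb_tangent.
apply/smooth_nearP => x; have [e fe] := frame_ex x.
apply: (@smooth_near_ext _ _ _ _ (fun y => \sum_i cv e y 0 i * e i y f)).
  by apply: filterS (vfield_near fe) => y ->; rewrite /comb tvec_combE.
apply: smooth_near_sum => i; apply: smooth_near_mul; first exact: cv_smooth.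
by apply: smooth_near_Cinf; have [_] := frame_field i fe; apply.
Qed.

Lemma cder_hv x e t : frame (phi t x) e ->
  cder e x (fun s => pv e (phi s x) (hv (phi s x))) t (qv e (phi t x) (hv (phi t x))).
Proof.
move=> fe; have := cder_pv fe (field_tangent x hvF).
rewrite (push_velocity smf).
by have -> : (fun s => pv e (phi s x) (push (phi s) (hv x))) = (fun s => pv e (phi s x) (hv (phi s x))) by apply/funext => s; rewrite (push_velocity smf).
Qed.

Lemma cv_alg (q p : 'rV[R]_n) (g G B K : 'M[R]_n) : g *m G = 1%:M -> B^T *m G = K ->
  ((q + 2^-1 *: (p *m B)) *m g + p *m (- (2^-1 *: (B *m g + g *m B^T)))) *m G
  = q - 2^-1 *: (p *m g *m K).
Proof.
move=> gG BG; rewrite mulmxDl -(mulmxA _ g G) gG mulmx1 -mulmxA mulNmx -scalemxAl mulmxDl -!mulmxA gG BG mulmx1.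
rewrite mulmxN -scalemxAr mulmxDr.
move: (_ *m _) (p *m (_ *m _)) => A1 A2.
by apply/matrixP => i j; rewrite !mxE; ring.
Qed.

Lemma fdm_cv x e : frame x e -> fdm (cv e) x *m Gm e x
  = qv e x (hv x) - 2^-1 *: (pv e x (hv x) *m Gi e x *m Km e x).
Proof.
move=> fe; have fe0 : frame (phi 0 x) e by rewrite (phi0 smf).
have D := mder_mul (cder_hv fe0) (mder_Gi fe0).
have D' := mder_flow (cv_smooth fe0).
have := mder_unique D D'; rewrite (phi0 smf) => <-.
by apply: cv_alg; [exact: (GiG fe)|exact: (BTG fe)].
Qed.

(** By the choice of [v], the fields [L v] and [hv] have the same row [p] near [x]. Differentiating
    this along the flow leaves [sigma (hv) (L (e j)) - sigma (L v) (L (e j))], computed with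
    [fdm_cv]. *)
Lemma sg_LLvfield x e j : frame x e ->
  sigma x (L (L (vfield sigma Delta h)) x) (e j x) = 2 * (qv e x (hv x)) 0 j.
Proof.
move=> fe; set v := vfield sigma Delta h.
have vv : vector_field v by exact: vfield_field.
have vLv : vector_field (L v) by exact: L_field.
have vj := frame_field j fe.
have LvE y : frame y e -> L v y = comb e y (\row_i fd (fun y => cv e y 0 i) y) + \sum_i cv e y 0 i *: L (e i) y.
  move=> fy; rewrite (lie_coef fy vv (cv_smooth fy) (vfield_near fy)) big_split /=.
  by congr (_ + _); apply: eq_bigr => i _; rewrite mxE.
have pLv y : frame y e -> pv e y (L v y) = pv e y (hv y).
  move=> fy; rewrite (LvE _ fy) pvD ?pv_comb ?pv_Lsum ?add0r //; [|exact: comb_tangent|exact: Lsum_tangent].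
  by rewrite /cv -mulmxA (GiG fy) mulmx1.
have E1 : hv x (fun y => sigma y (L v y) (e j y)) = hv x (fun y => sigma y (hv y) (e j y)).
  rewrite -!fd_Cinf; try by apply: sg_smooth => //; exact: hvF.
  apply: fd_ext; apply: filterS (frame_near fe) => y fy.
  by have := congr1 (fun r : 'rV[R]_n => r 0 j) (pLv y fy); rewrite !mxE.
move: E1; rewrite !lie_sigma //; last exact: hvF.
have -> : L hv x = 0 by apply/funext => f; rewrite /lie subrr.
rewrite sg0l ?add0r; last exact: (field_tangent x vj).
have -> : sigma x (hv x) (L (e j) x) = dpv e x (hv x) 0 j by rewrite mxE.
have -> : sigma x (L v x) (L (e j) x) = dpv e x (L v x) 0 j by rewrite mxE.
rewrite (LvE _ fe) dpvD //; [|exact: comb_tangent|exact: Lsum_tangent].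
rewrite dpv_comb // dpv_Lsum //.
have -> : \row_i fd (fun y => cv e y 0 i) x = fdm (cv e) x by apply/rowP => i; rewrite !mxE.
rewrite fdm_cv // /cv /qv.
have EB : Bm e x = Gi e x *m (Km e x + Om e x + Om e x) by rewrite -(Km_tr fe).
rewrite EB !mulmxDr -!mulmxA; move: (dpv _ _ _) => d.
move: (_ *m (_ *m Km e x)) (_ *m (_ *m Om e x)) => A1 A2.
rewrite !mxE => E2; lra.
Qed.

Lemma sg_LLvfield_comb x e a : frame x e ->
  sigma x (L (L (vfield sigma Delta h)) x) (comb e x a) = 2 * (qv e x (hv x) *m a^T) 0 0.
Proof.
move=> fe; have vLL := L_field (L_field vfield_field).
rewrite sg_sumr; [|by move=> i; exact: (frame_tangent i x fe)|exact: (field_tangent x vLL)].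
rewrite mxE mulr_sumr; apply: eq_bigr => i _.
by rewrite sg_LLvfield // [a^T _ _]mxE; ring.
Qed.

(** * The curvature operator *)

Section JacobiCurve.
Variables (x : M) (e : 'I_n -> M -> tvec M).
Hypothesis fe : frame x e.

Let te i : tangent x (e i x) := frame_tangent i x fe.

(** The [Em j s] span the Jacobi curve at [s]. The rows of [Ym] and [QYm] are [p] and [q] of the
    transported frame of [Delta x], a solution of [DY = Q], [DQ = - Y R] with [Y(0) = 0] and
    [Q(0) = - G]. *)
Definition Em j s : tvec M := push (phi (- s)) (e j (phi s x)).
Definition Ym s : 'M[R]_n := \matrix_(i, j) pv e (phi s x) (push (phi s) (e i x)) 0 j.
Definition QYm s : 'M[R]_n := \matrix_(i, j) qv e (phi s x) (push (phi s) (e i x)) 0 j.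
Local Notation G0 := (Gm e x).
Local Notation g s := (Gi e (phi s x)).

Lemma row_Ym s i : row i (Ym s) = pv e (phi s x) (push (phi s) (e i x)).
Proof. by apply/rowP => j; rewrite !mxE. Qed.
Lemma row_QYm s i : row i (QYm s) = qv e (phi s x) (push (phi s) (e i x)).
Proof. by apply/rowP => j; rewrite !mxE. Qed.

Lemma cder_Ym t : frame (phi t x) e -> cder e x Ym t (QYm t).
Proof.
move=> ft; apply: mder_rows => i; have := cder_pv ft (te i).
have -> : row i (QYm t + 2^-1 *: (Ym t *m Bm e (phi t x))) = row i (QYm t) + 2^-1 *: (row i (Ym t) *m Bm e (phi t x)).
  by rewrite -!row_mul; apply/rowP => j; rewrite !mxE.
rewrite /cder row_Ym row_QYm.
by have -> : (fun s => row i (Ym s)) = (fun s => pv e (phi s x) (push (phi s) (e i x))) by apply/funext => s; rewrite row_Ym.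
Qed.

Lemma cder_QYm t : frame (phi t x) e -> cder e x QYm t (- (Ym t *m Rm e (phi t x))).
Proof.
move=> ft; apply: mder_rows => i; have := cder_qv ft (te i).
have -> : row i (- (Ym t *m Rm e (phi t x)) + 2^-1 *: (QYm t *m Bm e (phi t x)))
   = - (row i (Ym t) *m Rm e (phi t x)) + 2^-1 *: (row i (QYm t) *m Bm e (phi t x)).
  by rewrite -!row_mul; apply/rowP => j; rewrite !mxE.
rewrite /cder row_Ym row_QYm.
by have -> : (fun s => row i (QYm s)) = (fun s => qv e (phi s x) (push (phi s) (e i x))) by apply/funext => s; rewrite row_QYm.
Qed.

Lemma Ym0 : Ym 0 = 0.
Proof.
apply/row_matrixP => i; rewrite row_Ym (phi0 smf) (push0 smf) row0.
exact: (pv_e fe).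
Qed.

Lemma QYm0 : QYm 0 = - G0.
Proof.
apply/row_matrixP => i; rewrite row_QYm (phi0 smf) (push0 smf) linearN /=.
exact: (qv_e fe).
Qed.

Lemma frames_near0 : \forall s \near (0 : R), frame (phi s x) e.
Proof. exact: (flow_near0 (frame_near fe)). Qed.

Lemma sg_row s zeta : frame (phi s x) e -> tangent x zeta ->
  qv e (phi s x) (push (phi s) zeta) *m g s *m (Ym s)^T - pv e (phi s x) (push (phi s) zeta) *m g s *m (QYm s)^T
  = pv e x zeta.
Proof.
move=> fs tz; apply/rowP => i.
have := sgE fs (push_tangent smf s tz) (push_tangent smf s (te i)).
rewrite sigma_const // => /(congr1 (fun A : 'M[R]_1 => A 0 0)).
have -> : pv e x zeta 0 i = sigma x zeta (e i x) by rewrite mxE.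
rewrite -row_Ym -row_QYm mxE eqxx mulr1n => ->.
move: (qv _ _ _ *m _) (pv _ _ _ *m _) => a b.
have E (r : 'rV[R]_n) (A : 'M[R]_n) : (r *m (row i A)^T) 0 0 = (r *m A^T) 0 i.
  by rewrite !mxE; apply: eq_bigr => k _; rewrite !mxE.
have S (A B : 'M[R]_1) : (A - B) 0 0 = A 0 0 - B 0 0 by rewrite !mxE.
by rewrite S !E !mxE.
Qed.

(** [sg_row] for the vectors of the frame: the transported [Delta x] remains Lagrangian. *)
Lemma sg_lagr s : frame (phi s x) e -> QYm s *m g s *m (Ym s)^T = Ym s *m g s *m (QYm s)^T.
Proof.
move=> fs; apply/row_matrixP => i; apply/eqP; rewrite -subr_eq0; apply/eqP.
rewrite !row_mul row_Ym row_QYm sg_row //; exact: (pv_e fe).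
Qed.

Section Projector.
Variable s : R.
Hypothesis fs : frame (phi s x) e.

(** The rows [p] at time [tau] of the basis of the Jacobi curve at [s]; its invertibility expresses
    the transversality of the curve at [tau] and at [s]. *)
Definition Nm tau : 'M[R]_n := \matrix_(j, i) pv e (phi tau x) (push (phi tau) (Em j s)) 0 i.

Lemma Em_tangent j : tangent x (Em j s).
Proof. by have := push_tangent smf (- s) (frame_tangent j (phi s x) fe); rewrite (phiNK smf). Qed.

Lemma Nm0 : Nm 0 = - (Ym s)^T.
Proof.
apply/matrixP => j i; rewrite !mxE (phi0 smf) (push0 smf).
rewrite -(sigma_const s (Em_tangent j) (te i)) /Em (pushKN smf).
by rewrite sg_anti //; [exact: frame_tangent fe|exact: (push_tangent smf s (te i))].
Qed.

Lemma jacobiP tau z : frame (phi tau x) e ->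
  jacobi_curve Delta phi x tau z <-> tangent x z /\ pv e (phi tau x) (push (phi tau) z) = 0.
Proof.
move=> ft; split=> [[w Dw <-]|[tz Hz]].
  have tw := Delta_tangent Dw.
  split; first by have := push_tangent smf (- tau) tw; rewrite (phiNK smf).
  by rewrite (pushKN smf); apply/(Delta_pv ft tw).
exists (push (phi tau) z); last by rewrite (pushNK smf).
by apply/(Delta_pv ft (push_tangent smf tau tz)).
Qed.

Lemma jacobi_comb z : jacobi_curve Delta phi x s z <-> exists c : 'rV[R]_n, z = \sum_j c 0 j *: Em j s.
Proof.
split=> [[w /(DeltaE _ fs)[c ->] <-]|[c ->]].
  by exists c; rewrite /comb push_lcomb.
exists (comb e (phi s x) c); first by apply/(DeltaE _ fs); exists c.
by rewrite /comb push_lcomb.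
Qed.

Lemma pv_Ecomb tau (c : 'rV[R]_n) : frame (phi tau x) e ->
  pv e (phi tau x) (push (phi tau) (\sum_j c 0 j *: Em j s)) = c *m Nm tau.
Proof.
move=> ft; apply/rowP => i; rewrite push_lcomb !mxE sg_suml; last exact: frame_tangent fe.
  by apply: eq_bigr => j _; rewrite !mxE.
by move=> j; apply: (push_tangent smf); exact: Em_tangent.
Qed.

Lemma pv_sub y u v : frame y e -> tangent y u -> tangent y v -> pv e y (u - v) = pv e y u - pv e y v.
Proof. by move=> fy tu tv; rewrite addrC -scaleN1r (pv_lin fy) // scaleN1r addrC. Qed.

(** [xi - eta] lies on the Jacobi curve at [tau] exactly when its [p] vanishes at that time; for
    [eta] on the curve at [s] this is a linear system with matrix [Nm tau]. *)
Lemma projectorE tau xi f : frame (phi tau x) e -> Nm tau \in unitmx -> tangent x xi ->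
  projector (jacobi_curve Delta phi x tau) (jacobi_curve Delta phi x s) xi f
  = (pv e (phi tau x) (push (phi tau) xi) *m invmx (Nm tau) *m \col_j Em j s f) 0 0.
Proof.
move=> ft uN txi; rewrite /projector; set P := [set eta | _].
have tE (c : 'rV[R]_n) : tangent x (\sum_j c 0 j *: Em j s) by apply: tangent_lcomb => j; exact: Em_tangent.
have Pc (c : 'rV[R]_n) : P (\sum_j c 0 j *: Em j s) <-> c *m Nm tau = pv e (phi tau x) (push (phi tau) xi).
  have E : push (phi tau) (xi - \sum_j c 0 j *: Em j s) = push (phi tau) xi - push (phi tau) (\sum_j c 0 j *: Em j s) by [].
  split=> [[_ /(jacobiP _ ft)[_]]|H].
    rewrite E pv_sub ?pv_Ecomb //; try by apply: (push_tangent smf).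
    by move=> /eqP; rewrite subr_eq0 => /eqP.
  split; first by apply/jacobi_comb; exists c.
  apply/(jacobiP _ ft); split; first exact: tangentB.
  by rewrite E pv_sub ?pv_Ecomb ?H ?subrr //; apply: (push_tangent smf).
have Pex : exists eta, P eta.
  exists (\sum_j (pv e (phi tau x) (push (phi tau) xi) *m invmx (Nm tau)) 0 j *: Em j s).
  by apply/Pc; rewrite mulmxKV.
have Px := xgetPex 0 Pex; have [/jacobi_comb[c Ec] _] := Px.
rewrite Ec in Px *; move/Pc: Px => <-.
by rewrite mulmxK // tvec_combE mxE; apply: eq_bigr => j _; rewrite mxE.
Qed.

Lemma mder_Nm : mder Nm 0 (\matrix_(j, i) dpv e x (Em j s) 0 i).
Proof.
apply: mder_rows => j.
have ve i := frame_field i fe.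
have := mder_pv 0 ve (Em_tangent j).
have -> : (fun tau => row j (Nm tau)) = (fun tau => pv e (phi tau x) (push (phi tau) (Em j s))).
  by apply/funext => tau; apply/rowP => i; rewrite !mxE.
by rewrite (phi0 smf) (push0 smf) => D; apply: (mder_eq D); apply/rowP => i; rewrite !mxE.
Qed.

(** At [tau = 0] the row [p] of [comb e x a] vanishes, so only its derivative [- a G] survives and
    the derivative of the inverse matrix drops out. The function [f] enters through [zeta]. *)
Lemma inner_derivative (a : 'rV[R]_n) f zeta : Ym s \in unitmx -> tangent x zeta ->
  (forall xi, tangent x xi -> xi f = sigma x xi zeta) ->
  derive1 (fun tau => projector (jacobi_curve Delta phi x tau) (jacobi_curve Delta phi x s) (comb e x a) f) 0
  = - (pv e (phi s x) (push (phi s) zeta) *m invmx (Ym s) *m G0 *m a^T) 0 0.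
Proof.
move=> uY tz Hz.
have txi := comb_tangent a fe; set xi := comb e x a in txi *.
have uN0 : Nm 0 \in unitmx by rewrite Nm0 -scaleN1r unitmxZ ?unitmx_tr // unitrN1.
have ve i := frame_field i fe.
have D1 := mder_pv 0 ve txi.
have D2 := mder_inv uN0 mder_Nm.
have D := mder_mul (mder_mul D1 D2) (mder_cst (\col_j Em j s f) 0).
have n2 := cvg_unit (nbhs_filter (0 : R)) uN0 (mder_cont mder_Nm : mcvg _ _ _).
have nE : \forall tau \near (0 : R),
   (pv e (phi tau x) (push (phi tau) xi) *m invmx (Nm tau) *m \col_j Em j s f) 0 0
   = projector (jacobi_curve Delta phi x tau) (jacobi_curve Delta phi x s) xi f.
  by apply: filterS2 frames_near0 n2 => tau ft uN; rewrite projectorE.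
rewrite derive1E; have D' := near_eq_is_derive nE (D 0 0).
rewrite (@derive_val _ _ _ _ _ _ _ D') {D D' D1 D2 nE n2}.
rewrite (phi0 smf) (push0 smf) (pv_comb _ fe) (dpv_comb _ fe) mul0mx addr0 mulmx0 addr0 Nm0.
have -> : \col_j Em j s f = - (pv e (phi s x) (push (phi s) zeta))^T.
  apply/matrixP => j k; rewrite !mxE (Hz _ (Em_tangent j)).
  rewrite -(sigma_const s (Em_tangent j) tz) /Em (pushKN smf).
  by rewrite sg_anti //; [exact: frame_tangent fe|exact: (push_tangent smf s tz)].
have -> : invmx (- (Ym s)^T) = - (invmx (Ym s))^T.
  by rewrite -scaleN1r invmxZ ?unitmx_tr // ?unitmxZ ?unitrN1 ?unitmx_tr // invrN1 scaleN1r trmx_inv.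
rewrite !(mulmxN, mulNmx) opprK.
have := Gm_tr fe; move: (pv _ _ _) (Gm e x) (invmx _) => p G Y GT.
have -> : a *m G *m Y^T *m p^T = (p *m Y *m G *m a^T)^T.
  by rewrite !trmx_mul trmxK GT !mulmxA.
by rewrite !mxE.
Qed.

End Projector.

(** The derivative is [(q - p Y^-1 Q) Y^-1]; the conservation laws [sg_row] and [sg_lagr] give
    [(q - p Y^-1 Q) g Y^T = pv e x zeta], which eliminates [q] and [Q]. *)
Lemma mder_PY t zeta : frame (phi t x) e -> tangent x zeta -> Ym t \in unitmx ->
  mder (fun s => pv e (phi s x) (push (phi s) zeta) *m invmx (Ym s)) t
    (pv e x zeta *m (invmx (Ym t))^T *m Gm e (phi t x) *m invmx (Ym t)).
Proof.
move=> ft tz uY.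
have D := mder_mul (cder_pv ft tz) (mder_inv uY (cder_Ym ft)).
apply: (mder_eq D) => {D}.
have H1 := sg_row ft tz; have H2 := sg_lagr ft.
have gG := GiG ft; have gT := Gi_tr ft.
move: (qv _ _ _) (pv e (phi t x) _) (pv e x zeta) (Bm _ _) (Gm _ _) (Gi _ _) (Ym t) (QYm t) uY H1 H2 gG gT.
move=> q p w B G gg Y Q uY H1 H2 gG gT.
have uG : G \in unitmx by move/mulmx1C: gG => /mulmx1_unit [].
have key : (q - p *m invmx Y *m Q) *m gg *m Y^T = w.
  rewrite -H1 !mulmxBl; congr (_ - _).
  by rewrite -!mulmxA (mulmxA Q) H2 !mulmxA mulmxKV // -!mulmxA.
have key2 : q - p *m invmx Y *m Q = w *m (invmx Y)^T *m G.
  rewrite -key trmx_inv mulmxK ?unitmx_tr // -[_ *m gg *m G]mulmxA gG mulmx1 //.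
have E : invmx Y *m (Q + 2^-1 *: (Y *m B)) = invmx Y *m Q + 2^-1 *: B.
  by rewrite mulmxDr -scalemxAr mulmxA mulVmx // mul1mx.
rewrite -key2 E mulmxBl mulmxN !mulmxDl mulmxDr -!scalemxAl -!scalemxAr !mulmxA.
by rewrite opprD addrACA subrr addr0.
Qed.

Local Notation Y := Ym.
Local Notation Q := QYm.
Local Notation g0 := (Gi e x).
(* By [mixed_derivativeE] the mixed derivative of the projector is expressed by
   the inverse of Zm.  Integrating the equations DY = Q, DQ = - Y R gives
   Zm(t) = t^2 G - t^4/3 G S G + O(t^5), so that the curvature operator is R. *)
Definition Sm t := Rm e (phi t x) *m Gi e (phi t x).
Definition S0 := Rm e x *m Gi e x.
Definition Zm t := Y t *m g t *m (Y t)^T.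
Definition Um t := Q t *m g t *m (Y t)^T.
Definition Vm t := Q t *m g t *m (Q t)^T.
Definition H0 := G0 *m S0 *m G0.

Let fr0 := frames_near0.

Lemma frame0 : frame (phi 0 x) e. Proof. by rewrite (phi0 smf). Qed.

Lemma O_Y0 : mO 0 Y. Proof. exact: (mO_mder (cder_Ym frame0)). Qed.
Lemma O_Q0 : mO 0 Q. Proof. exact: (mO_mder (cder_QYm frame0)). Qed.
Lemma O_flow p q (A : M -> 'M[R]_(p, q)) : smooth_mx x A -> mO 0 (fun t => A (phi t x)).
Proof. by move=> sA; have := @mder_flow _ _ A x 0; rewrite (phi0 smf) => /(_ sA) /mO_mder. Qed.
Lemma O_B : mO 0 (fun t => Bm e (phi t x)). Proof. exact/O_flow/Bm_smooth. Qed.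
Lemma O_R : mO 0 (fun t => Rm e (phi t x)). Proof. exact/O_flow/Rm_smooth. Qed.
Lemma O_S : mO 0 Sm. Proof. exact: (mO_mul O_R (O_flow (Gi_smooth fe))). Qed.

Lemma S_smooth y : frame y e -> smooth_mx y (fun z => Rm e z *m Gi e z).
Proof. by move=> fy; apply: smooth_mx_mul; [exact: (Rm_smooth fy)|exact: (Gi_smooth fy)]. Qed.

Lemma O_SS : mO 1 (fun t => Sm t - S0).
Proof.
apply: (@mO_int _ _ _ _ _ (fun t => fdm (fun z => Rm e z *m Gi e z) (phi t x))).
- apply: filterS fr0 => t ft; apply: (mder_eq (mder_add (mder_flow (S_smooth ft)) (mder_cst (- S0) t))).
  by rewrite addr0.
- by rewrite /Sm (phi0 smf) subrr.
- exact/O_flow/fdm_smooth/S_smooth.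
Qed.

Lemma O_Y1 : mO 1 Y.
Proof.
apply: (@mO_int _ _ _ _ _ (fun t => Q t + 2^-1 *: (Y t *m Bm e (phi t x)))).
- by apply: filterS fr0 => t ft; exact: (cder_Ym ft).
- exact: Ym0.
- by apply: mO_add O_Q0 _; apply: mO_scale; exact: (mO_mul O_Y0 O_B).
Qed.

Lemma O_Q1 : mO 1 (fun t => Q t + G0).
Proof.
apply: (@mO_int _ _ _ _ _ (fun t => - (Y t *m Rm e (phi t x)) + 2^-1 *: (Q t *m Bm e (phi t x)))).
- apply: filterS fr0 => t ft; apply: (mder_eq (mder_add (cder_QYm ft) (mder_cst G0 t))).
  by rewrite addr0.
- by rewrite QYm0 addNr.
- apply: mO_add; last by apply: mO_scale; exact: (mO_mul O_Q0 O_B).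
  by apply: mO_opp; exact: (mO_mul O_Y0 O_R).
Qed.

Lemma O_Y2 : mO 2 (fun t => Y t + t *: G0).
Proof.
apply: (@mO_int _ _ _ _ _ (fun t => (Q t + G0) + 2^-1 *: (Y t *m Bm e (phi t x)))).
- apply: filterS fr0 => t ft.
  have D : mder (fun s => s *: G0) t G0.
    by apply: (mder_eq (mder_scale (is_derive_id t (1 : R)) (mder_cst G0 t))); rewrite scaler0 addr0 scale1r.
  by apply: (mder_eq (mder_add (cder_Ym ft) D)); rewrite addrAC.
- by rewrite Ym0 scale0r addr0.
- by apply: mO_add O_Q1 _; apply: mO_scale; exact: (mO_mul O_Y1 O_B).
Qed.

Lemma S_sym t : frame (phi t x) e -> (Sm t)^T = Sm t.
Proof. exact: Sm_sym. Qed.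

Lemma YSQ : mO 2 (fun t => Y t *m Sm t *m (Q t)^T - t *: H0).
Proof.
have T1 : mO 2 (fun t => (Y t + t *: G0) *m Sm t *m (Q t)^T).
  exact: (mO_mul (mO_mul O_Y2 O_S) (mO_tr O_Q0)).
have T2 : mO 2 (fun t => t *: (G0 *m (Sm t - S0) *m (Q t)^T)).
  by apply: mO_t; exact: (mO_mul (mO_mul (mO_cst G0) O_SS) (mO_tr O_Q0)).
have T3 : mO 2 (fun t => t *: (G0 *m S0 *m (Q t + G0)^T)).
  by apply: mO_t; exact: (mO_mul (mO_cst (G0 *m S0)) (mO_tr O_Q1)).
apply: mO_ext (mO_sub T1 (mO_add T2 T3)) => t.
rewrite /H0; have GT := Gm_tr fe.
have -> : (Q t + G0)^T = (Q t)^T + G0 by rewrite -[in RHS]GT; apply/matrixP => i j; rewrite !mxE.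
move: (Sm t) S0 (Y t) (Q t)^T G0 {GT} => S S' Y' Q' G.
rewrite !(mulmxDl, mulmxDr, mulmxN, mulNmx, mulmxA, =^~ scalemxAl).
move: (Y' *m S *m Q') (G *m S *m Q') (G *m S' *m Q') (G *m S' *m G) => A1 A2 A3 A4.
by apply/matrixP => i j; rewrite !mxE; ring.
Qed.

Lemma YSY : mO 3 (fun t => Y t *m Sm t *m (Y t)^T - t ^+ 2 *: H0).
Proof.
have T1 : mO 3 (fun t => Y t *m Sm t *m (Y t + t *: G0)^T).
  exact: (mO_mul (mO_mul O_Y1 O_S) (mO_tr O_Y2)).
have T2 : mO 3 (fun t => t *: ((Y t + t *: G0) *m Sm t *m G0)).
  by apply: mO_t; exact: (mO_mul (mO_mul O_Y2 O_S) (mO_cst G0)).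
have T3 : mO 3 (fun t => t *: (t *: (G0 *m (Sm t - S0) *m G0))).
  by do 2! apply: mO_t; exact: (mO_mul (mO_mul (mO_cst G0) O_SS) (mO_cst G0)).
apply: mO_ext (mO_add (mO_sub T1 T2) T3) => t.
rewrite /H0; have GT := Gm_tr fe.
have -> : (Y t + t *: G0)^T = (Y t)^T + t *: G0 by rewrite -[in RHS]GT; apply/matrixP => i j; rewrite !mxE.
move: (Sm t) S0 (Y t)^T (Y t) G0 {GT} => S S' YT Y' G.
rewrite !(mulmxDl, mulmxDr, mulmxN, mulNmx, mulmxA, =^~ scalemxAl, =^~ scalemxAr).
move: (Y' *m S *m YT) (Y' *m S *m G) (G *m S *m G) (G *m S' *m G) => A1 A2 A3 A4.
by apply/matrixP => i j; rewrite !mxE; ring.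
Qed.

Lemma gRT t : frame (phi t x) e -> g t *m (Rm e (phi t x))^T = Sm t.
Proof. by move=> ft; rewrite -(S_sym ft) /Sm trmx_mul (Gi_tr ft). Qed.

(** Here [V' = - Y S Q^T - (Y S Q^T)^T], then [U' = V - Y S Y^T] and [Z' = U + U^T]: three
    successive integrations, each raising the order of the remainder by one. *)
Lemma V_exp : mO 3 (fun t => Vm t - G0 + t ^+ 2 *: H0).
Proof.
apply: (@mO_int _ _ _ _ _ (fun t => - (Y t *m Sm t *m (Q t)^T) - (Y t *m Sm t *m (Q t)^T)^T + 2 * t *: H0)).
- apply: filterS fr0 => t ft.
  have D := cov_leibniz ft (cder_QYm ft) (cder_QYm ft).
  have Dp := mder_pow 1 H0 1 t.
  have := mder_add (mder_add D (mder_cst (- G0) t)) Dp.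
  have -> : (fun s => Q s *m g s *m (Q s)^T - G0 + (1 * s ^+ 2) *: H0) = (fun s => Vm s - G0 + s ^+ 2 *: H0).
    by apply/funext => s; rewrite mul1r.
  move=> D'; apply: (mder_eq D') => {D D' Dp}.
  rewrite addr0 mul1r expr1; congr (_ + _).
  rewrite !mulNmx -[_ *m Rm _ _ *m _]mulmxA -/(Sm t); congr (_ + _).
  have -> : (- (Y t *m Rm e (phi t x)))^T = - ((Rm e (phi t x))^T *m (Y t)^T) by rewrite -trmx_mul; apply/matrixP => i j; rewrite !mxE.
  by rewrite mulmxN tr_mul3 trmxK (S_sym ft) -(gRT ft) !mulmxA.
- rewrite /Vm (phi0 smf) QYm0 expr0n /= scale0r addr0.
  have -> : (- G0)^T = - G0 by rewrite -[in RHS](Gm_tr fe); apply/matrixP => i j; rewrite !mxE.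
  by rewrite mulmxN !mulNmx opprK (GGi fe) mul1mx subrr.
- apply: mO_ext (mO_opp (mO_add YSQ (mO_tr YSQ))) => t.
  have HT : H0^T = H0 by rewrite /H0 tr_mul3 (Gm_tr fe) (Sm_sym fe).
  have -> : (Y t *m Sm t *m (Q t)^T - t *: H0)^T = (Y t *m Sm t *m (Q t)^T)^T - t *: H0.
    by rewrite -[in RHS]HT; apply/matrixP => i j; rewrite !mxE.
  move: (_ *m (Q t)^T) => A; apply/matrixP => i j; rewrite !mxE; ring.
Qed.

Lemma U_exp : mO 4 (fun t => Um t - t *: G0 + (2 / 3 * t ^+ 3) *: H0).
Proof.
apply: (@mO_int _ _ _ _ _ (fun t => Vm t - Y t *m Sm t *m (Y t)^T - G0 + (2 * t ^+ 2) *: H0)).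
- apply: filterS fr0 => t ft.
  have D := cov_leibniz ft (cder_QYm ft) (cder_Ym ft).
  have Dp := mder_pow 2 H0 (2 / 3) t.
  have D1 : mder (fun s => s *: G0) t G0.
    by apply: (mder_eq (mder_scale (is_derive_id t (1 : R)) (mder_cst G0 t))); rewrite scaler0 addr0 scale1r.
  apply: (mder_eq (mder_add (mder_add D (mder_opp D1)) Dp)).
  have -> : 2 / 3 * (3%:R * t ^+ 2) = 2 * t ^+ 2 :> R by field.
  congr (_ + _); congr (_ - _).
  by rewrite !mulNmx -[_ *m Rm _ _ *m _]mulmxA -/(Sm t) addrC.
- by rewrite /Um Ym0 trmx0 mulmx0 scale0r expr0n /= mulr0 scale0r subr0 addr0.
- apply: mO_ext (mO_sub V_exp YSY) => t.
  by move: (Y t *m _ *m _) => A; apply/matrixP => i j; rewrite !mxE; ring.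
Qed.

Lemma Z_exp : mO 5 (fun t => Zm t - t ^+ 2 *: G0 + (3^-1 * t ^+ 4) *: H0).
Proof.
apply: (@mO_int _ _ _ _ _ (fun t => Um t + (Um t)^T - (2 * t) *: G0 + (4 / 3 * t ^+ 3) *: H0)).
- apply: filterS fr0 => t ft.
  have D := cov_leibniz ft (cder_Ym ft) (cder_Ym ft).
  have Dp := mder_pow 3 H0 3^-1 t.
  have D1 : mder (fun s => s ^+ 2 *: G0) t ((2 * t) *: G0).
    have := mder_pow 1 G0 1 t; rewrite mul1r expr1.
    by have -> : (fun s => (1 * s ^+ 2) *: G0) = (fun s => s ^+ 2 *: G0) by apply/funext => s; rewrite mul1r.
  apply: (mder_eq (mder_add (mder_add D (mder_opp D1)) Dp)).
  have -> : 3^-1 * (4%:R * t ^+ 3) = 4 / 3 * t ^+ 3 :> R by field.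
  congr (_ + _); congr (_ - _); congr (_ + _).
  by rewrite /Um !trmx_mul trmxK (Gi_tr ft) mulmxA.
- by rewrite /Zm Ym0 !mul0mx !expr0n /= mulr0 !scale0r subr0 addr0.
- apply: mO_ext (mO_add U_exp (mO_tr U_exp)) => t.
  have HT : H0^T = H0 by rewrite /H0 tr_mul3 (Gm_tr fe) (Sm_sym fe).
  have -> : (Um t - t *: G0 + (2 / 3 * t ^+ 3) *: H0)^T = (Um t)^T - t *: G0 + (2 / 3 * t ^+ 3) *: H0.
    by rewrite -[in RHS]HT -[in RHS](Gm_tr fe); apply/matrixP => i j; rewrite !mxE.
  by apply/matrixP => i j; rewrite !mxE; field.
Qed.

(* t^-2 Zm(t), extended to t = 0 by its limit. *)
Definition Wm t : 'M[R]_n := t ^- 2 *: Zm t + (t == 0)%:R *: G0.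
Definition Em3 t : 'M[R]_n := invmx (Wm t) - g0 - (3^-1 * t ^+ 2) *: S0.

Lemma W_exp : mO 3 (fun t => Wm t - G0 + (3^-1 * t ^+ 2) *: H0).
Proof.
apply: mO_ext (mO_div2 Z_exp) => t; rewrite /Wm.
have [->|t0] := eqVneq t 0.
  by rewrite expr2 mulr0 invr0 !scale0r scale1r add0r mulr0 scale0r subrr addr0.
rewrite scale0r addr0; move: (Zm t) G0 H0 => A B C.
by apply/matrixP => i j; rewrite !mxE; field.
Qed.

Lemma W_cvg : mcvg (nbhs (0 : R)) Wm G0.
Proof.
have E : mO 2 (fun t => Wm t - G0).
  have := mO_sub (@mO_le _ 3 2 _ _ _ isT W_exp) (mO_pow 2 H0 3^-1).
  by apply: mO_ext => t; rewrite addrK.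
exact: (mO_cvg E).
Qed.

Lemma W_unit : \forall t \near (0 : R), Wm t \in unitmx.
Proof. exact: (cvg_unit (nbhs_filter (0 : R)) (Gm_unit fe) W_cvg). Qed.

(** [g + t^2 S / 3] is an approximate inverse of [G - t^2 H / 3]: as [H g = G S], the terms of order
    [t^2] cancel and the product is [1 - t^4 H S / 9]. *)
Lemma Em3_O : mO 3 Em3.
Proof.
have Wi := mO_cont (mcvg_inv (nbhs_filter (0 : R)) (Gm_unit fe) W_cvg).
have X : mO 0 (fun t => g0 + (3^-1 * t ^+ 2) *: S0).
  apply: mO_add (mO_cst g0) _; exact: (@mO_le _ 2 0 _ _ _ isT (mO_pow 2 S0 3^-1)).
have T1 := mO_mul W_exp X.
have T2 : mO 3 (fun t => (- 9^-1 * t ^+ 4) *: (H0 *m S0)).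
  exact: (@mO_le _ 4 3 _ _ _ isT (mO_pow 4 (H0 *m S0) (- 9^-1))).
apply: mO_near (mO_opp (mO_mul Wi (mO_add T1 T2))).
apply: filterS W_unit => t uW.
have E1 : H0 *m g0 = G0 *m S0.
  by rewrite /H0 -!mulmxA (GGi fe) mulmx1.
have -> : (Wm t - G0 + (3^-1 * t ^+ 2) *: H0) *m (g0 + (3^-1 * t ^+ 2) *: S0) + (- 9^-1 * t ^+ 4) *: (H0 *m S0)
  = Wm t *m (g0 + (3^-1 * t ^+ 2) *: S0) - 1%:M.
  rewrite -(GGi fe).
  have -> : (Wm t - G0 + (3^-1 * t ^+ 2) *: H0) *m (g0 + (3^-1 * t ^+ 2) *: S0)
     = Wm t *m (g0 + (3^-1 * t ^+ 2) *: S0) - G0 *m g0 - (3^-1 * t ^+ 2) *: (G0 *m S0) +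
       (3^-1 * t ^+ 2) *: (H0 *m g0) + (9^-1 * t ^+ 4) *: (H0 *m S0).
    move: (Wm t) => W; rewrite !(mulmxDl, mulmxDr, mulNmx, =^~ scalemxAl, =^~ scalemxAr).
    move: (_ *m _) (_ *m _) (_ *m _) (_ *m _) (_ *m _) (_ *m _) => A1 A2 A3 A4 A5 A6.
    by apply/matrixP => i j; rewrite !mxE; field.
  rewrite E1; move: (Wm t *m _) (G0 *m g0) (G0 *m S0) (H0 *m S0) => A1 A2 A3 A4.
  by apply/matrixP => i j; rewrite !mxE; ring.
rewrite mulmxDr mulKmx // mulmxN mulmx1 /Em3.
by move: (invmx _) => A; apply/matrixP => i j; rewrite !mxE; ring.
Qed.

Lemma Zm_W t : t != 0 -> Zm t = t ^+ 2 *: Wm t.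
Proof. by move=> t0; rewrite /Wm (negPf t0) scale0r addr0 scalerA divff ?scale1r // expf_neq0. Qed.

Definition good t := [/\ frame (phi t x) e, Wm t \in unitmx & t != 0].

Lemma good_Y t : good t -> Y t \in unitmx.
Proof.
move=> [ft uW t0]; have := Zm_W t0; rewrite /Zm => E.
have : Y t *m g t *m (Y t)^T \in unitmx by rewrite E unitmxZ // unitfE expf_neq0.
by rewrite !unitmx_mul => /andP[/andP[]].
Qed.

Lemma good_inv t : good t -> invmx (Zm t) = t ^- 2 *: invmx (Wm t).
Proof.
move=> [ft uW t0]; apply: invmx_unique.
by rewrite Zm_W // -scalemxAl -scalemxAr scalerA mulVf ?expf_neq0 // scale1r mulVmx.
Qed.

Lemma good_inv2 t : good t -> invmx (Zm t) = (invmx (Y t))^T *m Gm e (phi t x) *m invmx (Y t).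
Proof.
move=> gt; have [ft uW t0] := gt; have uY := good_Y gt; apply: invmx_unique.
rewrite /Zm !mulmxA mulmxKV // -[_ *m Gm _ _ *m _]mulmxA (GGi ft) mulmx1.
by rewrite trmx_inv mulVmx // unitmx_tr.
Qed.

(** The outer derivative at [t] requires the formula for the inner one at all [s] near [t], hence
    the nested neighbourhoods; 0 is excluded because [Ym] vanishes there. *)
Lemma near_good : \forall t \near (0 : R)^', \forall s \near t, good s.
Proof.
have n1 : \forall t \near (0 : R), \forall s \near t, frame (phi s x) e /\ Wm s \in unitmx.
  apply: near_join; exact: (filterI fr0 W_unit).
have n2 : \forall t \near (0 : R)^', \forall s \near t, frame (phi s x) e /\ Wm s \in unitmx.
  exact: nbhs_dnbhs.
have n3 : \forall t \near (0 : R)^', t != 0 by exact: nbhs_dnbhs_neq.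
apply: filterS2 n2 n3 => t H t0.
have n4 : \forall s \near t, s != 0 by exact: (cvgr_neq0 t (@cvg_id _ _) t0).
by apply: filterS2 H n4 => s [].
Qed.

Variables (f : M -> R) (zeta : tvec M).
Hypothesis tz : tangent x zeta.
Hypothesis fz : forall xi, tangent x xi -> xi f = sigma x xi zeta.

Lemma comb_val a : comb e x a f = - (pv e x zeta *m a^T) 0 0.
Proof.
have tc := comb_tangent a fe.
by rewrite fz // sg_anti // sg_comb_r.
Qed.

Lemma mixed_derivativeE a t : (\forall s \near t, good s) ->
  mixed_derivative Delta phi x (comb e x a) f t = - (pv e x zeta *m invmx (Zm t) *m G0 *m a^T) 0 0.
Proof.
move=> ng; have gt := nbhs_singleton ng; have [ft _ _] := gt.
have D := mder_mul (mder_PY ft tz (good_Y gt)) (mder_cst (G0 *m a^T) t).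
have nE : \forall s \near t, - ((pv e (phi s x) (push (phi s) zeta) *m invmx (Y s)) *m (G0 *m a^T)) 0 0 =
   derive1 (fun tau => projector (jacobi_curve Delta phi x tau) (jacobi_curve Delta phi x s) (comb e x a) f) 0.
  apply: filterS ng => s gs; have [fs _ _] := gs.
  by rewrite (inner_derivative fs a (good_Y gs) tz fz) !mulmxA.
have D1 := near_eq_is_derive nE (is_deriveN (D 0 0)).
rewrite /mixed_derivative derive1E (@derive_val _ _ _ _ _ _ _ D1) mulmx0 addr0.
by rewrite good_inv2 // !mulmxA.
Qed.

(** [Z^-1 = t^-2 g + S / 3 + O(t)] and [S G = R]; the constant term shows [R] as the curvature
    operator, with the factor 1/3 of the normalization. *)
Lemma mixed_derivative_exp a : exists2 C, 0 < C & \forall t \near (0 : R)^',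
  `|mixed_derivative Delta phi x (comb e x a) f t
    - (t ^- 2 * comb e x a f + 3^-1 * comb e x (a *m (Rm e x)^T) f)| <= C * `|t|.
Proof.
have [C C0 H] := mO_mul (mO_mul (mO_cst (pv e x zeta)) (mO_div2 Em3_O)) (mO_cst (G0 *m a^T)).
exists (C + 1); first by rewrite ltr_wpDl.
have H' := nbhs_dnbhs H.
apply: filterS2 near_good H' => t ng /(_ 0 0).
rewrite expr1 => Ht; have gt := nbhs_singleton ng; have [ft _ t0] := gt.
rewrite mixed_derivativeE // !comb_val trmx_mul trmxK.
have E : pv e x zeta *m (t ^- 2 *: Em3 t) *m (G0 *m a^T) =
   pv e x zeta *m invmx (Zm t) *m G0 *m a^T - t ^- 2 *: (pv e x zeta *m a^T) - 3^-1 *: (pv e x zeta *m (Rm e x *m a^T)).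
  rewrite good_inv // /Em3 /S0.
  have Ec : t ^- 2 * (3^-1 * t ^+ 2) = 3^-1 :> R by field.
  rewrite !scalerBr scalerA Ec.
  have R1 : Rm e x *m a^T = (Rm e x *m g0) *m (G0 *m a^T) by rewrite -!mulmxA (mulmxA g0) (GiG fe) mul1mx.
  have R2 : a^T = g0 *m (G0 *m a^T) by rewrite mulmxA (GiG fe) mul1mx.
  rewrite R1 [X in _ - _ *: (_ *m X) - _]R2 -[_ *m G0 *m a^T]mulmxA.
  move: (G0 *m a^T) (Rm e x *m g0) g0 (invmx _) => A B D F.
  by rewrite !(mulmxDr, mulmxDl, mulmxN, mulNmx, =^~ scalemxAr, =^~ scalemxAl, mulmxA).
have N (A B D : 'M[R]_1) (u v : R) : - A 0 0 - (u * - B 0 0 + v * - D 0 0) = - (A - u *: B - v *: D) 0 0.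
  by rewrite !mxE; ring.
rewrite N -E normrN; apply: le_trans Ht _.
by rewrite ler_wpM2r // lerDl.
Qed.

End JacobiCurve.

Lemma gform_comb_sym x e a b : frame x e -> gform x (comb e x (a *m (Rm e x)^T)) (comb e x b) =
  gform x (comb e x a) (comb e x (b *m (Rm e x)^T)).
Proof.
move=> fe; rewrite !gformE //.
have E : (Rm e x)^T *m Gm e x = Gm e x *m Rm e x.
  have S := Sm_sym fe; have S1 : Gi e x *m (Rm e x)^T = Rm e x *m Gi e x.
    by rewrite -S trmx_mul (Gi_tr fe).
  rewrite -[(Rm e x)^T]mul1mx -(GGi fe) -(mulmxA (Gm e x)) S1 -!mulmxA (GiG fe) mulmx1 //.
by rewrite trmx_mul trmxK -!(mulmxA a) !mulmxA -(mulmxA a) E !mulmxA.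
Qed.

Lemma curvature_operator_ex x e : frame x e -> exists2 A, is_curvature_operator sigma Delta h phi x A &
  forall a, A (comb e x a) = comb e x (a *m (Rm e x)^T).
Proof.
move=> fe; pose A xi := xget 0 [set z | exists a, xi = comb e x a /\ z = comb e x (a *m (Rm e x)^T)].
have AE a : A (comb e x a) = comb e x (a *m (Rm e x)^T).
  rewrite /A; set P := [set z | _].
  have Pex : exists z, P z by exists (comb e x (a *m (Rm e x)^T)), a.
  by have [b [/(comb_inj fe) <- ->]] := xgetPex 0 Pex.
exists A => //; split.
- by move=> xi /(DeltaE _ fe)[a ->]; rewrite AE; apply/(DeltaE _ fe); exists (a *m (Rm e x)^T).
- move=> c xi eta /(DeltaE _ fe)[a ->] /(DeltaE _ fe)[b ->].
  by rewrite -comb_lin !AE mulmxDl -scalemxAl comb_lin.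
- by move=> xi eta /(DeltaE _ fe)[a ->] /(DeltaE _ fe)[b ->]; rewrite !AE gform_comb_sym.
move=> xi f /(DeltaE _ fe)[a ->] sf; rewrite AE.
have [zeta tz fz] := dual_vector x f.
have [C C0 H] := mixed_derivative_exp fe tz fz a.
exact: (bigO_id C0 H).
Qed.

(** Two operators with the same expansion differ, on each vector and smooth function, by a number
    that is O(t), hence by 0. *)
Lemma curvature_operator_unique x e A : frame x e -> is_curvature_operator sigma Delta h phi x A ->
  forall a, A (comb e x a) = comb e x (a *m (Rm e x)^T).
Proof.
move=> fe [A1 A2 A3 A4] a.
have Da : Delta x (comb e x a) by apply/(DeltaE _ fe); exists a.
have DA := A1 _ Da; apply: (@tangent_ext _ _ _ x); [exact: (Delta_tangent DA)|exact: (comb_tangent _ fe)|].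
move=> f sf; have [zeta tz fz] := dual_vector x f.
have [C C0 H] := mixed_derivative_exp fe tz fz a.
have [D D0 K] := bigO_idP (A4 _ _ Da sf).
set u := A _ f; set v := comb _ _ _ f.
have n0 : \forall t \near (0 : R)^', `|3^-1 * (u - v)| <= (C + D) * `|t|.
  apply: filterS2 H K => t H K; rewrite mulrDl.
  apply: le_trans (lerD H K); rewrite -/u -/v.
  apply: le_trans (ler_normB _ _).
  by rewrite le_eqVlt; apply/orP; left; apply/eqP; congr `|_|; ring.
apply/eqP; rewrite -subr_eq0 -normr_le0 leNgt; apply/negP => uv0.
have [eps e0 euv] : exists2 eps, 0 < eps & eps < `|u - v| by exists (`|u - v| / 2); lra.
have n1 : \forall t \near (0 : R)^', `|t| <= (3 * (C + D))^-1 * eps.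
  have k0 : 0 < (3 * (C + D))^-1 * eps by rewrite mulr_gt0 // invr_gt0 mulr_gt0 // addr_gt0.
  exact: (nbhs_dnbhs (nbhs0_le k0)). 
have FF : ProperFilter ((0 : R)^') by exact: Proper_dnbhs_numFieldType.
have [t [/= t1 t2]] := filter_ex (filterI n0 n1).
have : `|u - v| <= 3 * ((C + D) * ((3 * (C + D))^-1 * eps)).
  move: t1; rewrite normrM gtr0_norm ?invr_gt0 // ler_pdivrMl // => /le_trans; apply.
  by rewrite ler_wpM2l // ler_wpM2l // ltW // addr_gt0.
have CD : C + D != 0 by rewrite gt_eqF // addr_gt0.
have -> : 3 * ((C + D) * ((3 * (C + D))^-1 * eps)) = eps by field.
by rewrite leNgt euv.
Qed.

Lemma curvature_formE x e a : frame x e ->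
  curvature_form sigma Delta h phi x (comb e x a) = (a *m Gm e x *m Rm e x *m a^T) 0 0.
Proof.
move=> fe; rewrite /curvature_form.
have [A HA _] := curvature_operator_ex fe.
have Pex : exists A, is_curvature_operator sigma Delta h phi x A by exists A.
have -> : curvature_operator sigma Delta h phi x (comb e x a) = comb e x (a *m (Rm e x)^T).
  exact: (curvature_operator_unique fe (xgetPex 0 Pex) a).
rewrite gform_comb_sym // gformE //.
by rewrite trmx_mul trmxK mulmxA.
Qed.

(** The factor 2 of [sg_LLvfield_comb], squared, cancels the 4 of the definition, and [g^h] of the
    vector [vfield] is [<p(hv), p(hv)>]. *)
Lemma reduced_curvature_formE x e a : frame x e ->
  let ph := pv e x (hv x) in let qh := qv e x (hv x) in
  reduced_curvature_form sigma Delta h phi x (comb e x a) =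
  (a *m Gm e x *m Rm e x *m a^T) 0 0 + 3 * (qh *m a^T) 0 0 ^+ 2 / (ph *m Gi e x *m ph^T) 0 0.
Proof.
move=> fe ph qh; rewrite /reduced_curvature_form curvature_formE // hvE sg_LLvfield_comb //.
rewrite (vfieldE fe) gformE // trmx_mul (Gi_tr fe).
rewrite -/ph -(mulmxA ph (Gi e x) (Gm e x)) (GiG fe) mulmx1 mulmxA.
congr (_ + _); move: ((qh *m _) 0 0) ((_ *m ph^T) 0 0) => u v.
(* If the denominator is 0, both quotients are 0 by the convention on inverses. *)
have [->|v0] := eqVneq v 0; first by rewrite mulr0 invr0 !mulr0.
by field.
Qed.

(** * Frame-independent quadratic forms *)

Lemma bilf_ext (A B : 'M[R]_n) x e : frame x e ->
  (forall xi eta, tangent x xi -> tangent x eta -> bilf A (pv e x xi) (pv e x eta) = bilf B (pv e x xi) (pv e x eta)) ->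
  A = B.
Proof.
move=> fe H; have tL i : tangent x (L (e i) x) by exact: (frameL_tangent i x fe).
have uG := Gm_unit fe.
have E : Gm e x *m A *m (Gm e x)^T = Gm e x *m B *m (Gm e x)^T.
  apply/matrixP => i j; have := H _ _ (tL i) (tL j).
  by rewrite /bilf !pv_Le // !row_form.
have := congr1 (fun A => invmx (Gm e x) *m A *m invmx (Gm e x)^T) E.
by rewrite !mulmxA mulVmx // !mul1mx -!mulmxA mulmxV ?unitmx_tr // !mulmx1.
Qed.

Lemma comb_delta x e i : comb e x (row i 1%:M) = e i x.
Proof.
rewrite /comb (bigD1 i) //= !mxE eqxx scale1r big1 ?addr0 // => j ji.
by rewrite !mxE eq_sym (negPf ji) scale0r.
Qed.

Lemma frame_matrix x e e' : frame x e -> frame x e' -> exists X : 'M[R]_n,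
  [/\ X \in unitmx, (forall eta, tangent x eta -> pv e' x eta = pv e x eta *m X^T),
      Gm e' x = X *m Gm e x *m X^T & Gi e' x = invmx X^T *m Gi e x *m invmx X].
Proof.
move=> fe fe'.
have H i : exists a, e' i x = comb e x a by apply/(DeltaE _ fe); exact: (Delta_frame i fe').
have [a aE] := boolp.choice H; pose X : 'M[R]_n := \matrix_i a i; exists X.
have rX i : row i X = a i by rewrite rowK.
have GE : Gm e' x = X *m Gm e x *m X^T.
  apply/matrixP => i j; rewrite -row_form !rX -gformE // -!aE -!(comb_delta x e').
  by rewrite gformE // row_form trmx1 mulmx1 mul1mx.
have uX : X \in unitmx.
  by have := Gm_unit fe'; rewrite GE !unitmx_mul => /andP[/andP[]].
split=> //.
  move=> eta te; apply/rowP => j; rewrite mxE aE sg_comb_r // -rX.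
  by rewrite !mxE; apply: eq_bigr => k _; rewrite !mxE.
rewrite /Gi GE; apply: invmx_unique.
rewrite !mulmxA mulmxKV // -[_ *m invmx (Gm e x) *m _]mulmxA mulVmx ?(Gm_unit fe) // mulmx1.
by rewrite mulVmx ?unitmx_tr.
Qed.

Lemma near_frames2 x e e' : frame x e -> frame x e' -> \forall s \near (0 : R), frame (phi s x) e /\ frame (phi s x) e'.
Proof. by move=> fe fe'; apply: filterI; [exact: (frames_near0 fe)|exact: (frames_near0 fe')]. Qed.

Lemma PP_indep x e e' xi eta : frame x e -> frame x e' -> tangent x xi -> tangent x eta ->
  bilf (Gi e x) (pv e x xi) (pv e x eta) = bilf (Gi e' x) (pv e' x xi) (pv e' x eta).
Proof. by move=> fe fe' tx te; have [X [uX pE _ ->]] := frame_matrix fe fe'; rewrite !pE // bilf_change. Qed.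

Lemma QP_sym x e xi eta : frame x e -> tangent x xi -> tangent x eta ->
  sigma x xi eta = bilf (Gi e x) (qv e x xi) (pv e x eta) - bilf (Gi e x) (pv e x xi) (qv e x eta).
Proof.
move=> fe tx te; have /(congr1 (fun A : 'M[R]_1 => A 0 0)) := sgE fe tx te.
by rewrite submx00 [LHS]mxE eqxx mulr1n => ->.
Qed.

(** The derivative of [<p1, p2>] along the flow is [<q1, p2> + <p1, q2>], and [sigma] is the
    difference of the same terms; both sum and difference are independent of the frame. *)
Lemma QP_indep x e e' xi eta : frame x e -> frame x e' -> tangent x xi -> tangent x eta ->
  bilf (Gi e x) (qv e x xi) (pv e x eta) = bilf (Gi e' x) (qv e' x xi) (pv e' x eta).
Proof.
move=> fe fe' tx te.
have f0 : frame (phi 0 x) e by rewrite (phi0 smf).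
have f0' : frame (phi 0 x) e' by rewrite (phi0 smf).
have D := cov_leibniz f0 (cder_pv f0 tx) (cder_pv f0 te).
have D' := cov_leibniz f0' (cder_pv f0' tx) (cder_pv f0' te).
have nE : \forall s \near (0 : R), bilf (Gi e (phi s x)) (pv e (phi s x) (push (phi s) xi)) (pv e (phi s x) (push (phi s) eta)) =
   bilf (Gi e' (phi s x)) (pv e' (phi s x) (push (phi s) xi)) (pv e' (phi s x) (push (phi s) eta)).
  apply: filterS (near_frames2 fe fe') => s [fs fs'].
  exact: (PP_indep fs fs' (push_tangent smf s tx) (push_tangent smf s te)).
have := deriv_bilf nE D D'; rewrite (phi0 smf) !(push0 smf).
have E1 := QP_sym fe tx te; have E2 := QP_sym fe' tx te.
have S (A B : 'M[R]_1) : (A + B) 0 0 = A 0 0 + B 0 0 by rewrite mxE.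
rewrite !S -!/(bilf _ _ _) => E3; lra.
Qed.

(** [QP_indep] against the vectors [L (e j)], whose rows [p] form an invertible matrix, shows that
    [q] changes by the same matrix as [p]. *)
Lemma frame_matrix_q x e e' : frame x e -> frame x e' -> exists X : 'M[R]_n,
  [/\ X \in unitmx, (forall eta, tangent x eta -> pv e' x eta = pv e x eta *m X^T),
      (forall eta, tangent x eta -> qv e' x eta = qv e x eta *m X^T) & Gi e' x = invmx X^T *m Gi e x *m invmx X].
Proof.
move=> fe fe'; have [X [uX pE GE giE]] := frame_matrix fe fe'; exists X; split=> // xi tx.
have uXT : X^T \in unitmx by rewrite unitmx_tr.
suff E : qv e' x xi *m invmx X^T = qv e x xi by rewrite -E mulmxKV.
have tL i : tangent x (L (e i) x) by exact: (frameL_tangent i x fe).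
have H : qv e' x xi *m invmx X^T *m Gi e x *m (Gm e x)^T = qv e x xi *m Gi e x *m (Gm e x)^T.
  apply/rowP => j; have := QP_indep fe fe' tx (tL j).
  rewrite giE pE // pv_Le // -[qv e' x xi](mulmxKV uXT) bilf_change // /bilf.
  have F (r : 'rV[R]_n) (A : 'M[R]_n) : (r *m (row j A)^T) 0 0 = (r *m A^T) 0 j.
    by rewrite !mxE; apply: eq_bigr => k _; rewrite !mxE.
  by rewrite !F => ->; rewrite mulmxK.
have := congr1 (fun A => A *m Gi e x *m Gm e x) H; rewrite (Gm_tr fe).
by rewrite -!mulmxA (mulmxA (Gm e x)) (GGi fe) !(mul1mx, mulmxA) -!mulmxA (GiG fe) !mulmx1.
Qed.

Lemma QQ_indep x e e' xi eta : frame x e -> frame x e' -> tangent x xi -> tangent x eta ->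
  bilf (Gi e x) (qv e x xi) (qv e x eta) = bilf (Gi e' x) (qv e' x xi) (qv e' x eta).
Proof. by move=> fe fe' tx te; have [X [uX pE qE ->]] := frame_matrix_q fe fe'; rewrite !qE // bilf_change. Qed.

Definition Sf e y : 'M[R]_n := Rm e y *m Gi e y.

Lemma QP_mder x e xi eta t : frame (phi t x) e -> tangent x xi -> tangent x eta ->
  mder (fun s => qv e (phi s x) (push (phi s) xi) *m Gi e (phi s x) *m (pv e (phi s x) (push (phi s) eta))^T) t
  (qv e (phi t x) (push (phi t) xi) *m Gi e (phi t x) *m (qv e (phi t x) (push (phi t) eta))^T
   - pv e (phi t x) (push (phi t) xi) *m Sf e (phi t x) *m (pv e (phi t x) (push (phi t) eta))^T).
Proof.
move=> fe tx te; apply: (mder_eq (cov_leibniz fe (cder_qv fe tx) (cder_pv fe te))).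
by rewrite addrC /Sf !mulNmx !mulmxA.
Qed.

(** The derivative of [<q, p>] along the flow is [<q, q>] minus this form, and the other two are
    already known to be independent of the frame. *)
Lemma SS_indep x e e' xi eta : frame x e -> frame x e' -> tangent x xi -> tangent x eta ->
  bilf (Sf e x) (pv e x xi) (pv e x eta) = bilf (Sf e' x) (pv e' x xi) (pv e' x eta).
Proof.
move=> fe fe' tx te.
have f0 : frame (phi 0 x) e by rewrite (phi0 smf).
have f0' : frame (phi 0 x) e' by rewrite (phi0 smf).
have nE : \forall s \near (0 : R), bilf (Gi e (phi s x)) (qv e (phi s x) (push (phi s) xi)) (pv e (phi s x) (push (phi s) eta)) =
   bilf (Gi e' (phi s x)) (qv e' (phi s x) (push (phi s) xi)) (pv e' (phi s x) (push (phi s) eta)).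
  apply: filterS (near_frames2 fe fe') => s [fs fs'].
  exact: (QP_indep fs fs' (push_tangent smf s tx) (push_tangent smf s te)).
have := deriv_bilf nE (QP_mder f0 tx te) (QP_mder f0' tx te).
rewrite (phi0 smf) !(push0 smf).
rewrite !submx00 -!/(bilf _ _ _) (QQ_indep fe fe' tx te) => E3; lra.
Qed.

Lemma Sf_change x e e' : frame x e -> frame x e' -> exists X : 'M[R]_n,
  [/\ X \in unitmx, (forall eta, tangent x eta -> pv e' x eta = pv e x eta *m X^T),
      (forall eta, tangent x eta -> qv e' x eta = qv e x eta *m X^T) & Sf e' x = invmx X^T *m Sf e x *m invmx X].
Proof.
move=> fe fe'; have [X [uX pE qE giE]] := frame_matrix_q fe fe'; exists X; split=> //.
have uXT : X^T \in unitmx by rewrite unitmx_tr.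
suff -> : Sf e x = X^T *m Sf e' x *m X by rewrite !mulmxA mulVmx // mul1mx mulmxK.
apply: (bilf_ext fe) => xi eta tx te; rewrite (SS_indep fe fe' tx te) !pE //.
by rewrite /bilf trmx_mul trmxK !mulmxA.
Qed.

Lemma SQ_indep x e e' xi eta : frame x e -> frame x e' -> tangent x xi -> tangent x eta ->
  bilf (Sf e x) (qv e x xi) (pv e x eta) = bilf (Sf e' x) (qv e' x xi) (pv e' x eta).
Proof. by move=> fe fe' tx te; have [X [uX pE qE ->]] := Sf_change fe fe'; rewrite qE // pE // bilf_change. Qed.

(* Some frame near y; by [formsE] the choice does not matter below. *)
Definition fr y : 'I_n -> M -> tvec M := xget (fun _ _ => 0) [set e | frame y e].

Lemma frP y : frame y (fr y).
Proof. by have [e fe] := frame_ex y; apply: (xgetPex (fun _ _ => 0) (ex_intro [set e | frame y e] e fe)). Qed.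

Definition PP y xi eta := bilf (Gi (fr y) y) (pv (fr y) y xi) (pv (fr y) y eta).
Definition QP y xi eta := bilf (Gi (fr y) y) (qv (fr y) y xi) (pv (fr y) y eta).
Definition QQ y xi eta := bilf (Gi (fr y) y) (qv (fr y) y xi) (qv (fr y) y eta).
Definition SS y xi eta := bilf (Sf (fr y) y) (pv (fr y) y xi) (pv (fr y) y eta).
Definition SQ y xi eta := bilf (Sf (fr y) y) (qv (fr y) y xi) (pv (fr y) y eta).

Lemma formsE y e xi eta : frame y e -> tangent y xi -> tangent y eta ->
  [/\ PP y xi eta = bilf (Gi e y) (pv e y xi) (pv e y eta),
      QP y xi eta = bilf (Gi e y) (qv e y xi) (pv e y eta),
      QQ y xi eta = bilf (Gi e y) (qv e y xi) (qv e y eta),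
      SS y xi eta = bilf (Sf e y) (pv e y xi) (pv e y eta) &
      SQ y xi eta = bilf (Sf e y) (qv e y xi) (pv e y eta)].
Proof.
move=> fe tx te; split; [exact: (PP_indep (frP y))|exact: (QP_indep (frP y))|exact: (QQ_indep (frP y))|exact: (SS_indep (frP y))|exact: (SQ_indep (frP y))].
Qed.

Section Linear.
Variables (y : M) (c : R) (u v w : tvec M).
Hypotheses (tu : tangent y u) (tv : tangent y v) (tw : tangent y w).
Let fy := frP y.

Lemma PP_linl : PP y (c *: u + v) w = c * PP y u w + PP y v w.
Proof. by rewrite /PP (pv_lin fy) // bilf_linl. Qed.
Lemma PP_linr : PP y w (c *: u + v) = c * PP y w u + PP y w v.
Proof. by rewrite /PP (pv_lin fy) // bilf_linr. Qed.
Lemma QP_linl : QP y (c *: u + v) w = c * QP y u w + QP y v w.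
Proof. by rewrite /QP (qv_lin fy) // bilf_linl. Qed.
Lemma QP_linr : QP y w (c *: u + v) = c * QP y w u + QP y w v.
Proof. by rewrite /QP (pv_lin fy) // bilf_linr. Qed.
Lemma QQ_linl : QQ y (c *: u + v) w = c * QQ y u w + QQ y v w.
Proof. by rewrite /QQ (qv_lin fy) // bilf_linl. Qed.
Lemma QQ_linr : QQ y w (c *: u + v) = c * QQ y w u + QQ y w v.
Proof. by rewrite /QQ (qv_lin fy) // bilf_linr. Qed.
Lemma SS_linl : SS y (c *: u + v) w = c * SS y u w + SS y v w.
Proof. by rewrite /SS (pv_lin fy) // bilf_linl. Qed.
Lemma SS_linr : SS y w (c *: u + v) = c * SS y w u + SS y w v.
Proof. by rewrite /SS (pv_lin fy) // bilf_linr. Qed.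
Lemma SQ_linl : SQ y (c *: u + v) w = c * SQ y u w + SQ y v w.
Proof. by rewrite /SQ (qv_lin fy) // bilf_linl. Qed.
Lemma SQ_linr : SQ y w (c *: u + v) = c * SQ y w u + SQ y w v.
Proof. by rewrite /SQ (pv_lin fy) // bilf_linr. Qed.

Lemma PP_sym : PP y u v = PP y v u.
Proof. exact: bilf_sym (Gi_tr fy). Qed.
Lemma QQ_sym : QQ y u v = QQ y v u.
Proof. exact: bilf_sym (Gi_tr fy). Qed.

Lemma sigma_QP : sigma y u v = QP y u v - QP y v u.
Proof. by rewrite (QP_sym fy tu tv) [X in _ - X](bilf_sym _ _ (Gi_tr fy)). Qed.
End Linear.

Section Along.
Variables (x : M) (xi eta : tvec M).
Hypotheses (tx : tangent x xi) (te : tangent x eta).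

(** The choice [fr] has no continuity in the point. The derivative is therefore computed in one
    frame valid near time [t], in which the form takes the same values. *)
Lemma along (F : M -> tvec M -> tvec M -> R) (A : R -> 'M[R]_1) t A' e : frame (phi t x) e ->
  (forall s, frame (phi s x) e -> A s 0 0 = F (phi s x) (push (phi s) xi) (push (phi s) eta)) ->
  mder A t A' -> is_derive t 1 (fun s => F (phi s x) (push (phi s) xi) (push (phi s) eta)) (A' 0 0).
Proof.
move=> fe H D; have nf : \forall s \near t, frame (phi s x) e by exact: (flow_near smf (frame_near fe)).
by apply: near_eq_is_derive (D 0 0); apply: filterS nf.
Qed.

Let tp s : tangent (phi s x) (push (phi s) xi) := push_tangent smf s tx.
Let tq s : tangent (phi s x) (push (phi s) eta) := push_tangent smf s te.

Lemma PP_derive t : is_derive t 1 (fun s => PP (phi s x) (push (phi s) xi) (push (phi s) eta))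
  (QP (phi t x) (push (phi t) xi) (push (phi t) eta) + QP (phi t x) (push (phi t) eta) (push (phi t) xi)).
Proof.
have fe := frP (phi t x).
have D := along (F := PP) fe _ (cov_leibniz fe (cder_pv fe tx) (cder_pv fe te)).
apply: (is_derive_eq (D _)) => [s fs|]; first by have [-> _ _ _ _] := formsE fs (tp s) (tq s).
rewrite mxE; congr (_ + _).
by rewrite -/(bilf _ _ _) (bilf_sym _ _ (Gi_tr fe)).
Qed.

Lemma QP_derive t : is_derive t 1 (fun s => QP (phi s x) (push (phi s) xi) (push (phi s) eta))
  (QQ (phi t x) (push (phi t) xi) (push (phi t) eta) - SS (phi t x) (push (phi t) xi) (push (phi t) eta)).
Proof.
have fe := frP (phi t x).
have D := along (F := QP) fe _ (QP_mder fe tx te).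
apply: (is_derive_eq (D _)) => [s fs|]; first by have [_ -> _ _ _] := formsE fs (tp s) (tq s).
by rewrite submx00.
Qed.

Lemma QQ_derive t : is_derive t 1 (fun s => QQ (phi s x) (push (phi s) xi) (push (phi s) eta))
  (- (SQ (phi t x) (push (phi t) xi) (push (phi t) eta) + SQ (phi t x) (push (phi t) eta) (push (phi t) xi))).
Proof.
have fe := frP (phi t x).
have D := along (F := QQ) fe _ (cov_leibniz fe (cder_qv fe tx) (cder_qv fe te)).
apply: (is_derive_eq (D _)) => [s fs|]; first by have [_ _ -> _ _] := formsE fs (tp s) (tq s).
have Nt (a : 'rV[R]_n) : (- a)^T = - a^T by apply/matrixP => i j; rewrite !mxE.
have S (A B : 'M[R]_1) : (- A + - B) 0 0 = - (A 0 0 + B 0 0) by rewrite !mxE; ring.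
have St : Gi (fr (phi t x)) (phi t x) *m (Rm (fr (phi t x)) (phi t x))^T = Sf (fr (phi t x)) (phi t x).
  by rewrite /Sf -[RHS](Sm_sym fe) trmx_mul (Gi_tr fe).
rewrite Nt mulmxN !mulNmx S trmx_mul mulmxA -[_ *m Gi _ _ *m (Rm _ _)^T]mulmxA St -[_ *m Rm _ _ *m _]mulmxA.
by rewrite -/(Sf _ _) -!/(bilf _ _ _) [X in - (X + _)](bilf_sym _ _ (Sm_sym fe)) addrC.
Qed.

End Along.

(** * Uniform estimates on a compact set *)

(* DD and KK are the derivatives of the forms <q, p> and <q, q> along the
   projected vectors [hat], see [Q_derive] and [QQ_hat_derive]; the reduced
   curvature is what makes DD definite. *)
Definition mm y := PP y (hv y) (hv y).
Definition NN y z := Num.sg (mm y) * (PP y z z + QQ y z z).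
Definition DD y z := Num.sg (mm y) * (QQ y z z - SS y z z - 4 * QP y (hv y) z ^+ 2 / mm y).
Definition KK y z := Num.sg (mm y) * (- 2 * SQ y z z - 4 * (QP y (hv y) z / mm y) * QQ y z (hv y)).

(* The last condition says that sigma(z, hv) = 0, hence z is in ker dh. *)
Definition adapted y z := [/\ tangent y z, PP y z (hv y) = 0 & QP y z (hv y) = QP y (hv y) z].

Definition bounds c y := forall z, adapted y z ->
  [/\ c * NN y z <= DD y z, c * `|QP y z z| <= NN y z, c * `|KK y z| <= NN y z &
      c * (2 * QP y (hv y) z / mm y) ^+ 2 <= NN y z].

(** * Local estimates in a fixed frame *)

Section InFrame.
Variables (e : 'I_n -> M -> tvec M).
Local Notation V := 'rV[R]_(n + n).
Local Notation p v := (lsubmx v).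
Local Notation q v := (rsubmx v).
Local Notation ph y := (pv e y (hv y)).
Local Notation qh y := (qv e y (hv y)).

(* The same expressions with p and q as independent variables, which range over
   a fixed space, so that compactness of its unit sphere gives uniformity. *)
Definition fm y := bilf (Gi e y) (ph y) (ph y).
Definition fN y (v : V) := Num.sg (fm y) * (bilf (Gi e y) (p v) (p v) + bilf (Gi e y) (q v) (q v)).
Definition fQ y (v : V) := bilf (Gi e y) (q v) (p v).
Definition fB y (v : V) := bilf (Gi e y) (qh y) (p v).
Definition fD y (v : V) := Num.sg (fm y) * (bilf (Gi e y) (q v) (q v) - bilf (Sf e y) (p v) (p v) - 4 * fB y v ^+ 2 / fm y).
Definition fK y (v : V) := Num.sg (fm y) * (- 2 * bilf (Sf e y) (q v) (p v) - 4 * (fB y v / fm y) * bilf (Gi e y) (q v) (qh y)).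
Definition fC1 y (v : V) := bilf (Gi e y) (p v) (ph y).
Definition fC2 y (v : V) := bilf (Gi e y) (q v) (ph y) - bilf (Gi e y) (qh y) (p v).

Definition fbounds c y (v : V) := (fC1 y v = 0 -> fC2 y v = 0 -> c * fN y v <= fD y v) /\
  [/\ c * `|fQ y v| <= fN y v, c * `|fK y v| <= fN y v & c * (2 * fB y v / fm y) ^+ 2 <= fN y v].

Lemma lsubmxZ (r : R) (v : V) : p (r *: v) = r *: p v.
Proof. by apply/rowP => i; rewrite !mxE. Qed.
Lemma rsubmxZ (r : R) (v : V) : q (r *: v) = r *: q v.
Proof. by apply/rowP => i; rewrite !mxE. Qed.

Lemma fbounds_homogeneous c y r v : 0 < r -> fbounds c y v -> fbounds c y (r *: v).
Proof.
move=> r0; have r2 : 0 < r ^+ 2 by rewrite exprn_gt0.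
have EN : fN y (r *: v) = r ^+ 2 * fN y v.
  by rewrite /fN lsubmxZ rsubmxZ !(bilfZ, bilfZr); ring.
have EB : fB y (r *: v) = r * fB y v by rewrite /fB lsubmxZ bilfZr.
have EQ : fQ y (r *: v) = r ^+ 2 * fQ y v.
  by rewrite /fQ lsubmxZ rsubmxZ !(bilfZ, bilfZr); ring.
have EK : fK y (r *: v) = r ^+ 2 * fK y v.
  by rewrite /fK EB lsubmxZ rsubmxZ !(bilfZ, bilfZr); ring.
have ED : fD y (r *: v) = r ^+ 2 * fD y v.
  by rewrite /fD EB lsubmxZ rsubmxZ !(bilfZ, bilfZr); ring.
have EC1 : fC1 y (r *: v) = r * fC1 y v by rewrite /fC1 lsubmxZ bilfZ.
have EC2 : fC2 y (r *: v) = r * fC2 y v.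
  by rewrite /fC2 lsubmxZ rsubmxZ !(bilfZ, bilfZr); ring.
have rn : r != 0 by rewrite gt_eqF.
move=> [H [H1 H2 H3]]; split.
  rewrite EC1 EC2 EN ED => /eqP; rewrite mulf_eq0 (negPf rn) /= => /eqP C1.
  move=> /eqP; rewrite mulf_eq0 (negPf rn) /= => /eqP C2.
  by rewrite mulrCA ler_wpM2l ?(ltW r2) // H.
rewrite EQ EK EN EB !(normrM (r ^+ 2)) (gtr0_norm r2); split.
- by rewrite mulrCA ler_wpM2l ?(ltW r2).
- by rewrite mulrCA ler_wpM2l ?(ltW r2).
- have -> : c * (2 * (r * fB y v) / fm y) ^+ 2 = r ^+ 2 * (c * (2 * fB y v / fm y) ^+ 2) by ring.
  by rewrite ler_wpM2l ?(ltW r2).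
Qed.

(** Monotonicity allows [g^h] to have either sign; the sign of [<p(hv), p(hv)>] as a factor treats
    both cases at once. *)
Lemma Gi_definite y (a : 'rV[R]_n) : frame y e -> ph y != 0 -> a != 0 -> 0 < Num.sg (fm y) * bilf (Gi e y) a a.
Proof.
move=> fe ph0 a0; have uG := Gm_unit fe.
have E b : bilf (Gi e y) b b = ((b *m Gi e y) *m Gm e y *m (b *m Gi e y)^T) 0 0.
  by rewrite trmx_mul (Gi_tr fe) /bilf -!mulmxA (mulmxA (Gm e y)) (GGi fe) mul1mx.
have nz (b : 'rV[R]_n) : b != 0 -> b *m Gi e y != 0.
  by apply: contra_neq => b0; rewrite -[b](mulmxKV uG) b0 mul0mx.
have [H|H] := gform_definite fe; have := H _ (nz _ a0); have := H _ (nz _ ph0); rewrite -!E => H1 H2.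
  by rewrite gtr0_sg ?mul1r.
by rewrite ltr0_sg ?mulN1r ?oppr_gt0.
Qed.

Lemma Gi_semidefinite y (a : 'rV[R]_n) : frame y e -> ph y != 0 -> 0 <= Num.sg (fm y) * bilf (Gi e y) a a.
Proof.
move=> fe ph0; have [->|a0] := eqVneq a 0; first by rewrite bilf0l mulr0.
exact/ltW/Gi_definite.
Qed.

Lemma fm_neq0 y : frame y e -> ph y != 0 -> fm y != 0.
Proof. by move=> fe ph0; have := Gi_definite fe ph0 ph0; apply: contraTneq => ->; rewrite sgr0 mul0r ltxx. Qed.

Lemma fN_pos y v : frame y e -> ph y != 0 -> v != 0 -> 0 < fN y v.
Proof.
move=> fe ph0 v0; rewrite /fN mulrDr.
have [pz|p0] := eqVneq (p v) 0; last by rewrite ltr_wpDr ?Gi_semidefinite ?Gi_definite.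
rewrite ltr_wpDl ?Gi_semidefinite ?Gi_definite //; apply: contra_neq v0 => qz.
by rewrite -[v]hsubmxK pz qz row_mx0.
Qed.

(** For [p = 0] only [<q, q>] is left. Otherwise the component of [q] along [p(hv)], prescribed by
    [C2], is split off, and the rest is minus the reduced curvature of the vector of [Delta] that
    corresponds to [p]. *)
Lemma fD_pos y v : frame y e -> ph y != 0 -> negative_reduced_curvature sigma Delta h phi y ->
  v != 0 -> fC1 y v = 0 -> fC2 y v = 0 -> 0 < fD y v.
Proof.
move=> fe ph0 Hneg v0 C1 /eqP; rewrite subr_eq0 => /eqP C2.
have m0 := fm_neq0 fe ph0; have gT := Gi_tr fe.
have [pz|p0] := eqVneq (p v) 0.
  have qz : q v != 0 by apply: contra_neq v0 => qz; rewrite -[v]hsubmxK pz qz row_mx0.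
  rewrite /fD /fB pz !(bilf0l, bilf0r) expr0n /= mulr0 mul0r !subr0.
  exact: Gi_definite.
(* [comb e y a] is the vector of [Delta] that [g^h] identifies with [p v]; [C1] says that it lies in
   the kernel of [dh]. *)
pose a := p v *m Gi e y; have aG : a *m Gm e y = p v by rewrite -mulmxA (GiG fe) mulmx1.
have a0 : a != 0 by apply: contra_neq p0 => a0; rewrite -aG a0 mul0mx.
have tc := comb_tangent a fe; have th := field_tangent y hvF.
have Dc : Delta y (comb e y a) by apply/(DeltaE _ fe); exists a.
have kc : ker_d h y (comb e y a).
  split=> //; rewrite (hamP tc) (sg_anti tc th) sg_comb_r // trmx_mul gT mulmxA.
  by move: C1; rewrite /fC1 (bilf_sym _ _ gT) /bilf => ->; rewrite oppr0.
have nc : comb e y a <> 0 by move=> c0; move/eqP: a0; apply; apply: (comb_inj fe); rewrite c0 comb0.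
have := Hneg _ Dc kc nc; rewrite reduced_curvature_formE // gformE // aG.
have aT : a^T = Gi e y *m (p v)^T by rewrite trmx_mul gT.
rewrite aT !mulmxA -/(bilf _ _ _) -[p v *m _ *m Gi e y]mulmxA -!/(bilf _ _ _) -/(Sf e y) -/(fm y) => neg.
(* [r] is the part of [q] orthogonal to [p(hv)], since [<q, p(hv)> = b]. That [<r, r>] has the right
   sign supplies [b^2 / m] and turns the coefficient 4 into the 3 of the reduced curvature. *)
pose b := fB y v; pose r := - (b / fm y) *: ph y + q v.
have rr := Gi_semidefinite r fe ph0.
have Er : bilf (Gi e y) r r = bilf (Gi e y) (q v) (q v) - b ^+ 2 / fm y.
  rewrite /r bilf_linl !bilf_linr -/(fm y) C2 -/(fB y v) -/b [bilf _ (ph y) (q v)](bilf_sym _ _ gT) C2 -/(fB y v) -/b.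
  by field.
have pp := Gi_definite fe ph0 p0.
have sg2 : Num.sg (fm y) * Num.sg (fm y) = 1 by rewrite -expr2 sqr_sg m0.
have {pp neg} : 0 < - (Num.sg (fm y) * (bilf (Sf e y) (p v) (p v) + 3 * b ^+ 2 / fm y)).
  rewrite oppr_gt0 -(pmulr_llt0 _ pp) mulrACA sg2 mul1r mulrC.
  by move: neg; rewrite mulrC -/(fB y v) -/b.
move: rr; rewrite Er /fD -/b; move: (Num.sg _) (bilf _ _ _) (bilf _ _ _) => sg A1 A2.
move=> H1 H2; have := ltr_leD H2 H1; rewrite addr0.
by congr (_ < _); field.
Qed.

Variables (y0 : M).
Hypotheses (fe : frame y0 e) (ph0 : ph y0 != 0).
Hypothesis Hneg : negative_reduced_curvature sigma Delta h phi y0.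

(** The simultaneous limit in the vector, the point and the constant [c] tending to 0 from above, as
    the two compactness arguments that follow require. *)
Definition tri (v : V) : set_system (V * (M * R)) := filter_prod (nbhs v) (filter_prod (nbhs y0) (0^'+)).

Instance tri_filter v : Filter (tri v).
Proof. by apply: filter_prod_filter. Qed.

Lemma tri_snd k l (A : M -> 'M[R]_(k, l)) v : smooth_mx y0 A -> mcvg (tri v) (fun w => A w.2.1) (A y0).
Proof.
move=> sA i j; have c := smooth_near_cont (sA i j).
have c1 : w.2 @[w --> tri v] --> filter_prod (nbhs y0) (0^'+) by exact: cvg_snd.
have c2 : w.1 @[w --> filter_prod (nbhs y0) ((0 : R)^'+)] --> nbhs y0 by exact: cvg_fst.
exact: (cvg_comp _ _ (cvg_comp _ _ c1 c2) c).
Qed.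

Lemma tri_c v : (w.2.2 : R) @[w --> tri v] --> (0 : R).
Proof.
have c1 : w.2 @[w --> tri v] --> filter_prod (nbhs y0) (0^'+) by exact: cvg_snd.
have c2 : w.2 @[w --> filter_prod (nbhs y0) ((0 : R)^'+)] --> (0 : R)^'+ by exact: cvg_snd.
exact: (cvg_trans (cvg_comp _ _ c1 c2) (cvg_within _)).
Qed.

Lemma tri_coord v j : (w.1 : V) 0 j @[w --> tri v] --> v 0 j.
Proof.
have c1 : w.1 @[w --> tri v] --> nbhs v by exact: cvg_fst.
exact: (cvg_comp _ _ c1 (@coord_continuous _ _ _ 0 j v)).
Qed.

Lemma tri_p v : mcvg (tri v) (fun w => p w.1) (p v).
Proof.
move=> i j; rewrite (ord1 i) mxE.
have -> : (fun w : V * (M * R) => p w.1 0 j) = (fun w => w.1 0 (lshift n j)) by apply/funext => w; rewrite mxE.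
exact: tri_coord.
Qed.
Lemma tri_q v : mcvg (tri v) (fun w => q w.1) (q v).
Proof.
move=> i j; rewrite (ord1 i) mxE.
have -> : (fun w : V * (M * R) => q w.1 0 j) = (fun w => w.1 0 (rshift n j)) by apply/funext => w; rewrite mxE.
exact: tri_coord.
Qed.

Lemma Sf_smooth y : frame y e -> smooth_mx y (Sf e).
Proof. by move=> fy; apply: smooth_mx_mul; [exact: (Rm_smooth fy)|exact: (Gi_smooth fy)]. Qed.

Lemma ph_smooth : smooth_mx y0 (fun y => ph y).
Proof. exact: (pv_smooth hvF fe). Qed.

Lemma qh_smooth : smooth_mx y0 (fun y => qh y).
Proof.
apply: smooth_mx_add; last first.
  apply: smooth_mx_opp; apply: smooth_mx_scale; apply: smooth_mx_mul; first exact: ph_smooth.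
  exact: (Bm_smooth fe).
move=> i j; apply: smooth_near_Cinf.
have -> : (fun y => dpv e y (hv y) i j) = fun y => sigma y (hv y) (lie hv (e j) y) by apply/funext => y; rewrite mxE.
apply: sg_smooth; first exact: hvF.
by apply: L_field; exact: (frame_field j fe).
Qed.

Lemma fm_smooth : smooth_near y0 fm.
Proof.
exact: (smooth_mx_mul (smooth_mx_mul ph_smooth (Gi_smooth fe)) (smooth_mx_tr ph_smooth)).
Qed.

Lemma sgfm_near : \forall y \near y0, Num.sg (fm y) = Num.sg (fm y0).
Proof.
have c := smooth_near_cont fm_smooth.
have := fm_neq0 fe ph0; rewrite neq_lt => /orP[m0|m0].
  have H : \forall y \near y0, fm y < 0 by exact: (cvgr_lt (fm y0) c 0 m0).
  by apply: filterS H => y my; rewrite !ltr0_sg.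
have H : \forall y \near y0, 0 < fm y by exact: (cvgr_gt (fm y0) c 0 m0).
by apply: filterS H => y my; rewrite !gtr0_sg.
Qed.

Let g_c v := tri_snd v (Gi_smooth fe).
Let S_c v := tri_snd v (Sf_smooth fe).
Let ph_c v := tri_snd v ph_smooth.
Let qh_c v := tri_snd v qh_smooth.

Lemma fm_c v : fm w.2.1 @[w --> tri v] --> fm y0.
Proof. exact: (mcvg_bilf (tri_filter v) (g_c v) (ph_c v) (ph_c v)). Qed.

Lemma sg_c v : Num.sg (fm w.2.1) @[w --> tri v] --> Num.sg (fm y0).
Proof.
have c1 : w.2 @[w --> tri v] --> filter_prod (nbhs y0) (0^'+) by exact: cvg_snd.
have c2 : w.1 @[w --> filter_prod (nbhs y0) ((0 : R)^'+)] --> nbhs y0 by exact: cvg_fst.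
have c3 : Num.sg (fm y) @[y --> nbhs y0] --> Num.sg (fm y0).
  have nE : \forall y \near y0, Num.sg (fm y0) = Num.sg (fm y) by apply: filterS sgfm_near => y ->.
  exact: cvg_trans (near_eq_cvg nE) (cvg_cst _).
exact: (cvg_comp _ _ (cvg_comp _ _ c1 c2) c3).
Qed.

Lemma fN_c v : fN w.2.1 w.1 @[w --> tri v] --> fN y0 v.
Proof.
apply: cvgM; first exact: sg_c.
apply: cvgD; apply: (mcvg_bilf (tri_filter v) (g_c v)); by [exact: tri_p|exact: tri_q].
Qed.
Lemma fB_c v : fB w.2.1 w.1 @[w --> tri v] --> fB y0 v.
Proof. exact: (mcvg_bilf (tri_filter v) (g_c v) (qh_c v) (@tri_p v)). Qed.
Lemma fQ_c v : fQ w.2.1 w.1 @[w --> tri v] --> fQ y0 v.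
Proof. exact: (mcvg_bilf (tri_filter v) (g_c v) (@tri_q v) (@tri_p v)). Qed.
Lemma fC1_c v : fC1 w.2.1 w.1 @[w --> tri v] --> fC1 y0 v.
Proof. exact: (mcvg_bilf (tri_filter v) (g_c v) (@tri_p v) (ph_c v)). Qed.
Lemma fC2_c v : fC2 w.2.1 w.1 @[w --> tri v] --> fC2 y0 v.
Proof.
apply: cvgB; first exact: (mcvg_bilf (tri_filter v) (g_c v) (@tri_q v) (ph_c v)).
exact: (mcvg_bilf (tri_filter v) (g_c v) (qh_c v) (@tri_p v)).
Qed.
Lemma fBm_c v : fB w.2.1 w.1 / fm w.2.1 @[w --> tri v] --> fB y0 v / fm y0.
Proof. by apply: cvgM; [exact: fB_c|apply: cvgV; [exact: fm_neq0|exact: fm_c]]. Qed.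
Lemma fD_c v : fD w.2.1 w.1 @[w --> tri v] --> fD y0 v.
Proof.
apply: cvgM; first exact: sg_c.
apply: cvgB.
  apply: cvgB; first exact: (mcvg_bilf (tri_filter v) (g_c v) (@tri_q v) (@tri_q v)).
  exact: (mcvg_bilf (tri_filter v) (S_c v) (@tri_p v) (@tri_p v)).
apply: cvgM; last by apply: cvgV; [exact: fm_neq0|exact: fm_c].
by apply: cvgM; [exact: cvg_cst|apply: cvgM; exact: fB_c].
Qed.
Lemma fK_c v : fK w.2.1 w.1 @[w --> tri v] --> fK y0 v.
Proof.
apply: cvgM; first exact: sg_c.
apply: cvgB.
  by apply: cvgM; [exact: cvg_cst|exact: (mcvg_bilf (tri_filter v) (S_c v) (@tri_q v) (@tri_p v))].
apply: cvgM; first by apply: cvgM; [exact: cvg_cst|exact: (@fBm_c v)].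
exact: (mcvg_bilf (tri_filter v) (g_c v) (@tri_q v) (qh_c v)).
Qed.

(** The constant tends to 0 while [fN] has a positive limit. *)
Lemma small_bound (v : V) (F : M -> V -> R) : v != 0 -> F w.2.1 w.1 @[w --> tri v] --> F y0 v ->
  \forall w \near tri v, w.2.2 * F w.2.1 w.1 <= fN w.2.1 w.1.
Proof.
move=> v0 Fc.
have c : fN w.2.1 w.1 - w.2.2 * F w.2.1 w.1 @[w --> tri v] --> fN y0 v - 0 * F y0 v.
  by apply: cvgB; [exact: fN_c|apply: cvgM => //; exact: tri_c].
have p0 : 0 < fN y0 v - 0 * F y0 v by rewrite mul0r subr0 fN_pos.
have := cvgr_gt _ c _ p0; move=> /(_ (tri_filter v)); apply: (@filterS _ _ (tri_filter v)) => w.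
by rewrite subr_gt0 => /ltW.
Qed.

Lemma fbounds_near v : v != 0 -> \forall w \near tri v, fbounds w.2.2 w.2.1 w.1.
Proof.
move=> v0.
suff H1 : \forall w \near tri v, fC1 w.2.1 w.1 = 0 -> fC2 w.2.1 w.1 = 0 -> w.2.2 * fN w.2.1 w.1 <= fD w.2.1 w.1.
  have n1 := small_bound (F := fun y v => `|fQ y v|) v0 (cvg_norm (fQ_c (v := v))).
  have n2 := small_bound (F := fun y v => `|fK y v|) v0 (cvg_norm (fK_c (v := v))).
  have c3 : (2 * fB w.2.1 w.1 / fm w.2.1) ^+ 2 @[w --> tri v] --> (2 * fB y0 v / fm y0) ^+ 2.
    have c4 : 2 * fB w.2.1 w.1 / fm w.2.1 @[w --> tri v] --> 2 * fB y0 v / fm y0.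
      apply: cvgM; last by apply: cvgV; [exact: fm_neq0|exact: fm_c].
      by apply: cvgM; [exact: cvg_cst|exact: fB_c].
    by apply: cvgM; exact: c4.
  have n3 := small_bound (F := fun y v => (2 * fB y v / fm y) ^+ 2) v0 c3.
  have n4 := @filterI _ _ (tri_filter v) _ _ (n2 (tri_filter v)) n3.
  by apply: (@filterS3 _ _ (tri_filter v) _ _ _ _ _ H1 (n1 (tri_filter v)) n4) => w ? ? [? ?]; split.
(* If one of the two constraints fails at the limit it fails nearby, and the implication holds
   vacuously; if both hold, [fD_pos] applies. *)
have [C1|C1] := eqVneq (fC1 y0 v) 0; last first.
  by have := cvgr_neq0 _ (fC1_c (v := v)) C1; move=> /(_ (tri_filter v)); apply: (@filterS _ _ (tri_filter v)) => w /eqP H /H.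
have [C2|C2] := eqVneq (fC2 y0 v) 0; last first.
  by have := cvgr_neq0 _ (fC2_c (v := v)) C2; move=> /(_ (tri_filter v)); apply: (@filterS _ _ (tri_filter v)) => w /eqP H _ /H.
have c : fD w.2.1 w.1 - w.2.2 * fN w.2.1 w.1 @[w --> tri v] --> fD y0 v - 0 * fN y0 v.
  by apply: cvgB; [exact: fD_c|apply: cvgM; [exact: tri_c|exact: fN_c]].
have p0 : 0 < fD y0 v - 0 * fN y0 v by rewrite mul0r subr0 fD_pos.
have := cvgr_gt _ c _ p0; move=> /(_ (tri_filter v)); apply: (@filterS _ _ (tri_filter v)) => w H _ _.
by move: H; rewrite subr_gt0 => /ltW.
Qed.

Lemma fbounds_ex : \forall w \near filter_prod (nbhs y0) ((0 : R)^'+), forall v, fbounds w.2 w.1 v.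
Proof.
have [+ _] := compact_near_coveringP [set v : V | `|v| = 1].
move=> /(_ (@rV_sphere_compact R (n + n))) /(_ _ (filter_prod (nbhs y0) ((0 : R)^'+)) (fun w v => fbounds w.2 w.1 v)).
have FF : Filter (filter_prod (nbhs y0) ((0 : R)^'+)) by exact: filter_prod_filter.
move=> /(_ FF) H.
have {}H : \forall w \near filter_prod (nbhs y0) ((0 : R)^'+), [set v : V | `|v| = 1] `<=` fbounds w.2 w.1.
  apply: H => v /= v1; apply: (@fbounds_near v).
  by rewrite -normr_gt0 v1.
apply: filterS H => w Hw v; have [->|v0] := eqVneq v 0.
  split=> [_ _|]; rewrite /fD /fN /fQ /fK /fB ?(linear0, bilf0l, bilf0r, expr0n, mulr0, mul0r, subr0, addr0, normr0) //=.
have nv : 0 < `|v| by rewrite normr_gt0.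
have -> : v = `|v| *: (`|v|^-1 *: v) by rewrite scalerA divff ?scale1r // gt_eqF.
apply: fbounds_homogeneous => //; apply: Hw => /=.
by rewrite normrZ normfV normr_id mulVf // gt_eqF.
Qed.

Lemma bounds_near : \forall w \near filter_prod (nbhs y0) ((0 : R)^'+), bounds w.2 w.1.
Proof.
have FF : Filter (filter_prod (nbhs y0) ((0 : R)^'+)) by exact: filter_prod_filter.
have nf : \forall w \near filter_prod (nbhs y0) ((0 : R)^'+), frame w.1 e.
  have c2 : w.1 @[w --> filter_prod (nbhs y0) ((0 : R)^'+)] --> nbhs y0 by exact: cvg_fst.
  exact: (c2 _ (frame_near fe)).
apply: filterS2 nf fbounds_ex => -[y c] /= fy Hb z [tz C1 C2].
have th := field_tangent y hvF.
have [E1 E2 E3 E4 E5] := formsE fy tz tz.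
have [F1 F2 F3 _ _] := formsE fy tz th; have [G1 G2 _ _ _] := formsE fy th tz.
have [Em _ _ _ _] := formsE fy th th.
have [Hb1 Hb2] := Hb (row_mx (pv e y z) (qv e y z)).
have {}Em : mm y = fm y by rewrite /mm Em.
move: Hb1 Hb2; rewrite /fD /fN /fQ /fK /fB /fC1 /fC2 row_mxKl row_mxKr.
rewrite -E1 -E2 -E3 -E4 -E5 -G2 -F1 -F2 -F3 -Em -/(NN y z) -/(DD y z) -/(KK y z) => Hb1 [Hb2 Hb3 Hb4].
by split=> //; apply: Hb1 => //; rewrite C2 subrr.
Qed.

End InFrame.

Implicit Types (z u v : tvec M).

Lemma bounds_uniform (S : set M) : compact S -> (forall y, S y -> ~ Delta y (hv y)) ->
  (forall y, S y -> negative_reduced_curvature sigma Delta h phi y) ->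
  exists2 c, 0 < c & forall y, S y -> bounds c y.
Proof.
move=> cS Sd Sn; have [+ _] := compact_near_coveringP S.
move=> /(_ cS) /(_ _ ((0 : R)^'+) bounds) H.
have n1 : \forall c \near (0 : R)^'+, S `<=` bounds c.
  apply: H => y Sy; have fe := frP y.
  apply: (@bounds_near (fr y) y) => //; last exact: Sn.
  by apply: contra_notN (Sd _ Sy) => /eqP; exact: (Delta_pv fe (field_tangent y hvF)).2.
have FF : ProperFilter ((0 : R)^'+) by exact: at_right_proper_filter.
have [c [c0 Hc]] := filter_ex (filterI (nbhs_right_gt (0 : R)) n1).
by exists c.
Qed.

(** * Growth along an orbit *)

(** The flow component of [xi], read off from [p] alone; along an orbit it is the [b] of
    [lyapunov]. *)
Definition be y xi := PP y xi (hv y) / mm y.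
Definition hat y xi : tvec M := - be y xi *: hv y + xi.
Definition Nf y xi := NN y (hat y xi).
Definition N0f y xi := Num.sg (mm y) * PP y (hat y xi) (hat y xi).
Definition Qf y xi := Num.sg (mm y) * QP y (hat y xi) (hat y xi).

Lemma thv y : tangent y (hv y). Proof. exact: (field_tangent y hvF). Qed.

Lemma hat_tangent y xi : tangent y xi -> tangent y (hat y xi).
Proof. by move=> tx; apply: tangent_comb => //; exact: thv. Qed.

Lemma be_lin y a u v : tangent y u -> tangent y v -> be y (a *: u + v) = a * be y u + be y v.
Proof. by move=> tu tv; have th := thv y; rewrite /be PP_linl //; ring. Qed.

Lemma hat_lin y a u v : tangent y u -> tangent y v -> hat y (a *: u + v) = a *: hat y u + hat y v.
Proof.
move=> tu tv; rewrite /hat be_lin // scalerDr scalerA opprD scalerDl mulrN addrACA.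
by congr (_ + _ + _); rewrite scaleNr mulrN -scaleNr.
Qed.

Lemma mm_pv y : mm y != 0 -> pv (fr y) y (hv y) != 0.
Proof. by apply: contra_neq => E; rewrite /mm /PP E bilf0l. Qed.

Lemma sgPP_ge0 y z : mm y != 0 -> tangent y z -> 0 <= Num.sg (mm y) * PP y z z.
Proof. by move=> m0 tz; apply: (Gi_semidefinite _ (frP y)); exact: mm_pv. Qed.

Lemma sgQQ_ge0 y z : mm y != 0 -> tangent y z -> 0 <= Num.sg (mm y) * QQ y z z.
Proof. by move=> m0 tz; apply: (Gi_semidefinite _ (frP y)); exact: mm_pv. Qed.

Lemma PP_eq0 y z : mm y != 0 -> tangent y z -> Num.sg (mm y) * PP y z z = 0 -> pv (fr y) y z = 0.
Proof.
move=> m0 tz E; apply/eqP/negPn/negP => p0.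
by have := Gi_definite (frP y) (mm_pv m0) p0; rewrite E ltxx.
Qed.

Lemma QQ_eq0 y z : mm y != 0 -> tangent y z -> Num.sg (mm y) * QQ y z z = 0 -> qv (fr y) y z = 0.
Proof.
move=> m0 tz E; apply/eqP/negPn/negP => p0.
by have := Gi_definite (frP y) (mm_pv m0) p0; rewrite E ltxx.
Qed.

Lemma pq_eq0 y e z : frame y e -> tangent y z -> pv e y z = 0 -> qv e y z = 0 -> z = 0.
Proof.
move=> fe tz p0 q0; apply: (sg_nondeg tz) => w tw.
by rewrite (QP_sym fe tz tw) p0 q0 !bilf0l subr0.
Qed.

Lemma NN_eq0 y z : mm y != 0 -> tangent y z -> NN y z = 0 -> z = 0.
Proof.
move=> m0 tz; rewrite /NN mulrDr => /eqP.
rewrite paddr_eq0 ?sgPP_ge0 ?sgQQ_ge0 // => /andP[/eqP p0 /eqP q0].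
apply: (pq_eq0 (frP y) tz); [exact: PP_eq0|exact: QQ_eq0].
Qed.

Lemma NN_ge0 y z : mm y != 0 -> tangent y z -> 0 <= NN y z.
Proof. by move=> m0 tz; rewrite /NN mulrDr addr_ge0 ?sgPP_ge0 ?sgQQ_ge0. Qed.

Lemma hat_adapted y xi : mm y != 0 -> ker_d h y xi -> adapted y (hat y xi).
Proof.
move=> m0 [tx xh]; have th := thv y; split; first exact: hat_tangent.
  by rewrite PP_linl // -/(mm y) /be; field.
rewrite QP_linl // QP_linr //; congr (_ + _).
apply/eqP; rewrite -subr_eq0; apply/eqP.
by rewrite -sigma_QP // -hamP.
Qed.

Lemma h_const x t : h (phi t x) = h x.
Proof.
have D s : is_derive s 1 (fun t => h (phi t x)) 0 by rewrite -(hv_h (phi s x)); exact: (flow_deriv smf x s h_smooth).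
have E := is_derive_0_is_cst t 0 D.
by rewrite E (phi0 smf).
Qed.

Lemma push_ker x t xi : ker_d h x xi -> ker_d h (phi t x) (push (phi t) xi).
Proof.
move=> [tx xh]; split; first exact: (push_tangent smf).
rewrite -[RHS]xh /push; congr (xi _); apply/funext => y /=; exact: h_const.
Qed.

Section Orbit.
Variables (x : M) (c : R).
Hypotheses (c0 : 0 < c) (m0 : forall t, mm (phi t x) != 0) (Hb : forall t, bounds c (phi t x)).
Variable xi : tvec M.
Hypothesis kx : ker_d h x xi.

Let tx : tangent x xi := kx.1.
Local Notation xit t := (push (phi t) xi).
Local Notation y t := (phi t x).
Let txt t : tangent (y t) (xit t) := push_tangent smf t tx.
Let th t : tangent (y t) (hv (y t)) := thv (y t).
Let hE t : push (phi t) (hv x) = hv (y t) := push_velocity smf t x.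
Let kxt t : ker_d h (y t) (xit t) := push_ker t kx.
Local Notation z t := (hat (y t) (xit t)).
Let tz t : tangent (y t) (z t) := hat_tangent (txt t).

Lemma mm_derive t : is_derive t 1 (fun s => mm (y s)) (2 * QP (y t) (hv (y t)) (hv (y t))).
Proof.
have := PP_derive (thv x) (thv x) t; rewrite !hE mulr_natl mulr2n.
by have -> : (fun s => PP (y s) (push (phi s) (hv x)) (push (phi s) (hv x))) = (fun s => mm (y s)) by apply/funext => s; rewrite !hE.
Qed.

(** The sign is locally constant along the orbit, so it may be frozen while the forms that it
    multiplies are differentiated. *)
Lemma sg_near t : \forall s \near t, Num.sg (mm (y s)) = Num.sg (mm (y t)).
Proof.
have ct := is_derive_cont (mm_derive t).
have := m0 t; rewrite neq_lt => /orP[mt|mt].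
  have H : \forall s \near t, mm (y s) < 0 by exact: (cvgr_lt (mm (y t)) ct 0 mt).
  by apply: filterS H => s ms; rewrite !ltr0_sg.
have H : \forall s \near t, 0 < mm (y s) by exact: (cvgr_gt (mm (y t)) ct 0 mt).
by apply: filterS H => s ms; rewrite !gtr0_sg.
Qed.

(** On the kernel of [dh] one has [<q(xi), p(hv)> = <q(hv), p(xi)>]; the quotient rule then gives an
    expression in [hat xi] only, so the flow component does not feed its own growth. *)
Lemma be_derive t : is_derive t 1 (fun s => be (y s) (xit s)) (2 * QP (y t) (hv (y t)) (z t) / mm (y t)).
Proof.
have D1 := PP_derive tx (thv x) t.
have {}D1 : is_derive t 1 (fun s => PP (y s) (xit s) (hv (y s))) (QP (y t) (xit t) (hv (y t)) + QP (y t) (hv (y t)) (xit t)).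
  move: D1; rewrite hE.
  by have -> : (fun s => PP (y s) (xit s) (push (phi s) (hv x))) = (fun s => PP (y s) (xit s) (hv (y s))) by apply/funext => s; rewrite hE.
have D2 := @is_deriveV _ (fun s => mm (y s)) t _ 1 (m0 t) (mm_derive t).
have D := @is_deriveM _ _ _ _ t 1 _ _ D1 D2.
apply: (is_derive_eq D) => {D D1 D2}.
have E : QP (y t) (xit t) (hv (y t)) = QP (y t) (hv (y t)) (xit t).
  apply/eqP; rewrite -subr_eq0; apply/eqP.
  by rewrite -sigma_QP // -hamP //; have [] := kxt t.
rewrite QP_linr // E /be /GRing.scale /=.
by have := m0 t; move: (mm _) (PP _ _ _) (QP _ _ _) (QP _ _ _) => m p u v mn; field.
Qed.

Section Form.
Variables (F F' : M -> tvec M -> tvec M -> R).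
Hypothesis Fl : forall y a u v w, tangent y u -> tangent y v -> tangent y w -> F y (a *: u + v) w = a * F y u w + F y v w.
Hypothesis Fr : forall y a u v w, tangent y u -> tangent y v -> tangent y w -> F y w (a *: u + v) = a * F y w u + F y w v.
Hypothesis Fl' : forall y a u v w, tangent y u -> tangent y v -> tangent y w -> F' y (a *: u + v) w = a * F' y u w + F' y v w.
Hypothesis Fr' : forall y a u v w, tangent y u -> tangent y v -> tangent y w -> F' y w (a *: u + v) = a * F' y w u + F' y w v.
Hypothesis FD : forall u v t, tangent x u -> tangent x v ->
  is_derive t 1 (fun s => F (y s) (push (phi s) u) (push (phi s) v)) (F' (y t) (push (phi t) u) (push (phi t) v)).

(** [hat xi] is not carried by the flow, but it is [xi - b hv] with both vectors carried by it;
    bilinearity leaves [b'] times a correction. *)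
Lemma form_hat t : is_derive t 1 (fun s => F (y s) (z s) (z s))
  (F' (y t) (z t) (z t) - 2 * QP (y t) (hv (y t)) (z t) / mm (y t) * (F (y t) (z t) (hv (y t)) + F (y t) (hv (y t)) (z t))).
Proof.
set b' := 2 * QP _ _ _ / _.
pose b s := be (y s) (xit s).
have Db : is_derive t 1 b b' := be_derive t.
have D11 := FD t tx tx; have D12 := FD t tx (thv x); have D21 := FD t (thv x) tx; have D22 := FD t (thv x) (thv x).
have -> : (fun s => F (y s) (z s) (z s)) =
  (fun s => - b s * (- b s * F (y s) (push (phi s) (hv x)) (push (phi s) (hv x)) + F (y s) (push (phi s) (hv x)) (xit s))
    + (- b s * F (y s) (xit s) (push (phi s) (hv x)) + F (y s) (xit s) (xit s))).
  by apply/funext => s; rewrite hE Fl // !Fr.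
have DN := is_deriveN Db.
have D1 := @is_deriveD _ _ _ _ _ t 1 _ _ (@is_deriveM _ _ _ _ t 1 _ _ DN D22) D21.
have D2 := @is_deriveM _ _ _ _ t 1 _ _ DN D1.
have D3 := @is_deriveD _ _ _ _ _ t 1 _ _ (@is_deriveM _ _ _ _ t 1 _ _ DN D12) D11.
apply: (is_derive_eq (@is_deriveD _ _ _ _ _ t 1 _ _ D2 D3)).
rewrite Fl' // !Fr' // [F (y t) (z t) _]Fl // [F (y t) _ (z t)]Fr // /GRing.scale /= !hE -/(b t).
rewrite -[(- b * _ + _) t]/(- b t * F (y t) (push (phi t) (hv x)) (push (phi t) (hv x)) + F (y t) (push (phi t) (hv x)) (xit t)).
rewrite -[(- b) t]/(- b t) !hE; move: (b t) => bt.
by ring.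
Qed.
End Form.

(** The correction vanishes because [<p, p(hv)> = 0] for the projected vector. *)
Lemma N0_derive t : is_derive t 1 (fun s => N0f (y s) (xit s)) (2 * Qf (y t) (xit t)).
Proof.
have nE : \forall s \near t, Num.sg (mm (y t)) * PP (y s) (z s) (z s) = N0f (y s) (xit s).
  by apply: filterS (sg_near t) => s <-.
apply: near_eq_is_derive nE _.
have D := form_hat (F := PP) (F' := fun y u v => QP y u v + QP y v u) _ _ _ _ _ t.
have [_ A1 A2] := hat_adapted (m0 t) (kxt t).
have D' := @is_deriveZ _ _ _ _ (Num.sg (mm (y t))) t 1 _ (D _ _ _ _ _).
apply: (is_derive_eq (D' _ _ _ _ _)) => {D D'}.
- by move=> *; exact: PP_linl.
- by move=> *; exact: PP_linr.
- by move=> w a u v z tu tv tw; rewrite QP_linl // QP_linr //; ring.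
- by move=> w a u v z tu tv tw; rewrite QP_linl // QP_linr //; ring.
- by move=> u v s tu tv; exact: PP_derive.
by rewrite (PP_sym (y t) (hv (y t)) (z t)) A1 /Qf /GRing.scale /=; ring.
Qed.

(** Both pairings of the projected vector with [hv] equal [<q(hv), p>], and [b'] is
    [2 <q(hv), p> / mm]; this produces the term with the factor 4 in [DD]. *)
Lemma Q_derive t : is_derive t 1 (fun s => Qf (y s) (xit s)) (DD (y t) (z t)).
Proof.
have nE : \forall s \near t, Num.sg (mm (y t)) * QP (y s) (z s) (z s) = Qf (y s) (xit s).
  by apply: filterS (sg_near t) => s <-.
apply: near_eq_is_derive nE _.
have D := form_hat (F := QP) (F' := fun y u v => QQ y u v - SS y u v) _ _ _ _ _ t.
have [_ A1 A2] := hat_adapted (m0 t) (kxt t).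
have D' := @is_deriveZ _ _ _ _ (Num.sg (mm (y t))) t 1 _ (D _ _ _ _ _).
apply: (is_derive_eq (D' _ _ _ _ _)) => {D D'}.
- by move=> *; exact: QP_linl.
- by move=> *; exact: QP_linr.
- by move=> w a u v z tu tv tw; rewrite QQ_linl // SS_linl //; ring.
- by move=> w a u v z tu tv tw; rewrite QQ_linr // SS_linr //; ring.
- by move=> u v s tu tv; exact: QP_derive.
rewrite A2 /DD /GRing.scale /=.
by have := m0 t; move: (mm _) (QP _ _ _) => m p mn; field.
Qed.

Lemma QQ_hat_derive t : is_derive t 1 (fun s => Num.sg (mm (y s)) * QQ (y s) (z s) (z s)) (KK (y t) (z t)).
Proof.
have nE : \forall s \near t, Num.sg (mm (y t)) * QQ (y s) (z s) (z s) = Num.sg (mm (y s)) * QQ (y s) (z s) (z s).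
  by apply: filterS (sg_near t) => s <-.
apply: near_eq_is_derive nE _.
have D := form_hat (F := QQ) (F' := fun y u v => - (SQ y u v + SQ y v u)) _ _ _ _ _ t.
have D' := @is_deriveZ _ _ _ _ (Num.sg (mm (y t))) t 1 _ (D _ _ _ _ _).
apply: (is_derive_eq (D' _ _ _ _ _)) => {D D'}.
- by move=> *; exact: QQ_linl.
- by move=> *; exact: QQ_linr.
- by move=> w a u v z tu tv tw; rewrite SQ_linl // SQ_linr //; ring.
- by move=> w a u v z tu tv tw; rewrite SQ_linl // SQ_linr //; ring.
- by move=> u v s tu tv; exact: QQ_derive.
rewrite (QQ_sym (y t) (hv (y t)) (z t)) /KK /GRing.scale /=.
by have := m0 t; move: (mm _) (QP _ _ _) => m p mn; field.
Qed.

(** The constant [3 / c] comes from [N' = 2 Q + KK] with [|Q|] and [|KK|] at most [N / c] each; it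
    also covers the remaining bounds by [N / c]. *)
Lemma orbit_lyapunov : lyapunov c (3 / c) (fun t => Nf (y t) (xit t)) (fun t => N0f (y t) (xit t))
  (fun t => Qf (y t) (xit t)) (fun t => be (y t) (xit t)).
Proof.
have B t := Hb (hat_adapted (m0 t) (kxt t)).
have N0 t : 0 <= Nf (y t) (xit t) by exact: NN_ge0.
have QN t : c * `|Qf (y t) (xit t)| <= Nf (y t) (xit t).
  have [_ + _ _] := B t; rewrite /Qf normrM.
  have -> : `|Num.sg (mm (y t))| = 1 by rewrite normr_sg m0.
  by rewrite mul1r.
have K (u : R) t : c * u <= Nf (y t) (xit t) -> u <= 3 / c * Nf (y t) (xit t).
  move=> Hu; rewrite mulrAC ler_pdivlMr // mulrC; apply: le_trans Hu _.
  by rewrite ler_peMl // -[1]/(1%:R) ler_nat.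
split=> t.
- exact: N0_derive.
- exists (2 * Qf (y t) (xit t) + KK (y t) (z t)).
    have := @is_deriveD _ _ _ _ _ t 1 _ _ (N0_derive t) (QQ_hat_derive t).
    have -> // : (fun s => N0f (y s) (xit s)) + (fun s => Num.sg (mm (y s)) * QQ (y s) (z s) (z s)) = (fun s => Nf (y s) (xit s)).
    by apply/funext => s; rewrite /Nf /NN mulrDr.
  have [_ _ HK _] := B t; rewrite mulrAC ler_pdivlMr // mulrC.
  apply: (@le_trans _ _ (c * (2 * `|Qf (y t) (xit t)| + `|KK (y t) (z t)|))).
    rewrite ler_pM2l //; apply: le_trans (ler_normD _ _) _.
    by rewrite normrM ger0_norm.
  by have := QN t; move: HK; rewrite -/(Nf _ _); lra.
- by exists (DD (y t) (z t)); [exact: Q_derive|have [+ _ _ _] := B t].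
- exists (2 * QP (y t) (hv (y t)) (z t) / mm (y t)); first exact: be_derive.
  by apply: K; have [_ _ _ +] := B t.
- exact/K/QN.
- by rewrite /N0f sgPP_ge0 //= /Nf /NN mulrDr lerDl sgQQ_ge0.
Qed.

End Orbit.

(** * Stable and unstable spaces *)

(** The parallelogram identity, the other diagonal [- a *: u + v] having a nonnegative [NN]. *)
Lemma NN_lin_le y a u v : mm y != 0 -> tangent y u -> tangent y v ->
  NN y (a *: u + v) <= 2 * a ^+ 2 * NN y u + 2 * NN y v.
Proof.
move=> m0 tu tv; have tw : tangent y (- a *: u + v) by exact: tangent_comb.
have := NN_ge0 m0 tw; rewrite /NN.
have tw' := tangent_comb a tu tv.
rewrite !PP_linl // !PP_linr // !QQ_linl // !QQ_linr //.
rewrite (PP_sym y v u) (QQ_sym y v u).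
by move: (Num.sg _) => sg; lra.
Qed.

Lemma ker_hv y : ker_d h y (hv y).
Proof. by split; [exact: thv|exact: hv_h]. Qed.

Lemma ker_comb y a u v : ker_d h y u -> ker_d h y v -> ker_d h y (a *: u + v).
Proof.
move=> [tu uh] [tv vh]; split; first exact: tangent_comb.
by rewrite -[LHS]/(a * u h + v h) uh vh mulr0 addr0.
Qed.

Lemma ker0 y : ker_d h y 0.
Proof. by split; [exact: tangent0|]. Qed.

Lemma be_hv y : mm y != 0 -> be y (hv y) = 1.
Proof. by move=> m0; rewrite /be -/(mm y) divff. Qed.

Lemma hat_hv y : mm y != 0 -> hat y (hv y) = 0.
Proof. by move=> m0; rewrite /hat be_hv // scaleN1r addNr. Qed.

Lemma hat_shift y a u : mm y != 0 -> tangent y u -> hat y (a *: hv y + u) = hat y u.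
Proof. by move=> m0 tu; rewrite hat_lin ?hat_hv ?scaler0 ?add0r //; exact: thv. Qed.

Lemma be_shift y a u : mm y != 0 -> tangent y u -> be y (a *: hv y + u) = a + be y u.
Proof. by move=> m0 tu; rewrite be_lin ?be_hv ?mulr1 //; exact: thv. Qed.

Lemma Nf_shift y a u : mm y != 0 -> tangent y u -> Nf y (a *: hv y + u) = Nf y u.
Proof. by move=> m0 tu; rewrite /Nf hat_shift. Qed.

Lemma Qf_shift y a u : mm y != 0 -> tangent y u -> Qf y (a *: hv y + u) = Qf y u.
Proof. by move=> m0 tu; rewrite /Qf hat_shift. Qed.

Lemma hat_decomp y u : u = be y u *: hv y + hat y u.
Proof. by rewrite /hat scaleNr addrA subrr add0r. Qed.

Lemma be0 y : be y 0 = 0.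
Proof. by rewrite /be /PP (pv0 (frP y)) bilf0l mul0r. Qed.

Lemma hat0 y : hat y 0 = 0.
Proof. by rewrite /hat be0 oppr0 scale0r add0r. Qed.

Lemma Nf0 y : Nf y 0 = 0.
Proof. by rewrite /Nf hat0 /NN /PP /QQ (pv0 (frP y)) (qv0 (frP y)) !bilf0l addr0 mulr0. Qed.

(* Only tau = 1 and tau = -1 are used: the unstable space is the stable space
   of the reversed flow. *)
Definition orbitN tau x xi t := Nf (phi (tau * t) x) (push (phi (tau * t)) xi).
Definition orbitN0 tau x xi t := N0f (phi (tau * t) x) (push (phi (tau * t)) xi).
Definition orbitQ tau x xi t := tau * Qf (phi (tau * t) x) (push (phi (tau * t)) xi).
Definition orbitb tau x xi t := be (phi (tau * t) x) (push (phi (tau * t)) xi).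

Definition Est tau x : set (tvec M) := [set xi | ker_d h x xi /\ stable (orbitN tau x xi) (orbitb tau x xi)].

Section StableSpaces.
Variables (c : R).
Hypothesis c0 : 0 < c.

Definition good_orbit x := (forall t, mm (phi t x) != 0) /\ forall t, bounds c (phi t x).

Lemma good_mm x : good_orbit x -> mm x != 0.
Proof. by move=> [/(_ 0)]; rewrite (phi0 smf). Qed.

Lemma orbit_lyapunov_tau tau x xi : tau * tau = 1 -> good_orbit x -> ker_d h x xi ->
  lyapunov c (3 / c) (orbitN tau x xi) (orbitN0 tau x xi) (orbitQ tau x xi) (orbitb tau x xi).
Proof.
move=> t2 [m0 Hb] kx; have H := orbit_lyapunov c0 m0 Hb kx.
have /orP[/eqP->|/eqP->] : (tau == 1) || (tau == -1) by rewrite -sqrf_eq1 expr2 t2.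
  have E (f : R -> R) : (fun t => f (1 * t)) = f by apply/funext => t; rewrite mul1r.
  rewrite /orbitN (E (fun t => Nf (phi t x) (push (phi t) xi))) /orbitN0 (E (fun t => N0f (phi t x) (push (phi t) xi))).
  rewrite /orbitb (E (fun t => be (phi t x) (push (phi t) xi))).
  by have -> // : orbitQ 1 x xi = (fun t => Qf (phi t x) (push (phi t) xi)) by apply/funext => t; rewrite /orbitQ !mul1r.
have E (f : R -> R) : (fun t => f (-1 * t)) = (fun t => f (- t)) by apply/funext => t; rewrite mulN1r.
rewrite /orbitN (E (fun t => Nf (phi t x) (push (phi t) xi))) /orbitN0 (E (fun t => N0f (phi t x) (push (phi t) xi))).
rewrite /orbitb (E (fun t => be (phi t x) (push (phi t) xi))).
have -> : orbitQ (-1) x xi = (fun t => - Qf (phi (- t) x) (push (phi (- t)) xi)) by apply/funext => t; rewrite /orbitQ !mulN1r.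
exact: lyapunov_rev H.
Qed.

Lemma C_gt0 : 0 < 3 / c. Proof. exact: divr_gt0. Qed.

Lemma push_lin t a u v : push (phi t) (a *: u + v) = a *: push (phi t) u + push (phi t) v.
Proof. by []. Qed.

Lemma orbitN_lin_le tau x a u v t : good_orbit x -> tangent x u -> tangent x v ->
  orbitN tau x (a *: u + v) t <= 2 * a ^+ 2 * orbitN tau x u t + 2 * orbitN tau x v t.
Proof.
move=> [m0 _] tu tv; have tu' := push_tangent smf (tau * t) tu; have tv' := push_tangent smf (tau * t) tv.
rewrite /orbitN push_lin /Nf hat_lin //; apply: NN_lin_le => //; exact: hat_tangent.
Qed.

Lemma orbitb_lin tau x a u v t : tangent x u -> tangent x v ->
  orbitb tau x (a *: u + v) t = a * orbitb tau x u t + orbitb tau x v t.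
Proof.
move=> tu tv; have tu' := push_tangent smf (tau * t) tu; have tv' := push_tangent smf (tau * t) tv.
by rewrite /orbitb push_lin be_lin.
Qed.

Lemma max_ge (T1 T2 t : R) : Num.max T1 T2 <= t -> T1 <= t /\ T2 <= t.
Proof. by rewrite ge_max => /andP[]. Qed.

Lemma Est_comb tau x a u v : good_orbit x -> Est tau x u -> Est tau x v -> Est tau x (a *: u + v).
Proof.
move=> gx [ku [Su1 Su2]] [kv [Sv1 Sv2]]; split; first exact: ker_comb.
have [tu _] := ku; have [tv _] := kv; have a1 : 0 < a ^+ 2 + 1 by rewrite ltr_wpDl ?sqr_ge0.
have aa : 0 < `|a| + 1 by rewrite ltr_wpDl.
split=> eps e0.
  have [|T1 T10 H1] := Su1 (eps / (4 * (a ^+ 2 + 1))); first by rewrite divr_gt0 // mulr_gt0.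
  have [|T2 T20 H2] := Sv1 (eps / 4); first by rewrite divr_gt0.
  exists (Num.max T1 T2) => [|t /max_ge[t1 t2]]; first by rewrite le_max T10.
  apply: le_lt_trans (orbitN_lin_le _ _ _ gx tu tv) _.
  apply: (@le_lt_trans _ _ (2 * (a ^+ 2 + 1) * orbitN tau x u t + 2 * orbitN tau x v t)).
    rewrite lerD2r ler_wpM2r //; last by rewrite ler_pM2l // lerDl.
    by apply: NN_ge0; [case: gx|apply: hat_tangent; exact: (push_tangent smf)].
  have := H1 _ t1; rewrite ltr_pdivlMr ?mulr_gt0 // => h1; have := H2 _ t2; rewrite ltr_pdivlMr // => h2.
  by lra.
have [|T1 T10 H1] := Su2 (eps / (2 * (`|a| + 1))); first by rewrite divr_gt0 // mulr_gt0.
have [|T2 T20 H2] := Sv2 (eps / 2); first by rewrite divr_gt0.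
exists (Num.max T1 T2) => [|t /max_ge[t1 t2]]; first by rewrite le_max T10.
rewrite orbitb_lin //; apply: le_lt_trans (ler_normD _ _) _; rewrite normrM.
apply: (@le_lt_trans _ _ ((`|a| + 1) * `|orbitb tau x u t| + `|orbitb tau x v t|)).
  by rewrite lerD2r ler_wpM2r // lerDl.
have := H1 _ t1; rewrite ltr_pdivlMr ?mulr_gt0 // => h1; have := H2 _ t2; rewrite ltr_pdivlMr // => h2.
by lra.
Qed.

Lemma Est0 tau x : good_orbit x -> Est tau x 0.
Proof.
move=> gx; have p0 s : push (phi s) 0 = 0 :> tvec M by [].
split; first exact: ker0.
by split=> eps e0; exists 0 => // t _; rewrite /orbitN /orbitb p0 ?Nf0 ?be0 ?normr0.
Qed.

Lemma Est_subspace tau x : good_orbit x -> Defs.subspace (Est tau x).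
Proof. by move=> gx; split; [exact: Est0|move=> a u v; exact: Est_comb]. Qed.

Lemma Est_push tau x s xi : tau * tau = 1 -> Est tau x xi -> Est tau (phi s x) (push (phi s) xi).
Proof.
move=> t2 [kx [S1 S2]]; split; first exact: push_ker.
have E t : tau * t + s = tau * (t + tau * s) by rewrite mulrDr mulrA t2 mul1r.
have EN t : orbitN tau (phi s x) (push (phi s) xi) t = orbitN tau x xi (t + tau * s).
  by rewrite /orbitN -(phiD smf) -(pushD smf) E.
have Eb t : orbitb tau (phi s x) (push (phi s) xi) t = orbitb tau x xi (t + tau * s).
  by rewrite /orbitb -(phiD smf) -(pushD smf) E.
split=> eps e0; [have [T T0 H] := S1 _ e0|have [T T0 H] := S2 _ e0];
  exists (Num.max 0 (T - tau * s)); rewrite ?le_max ?lexx // => t /max_ge[_ tT]; rewrite ?EN ?Eb;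
  by apply: H; rewrite -lerBlDr.
Qed.

Lemma Est_image tau x s : tau * tau = 1 -> push (phi s) @` Est tau x = Est tau (phi s x).
Proof.
move=> t2; apply/seteqP; split=> [_ [xi Ex <-]|xi Ex]; first exact: Est_push.
exists (push (phi (- s)) xi); last exact: (pushKN smf).
by have := Est_push (- s) t2 Ex; rewrite (phiNK smf).
Qed.

Lemma Est_Q tau x xi : tau * tau = 1 -> good_orbit x -> Est tau x xi -> forall t, orbitQ tau x xi t <= 0.
Proof.
move=> t2 gx [kx [S1 S2]]; have H := orbit_lyapunov_tau t2 gx kx.
exact: (stable_Q c0 C_gt0 H S1).
Qed.

(** For a stable vector [N] and [b^2] are bounded by multiples of [- Q], so both components of [xi]
    vanish together with [Q]. *)
Lemma Est_zero tau x xi : tau * tau = 1 -> good_orbit x -> Est tau x xi -> Qf x xi = 0 -> xi = 0.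
Proof.
move=> t2 gx Ex Q0; have [kx [S1 S2]] := Ex; have H := orbit_lyapunov_tau t2 gx kx.
have Qn := Est_Q t2 gx Ex; have m0 := good_mm gx; have [tx _] := kx.
have Q00 : orbitQ tau x xi 0 = 0 by rewrite /orbitQ mulr0 (phi0 smf) (push0 smf) Q0 mulr0.
have := N_upper c0 C_gt0 H Qn 0; rewrite Q00 oppr0 mulr0 pmulr_rle0 // => N0.
have := b_bound c0 C_gt0 H Qn 0 S2; rewrite Q00 oppr0 mulr0 => b0.
have {}b0 : be x xi = 0.
  have := b0; rewrite /orbitb mulr0 (phi0 smf) (push0 smf) => b1.
  by apply/eqP; rewrite -sqrf_eq0 eq_le b1 sqr_ge0.
have z0 : hat x xi = 0.
  apply: (NN_eq0 m0); first exact: hat_tangent.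
  apply/eqP; rewrite eq_le (NN_ge0 m0) ?andbT; last exact: hat_tangent.
  by move: N0; rewrite /orbitN mulr0 (phi0 smf) (push0 smf).
by rewrite (hat_decomp x xi) b0 z0 scale0r addr0.
Qed.

(** [Qf] is even and does not see the flow direction. *)
Lemma Qf_opp x u v a : mm x != 0 -> tangent x u -> tangent x v -> u + v + a *: hv x = 0 -> Qf x u = Qf x v.
Proof.
move=> m0 tu tv E; have th := thv x.
have -> : u = - a *: hv x + (-1) *: v.
  by move/eqP: E; rewrite addr_eq0 => /eqP E; rewrite scaleN1r scaleNr -E addrK.
rewrite Qf_shift //; last exact: tangentZ.
have -> : (-1) *: v = (-1) *: v + (0 : tvec M) by rewrite addr0.
have t0 := tangent0 x : tangent x (0 : tvec M).
rewrite /Qf hat_lin //.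
have thv := hat_tangent tv; rewrite hat0 QP_linl // ?QP_linr //; try exact: tangent_comb.
rewrite /QP !(pv0 (frP x)) !(qv0 (frP x)) !bilf0r !bilf0l; ring.
Qed.

(** [Qf] is nonpositive on stable and nonnegative on unstable vectors; the relation makes its values
    on [u] and [v] equal, hence 0, and [Est_zero] applies to both. *)
Lemma Est_independent x u v a : good_orbit x -> Est 1 x u -> Est (-1) x v -> u + v + a *: hv x = 0 ->
  [/\ u = 0, v = 0 & a *: hv x = 0].
Proof.
move=> gx Eu Ev E; have m0 := good_mm gx.
have [[tu _] _] := Eu; have [[tv _] _] := Ev.
have t1 : (1 : R) * 1 = 1 by rewrite mulr1.
have tN : (-1 : R) * -1 = 1 by rewrite mulrNN mulr1.
have QE := Qf_opp m0 tu tv E.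
have := Est_Q t1 gx Eu 0; have := Est_Q tN gx Ev 0.
rewrite /orbitQ !mulr0 (phi0 smf) !(push0 smf) mul1r mulN1r oppr_le0 => Q1 Q2.
have Qv : Qf x v = 0 by apply/eqP; rewrite eq_le Q1 -QE Q2.
have u0 := Est_zero t1 gx Eu (etrans QE Qv); have v0 := Est_zero tN gx Ev Qv.
by split=> //; move: E; rewrite u0 v0 !add0r.
Qed.

Local Notation pr y := (pv (fr y) y).

Lemma lin_sumE k m (l : tvec M -> 'rV[R]_k) y (w : 'I_m -> tvec M) (a : 'rV[R]_m) : (forall i, tangent y (w i)) ->
  (forall c u v, tangent y u -> tangent y v -> l (c *: u + v) = c *: l u + l v) ->
  l (\sum_i a 0 i *: w i) = a *m \matrix_i l (w i).
Proof.
move=> tw H; have l0 : l 0 = 0.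
  have := H 1 _ _ (tangent0 y) (tangent0 y); rewrite scale1r addr0 scale1r => /eqP.
  by rewrite -subr_eq subrr eq_sym => /eqP.
rewrite mulmx_sum_row.
suff [_ ->] : tangent y (\sum_i a 0 i *: w i) /\ l (\sum_i a 0 i *: w i) = \sum_i a 0 i *: row i (\matrix_i l (w i)) by [].
apply: (big_rec2 (fun u r => tangent y u /\ l u = r)) => [|i r u _ [tu lu]]; first by split=> //; exact: tangent0.
by split; [exact: tangent_comb|rewrite H // lu rowK].
Qed.

Lemma comb_linearE k (l : tvec M -> 'rV[R]_k) y e a : frame y e ->
  (forall c u v, tangent y u -> tangent y v -> l (c *: u + v) = c *: l u + l v) ->
  l (comb e y a) = a *m \matrix_i l (e i y).
Proof. by move=> fe; apply: lin_sumE => i; exact: (frame_tangent i y fe). Qed.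

Lemma ker_combE y e a : frame y e -> ker_d h y (comb e y a) <-> a *m (pv e y (hv y))^T = 0.
Proof.
move=> fe; have tc := comb_tangent a fe; have th := thv y.
have E : comb e y a h = - (a *m (pv e y (hv y))^T) 0 0.
  rewrite (hamP tc) (sg_anti tc th) sg_comb_r //.
  by congr (- _); rewrite !mxE; apply: eq_bigr => i _; rewrite !mxE mulrC.
split=> [[_]|H]; last by split=> //; rewrite E H mxE oppr0.
by rewrite E => /eqP; rewrite oppr_eq0 => /eqP H; apply/matrixP => i j; rewrite !ord1 H mxE.
Qed.

Lemma hat_pv0 y u : pr y u = 0 -> hat y u = u.
Proof. by move=> p0; rewrite /hat /be /PP p0 bilf0l mul0r oppr0 scale0r add0r. Qed.

Lemma Qf_pv0 y u : pr y u = 0 -> Qf y u = 0.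
Proof. by move=> p0; rewrite /Qf hat_pv0 // /QP p0 bilf0r mulr0. Qed.

Lemma N0f_pv y u v : tangent y u -> tangent y v -> pr y u = pr y v -> N0f y u = N0f y v.
Proof.
move=> tu tv E; have th := thv y; have fy := frP y.
have b : be y u = be y v by rewrite /be /PP E.
by rewrite /N0f /PP !(pv_lin fy) // b E.
Qed.

Section Splitting.
Variable x : M.
Hypothesis gx : good_orbit x.

Let m0 : mm x != 0 := good_mm gx.
Let fx : frame x (fr x) := frP x.
Let th : tangent x (hv x) := thv x.
Local Notation cmb a := (comb (fr x) x a).
Let tc a : tangent x (cmb a) := comb_tangent a fx.

Section StableExistence.
Variable tau : R.
Hypothesis t2 : tau * tau = 1.

(* The vectors that have p = 0 at the time tau T form, modulo the flow
   direction, a space of the right dimension with Q(T) = 0; they inject into the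
   values of p at time 0 because Q increases. *)
Lemma exists_T T (p : 'rV[R]_n) : 1 <= T -> exists xi, [/\ ker_d h x xi, pr x xi = p & orbitQ tau x xi T = 0].
Proof.
move=> T1; set y := phi (tau * T) x; have fy : frame y (fr y) := frP y.
have my : mm y != 0 by have [H _] := gx; exact: H.
have yx : phi (- (tau * T)) y = x by exact: (phiNK smf).
pose back u := push (phi (- (tau * T))) u.
have tb u : tangent y u -> tangent x (back u) by move=> tu; rewrite -yx; exact: (push_tangent smf).
have forth u : push (phi (tau * T)) (back u) = u by exact: (pushKN smf).
pose A : 'M[R]_n := \matrix_i pr x (back (fr y i y)).
have AE a : pr x (back (comb (fr y) y a)) = a *m A.
  apply: (comb_linearE (l := fun u => pr x (back u)) a fy) => r u v tu tv.
  by rewrite /back (push_lin) (pv_lin fx) //; exact: tb.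
have kb a : a *m (pr y (hv y))^T = 0 -> ker_d h x (back (comb (fr y) y a)).
  by move=> /(ker_combE _ fy) ka; rewrite -yx; exact: push_ker.
have Q0 a (g : R) : a *m (pr y (hv y))^T = 0 -> orbitQ tau x (g *: hv x + back (comb (fr y) y a)) T = 0.
  move=> ay; have tcy := comb_tangent a fy; rewrite /orbitQ -/y push_lin forth (push_velocity smf) -/y.
  by rewrite Qf_shift // Qf_pv0 ?mulr0 // pv_comb.
(* If [p] at time 0 is a multiple of [p(hv)], then [N0(0) = 0], and [N_bound] gives [N(0) = 0]; so
   the vector is [g *: hv x]. At time [tau * T] its [p] is 0, which forces [g = 0]. *)
have inj a (g : R) : a *m (pr y (hv y))^T = 0 -> a *m A = g *: pr x (hv x) -> a = 0.
  move=> ay aA; have kxi := kb _ ay; set xi := back _ in kxi.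
  have [txi _] := kxi; have H := orbit_lyapunov_tau t2 gx kxi.
  have QT : orbitQ tau x xi T = 0 by have := Q0 a 0 ay; rewrite scale0r add0r.
  have Q1 : orbitQ tau x xi 1 <= 0 by rewrite -QT; exact: (Q_incr c0 H).
  have px : pr x xi = g *: pr x (hv x) by rewrite AE.
  have := N_bound c0 C_gt0 H Q1.
  have bg : be x xi = g by rewrite /be /PP px bilfZ -/(PP _ _ _) -/(mm x) mulfK.
  have pz : pr x (hat x xi) = 0 by rewrite (pv_lin fx) // px bg scaleNr addNr.
  have -> : orbitN0 tau x xi 0 = 0.
    by rewrite /orbitN0 mulr0 (phi0 smf) (push0 smf) /N0f /PP pz bilf0l mulr0.
  rewrite mulr0 /orbitN mulr0 (phi0 smf) (push0 smf) => N0.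
  have z0 : hat x xi = 0.
    apply: (NN_eq0 m0); first exact: hat_tangent.
    by apply/eqP; rewrite eq_le N0 (NN_ge0 m0) //; exact: hat_tangent.
  have xE : xi = g *: hv x by rewrite (hat_decomp x xi) z0 bg addr0.
  have cE : comb (fr y) y a = g *: hv y.
    by rewrite -(forth (comb _ _ _)) -/xi xE -[g *: hv x]addr0 push_lin (push_velocity smf) addr0.
  have g0 : g *: pr y (hv y) = 0.
    rewrite -(pv_comb a fy) cE; have := pv_lin fy g (thv y) (tangent0 y).
    by rewrite addr0 (pv0 fy) addr0.
  move/eqP: g0; rewrite scaler_eq0 (negPf (mm_pv my)) orbF => /eqP g0.
  by apply: (comb_inj fy); rewrite cE g0 scale0r comb0.
have [a [g [ay E]]] := @hyperplane_complement R n A (pr y (hv y)) (pr x (hv x)) p (mm_pv my) (mm_pv m0) inj.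
exists (g *: hv x + back (comb (fr y) y a)); split; last exact: Q0.
  by apply: ker_comb; [exact: ker_hv|exact: kb].
by rewrite (pv_lin fx) ?AE ?E 1?addrC //; have [] := kb _ ay.
Qed.

Lemma Nf_lin_le a u v : tangent x u -> tangent x v -> Nf x (a *: u + v) <= 2 * a ^+ 2 * Nf x u + 2 * Nf x v.
Proof. by move=> tu tv; rewrite /Nf hat_lin //; apply: NN_lin_le => //; exact: hat_tangent. Qed.

Lemma pr_cmb a : pr x (cmb a) = 0. Proof. exact: pv_comb. Qed.

Lemma Nf_comb a : Nf x (cmb a) = bilf (Num.sg (mm x) *: Gm (fr x) x) a a.
Proof.
rewrite /Nf hat_pv0 ?pr_cmb // /NN /PP pr_cmb bilf0l add0r /QQ qv_comb // /bilf.
have Nt (r : 'rV[R]_n) : (- r)^T = - r^T by apply/matrixP => i j; rewrite !mxE.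
rewrite Nt mulmxN !mulNmx opprK trmx_mul (Gm_tr fx) -!mulmxA (mulmxA (Gi _ _)) (GiG fx) mul1mx.
by rewrite -scalemxAl -scalemxAr [RHS]mxE.
Qed.

Lemma Nf_comb_bound : exists2 c1, 0 < c1 & forall a, c1 * `|a| ^+ 2 <= Nf x (cmb a).
Proof.
have [|c1 c10 H] := @definite_bound R n (Num.sg (mm x) *: Gm (fr x) x).
  move=> a a0; rewrite -Nf_comb lt_neqAle (NN_ge0 m0) ?andbT; last exact: hat_tangent.
  apply: contra_neq a0 => /esym N0; apply: (comb_inj fx); rewrite comb0.
  have := NN_eq0 m0 (hat_tangent (tc a)) N0.
  by rewrite hat_pv0 ?pr_cmb.
by exists c1 => // a; rewrite Nf_comb.
Qed.

Lemma orbitQ_cont t z : tangent x z -> continuous (fun a : 'rV[R]_n => orbitQ tau x (1 *: cmb a + z) t).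
Proof.
move=> tz a; set y := phi (tau * t) x.
have tp u : tangent x u -> tangent y (push (phi (tau * t)) u) by exact: (push_tangent smf).
have fy := frP y.
pose lp u := pr y (hat y (push (phi (tau * t)) u)); pose lq u := qv (fr y) y (hat y (push (phi (tau * t)) u)).
have lpE r u v : tangent x u -> tangent x v -> lp (r *: u + v) = r *: lp u + lp v.
  move=> tu tv; have tu' := tp _ tu; have tv' := tp _ tv.
  have hu := hat_tangent tu'; have hw := hat_tangent tv'.
  rewrite /lp push_lin hat_lin // (pv_lin fy) //.
have lqE r u v : tangent x u -> tangent x v -> lq (r *: u + v) = r *: lq u + lq v.
  move=> tu tv; have tu' := tp _ tu; have tv' := tp _ tv.
  have hu := hat_tangent tu'; have hw := hat_tangent tv'.
  rewrite /lq push_lin hat_lin // (qv_lin fy) //.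
have E b : orbitQ tau x (1 *: cmb b + z) t =
   tau * (Num.sg (mm y) * bilf (Gi (fr y) y) (b *m (\matrix_i lq (fr x i x)) + lq z) (b *m (\matrix_i lp (fr x i x)) + lp z)).
  by rewrite -!(comb_linearE b fx) // -[lq (cmb b)]scale1r -[lp (cmb b)]scale1r -lqE // -lpE.
have -> : (fun b => orbitQ tau x (1 *: cmb b + z) t) = (fun b => tau * (Num.sg (mm y) *
   bilf (Gi (fr y) y) (b *m (\matrix_i lq (fr x i x)) + lq z) (b *m (\matrix_i lp (fr x i x)) + lp z))).
  by apply/funext => b; rewrite E.
have cst k l (W : 'M[R]_(k, l)) : mcvg (nbhs a) (fun=> W) W by move=> i j; exact: cvg_cst.
have cid' : mcvg (nbhs a) id a by move=> i j; exact: coord_continuous.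
have ad k l (A B : 'rV[R]_n -> 'M[R]_(k, l)) A' B' : mcvg (nbhs a) A A' -> mcvg (nbhs a) B B' -> mcvg (nbhs a) (fun b => A b + B b) (A' + B').
  move=> HA HB i j; rewrite mxE.
  have -> : (fun b => (A b + B b) i j) = (fun b => A b i j + B b i j) by apply/funext => b; rewrite mxE.
  by apply: cvgD.
have FF := nbhs_filter a.
have c1 := ad _ _ _ _ _ _ (mcvg_mul FF cid' (cst _ _ (\matrix_i lq (fr x i x)))) (cst _ _ (lq z)).
have c2 := ad _ _ _ _ _ _ (mcvg_mul FF cid' (cst _ _ (\matrix_i lp (fr x i x)))) (cst _ _ (lp z)).
apply: cvgM; first exact: cvg_cst.
apply: cvgM; first exact: cvg_cst.
exact: (mcvg_bilf FF (cst _ _ _) c1 c2).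
Qed.

Lemma closed_ball_rV (r : R) : compact [set a : 'rV[R]_n | `|a| <= r].
Proof.
apply: bounded_closed_compact.
  by exists r; split; [exact: num_real|move=> s rs a /= /le_trans; apply; exact: ltW].
apply: (@closed_comp _ _ (fun v : 'rV[R]_n => `|v|) [set t : R | t <= r]); last exact: closed_le.
by move=> v _; exact: norm_continuous.
Qed.

Lemma cluster_closed (a_ : nat -> 'rV[R]_n) (a : 'rV[R]_n) (A : set 'rV[R]_n) k0 :
  cluster (a_ @ \oo) a -> closed A -> (forall k, (k0 <= k)%N -> A (a_ k)) -> A a.
Proof.
move=> Ha cA H; apply: cA => B nB; apply: Ha => //.
by exists k0 => // k /= kk; exact: H.
Qed.

(* A limit of the vectors of [exists_T] as T goes to infinity; it exists since
   N(0) is bounded by N0(0), which depends on p only. *)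
Lemma negative_orbit (p : 'rV[R]_n) : exists xi, [/\ ker_d h x xi, pr x xi = p & forall t, orbitQ tau x xi t <= 0].
Proof.
have [xk Hk] := boolp.choice (fun k : nat => exists_T p (ler1n R k.+1)).
pose z := xk 0%N; have [kz pz _] := Hk 0%N; have [tz _] := kz.
(* All [xk k] have the same [p] and differ from [z] by vectors of [Delta x]; the limit is taken for
   their coefficient rows. *)
have Ha k : exists a, xk k = 1 *: cmb a + z.
  have [kk pk _] := Hk k; have [tk _] := kk.
  have tkz : tangent x (xk k - z) by exact: tangentB.
  have /(Delta_pv fx tkz) /(DeltaE _ fx) [a E] : pr x (xk k - z) = 0.
    by rewrite -[_ - _]addrC -scaleN1r (pv_lin fx) // pk pz scaleN1r addNr.
  by exists a; rewrite scale1r -E subrK.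
have [a_ aE] := boolp.choice Ha.
have Qk k : orbitQ tau x (1 *: cmb (a_ k) + z) k.+1%:R = 0 by rewrite -aE; have [] := Hk k.
have ka k : ker_d h x (cmb (a_ k)).
  have -> : cmb (a_ k) = -1 *: z + xk k by rewrite aE scaleN1r scale1r addrC addrK.
  by apply: ker_comb => //; have [] := Hk k.
have [c1 c10 Hc1] := Nf_comb_bound.
pose K5 := expR (3 / c) / c.
have K50 : 0 <= K5 by rewrite divr_ge0 ?(ltW c0) // ltW // expR_gt0.
pose B := 2 * Nf x z + 2 * (K5 * N0f x z).
have NB k : Nf x (cmb (a_ k)) <= B.
  have [kk pk Qkk] := Hk k; have [tk _] := kk.
  have -> : cmb (a_ k) = -1 *: z + xk k by rewrite aE scaleN1r scale1r addrC addrK.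
  apply: le_trans (Nf_lin_le _ tz tk) _; rewrite sqrrN expr1n mulr1 lerD2l ler_pM2l //.
  have H := orbit_lyapunov_tau t2 gx kk.
  have Q1 : orbitQ tau x (xk k) 1 <= 0 by rewrite -Qkk; apply: (Q_incr c0 H); rewrite ler1n.
  have := N_bound c0 C_gt0 H Q1; rewrite /orbitN /orbitN0 mulr0 (phi0 smf) !(push0 smf).
  by rewrite (N0f_pv tk tz) // pk pz.
have B0 : 0 <= B / c1.
  by rewrite divr_ge0 ?(ltW c10) //; apply: le_trans (NB 0%N); apply: (NN_ge0 m0); exact: hat_tangent.
have nB k : `|a_ k| <= B / c1 + 1.
  have h1 : `|a_ k| ^+ 2 <= B / c1 by rewrite ler_pdivlMr // mulrC; exact: le_trans (Hc1 _) (NB k).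
  rewrite -(@ler_pXn2r _ 2) ?nnegrE // ?addr_ge0 //; apply: le_trans h1 _.
  by move: (B / c1) B0 => b b0; nra.
have PF : ProperFilter (a_ @ \oo) by exact: fmap_proper_filter.
have [a [_ Ca]] : [set a : 'rV[R]_n | `|a| <= B / c1 + 1] `&` cluster (a_ @ \oo) !=set0.
  by apply: closed_ball_rV; exists 0%N => // k _ /=; exact: nB.
have kx : ker_d h x (1 *: cmb a + z).
  apply: ker_comb => //; apply/(ker_combE _ fx).
  have clA : closed [set b : 'rV[R]_n | (b *m (pr x (hv x))^T) 0 0 = 0].
    apply: (@closed_comp _ _ (fun b : 'rV[R]_n => (b *m (pr x (hv x))^T) 0 0) [set 0 : R]); last exact: closed_eq.
    move=> b _; have cst : mcvg (nbhs b) (fun=> (pr x (hv x))^T) (pr x (hv x))^T by move=> i j; exact: cvg_cst.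
    have cid' : mcvg (nbhs b) id b by move=> i j; exact: coord_continuous.
    exact: (mcvg_mul (nbhs_filter b) cid' cst).
  have := cluster_closed (k0 := 0) Ca clA; move=> /(_ _)/= H0.
  apply/matrixP => i j; rewrite !ord1 H0 ?mxE // => k _.
  by have /(ker_combE _ fx) -> := ka k; rewrite mxE.
exists (1 *: cmb a + z); split=> //; first by rewrite (pv_lin fx) // pr_cmb scaler0 add0r.
have H := orbit_lyapunov_tau t2 gx kx.
suff Q0 t : 0 <= t -> orbitQ tau x (1 *: cmb a + z) t <= 0.
  move=> t; apply: (@le_trans _ _ (orbitQ tau x (1 *: cmb a + z) (Num.max t 0))).
    by apply: (Q_incr c0 H); rewrite le_max lexx.
  by apply: Q0; rewrite le_max lexx orbT.
move=> t0; have clA : closed [set b : 'rV[R]_n | orbitQ tau x (1 *: cmb b + z) t <= 0].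
  apply: (@closed_comp _ _ (fun b : 'rV[R]_n => orbitQ tau x (1 *: cmb b + z) t) [set t : R | t <= 0]); last exact: closed_le.
  by move=> b _; exact: orbitQ_cont.
(* For these [k] the time [k + 1] at which [Q] vanishes exceeds [t], so monotonicity gives
   [Q(t) <= 0]; this closed condition passes to the cluster point. *)
apply: (cluster_closed (k0 := Num.truncn t) Ca clA) => k tk /=.
rewrite -(Qk k); have Hkk := orbit_lyapunov_tau t2 gx (ker_comb 1 (ka k) kz).
apply: (Q_incr c0 Hkk); apply: ltW; apply: lt_le_trans (truncnS_gt _) _.
by rewrite ler_nat.
Qed.

(** [Q <= 0] makes [N] tend to 0, whereas the flow component only converges to some [l]; subtracting
    [l *: hv x] sends it to 0 and leaves [N] unchanged. *)
Lemma Est_exists (p : 'rV[R]_n) : exists xi (g : R), Est tau x xi /\ pr x (g *: hv x + xi) = p.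
Proof.
have [xi [kx px Qn]] := negative_orbit p.
have H := orbit_lyapunov_tau t2 gx kx; have [tx _] := kx.
have [l Hl] := b_limit c0 C_gt0 H Qn.
exists (- l *: hv x + xi), l; split; last by rewrite scaleNr addNKr.
have my s : mm (phi s x) != 0 by case: gx.
have txs s : tangent (phi s x) (push (phi s) xi) by exact: (push_tangent smf).
split; first by apply: ker_comb => //; exact: ker_hv.
split=> eps e0.
  have [T T0 HT] := N_small c0 C_gt0 H Qn e0; exists T => // t Tt; have := HT t Tt.
  by rewrite /orbitN push_lin (push_velocity smf) Nf_shift.
have [T T0 HT] := Hl _ e0; exists T => // t Tt; have := HT t Tt.
by rewrite /orbitb push_lin (push_velocity smf) be_shift // addrC.
Qed.

End StableExistence.

Local Notation lc a w := (\sum_i (a : 'rV[R]_n) 0 i *: w i).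

Lemma Est_sum tau (a : 'rV[R]_n) (w : 'I_n -> tvec M) : (forall i, Est tau x (w i)) -> Est tau x (lc a w).
Proof.
move=> Ew; elim/big_rec: _ => [|i u _ Eu]; first exact: (Est0 _ gx).
exact: (Est_comb _ gx).
Qed.

Lemma lcE (a g : 'rV[R]_n) (w : 'I_n -> tvec M) :
  lc a (fun i => g 0 i *: hv x + w i) = (\sum_i a 0 i * g 0 i) *: hv x + lc a w.
Proof. by rewrite scaler_suml -big_split /=; apply: eq_bigr => i _; rewrite scalerDr scalerA. Qed.

Definition E0 y : set (tvec M) := [set a *: hv y | a in [set: R]].

(** Modulo [hv], there are stable vectors [C i] and unstable vectors [B i] whose [p] are the unit
    rows. Subtracting from [xi] the combination of the [C i] with the same [p] leaves a vector of
    [Delta] in the kernel of [dh]; such vectors are exactly the combinations of the [B i - C i], by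
    a dimension count. *)
Lemma ker_split xi : ker_d h x xi -> exists a b d, [/\ E0 x a, Est (-1) x b, Est 1 x d & xi = a + b + d].
Proof.
move=> kx; have [tx _] := kx.
have t1 : (1 : R) * 1 = 1 by rewrite mulr1.
have tN : (-1 : R) * -1 = 1 by rewrite mulrNN mulr1.
have Hc i : exists w : tvec M * R, Est 1 x w.1 /\ pr x (w.2 *: hv x + w.1) = row i 1%:M.
  by have [u [g [Eu pu]]] := Est_exists t1 (row i 1%:M); exists (u, g).
have Hb i : exists w : tvec M * R, Est (-1) x w.1 /\ pr x (w.2 *: hv x + w.1) = row i 1%:M.
  by have [u [g [Eu pu]]] := Est_exists tN (row i 1%:M); exists (u, g).
have [uc Huc] := boolp.choice Hc; have [ub Hub] := boolp.choice Hb.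
pose C i := (uc i).2 *: hv x + (uc i).1; pose B i := (ub i).2 *: hv x + (ub i).1.
have kC i : ker_d h x (C i) by apply: ker_comb; [exact: ker_hv|have [[]] := Huc i].
have kB i : ker_d h x (B i) by apply: ker_comb; [exact: ker_hv|have [[]] := Hub i].
have tC i : tangent x (C i) by have [] := kC i.
have tB i : tangent x (B i) by have [] := kB i.
have Hd i : exists d, B i - C i = cmb d.
  apply/(DeltaE _ fx)/(Delta_pv fx (tangentB (tB i) (tC i))).
  rewrite -[_ - _]addrC -scaleN1r (pv_lin fx) //.
  by have [_ ->] := Huc i; have [_ ->] := Hub i; rewrite scaleN1r addNr.
have [d dE] := boolp.choice Hd; pose D : 'M[R]_n := \matrix_i d i.
have DE a : cmb (a *m D) = lc a B - lc a C.
  have -> : cmb (a *m D) = lc a (fun i => cmb (d i)).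
    rewrite /comb; under [RHS]eq_bigr do rewrite scaler_sumr.
    rewrite exchange_big /=; apply: eq_bigr => j _; rewrite mxE scaler_suml.
    by apply: eq_bigr => i _; rewrite mxE scalerA.
  by rewrite -sumrB; apply: eq_bigr => i _; rewrite -dE scalerBr.
have prC a : pr x (lc a C) = a.
  rewrite (lin_sumE (l := pr x) a tC); last by move=> r u v tu tv; exact: (pv_lin fx).
  rewrite (_ : \matrix_i _ = 1%:M) ?mulmx1 //.
  by apply/row_matrixP => i; rewrite rowK; have [_ ->] := Huc i.
have kD : D *m (pr x (hv x))^T = 0.
  apply/row_matrixP => i; rewrite row_mul rowK row0; apply/(ker_combE _ fx); rewrite -dE.
  by rewrite -[_ - _]addrC -scaleN1r; apply: ker_comb.
pose rB : 'rV[R]_n := \row_i (ub i).2; pose rC : 'rV[R]_n := \row_i (uc i).2.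
pose XB i := (ub i).1; pose XC i := (uc i).1.
have lB a : lc a B = (\sum_i a 0 i * rB 0 i) *: hv x + lc a XB.
  by rewrite -lcE; apply: eq_bigr => i _; rewrite mxE.
have lC a : lc a C = (\sum_i a 0 i * rC 0 i) *: hv x + lc a XC.
  by rewrite -lcE; apply: eq_bigr => i _; rewrite mxE.
have EB a : Est (-1) x (lc a XB) by apply: Est_sum => i; have [] := Hub i.
have EC a : Est 1 x (lc a XC) by apply: Est_sum => i; have [] := Huc i.
(* If [a *m D = 0], the stable and unstable combinations agree modulo [hv], so both vanish by
   independence, and [a], the [p] of [lc a C], is a multiple of [p(hv)]. *)
have inj a : a *m D = 0 -> exists g : R, a = g *: pr x (hv x).
  move=> aD; exists (\sum_i a 0 i * rC 0 i).
  have := DE a; rewrite aD comb0 => /eqP; rewrite eq_sym subr_eq0 => /eqP BC.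
  have [tX _] := (EC a).1.
  have [u0 _ _] : [/\ lc a XC = 0, -1 *: lc a XB + 0 = 0 & (\sum_i a 0 i * rC 0 i - \sum_i a 0 i * rB 0 i) *: hv x = 0].
    apply: (Est_independent gx); [exact: EC|by apply: (Est_comb _ gx) => //; exact: (Est0 _ gx)|].
    move: BC; rewrite lB lC scaleN1r addr0 scalerBl.
    move: (_ *: hv x) (_ *: hv x) (lc a XB) (lc a XC) => b1 c1 B1 C1 BC.
    by rewrite addrACA -opprD [C1 + _]addrC -BC [B1 + _]addrC subrr.
  rewrite -[LHS]prC lC u0; have -> := pv_lin fx (\sum_i a 0 i * rC 0 i) th (tangent0 x).
  by rewrite (pv0 fx) addr0.
have tS : tangent x (lc (pr x xi) C) by apply: tangent_lcomb.
have kS : ker_d h x (-1 *: lc (pr x xi) C + xi).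
  apply: ker_comb => //; rewrite lC; apply: ker_comb; [exact: ker_hv|exact: (EC _).1].
have /(Delta_pv fx kS.1) /(DeltaE _ fx) [r rE] : pr x (-1 *: lc (pr x xi) C + xi) = 0.
  by rewrite (pv_lin fx) // prC scaleN1r addNr.
have rk : r *m (pr x (hv x))^T = 0 by apply/(ker_combE _ fx); rewrite -rE.
have [a ra] := hyperplane_image (mm_pv m0) kD inj rk.
(* With [xi = lc (pr x xi) C + lc a B - lc a C], the number [ga] collects the flow components of the
   three combinations. *)
pose ga := \sum_i (pr x xi) 0 i * rC 0 i + (\sum_i a 0 i * rB 0 i - \sum_i a 0 i * rC 0 i).
exists (ga *: hv x), (lc a XB), (-1 *: lc a XC + lc (pr x xi) XC); split=> //.
- by exists ga.
- by apply: (Est_comb _ gx).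
have X : xi = lc (pr x xi) C + (-1 *: lc (pr x xi) C + xi) by rewrite scaleN1r addNKr.
rewrite [LHS]X rE ra DE !lC !lB /ga scalerDl scalerBl scaleN1r.
move: (_ *: hv x) (_ *: hv x) (_ *: hv x) (lc a XB) (lc a XC) (lc _ XC) => A1 A2 A3 B1 B2 B3.
have E (U V : tvec M) : (forall f, U f = V f) -> U = V by move=> H; apply/funext.
apply: E => f.
have aE (U V : tvec M) g : (U + V) g = U g + V g by [].
have oE (U : tvec M) g : (- U) g = - U g by [].
by rewrite !(aE, oE); ring.
Qed.

Lemma splitting : direct_sum3 (ker_d h x) (E0 x) (Est (-1) x) (Est 1 x).
Proof.
split.
  apply/seteqP; split=> [xi kx|_ [_ [b [d [[a _ <-] Eb Ed ->]]]]].
    by have [a [b [d [Ea Eb Ed ->]]]] := ker_split kx; exists a, b, d.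
  rewrite -addrA; apply: ker_comb; first exact: ker_hv.
  by rewrite -[b]scale1r; apply: ker_comb; [exact: Eb.1|exact: Ed.1].
move=> _ b d [a _ <-] Eb Ed E.
have [|-> -> ->] := @Est_independent x d b a gx Ed Eb; last by [].
by rewrite -E addrC [d + b]addrC addrA.
Qed.

End Splitting.

End StableSpaces.

(** * The adapted Riemannian metric *)

Section Metric.

Variables (kap del : R).
Hypotheses (kap0 : 0 < kap) (del0 : 0 < del).

(** The polarization of the decaying quantity of [stable_decay], see [rho_diag]; [PP] has the
    coefficient [1 + kap] because [Nf] contains it too. *)
Definition rho y xi eta : R :=
  Num.sg (mm y) * ((1 + kap) * PP y (hat y xi) (hat y eta) + kap * QQ y (hat y xi) (hat y eta))
  + del * (be y xi * be y eta).

Lemma rho_diag y xi : rho y xi xi = N0f y xi + kap * Nf y xi + del * be y xi ^+ 2.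
Proof. by rewrite /rho /N0f /Nf /NN expr2; move: (Num.sg _) => s; ring. Qed.

Lemma rho_sym y xi eta : rho y xi eta = rho y eta xi.
Proof. by rewrite /rho PP_sym QQ_sym [be y xi * _]mulrC. Qed.

Lemma rho_linl y a u v w : tangent y u -> tangent y v -> tangent y w ->
  rho y (a *: u + v) w = a * rho y u w + rho y v w.
Proof.
move=> tu tv tw; have hu := hat_tangent tu; have hw := hat_tangent tv; have hz := hat_tangent tw.
rewrite /rho hat_lin // be_lin // PP_linl // QQ_linl //.
by move: (Num.sg _) => s; ring.
Qed.

Lemma rho_gt0 y xi : mm y != 0 -> tangent y xi -> xi <> 0 -> 0 < rho y xi xi.
Proof.
move=> m0 tx /eqP; apply: contra_neqT; rewrite -leNgt => r0; have hx := hat_tangent tx.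
have a1 : 0 <= N0f y xi by exact: sgPP_ge0.
have a2 : 0 <= kap * Nf y xi by rewrite mulr_ge0 ?(ltW kap0) // NN_ge0.
have a3 : 0 <= del * be y xi ^+ 2 by rewrite mulr_ge0 ?(ltW del0) // sqr_ge0.
rewrite rho_diag in r0.
have : kap * Nf y xi = 0 by lra.
move=> /eqP; rewrite mulf_eq0 (gt_eqF kap0) /= => /eqP /(NN_eq0 m0 hx) z0.
have : del * be y xi ^+ 2 = 0 by lra.
move=> /eqP; rewrite mulf_eq0 (gt_eqF del0) /= sqrf_eq0 => /eqP b0.
by rewrite (hat_decomp y xi) z0 b0 scale0r addr0.
Qed.

Lemma smooth_bilf x (g : M -> 'M[R]_n) (a b : M -> 'rV[R]_n) : smooth_mx x g -> smooth_mx x a -> smooth_mx x b ->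
  smooth_near x (fun y => bilf (g y) (a y) (b y)).
Proof. by move=> sg sa sb; exact: (smooth_mx_mul (smooth_mx_mul sa sg) (smooth_mx_tr sb)). Qed.

Lemma qv_smooth X x e : vector_field X -> frame x e -> smooth_mx x (fun y => qv e y (X y)).
Proof.
move=> vX fe; apply: smooth_mx_add; last first.
  apply: smooth_mx_opp; apply: smooth_mx_scale; apply: smooth_mx_mul; first exact: pv_smooth.
  exact: (Bm_smooth fe).
move=> i j; apply: smooth_near_Cinf.
have -> : (fun y => dpv e y (X y) i j) = fun y => sigma y (X y) (lie hv (e j) y) by apply/funext => y; rewrite mxE.
by apply: sg_smooth => //; apply: L_field; exact: (frame_field j fe).
Qed.

Lemma mmE y e : frame y e -> mm y = fm e y.
Proof. by move=> fe; rewrite /mm; have [-> _ _ _ _] := formsE fe (thv y) (thv y). Qed.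

Lemma mm_open : open [set y | mm y != 0].
Proof.
rewrite openE => x /= m0; have fe := frP x.
have c := smooth_near_cont (fm_smooth fe).
have m0' : fm (fr x) x != 0 by rewrite -(mmE fe).
have n1 : \forall y \near x, fm (fr x) y != 0 by exact: (cvgr_neq0 (fm (fr x) x) c m0').
by apply: filterS2 n1 (frame_near fe) => y my fy; rewrite /= (mmE fy).
Qed.

(** Near [x] everything is rewritten in one fixed frame, and the sign of [mm] is replaced by its
    value at [x]; both are legitimate on a neighbourhood. *)
Lemma rho_smooth X Y x : vector_field X -> vector_field Y -> mm x != 0 -> smooth_near x (fun y => rho y (X y) (Y y)).
Proof.
move=> vX vY m0; set e := fr x; have fe : frame x e := frP x.
pose ph y := pv e y (hv y); pose qh y := qv e y (hv y).
have vh : vector_field hv := hvF.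
have s_g := Gi_smooth fe; have s_ph := pv_smooth vh fe; have s_qh := qv_smooth vh fe.
have sfm : smooth_near x (fm e) by exact: smooth_bilf.
have fm0 : fm e x != 0 by rewrite -(mmE fe).
pose b (Z : M -> tvec M) y := bilf (Gi e y) (pv e y (Z y)) (ph y) * (fm e y)^-1.
have sb Z : vector_field Z -> smooth_near x (b Z).
  move=> vZ; apply: smooth_near_mul; last exact: smooth_near_inv.
  by apply: smooth_bilf => //; exact: pv_smooth.
have sN Z : vector_field Z -> smooth_near x (fun y => - b Z y).
  move=> vZ; have := smooth_near_mul (smooth_near_cst x (-1)) (sb Z vZ).
  by apply: smooth_near_ext; apply: nearW => y; rewrite mulN1r.
pose P (Z : M -> tvec M) y := - b Z y *: ph y + pv e y (Z y).
pose Q (Z : M -> tvec M) y := - b Z y *: qh y + qv e y (Z y).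
have sP Z : vector_field Z -> smooth_mx x (P Z).
  by move=> vZ; apply: smooth_mx_add; [apply: smooth_mx_fscale => //; exact: sN|exact: pv_smooth].
have sQ Z : vector_field Z -> smooth_mx x (Q Z).
  by move=> vZ; apply: smooth_mx_add; [apply: smooth_mx_fscale => //; exact: sN|exact: qv_smooth].
apply: (@smooth_near_ext _ _ _ _ (fun y => Num.sg (mm x) * ((1 + kap) * bilf (Gi e y) (P X y) (P Y y) + kap * bilf (Gi e y) (Q X y) (Q Y y))
   + del * (b X y * b Y y))); last first.
  apply: smooth_near_add; last by apply: smooth_near_mul; [exact: smooth_near_cst|apply: smooth_near_mul; exact: sb].
  apply: smooth_near_mul; first exact: smooth_near_cst.
  by apply: smooth_near_add; (apply: smooth_near_mul; first exact: smooth_near_cst); apply: smooth_bilf => //; [exact: sP|exact: sP|exact: sQ|exact: sQ].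
have n1 := sgfm_near fe (mm_pv m0).
apply: filterS2 n1 (frame_near fe) => y sgE fy.
have th := thv y; have tX := field_tangent y vX; have tY := field_tangent y vY.
have bE Z : vector_field Z -> be y (Z y) = b Z y.
  move=> vZ; have tZ := field_tangent y vZ.
  by rewrite /be (mmE fy); have [-> _ _ _ _] := formsE fy tZ th.
have PE Z : vector_field Z -> pv e y (hat y (Z y)) = P Z y.
  by move=> vZ; have tZ := field_tangent y vZ; rewrite /hat (pv_lin fy) // bE.
have QE Z : vector_field Z -> qv e y (hat y (Z y)) = Q Z y.
  by move=> vZ; have tZ := field_tangent y vZ; rewrite /hat (qv_lin fy) // bE.
rewrite /rho; have [-> _ -> _ _] := formsE fy (hat_tangent tX) (hat_tangent tY).
by rewrite !PE // !QE // !bE // (mmE fy) sgE -(mmE fe).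
Qed.

Lemma rho_riemannian (U : set M) : U `<=` [set y | mm y != 0] -> riemannian_metric h U rho.
Proof.
move=> Um; split=> [x /Um /= m0|X Y vX vY _ x /Um /= m0].
  split=> [a u v w [tu _] [tv _] [tw _]|xi eta _ _|xi [tx _]].
  - by split; [exact: rho_linl|rewrite rho_sym rho_linl // !(rho_sym _ w)].
  - exact: rho_sym.
  - exact: rho_gt0.
have [F sF FE] := smooth_near_extend (rho_smooth vX vY m0).
by exists F => //; apply: filterS FE => y -> _.
Qed.

End Metric.

Lemma setting_hyperbolic (c : R) (S : set M) :
  compact S -> S `<=` [set x | h x = c] -> invariant_set phi S ->
  (forall x, S x -> ~ Delta x (hv x)) ->
  (forall x, S x -> negative_reduced_curvature sigma Delta h phi x) ->
  hyperbolic_set h c phi S.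
Proof.
move=> cS SW iS SD SN.
have [k k0 Hk] := bounds_uniform cS SD SN.
have Sm x : S x -> mm x != 0.
  move=> Sx; have fx := frP x; rewrite (mmE fx); apply: (fm_neq0 fx).
  by apply: contra_notN (SD _ Sx) => /eqP; exact: (Delta_pv fx (thv x)).2.
have good x : S x -> good_orbit k x.
  by move=> Sx; split=> t; [apply: Sm|apply: Hk]; exact: iS.
have [kap [del [gam [kap0 del0 gam0 decay]]]] := stable_decay k0 (C_gt0 k0).
have t1 : (1 : R) * 1 = 1 by rewrite mulr1.
have tN : (-1 : R) * -1 = 1 by rewrite mulrNN mulr1.
split=> //.
(* The rates are half of [gam] because the diagonal of [rho] is the square of the norm. The
   expanding space is the stable space of the reversed flow. *)
exists [set y | mm y != 0], (rho kap del), (expR (- (gam / 2))), (expR (gam / 2)),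
  (E0), (Est (-1)), (Est 1) => norm.
have sq tau x xi t : tau * tau = 1 -> S x -> Est tau x xi -> 0 <= t ->
    norm (phi (tau * t) x) (push (phi (tau * t)) xi) <= expR (- (gam / 2 * t)) * norm x xi.
  move=> t2 Sx Ex t0; have [kx st] := Ex; have H := orbit_lyapunov_tau k0 t2 (good _ Sx) kx.
  have := decay _ _ _ _ H st t t0; rewrite /orbitN0 /orbitN /orbitb mulr0 (phi0 smf) (push0 smf) -!rho_diag => D.
  have e0 : 0 <= expR (- (gam / 2 * t)) by exact/ltW/expR_gt0.
  rewrite -[X in _ <= X * _](ger0_norm e0) -sqrtr_sqr -sqrtrM ?sqr_ge0 // ler_wsqrtr // expr2 -expRD.
  by have -> : - (gam / 2 * t) - gam / 2 * t = - (gam * t) by field.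
split.
- by split; [exact: mm_open|move=> x /Sm].
(* Where [mm] is nonzero [hv] is nonzero, so by nondegeneracy of [sigma] the differential of [h]
   does not vanish. *)
- move=> x [_ /= m0]; apply: contrapT => Hn; move/eqP: m0; apply.
  suff hz : velocity phi x = 0 by rewrite /mm /PP hz (pv0 (frP x)) bilf0l.
  apply: (sg_nondeg (thv x)) => w tw; rewrite sg_anti //; last exact: thv.
  rewrite -(hamP tw); apply/eqP; rewrite oppr_eq0; apply/negPn/negP => /eqP w0.
  by apply: Hn; exists w.
- by apply: (rho_riemannian kap0 del0) => y [].
- by rewrite expR_gt0 expR_lt1 oppr_lt0 expR_gt1 !divr_gt0.
move=> x Sx; have gx := good _ Sx; have th := thv x.
have hn0 : velocity phi x <> 0.
  by move=> hz; have /eqP := Sm _ Sx; apply; rewrite /mm /PP hz (pv0 (frP x)) bilf0l.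
split.
- split; [|exact: (Est_subspace _ gx)|exact: (Est_subspace _ gx)].
  split; first by exists 0 => //; rewrite scale0r.
  by move=> a _ _ [b _ <-] [d _ <-]; exists (a * b + d) => //; rewrite scalerDl scalerA.
- exact: (splitting k0 gx).
- split=> //; last by exists 1 => //; rewrite scale1r.
  exists (fun=> velocity phi x); split.
    move=> a; rewrite big_ord1 => /eqP; rewrite scaler_eq0 => /orP[/eqP a0 i|/eqP //].
    by rewrite (ord1 i).
  apply/seteqP; split=> [_ [a _ <-]|_ [a _ <-]]; last by exists (a ord0) => //; rewrite big_ord1.
  by exists (fun=> a) => //; rewrite big_ord1.
- by move=> t; split; exact: Est_image.
have powE a s : expR a `^ s = expR (s * a) by rewrite /powR gt_eqF ?expR_gt0 // expRK.
move=> t t0; split=> xi Exi; rewrite powE.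
  have := sq 1 x xi t t1 Sx Exi t0; rewrite mul1r.
  by have -> : t * - (gam / 2) = - (gam / 2 * t) by ring.
have := sq (-1) x xi t tN Sx Exi t0; rewrite mulN1r.
by have -> : - t * (gam / 2) = - (gam / 2 * t) by ring.
Qed.

End MonotoneField.

Theorem theorem2 (R : realType) (n : nat) (M : manifold R (2 * n))
    (sigma : M -> tvec M -> tvec M -> R) (Delta : M -> set (tvec M))
    (h : M -> R) (phi : R -> M -> M) (c : R) (S : set M) :
  symplectic_form sigma ->
  lagrange_distribution n sigma Delta ->
  Cinf h ->
  flow_of (hamiltonian_field sigma h) phi ->
  (forall x, monotone_at sigma Delta h x) ->
  compact S ->
  S `<=` [set x | h x = c] ->
  invariant_set phi S ->
  (forall x, S x -> ~ Delta x (hamiltonian_field sigma h x)) ->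
  (forall x, S x -> negative_reduced_curvature sigma Delta h phi x) ->
  hyperbolic_set h c phi S.
Proof.
move=> Hs Hl Hh Hf Hm cS SW iS SD SN.
rewrite (hvE Hf) in SD.
exact: (setting_hyperbolic Hs Hl Hh Hf Hm).
Qed.
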